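(* Let $T(a,b,c)$ be the meromorphic continuation to $\mathbb C^3$ of $\sum_{m,n\ge1}m^{-a}n^{-b}(m+n)^{-c}$. For every integer $\ell\ge0$, $$\operatorname*{Res}_{a+c=1-\ell}T(a,b,c)=(-1)^\ell\frac{(c)_\ell}{\ell!}\,\zeta(b-\ell),\qquad \operatorname*{Res}_{b+c=1-\ell}T(a,b,c)=(-1)^\ell\frac{(c)_\ell}{\ell!}\,\zeta(a-\ell).$$ The full-support residue is $$\operatorname*{Res}_{a+b+c=2}T(a,b,c)=B(1-a,1-b).$$ These ($a+c=1-\ell$ and $b+c=1-\ell$ for $\ell\ge0$, and $a+b+c=2$) are all the generic polar divisors of $T$, and they are generically simple.
   Context: $(x)_\ell=x(x+1)\cdots(x+\ell-1)$, $(x)_0=1$; $\zeta$ is the Riemann zeta function; $B(x,y)=\Gamma(x)\Gamma(y)/\Gamma(x+y)$ is the (continued) beta function. The residue along a hyperplane $\{\Lambda=0\}$ is the coefficient of $\Lambda^{-1}$ with $\Lambda$ itself (here $a+c-1+\ell$, $b+c-1+\ell$, $a+b+c-2$) as transverse coordinate, at a generic point of the hyperplane; it is a meromorphic function on the hyperplane. *)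

(* Defs.v *)
(* Stdlib reals with Coquelicot.  Complex differentiability is Coquelicot's
   Frechet differentiability [ex_filterdiff] over the scalar ring [C_AbsRing];
   points of C^3 are triples [C * C * C]. *)
From Stdlib Require Import Reals.
From Coquelicot Require Import Coquelicot.

Open Scope C_scope.

Section Several_variables.

Context {V : NormedModule C_AbsRing}.
Implicit Types (T f g h lam : V -> C) (A D P : V -> Prop) (p v x : V).

(* Meant for open [U]. *)
Definition holomorphic_on (U : V -> Prop) f : Prop :=
  forall x, U x -> ex_filterdiff (K := C_AbsRing) f (locally x).

(* Holomorphic and not identically zero on a (connected) ball, so that the
   zero set is a thin subset of the ball. *)
Definition nonzero_holomorphic_on_ball p (eps : posreal) h : Prop :=
  holomorphic_on (ball p eps) h /\ exists x, ball p eps x /\ h x <> 0.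

(* A meromorphic function is represented by a total function whose values on
   thin sets are irrelevant.  This is equality of meromorphic functions. *)
Definition mero_eq_on_ball p (eps : posreal) f g : Prop :=
  exists h, nonzero_holomorphic_on_ball p eps h /\
    forall x, ball p eps x -> h x <> 0 -> f x = g x.

Definition meromorphic T : Prop :=
  forall p, exists (eps : posreal) g h,
    holomorphic_on (ball p eps) g /\
    nonzero_holomorphic_on_ball p eps h /\
    mero_eq_on_ball p eps T (fun x => g x / h x).

Definition regular_at T p : Prop :=
  exists (eps : posreal) f,
    holomorphic_on (ball p eps) f /\ mero_eq_on_ball p eps T f.

Definition polar_set T : V -> Prop := fun p => ~ regular_at T p.

(* The condition is imposed at every point of the ambient space, so analytic
   sets are closed. *)
Definition analytic_set A : Prop :=
  forall p, exists (eps : posreal) (N : nat) (f : nat -> V -> C),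
    (forall k, (k < N)%nat -> holomorphic_on (ball p eps) (f k)) /\
    forall x, ball p eps x ->
      (A x <-> forall k, (k < N)%nat -> f k x = 0).

Definition irreducible_analytic_set A : Prop :=
  analytic_set A /\ (exists x, A x) /\
  forall A1 A2, analytic_set A1 -> analytic_set A2 ->
    (forall x, A x <-> A1 x \/ A2 x) ->
    (forall x, A x -> A1 x) \/ (forall x, A x -> A2 x).

Definition irreducible_component P D : Prop :=
  irreducible_analytic_set D /\ (forall x, D x -> P x) /\
  forall D', irreducible_analytic_set D' -> (forall x, D' x -> P x) ->
    (forall x, D x -> D' x) -> forall x, D' x -> D x.

(* The polar set of a meromorphic function is empty or of pure codimension
   one, so no condition on the codimension of [D] is needed. *)
Definition polar_divisor T D : Prop := irreducible_component (polar_set T) D.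

(* [Q] holds at the generic point of the irreducible analytic set [A]. *)
Definition generically A (Q : V -> Prop) : Prop :=
  exists Z : V -> Prop, analytic_set Z /\ (forall x, Z x -> A x) /\
    (exists x, A x /\ ~ Z x) /\
    forall x, A x -> ~ Z x -> Q x.

Definition zero_set lam : V -> Prop := fun x => lam x = 0.

(* Moving by [t] times [v] increases the affine form [lam] by [t]: the
   direction [v] completes [lam] into coordinates in which [lam] is the
   transverse one. *)
Definition transverse lam v : Prop :=
  forall x (t : C), lam (plus x (scal t v)) = lam x + t.

Definition constant_along_on_ball v p (eps : posreal) f : Prop :=
  forall x (t : C), ball p eps x -> ball p eps (plus x (scal t v)) ->
    f (plus x (scal t v)) = f x.

(* For every choice of the transverse direction, near [p]
     T = G + c_0 lam^-1 + c_1 lam^-2 + ... + c_N lam^-(N+1)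
   with [G] holomorphic and the [c_k] holomorphic functions on the hyperplane
   (extended constantly along [v]), and [r] is the value of c_0 at [p]. *)
Definition residue_at T lam p (r : C) : Prop :=
  forall v, transverse lam v ->
    exists (eps : posreal) (N : nat) (c : nat -> V -> C) (G : V -> C),
      (forall k, holomorphic_on (ball p eps) (c k)) /\
      (forall k, constant_along_on_ball v p eps (c k)) /\
      holomorphic_on (ball p eps) G /\
      mero_eq_on_ball p eps T
        (fun x => G x + sum_n (fun k => c k x / lam x ^ S k) N) /\
      c 0%nat p = r.

(* The residue as a meromorphic function on the hyperplane. *)
Definition residue_along T lam (r : V -> C) : Prop :=
  generically (zero_set lam) (fun p => residue_at T lam p (r p)).

(* [n] is the exact order, for an affine form [lam] vanishing at [p]. *)
Definition pole_order_at T lam p (n : nat) : Prop :=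
  exists (eps : posreal) (F : V -> C),
    holomorphic_on (ball p eps) F /\ F p <> 0 /\
    mero_eq_on_ball p eps T (fun x => F x / lam x ^ n).

Definition generically_simple_pole T lam : Prop :=
  generically (zero_set lam) (fun p => pole_order_at T lam p 1).

End Several_variables.

Definition Cexp (z : C) : C :=
  (exp (Re z) * cos (Im z), exp (Re z) * sin (Im z))%R.

(* x ^ s for real x > 0 *)
Definition Rcpow (x : R) (s : C) : C := Cexp (s * ln x).

Definition is_riemann_zeta (zeta : C -> C) : Prop :=
  holomorphic_on (fun s : C => s <> 1) zeta /\
  forall s : C, (1 < Re s)%R ->
    is_series (fun n : nat => Rcpow (INR (S n)) (- s)) (zeta s).

(* Analytic continuation of the Euler integral. *)
Definition is_gamma (Gam : C -> C) : Prop :=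
  holomorphic_on (fun s : C => forall n : nat, s <> - INR n) Gam /\
  forall s : C, (0 < Re s)%R ->
    is_RInt_gen (V := C_R_NormedModule)
      (fun t : R => Rcpow t (s - 1) * exp (- t))
      (at_right 0%R) (Rbar_locally p_infty) (Gam s).

Definition Beta (Gam : C -> C) (x y : C) : C := Gam x * Gam y / Gam (x + y).

Fixpoint pochhammer (x : C) (l : nat) : C :=
  match l with
  | O => 1
  | S k => pochhammer x k * (x + INR k)
  end.

Definition is_double_series (u : nat -> nat -> C) (s : C) : Prop :=
  (exists M : R, forall N : nat,
     (sum_n (fun m => sum_n (fun n => Cmod (u m n)) N) N <= M)%R) /\
  filterlim (fun N : nat => sum_n (fun m => sum_n (u m) N) N)
    eventually (locally s).

(* Indices are shifted: the summand for m + 1 and n + 1. *)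
Definition MT_term (a b c : C) (m n : nat) : C :=
  Rcpow (INR (S m)) (- a) * Rcpow (INR (S n)) (- b) *
  Rcpow (INR (S m + S n)) (- c).

Definition is_MT_continuation (T : C * C * C -> C) : Prop :=
  meromorphic T /\
  forall a b c s : C, is_double_series (MT_term a b c) s -> T (a, b, c) = s.

Definition lam_ac (l : nat) : C * C * C -> C :=
  fun '(a, b, c) => a + c - 1 + INR l.

Definition lam_bc (l : nat) : C * C * C -> C :=
  fun '(a, b, c) => b + c - 1 + INR l.

Definition lam_abc : C * C * C -> C :=
  fun '(a, b, c) => a + b + c - 2.

(* Main.v *)
(* Write L_a(t) = sum_(n >= 1) n^-a e^(-n t).  For Re c large
     Gamma(c) T(a,b,c) = int_0^oo t^(c-1) L_a(t) L_b(t) dt,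
   and for a not an integer
     L_a(t) = Gamma(1-a) t^(a-1) + sum_(k < K) zeta(a-k) (-t)^k / k! + O(t^K)
   as t -> 0, locally uniformly in a.  Integrating the product of two such expansions over (0,1)
   gives explicit fractions with denominators a+b+c-2, a+c-1+k, b+c-1+k and c+i, plus a remainder
   holomorphic in a large region; the poles at c = -i disappear after division by Gamma(c).
   Hence the product of T and finitely many linear forms is locally holomorphic, and its value at a
   generic point of one of the hyperplanes is read off from the numerators.  The singularities at
   integers a, b come only from the expansion: they are removed by averaging over circles in a and b
   that avoid the integers, which changes nothing for Re c large by the mean value property, hence
   nowhere by the identity theorem.

   The expansion of L_a is obtained without contour integrals.  The difference
   E_a = L_a - Gamma(1-a) t^(a-1) is bounded for Re a > 2; comparing sum n^-a e^(-n t) with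
   int_1^oo x^-a e^(-x t) dx over unit cells expresses E_a by E_(a+1), E_(a+2), ... up to a bounded
   error, so E_a is bounded for all nonintegral a; its limit at 0 is zeta(a) by analytic continuation
   in a, and E_a' = - E_(a-1) turns this into the full Taylor expansion.

   Holomorphic functions of several variables are handled through one-variable Cauchy theory on
   complex lines, and the polar set is a locally finite family of hyperplanes, each irreducible by the
   identity theorem on lines. *)

(* The hypotheses give little: [T] is a total function whose values on thin sets are free, tied to
   the double series only where that converges absolutely; [Gam] and [zeta] are known only through
   one integral, one series and holomorphy. So outside the region of convergence no pointwise
   formula for [T] is claimed: the relation [agree] (a product of linear forms times [T] equals a
   holomorphic function off a thin set) is carried along segments on which only c moves, from large
   real part of c down to the given point. Dividing by Gamma(c) requires excluding zeros of Gamma.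
   This is done directly only for Re s > 1 + (Im s)^2 / 2; other c are reached through c + 2 K,
   which is one reason for the size of [order], and the same shift shows Gamma(c) <> 0 at generic
   points. No power series occur: Goursat on rectangles, carried to annuli by exp, yields mean
   values, and iterated Cauchy estimates yield the identity theorem. That a hyperplane is really
   polar needs a nonzero numerator at one explicit point; openness of the regular set then settles
   its non-generic points. *)
Require Import Defs.
From Stdlib Require Import Reals Lra Lia ClassicalEpsilon ZArith List.
From Stdlib Require Import Factorial FunctionalExtensionality PropExtensionality.
From Coquelicot Require Import Coquelicot.

Open Scope C_scope.

(** * Complex differentiability *)

(* [cd]: complex differentiability at a point; [cder f z l]: [f'(z) = l]; [hol], below: [cd] in a neighbourhood. *)
Notation cd f x := (@ex_filterdiff C_AbsRing _ C_NormedModule f (locally x)).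

Section Differentiability.
Context {V : NormedModule C_AbsRing}.

(** [filterdiff] quantifies over every limit of the filter; [locally x] has only the limit [x],
    which leaves the usual epsilon form. *)
Lemma cd_iff (f : V -> C) x :
  cd f x <-> exists L : V -> C, @is_linear C_AbsRing V C_NormedModule L /\
    forall eps : posreal, locally x (fun y =>
      (Cmod (f y - f x - L (minus y x)) <= eps * norm (minus y x))%R).
Proof.
split.
- intros [L [HL H]]. exists L. split; [exact HL|].
  intros eps. exact (H x (fun P HP => HP) eps).
- intros [L [HL H]]. exists L. split; [exact HL|].
  intros x' Hx' eps. apply is_filter_lim_locally_unique in Hx'. subst x'.
  exact (H eps).
Qed.

Lemma cd_continuous (f : V -> C) x : cd f x -> continuous f x.
Proof. intros H. now apply @filterdiff_continuous. Qed.

Lemma locally_norm_ball (x : V) (P : V -> Prop) :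
  locally x P <-> exists d : posreal, forall y, (norm (minus y x) < d)%R -> P y.
Proof.
split.
- intros H. apply (locally_norm_le_locally x) in H.
  destruct H as [d Hd]. now exists d.
- intros [d Hd]. apply (locally_le_locally_norm x). now exists d.
Qed.

Lemma cd_const (c : C) (x : V) : cd (fun _ : V => c) x.
Proof. apply ex_filterdiff_const. Qed.

Lemma cd_plus (f g : V -> C) x : cd f x -> cd g x -> cd (fun y => f y + g y) x.
Proof. intros Hf Hg. apply (ex_filterdiff_plus_fct (V := C_NormedModule) f g); auto. Qed.

Lemma cd_opp (f : V -> C) x : cd f x -> cd (fun y => - f y) x.
Proof. intros Hf. apply (ex_filterdiff_opp_fct (V := C_NormedModule) f); auto. Qed.

Lemma cd_minus (f g : V -> C) x : cd f x -> cd g x -> cd (fun y => f y - g y) x.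
Proof. intros Hf Hg. apply cd_plus; [|apply cd_opp]; auto. Qed.

Lemma cd_ext (f g : V -> C) x : (forall y, f y = g y) -> cd f x -> cd g x.
Proof. intros E. apply ex_filterdiff_ext; auto. Qed.

Lemma cd_ext_locally (f g : V -> C) x :
  locally x (fun y => f y = g y) -> cd f x -> cd g x.
Proof. apply ex_filterdiff_ext_locally. Qed.

Lemma cd_comp (f : V -> C) (g : C -> C) x :
  cd f x -> cd g (f x) -> cd (fun y => g (f y)) x.
Proof. intros Hf Hg. apply (ex_filterdiff_comp' (V := C_NormedModule) f g x Hf Hg). Qed.

End Differentiability.

Definition cder (f : C -> C) (z l : C) : Prop :=
  forall eps : posreal, locally z (fun w =>
    (Cmod (f w - f z - l * (w - z)) <= eps * Cmod (w - z))%R).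

Lemma locally_Cmod (z : C) (P : C -> Prop) :
  locally z P <-> exists d : posreal, forall w, (Cmod (w - z) < d)%R -> P w.
Proof. apply (locally_norm_ball (V := C_NormedModule) z P). Qed.

Lemma is_linear_Cmult (l : C) :
  @is_linear C_AbsRing C_NormedModule C_NormedModule (fun h => l * h).
Proof.
split.
- intros x y. apply Cmult_plus_distr_l.
- intros k x. unfold scal; simpl. unfold mult; simpl. ring.
- exists (Cmod l + 1)%R. split.
  + generalize (Cmod_ge_0 l); lra.
  + intros x. change (Cmod (l * x) <= (Cmod l + 1) * Cmod x)%R.
    rewrite Cmod_mult. generalize (Cmod_ge_0 x); nra.
Qed.

(** A C-linear map from C to itself is multiplication by its value at 1. *)
Lemma cd_cder (f : C -> C) z : cd f z <-> exists l, cder f z l.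
Proof.
rewrite (cd_iff (V := C_NormedModule)). split.
- intros [L [HL H]]. exists (L (RtoC 1)). intros eps.
  generalize (H eps). apply filter_imp. intros w Hw.
  replace (L (RtoC 1) * (w - z)) with (L (minus w z)); [exact Hw|].
  transitivity (L (scal (minus w z) (RtoC 1 : C_NormedModule))).
  + f_equal. unfold scal; simpl; unfold mult; simpl. now rewrite Cmult_1_r.
  + rewrite (linear_scal L HL). unfold scal; simpl; unfold mult; simpl.
    unfold minus, plus, opp; simpl. ring.
- intros [l H]. exists (fun h => l * h). split; [apply is_linear_Cmult|]. exact H.
Qed.

Lemma cder_cd f z l : cder f z l -> cd f z.
Proof. intros H. apply cd_cder. now exists l. Qed.

Lemma cder_unique f z l1 l2 : cder f z l1 -> cder f z l2 -> l1 = l2.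
Proof.
intros H1 H2.
apply NNPP. intros N.
assert (P : (0 < Cmod (l1 - l2))%R).
{ apply Cmod_gt_0. intros E. apply N. replace l1 with (l1 - l2 + l2) by ring. rewrite E; ring. }
assert (He : (0 < Cmod (l1 - l2) / 4)%R) by lra.
destruct (proj1 (locally_Cmod _ _) (filter_and _ _ (H1 (mkposreal _ He)) (H2 (mkposreal _ He)))) as [d Hd].
simpl in Hd. assert (Hd0 := cond_pos d).
assert (Hh : Cmod (RtoC (d/2)) = (d/2)%R) by (rewrite Cmod_R; apply Rabs_pos_eq; lra).
destruct (Hd (z + RtoC (d/2))) as [A B].
{ replace (z + RtoC (d/2) - z) with (RtoC (d/2)) by ring. lra. }
replace (z + RtoC (d/2) - z) with (RtoC (d/2)) in A, B by ring.
rewrite Hh in A, B.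
assert (Q : (Cmod ((l1 - l2) * RtoC (d/2)) <= Cmod (l1 - l2) / 2 * (d/2))%R).
{ set (X := f (z + RtoC (d/2)) - f z) in *.
  replace ((l1 - l2) * RtoC (d/2)) with (- (X - l1 * RtoC (d/2)) + (X - l2 * RtoC (d/2))) by ring.
  eapply Rle_trans; [apply Cmod_triangle|]. rewrite Cmod_opp. lra. }
rewrite Cmod_mult, Hh in Q. nra.
Qed.

Lemma cder_const c z : cder (fun _ => c) z 0.
Proof.
intros eps. apply filter_forall. intros w.
replace (c - c - 0 * (w - z)) with (RtoC 0) by ring. rewrite Cmod_0.
apply Rmult_le_pos; [left; apply cond_pos | apply Cmod_ge_0].
Qed.

Lemma cder_id z : cder (fun w => w) z 1.
Proof.
intros eps. apply filter_forall. intros w.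
replace (w - z - 1 * (w - z)) with (RtoC 0) by ring. rewrite Cmod_0.
apply Rmult_le_pos; [left; apply cond_pos | apply Cmod_ge_0].
Qed.

Lemma cder_plus f g z a b : cder f z a -> cder g z b -> cder (fun w => f w + g w) z (a + b).
Proof.
intros Hf Hg eps.
generalize (filter_and _ _ (Hf (pos_div_2 eps)) (Hg (pos_div_2 eps))). apply filter_imp.
intros w [A B]. simpl in A, B.
replace (f w + g w - (f z + g z) - (a + b) * (w - z)) with
  ((f w - f z - a * (w - z)) + (g w - g z - b * (w - z))) by ring.
eapply Rle_trans; [apply Cmod_triangle|]. lra.
Qed.

Lemma cder_scal f z a k : cder f z a -> cder (fun w => k * f w) z (k * a).
Proof.
intros Hf eps.
assert (P : (0 < eps / (Cmod k + 1))%R).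
{ apply Rdiv_lt_0_compat; [apply cond_pos | generalize (Cmod_ge_0 k); lra]. }
generalize (Hf (mkposreal _ P)). apply filter_imp. simpl. intros w A.
replace (k * f w - k * f z - k * a * (w - z)) with (k * (f w - f z - a * (w - z))) by ring.
rewrite Cmod_mult.
assert (K := Cmod_ge_0 k).
apply Rle_trans with ((Cmod k + 1) * (eps / (Cmod k + 1) * Cmod (w - z)))%R.
- apply Rmult_le_compat; [apply K | apply Cmod_ge_0 | lra | exact A].
- right. field. lra.
Qed.

Lemma cder_minus f g z a b : cder f z a -> cder g z b -> cder (fun w => f w - g w) z (a - b).
Proof.
intros Hf Hg. generalize (cder_plus _ _ _ _ _ Hf (cder_scal _ _ _ (-1) Hg)).
intros H eps. generalize (H eps). apply filter_imp. intros w A.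
replace (f w - g w - (f z - g z) - (a - b) * (w - z)) with
 (f w + -1 * g w - (f z + -1 * g z) - (a + -1 * b) * (w - z)) by ring. exact A.
Qed.

Lemma cder_lip f z a : cder f z a ->
  locally z (fun w => (Cmod (f w - f z) <= (Cmod a + 1) * Cmod (w - z))%R).
Proof.
intros H. generalize (H (mkposreal 1 Rlt_0_1)). apply filter_imp. simpl. intros w A.
replace (f w - f z) with ((f w - f z - a * (w - z)) + a * (w - z)) by ring.
eapply Rle_trans; [apply Cmod_triangle|]. rewrite Cmod_mult. lra.
Qed.

Lemma cder_comp f g z a b : cder f z a -> cder g (f z) b -> cder (fun w => g (f w)) z (b * a).
Proof.
intros Hf Hg eps.
assert (Ka := Cmod_ge_0 a). assert (Kb := Cmod_ge_0 b).
assert (P1 : (0 < eps / (2 * (Cmod a + 1)))%R).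
{ apply Rdiv_lt_0_compat; [apply cond_pos | lra]. }
assert (P2 : (0 < eps / (2 * (Cmod b + 1)))%R).
{ apply Rdiv_lt_0_compat; [apply cond_pos | lra]. }
assert (C0 : continuous f z).
{ apply (cd_continuous (V := C_NormedModule)). now apply (cder_cd _ _ a). }
assert (C1 : locally z (fun w => (Cmod (g (f w) - g (f z) - b * (f w - f z))
    <= eps / (2 * (Cmod a + 1)) * Cmod (f w - f z))%R)).
{ exact (C0 _ (Hg (mkposreal _ P1))). }
generalize (filter_and _ _ C1
  (filter_and _ _ (Hf (mkposreal _ P2)) (cder_lip _ _ _ Hf))).
apply filter_imp. simpl. intros w [A [B D]].
replace (g (f w) - g (f z) - b * a * (w - z)) with
  ((g (f w) - g (f z) - b * (f w - f z)) + b * (f w - f z - a * (w - z))) by ring.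
eapply Rle_trans; [apply Cmod_triangle|]. rewrite Cmod_mult.
assert (W := Cmod_ge_0 (w - z)).
apply Rle_trans with (eps / (2 * (Cmod a + 1)) * ((Cmod a + 1) * Cmod (w - z)) +
   (Cmod b + 1) * (eps / (2 * (Cmod b + 1)) * Cmod (w - z)))%R.
- apply Rplus_le_compat.
  + eapply Rle_trans; [exact A|]. apply Rmult_le_compat_l; [left; exact P1|exact D].
  + apply Rmult_le_compat; [lra | apply Cmod_ge_0 | lra | exact B].
- right. field. split; lra.
Qed.

Lemma cder_inv (z : C) : z <> 0 -> cder (fun w => / w) z (- / (z * z)).
Proof.
intros Hz eps. assert (P := proj1 (Cmod_gt_0 z) Hz).
assert (Pe := cond_pos eps).
(* The error equals (w - z)^2 / (w z^2). The first radius keeps |w| above |z| / 2, so that the error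
   is at most 2 |w - z|^2 / |z|^3; the second radius makes this at most eps |w - z|. *)
assert (Q : (0 < Rmin (Cmod z / 2) (eps * (Cmod z * Cmod z * Cmod z) / 2))%R).
{ apply Rmin_case; [lra|]. apply Rdiv_lt_0_compat; [|lra].
  repeat apply Rmult_lt_0_compat; auto. }
apply locally_Cmod. exists (mkposreal _ Q). simpl. intros w Hw.
assert (H1 := Rlt_le_trans _ _ _ Hw (Rmin_l _ _)).
assert (H2 := Rlt_le_trans _ _ _ Hw (Rmin_r _ _)).
assert (W : (Cmod z / 2 < Cmod w)%R).
{ assert (T := Cmod_triangle w (z - w)). replace (w + (z - w)) with z in T by ring.
  rewrite <- (Cmod_opp (z - w)) in T. replace (- (z - w)) with (w - z) in T by ring. lra. }
assert (Hw0 : w <> 0). { apply Cmod_gt_0. lra. }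
replace (/ w - / z - - / (z * z) * (w - z)) with ((w - z) * (w - z) / (w * (z * z))).
2: { field. split; auto. }
rewrite Cmod_div, !Cmod_mult.
2: { repeat apply Cmult_neq_0; auto. }
assert (N := Cmod_ge_0 (w - z)).
apply Rle_trans with (Cmod (w - z) * Cmod (w - z) / (Cmod z / 2 * (Cmod z * Cmod z)))%R.
- unfold Rdiv. apply Rmult_le_compat_l; [nra|]. apply Rinv_le_contravar; [|nra].
  apply Rmult_lt_0_compat; nra.
- apply (Rmult_le_reg_r (Cmod z / 2 * (Cmod z * Cmod z))).
  { apply Rmult_lt_0_compat; nra. }
  unfold Rdiv at 1. rewrite Rmult_assoc, Rinv_l.
  2: { apply Rgt_not_eq. apply Rmult_lt_0_compat; nra. }
  rewrite Rmult_1_r. nra.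
Qed.

Lemma cder_ext_locally f g z l : locally z (fun w => f w = g w) -> cder f z l -> cder g z l.
Proof.
intros E H eps. assert (E0 := locally_singleton _ _ E).
generalize (filter_and _ _ E (H eps)). apply filter_imp. intros w [A B].
now rewrite <- A, <- E0.
Qed.

Lemma Cmod_le_Re_Im (z : C) : (Cmod z <= Rabs (Re z) + Rabs (Im z))%R.
Proof.
unfold Cmod, Re, Im. destruct z as [x y]; simpl.
rewrite <- (sqrt_Rsqr (Rabs x + Rabs y)); [|generalize (Rabs_pos x) (Rabs_pos y); lra].
apply sqrt_le_1_alt. unfold Rsqr.
generalize (Rabs_pos x) (Rabs_pos y) (pow2_abs x) (pow2_abs y). simpl. nra.
Qed.

Section Products.
Context {V : NormedModule C_AbsRing}.

Lemma cd_mult (f g : V -> C) x : cd f x -> cd g x -> cd (fun y => f y * g y) x.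
Proof.
(* polarisation: the only nonlinear ingredient is the square *)
intros Hf Hg.
assert (S : forall z : C, cd (fun w : C => w * w) z).
{ intros z. apply (cder_cd _ _ (2 * z)). intros eps. apply locally_Cmod. exists eps.
  intros w Hw. replace (w * w - z * z - 2 * z * (w - z)) with ((w - z) * (w - z)) by ring.
  rewrite Cmod_mult. apply Rmult_le_compat_r; [apply Cmod_ge_0|lra]. }
assert (M : forall (k : C) (h : V -> C), cd h x -> cd (fun y => k * h y) x).
{ intros k h Hh. apply (cd_comp h (fun w => k * w)); [exact Hh|].
  apply @ex_filterdiff_linear. apply is_linear_Cmult. }
apply (cd_ext (fun y => /4 * ((f y + g y) * (f y + g y) - (f y - g y) * (f y - g y)))).
{ intros y. field. }
apply M, cd_minus.
- apply (cd_comp (fun y => f y + g y) (fun w => w * w)); [now apply cd_plus|apply S].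
- apply (cd_comp (fun y => f y - g y) (fun w => w * w)); [now apply cd_minus|apply S].
Qed.

Lemma cd_inv (f : V -> C) x : cd f x -> f x <> 0 -> cd (fun y => / f y) x.
Proof.
intros Hf H. apply (cd_comp f (fun w => / w)); [exact Hf|].
apply (cder_cd _ _ _ (cder_inv _ H)).
Qed.

Lemma cd_div (f g : V -> C) x : cd f x -> cd g x -> g x <> 0 -> cd (fun y => f y / g y) x.
Proof. intros. apply cd_mult; [|apply cd_inv]; auto. Qed.

Lemma is_linear_line (v : V) : @is_linear C_AbsRing C_NormedModule V (fun t : C => scal t v).
Proof.
split.
- intros s t. apply (scal_distr_r s t v).
- intros k t. symmetry. apply (scal_assoc k t v).
- exists (norm v + 1)%R. split; [generalize (norm_ge_0 v); lra|].
  intros t. eapply Rle_trans; [apply (norm_scal t v)|].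
  change (Cmod t * norm v <= (norm v + 1) * Cmod t)%R.
  generalize (Cmod_ge_0 t) (norm_ge_0 v); nra.
Qed.

Lemma cd_affine (x v : V) (t : C_NormedModule) :
  @ex_filterdiff C_AbsRing C_NormedModule V (fun t : C => plus x (scal t v)) (locally t).
Proof.
apply (ex_filterdiff_plus_fct (fun _ => x) (fun t : C => scal t v)).
- apply ex_filterdiff_const.
- apply ex_filterdiff_linear. apply is_linear_line.
Qed.

Lemma cd_line (f : V -> C) (x v : V) (t : C) :
  cd f (plus x (scal t v)) -> cd (fun t : C => f (plus x (scal t v))) t.
Proof.
intros H. apply (ex_filterdiff_comp' (U := C_NormedModule) (V := V) (W := C_NormedModule)
  (fun t : C => plus x (scal t v)) f t).
- apply cd_affine.
- exact H.
Qed.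

Lemma cd_shift (f : V -> C) (x v : V) :
  cd f (plus x v) -> cd (fun y => f (plus y v)) x.
Proof.
intros H. apply (ex_filterdiff_comp' (U := V) (V := V) (fun y => plus y v) f x); [|exact H].
apply (ex_filterdiff_plus_fct (fun y => y) (fun _ => v)).
- apply ex_filterdiff_id.
- apply ex_filterdiff_const.
Qed.

End Products.

(** * Integrals of complex-valued functions and Goursat's theorem *)

Notation is_CInt := (@is_RInt C_R_NormedModule).
Notation ex_CInt := (@ex_RInt C_R_NormedModule).
Definition CInt (f : R -> C) (a b : R) : C := @RInt C_R_CompleteNormedModule f a b.
Notation ccont := (@continuous R_UniformSpace C_UniformSpace).

(* Equalities at a structure sort are invisible to [ring] and [field]. *)
Ltac ceq := match goal with |- ?a = ?b => change (@eq C a b) end.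

Lemma norm_C_R (z : C) : @norm R_AbsRing C_R_NormedModule z = Cmod z.
Proof.
destruct z as [x y]. unfold norm; simpl. unfold prod_norm, Cmod; simpl.
unfold norm; simpl. unfold abs; simpl. f_equal.
rewrite !Rmult_1_r, <- !Rabs_mult, !Rabs_pos_eq; nra.
Qed.

(** The integral is taken in a real module, whose [scal] admits only real factors, so a complex
    factor has to be treated on real and imaginary parts. *)
Lemma is_CInt_mult (f : R -> C) a b (k l : C) :
  is_CInt f a b l -> is_CInt (fun t => k * f t) a b (k * l).
Proof.
intros H.
assert (H1 := is_RInt_fct_extend_fst (U := R_NormedModule) (V := R_NormedModule) f a b l H).
assert (H2 := is_RInt_fct_extend_snd (U := R_NormedModule) (V := R_NormedModule) f a b l H).
apply (is_RInt_fct_extend_pair (U := R_NormedModule) (V := R_NormedModule)); simpl.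
- apply (is_RInt_minus (V := R_NormedModule) (fun t => fst k * fst (f t))%R (fun t => snd k * snd (f t))%R a b (fst k * fst l)%R (snd k * snd l)%R).
  + now apply (is_RInt_scal (V := R_NormedModule)).
  + now apply (is_RInt_scal (V := R_NormedModule)).
- apply (is_RInt_plus (V := R_NormedModule) (fun t => fst k * snd (f t))%R (fun t => snd k * fst (f t))%R a b (fst k * snd l)%R (snd k * fst l)%R).
  + now apply (is_RInt_scal (V := R_NormedModule)).
  + now apply (is_RInt_scal (V := R_NormedModule)).
Qed.

Lemma is_CInt_R (f : R -> R) a b (l : R) :
  is_RInt f a b l -> is_CInt (fun t => RtoC (f t)) a b (RtoC l).
Proof.
intros H.
apply (is_RInt_fct_extend_pair (U := R_NormedModule) (V := R_NormedModule)); simpl; [exact H|].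
assert (Z := is_RInt_const (V := R_NormedModule) a b (0%R : R)).
replace (scal (b - a)%R (0%R : R_NormedModule)) with (0%R : R_NormedModule) in Z; [exact Z|].
unfold scal; simpl; unfold mult; simpl; ring.
Qed.

Lemma CInt_unique (f : R -> C) a b l : is_CInt f a b l -> CInt f a b = l.
Proof. apply (is_RInt_unique (V := C_R_CompleteNormedModule)). Qed.

Lemma CInt_correct (f : R -> C) a b : ex_CInt f a b -> is_CInt f a b (CInt f a b).
Proof. apply (RInt_correct (V := C_R_CompleteNormedModule)). Qed.

Lemma ex_CInt_cont (f : R -> C) a b :
  (forall t, Rmin a b <= t <= Rmax a b -> ccont f t)%R -> ex_CInt f a b.
Proof. apply (ex_RInt_continuous (V := C_R_CompleteNormedModule)). Qed.

Lemma CInt_mult (f : R -> C) a b k : ex_CInt f a b -> CInt (fun t => k * f t) a b = k * CInt f a b.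
Proof. intros H. apply CInt_unique, is_CInt_mult, CInt_correct, H. Qed.

Lemma CInt_plus (f g : R -> C) a b : ex_CInt f a b -> ex_CInt g a b ->
  CInt (fun t => f t + g t) a b = CInt f a b + CInt g a b.
Proof. intros. now apply (RInt_plus (V := C_R_CompleteNormedModule)). Qed.

Lemma CInt_minus (f g : R -> C) a b : ex_CInt f a b -> ex_CInt g a b ->
  CInt (fun t => f t - g t) a b = CInt f a b - CInt g a b.
Proof. intros. now apply (RInt_minus (V := C_R_CompleteNormedModule)). Qed.

Lemma CInt_Chasles (f : R -> C) a b c : ex_CInt f a b -> ex_CInt f b c ->
  CInt f a c = CInt f a b + CInt f b c.
Proof. intros. symmetry. now apply (RInt_Chasles (V := C_R_CompleteNormedModule)). Qed.

Lemma CInt_ext (f g : R -> C) a b :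
  (forall t, Rmin a b < t < Rmax a b -> f t = g t)%R -> CInt f a b = CInt g a b.
Proof. apply (RInt_ext (V := C_R_CompleteNormedModule)). Qed.

Global Opaque CInt.

Lemma CInt_const (c : C) a b : CInt (fun _ => c) a b = RtoC (b - a) * c.
Proof.
apply CInt_unique.
replace (RtoC (b - a) * c) with (@scal R_AbsRing C_R_NormedModule (b - a)%R c).
- apply (is_RInt_const (V := C_R_NormedModule)).
- destruct c as [x y]. unfold scal; simpl. unfold prod_scal, scal; simpl. unfold mult; simpl.
  unfold Cmult; simpl. f_equal; ring.
Qed.

Lemma CInt_bound (f : R -> C) a b M : (a <= b)%R -> ex_CInt f a b ->
  (forall t, a <= t <= b -> Cmod (f t) <= M)%R -> (Cmod (CInt f a b) <= M * (b - a))%R.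
Proof.
intros Hab Hex HM. rewrite <- norm_C_R, Rmult_comm.
apply (norm_RInt_le_const (V := C_R_NormedModule) f a b); auto.
- intros t Ht. rewrite norm_C_R. auto.
- now apply CInt_correct.
Qed.

Lemma CInt_bound_fct (f : R -> C) (g : R -> R) a b : (a <= b)%R -> ex_CInt f a b ->
  ex_RInt g a b ->
  (forall t, a <= t <= b -> Cmod (f t) <= g t)%R -> (Cmod (CInt f a b) <= RInt g a b)%R.
Proof.
intros Hab Hex Hg HM. rewrite <- norm_C_R.
apply (norm_RInt_le (V := C_R_NormedModule) f g a b); auto.
- intros t Ht. rewrite norm_C_R. auto.
- now apply CInt_correct.
- now apply (RInt_correct (V := R_CompleteNormedModule)).
Qed.

Lemma is_CInt_lin (al be : C) a b :
  is_CInt (fun s => al + be * RtoC s) a b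
   (RtoC (b - a) * al + be * RtoC ((b * b - a * a) / 2)).
Proof.
apply (is_RInt_plus (V := C_R_NormedModule) (fun _ => al) (fun s => be * RtoC s)).
- rewrite <- (CInt_const al a b). apply CInt_correct, ex_RInt_const.
- apply is_CInt_mult, is_CInt_R.
  replace ((b * b - a * a) / 2)%R with (minus (b * b / 2) (a * a / 2))%R.
  2: { unfold minus, plus, opp; simpl. field. }
  apply (is_RInt_derive (V := R_CompleteNormedModule) (fun s => s * s / 2)%R (fun s => s)).
  + intros x _. auto_derive; [auto|]. field.
  + intros x _. apply continuous_id.
Qed.

Lemma ccont_plus (f g : R -> C) t : ccont f t -> ccont g t -> ccont (fun s => f s + g s) t.
Proof. apply (continuous_plus (V := C_R_NormedModule)). Qed.

Lemma continuous_C_eps {U : UniformSpace} (f : U -> C) x :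
  (forall eps : posreal, locally x (fun y => Cmod (f y - f x) < eps)%R) ->
  @continuous U C_UniformSpace f x.
Proof.
intros H P HP. apply locally_Cmod in HP. destruct HP as [d Hd].
unfold filtermap. generalize (H d). apply filter_imp. intros y Hy. now apply Hd.
Qed.

Lemma continuous_C_eps_inv {U : UniformSpace} (f : U -> C) x :
  @continuous U C_UniformSpace f x ->
  forall eps : posreal, locally x (fun y => Cmod (f y - f x) < eps)%R.
Proof.
intros H eps. apply (H (fun z => Cmod (z - f x) < eps)%R). apply locally_Cmod. now exists eps.
Qed.

Lemma continuous_C_comp {U : UniformSpace} (f : U -> C) (g : C -> C) x :
  @continuous U C_UniformSpace f x -> cd g (f x) -> @continuous U C_UniformSpace (fun y => g (f y)) x.
Proof.
intros Hf Hg. apply (continuous_comp f g x Hf).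
apply (cd_continuous (V := C_NormedModule) g _ Hg).
Qed.

Lemma continuous_pair {U : UniformSpace} (f g : U -> R) x :
  continuous f x -> continuous g x -> @continuous U C_UniformSpace (fun y => (f y, g y)) x.
Proof.
intros Hf Hg. apply continuous_C_eps. intros eps.
assert (P : (0 < eps / 2)%R) by (generalize (cond_pos eps); lra).
assert (Hf1 := proj1 (filterlim_locally f (f x)) Hf (mkposreal _ P)).
assert (Hg1 := proj1 (filterlim_locally g (g x)) Hg (mkposreal _ P)).
generalize (filter_and _ _ Hf1 Hg1). apply filter_imp.
intros y [A B]. unfold ball in A, B; simpl in A, B. unfold AbsRing_ball, abs, minus, plus, opp in A, B; simpl in A, B.
eapply Rle_lt_trans; [apply Cmod_le_Re_Im|]. simpl. unfold Rminus in *. lra.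
Qed.

(** Polarisation as for [cd_mult]: squares and constant multiples are compositions with
    differentiable functions of one complex variable. *)
Lemma ccont_mult (f g : R -> C) t : ccont f t -> ccont g t -> ccont (fun s => f s * g s) t.
Proof.
intros Hf Hg.
assert (S : forall h, ccont h t -> ccont (fun s => h s * h s) t).
{ intros h Hh. apply (continuous_C_comp h (fun w => w * w) t Hh).
  apply (cd_mult (V := C_NormedModule) (fun w => w) (fun w => w)); apply (cder_cd _ _ 1), cder_id. }
assert (M : forall k h, ccont h t -> ccont (fun s => k * h s) t).
{ intros k h Hh. apply (continuous_C_comp h (fun w => k * w) t Hh).
  apply (cder_cd _ _ (k * 1)), cder_scal, cder_id. }
apply (continuous_ext (fun s => /4 * ((f s + g s) * (f s + g s) + (-1) * ((f s + -1 * g s) * (f s + -1 * g s))))).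
{ intros y. ceq. field. }
apply M, ccont_plus.
- apply S, ccont_plus; auto.
- apply M, S, ccont_plus; auto.
Qed.

Lemma ccont_RtoC (f : R -> R) t : continuous f t -> ccont (fun s => RtoC (f s)) t.
Proof. intros H. apply (continuous_pair f (fun _ => 0%R)); [exact H|apply continuous_const]. Qed.

Lemma ccont_minus (f g : R -> C) t : ccont f t -> ccont g t -> ccont (fun s => f s - g s) t.
Proof. apply (continuous_minus (V := C_R_NormedModule)). Qed.

Section Goursat.

Variable f : C -> C.

Definition rect (x1 x2 y1 y2 : R) (z : C) : Prop :=
  (x1 <= Re z <= x2 /\ y1 <= Im z <= y2)%R.

(** The contour integral of [f] over the boundary of the rectangle, counterclockwise from the lower
    left corner; [Ci] is the velocity on the vertical sides. *)
Definition J (x1 x2 y1 y2 : R) : C :=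
  CInt (fun s => f (s, y1)) x1 x2 + Ci * CInt (fun s => f (x2, s)) y1 y2
  - CInt (fun s => f (s, y2)) x1 x2 - Ci * CInt (fun s => f (x1, s)) y1 y2.

Lemma ex_CInt_horiz a b y : (a <= b)%R -> (forall z, rect a b y y z -> cd f z) ->
  ex_CInt (fun s => f (s, y)) a b.
Proof.
intros Hab H. apply ex_CInt_cont. intros t Ht.
rewrite Rmin_left, Rmax_right in Ht by exact Hab.
apply (continuous_C_comp (fun s => (s, y)) f).
- apply (continuous_pair (fun s => s) (fun _ => y)); [apply continuous_id|apply continuous_const].
- apply H. unfold rect; simpl. lra.
Qed.

Lemma ex_CInt_vert a b x : (a <= b)%R -> (forall z, rect x x a b z -> cd f z) ->
  ex_CInt (fun s => f (x, s)) a b.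
Proof.
intros Hab H. apply ex_CInt_cont. intros t Ht.
rewrite Rmin_left, Rmax_right in Ht by exact Hab.
apply (continuous_C_comp (fun s => (x, s)) f).
- apply (continuous_pair (fun _ => x) (fun s => s)); [apply continuous_const|apply continuous_id].
- apply H. unfold rect; simpl. lra.
Qed.

Ltac cint L := apply L; [lra|];
  let z := fresh in let Hz := fresh in intros z Hz;
  match goal with H : forall z, rect _ _ _ _ z -> _ |- _ => apply H end;
  unfold rect in *; simpl in Hz; lra.
Ltac cinth := cint ex_CInt_horiz.
Ltac cintv := cint ex_CInt_vert.

Lemma J_split_x x1 xm x2 y1 y2 : (x1 <= xm <= x2)%R -> (y1 <= y2)%R ->
  (forall z, rect x1 x2 y1 y2 z -> cd f z) ->
  J x1 x2 y1 y2 = J x1 xm y1 y2 + J xm x2 y1 y2.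
Proof.
intros Hx Hy H. unfold J at 1.
rewrite (CInt_Chasles (fun s => f (s, y1)) x1 xm x2); [|cinth|cinth].
rewrite (CInt_Chasles (fun s => f (s, y2)) x1 xm x2); [|cinth|cinth].
unfold J. ring.
Qed.

Lemma J_split_y x1 x2 y1 ym y2 : (x1 <= x2)%R -> (y1 <= ym <= y2)%R ->
  (forall z, rect x1 x2 y1 y2 z -> cd f z) ->
  J x1 x2 y1 y2 = J x1 x2 y1 ym + J x1 x2 ym y2.
Proof.
intros Hx Hy H. unfold J at 1.
rewrite (CInt_Chasles (fun s => f (x1, s)) y1 ym y2); [|cintv|cintv].
rewrite (CInt_Chasles (fun s => f (x2, s)) y1 ym y2); [|cintv|cintv].
unfold J. ring.
Qed.

(* Subtracting an affine function does not change [J]. *)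
Lemma J_small x1 x2 y1 y2 (al be : C) (e : R) : (x1 <= x2)%R -> (y1 <= y2)%R ->
  (forall z, rect x1 x2 y1 y2 z -> cd f z) ->
  (forall z, rect x1 x2 y1 y2 z -> Cmod (f z - al - be * z) <= e)%R ->
  (Cmod (J x1 x2 y1 y2) <= 2 * e * ((x2 - x1) + (y2 - y1)))%R.
Proof.
intros Hx Hy H He.
assert (HH : forall y, (y1 <= y <= y2)%R -> exists E : C, (Cmod E <= e * (x2 - x1))%R /\
  CInt (fun s => f (s, y)) x1 x2 = E + (RtoC (x2 - x1) * (al + be * (Ci * y)) + be * RtoC ((x2 * x2 - x1 * x1) / 2))).
{ intros y Hyy.
  assert (X1 : ex_CInt (fun s => f (s, y)) x1 x2) by cinth.
  assert (X2 := is_CInt_lin (al + be * (Ci * y)) be x1 x2).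
  exists (CInt (fun s => f (s, y) - (al + be * (Ci * y) + be * RtoC s)) x1 x2). split.
  - apply CInt_bound; [exact Hx| |].
    + apply (ex_RInt_minus (V := C_R_NormedModule)); [exact X1|]. now eexists; apply X2.
    + intros t Ht. replace (f (t, y) - (al + be * (Ci * y) + be * t)) with (f (t,y) - al - be * (t, y)).
      * apply He. unfold rect; simpl. lra.
      * replace ((t, y) : C) with (RtoC t + Ci * RtoC y). ring.
        apply injective_projections; simpl; ring.
  - rewrite CInt_minus; [|exact X1|now eexists; apply X2].
    rewrite (CInt_unique _ _ _ _ X2). ring. }
assert (VV : forall x, (x1 <= x <= x2)%R -> exists E : C, (Cmod E <= e * (y2 - y1))%R /\
  CInt (fun s => f (x, s)) y1 y2 = E + (RtoC (y2 - y1) * (al + be * x) + be * Ci * RtoC ((y2 * y2 - y1 * y1) / 2))).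
{ intros x Hxx.
  assert (X1 : ex_CInt (fun s => f (x, s)) y1 y2) by cintv.
  assert (X2 := is_CInt_lin (al + be * x) (be * Ci) y1 y2).
  exists (CInt (fun s => f (x, s) - (al + be * x + be * Ci * RtoC s)) y1 y2). split.
  - apply CInt_bound; [exact Hy| |].
    + apply (ex_RInt_minus (V := C_R_NormedModule)); [exact X1|]. now eexists; apply X2.
    + intros t Ht. replace (f (x, t) - (al + be * x + be * Ci * t)) with (f (x,t) - al - be * (x, t)).
      * apply He. unfold rect; simpl. lra.
      * replace ((x, t) : C) with (RtoC x + Ci * RtoC t). ring.
        apply injective_projections; simpl; ring.
  - rewrite CInt_minus; [|exact X1|now eexists; apply X2].
    rewrite (CInt_unique _ _ _ _ X2). ring. }
destruct (HH y1) as [E1 [B1 Q1]]; [lra|]. destruct (HH y2) as [E2 [B2 Q2]]; [lra|].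
destruct (VV x1) as [E3 [B3 Q3]]; [lra|]. destruct (VV x2) as [E4 [B4 Q4]]; [lra|].
unfold J. rewrite Q1, Q2, Q3, Q4.
(* The explicit parts on the four sides are integrals of one affine function, which has a primitive,
   so they cancel around the contour and only the four errors remain. *)
match goal with |- (Cmod ?z <= _)%R => replace z with (E1 + Ci * E4 + - E2 + - (Ci * E3)) end.
- eapply Rle_trans; [apply Cmod_triangle|].
  eapply Rle_trans; [apply Rplus_le_compat_r, Cmod_triangle|].
  eapply Rle_trans; [apply Rplus_le_compat_r, Rplus_le_compat_r, Cmod_triangle|].
  rewrite !Cmod_opp, !Cmod_mult, Cmod_Ci. lra.
- rewrite !RtoC_minus. ring.
Qed.

End Goursat.

(** [u k] is the lower end of an interval of length w / 2^k. Lower ends increase, and upper ends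
    decrease because a step is at most the length lost. *)
Lemma nested_intervals (u : nat -> R) (w : R) : (0 <= w)%R ->
  (forall k, u k <= u (S k) <= u k + w / 2 ^ (S k))%R ->
  exists X, forall k, (u k <= X <= u k + w / 2 ^ k)%R.
Proof.
intros Hw H.
assert (P : forall k, (0 < 2 ^ k)%R) by (intros k; apply pow_lt; lra).
assert (Q : forall k, (w / 2 ^ k = 2 * (w / 2 ^ S k))%R).
{ intros k. simpl. field. apply Rgt_not_eq, P. }
assert (D : forall k m, (u k <= u (k + m)%nat /\ u (k + m)%nat + w / 2 ^ (k + m) <= u k + w / 2 ^ k)%R).
{ intros k m. induction m as [|m IH].
  - rewrite Nat.add_0_r. lra.
  - rewrite Nat.add_succ_r. generalize (H (k + m)%nat) (Q (k + m)%nat). intros. lra. }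
assert (E : forall k, (0 <= w / 2 ^ k)%R).
{ intros k. apply Rdiv_le_0_compat; auto. }
destruct (ex_finite_lim_seq_incr u (u O + w)%R) as [X HX].
- intros n. apply H.
- intros n. destruct (D O n) as [_ D2]. simpl in D2. generalize (E n); lra.
- exists X. intros k. split.
  + apply (is_lim_seq_incr_compare u X HX). intros n. apply H.
  + apply (is_lim_seq_le (fun m => u (m + k)%nat) (fun _ => u k + w / 2 ^ k)%R X (u k + w / 2 ^ k)%R).
    * intros m. rewrite Nat.add_comm. destruct (D k m) as [_ D2]. generalize (E (k + m)%nat); lra.
    * now apply (is_lim_seq_incr_n u k X).
    * apply is_lim_seq_const.
Qed.

Lemma pow2_large (A d : R) : (0 < d)%R -> exists k, (A / 2 ^ k < d)%R.
Proof.
intros Hd. destruct (Rle_dec A 0) as [HA|HA].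
- exists O. simpl. unfold Rdiv. lra.
- destruct (pow_lt_1_zero (/2) ltac:(rewrite Rabs_pos_eq; lra) (d / A)) as [N HN].
  { apply Rdiv_lt_0_compat; lra. }
  exists N. specialize (HN N (Nat.le_refl N)).
  rewrite Rabs_pos_eq in HN by (apply pow_le; lra).
  rewrite pow_inv in HN. apply (Rmult_lt_compat_l A) in HN; [|lra].
  unfold Rdiv. replace (A * (d / A))%R with d in HN by (field; lra). exact HN.
Qed.

Section Goursat_theorem.
Variables (f : C -> C) (x1 x2 y1 y2 : R).
Hypothesis Hx : (x1 <= x2)%R.
Hypothesis Hy : (y1 <= y2)%R.
Hypothesis Hf : forall z, rect x1 x2 y1 y2 z -> cd f z.
Let w := (x2 - x1)%R.
Let h := (y2 - y1)%R.
Let J0 := Cmod (J f x1 x2 y1 y2).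

Definition quarter (k : nat) (x y : R) : R := Cmod (J f x (x + w / 2 ^ k)%R y (y + h / 2 ^ k)%R).

(** The last quarter is taken without a test: if the other three have a contour integral below a
    quarter of the bound, the triangle inequality forces the fourth one above it. *)
Definition next_corner (k : nat) (p : R * R) : R * R :=
  let a := (w / 2 ^ S k)%R in let b := (h / 2 ^ S k)%R in
  let good q := Rle_dec (J0 / 4 ^ S k) (quarter (S k) (fst q) (snd q)) in
  let p1 := (fst p, snd p) in let p2 := (fst p + a, snd p)%R in
  let p3 := (fst p, snd p + b)%R in let p4 := (fst p + a, snd p + b)%R in
  if good p1 then p1 else if good p2 then p2 else if good p3 then p3 else p4.

Fixpoint corner (k : nat) : R * R :=
  match k with O => (x1, y1) | S k => next_corner k (corner k) end.

Lemma corner_spec k :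
  (x1 <= fst (corner k) /\ fst (corner k) + w / 2 ^ k <= x2 /\
   y1 <= snd (corner k) /\ snd (corner k) + h / 2 ^ k <= y2 /\
   J0 / 4 ^ k <= quarter k (fst (corner k)) (snd (corner k)))%R /\
  (fst (corner k) <= fst (corner (S k)) <= fst (corner k) + w / 2 ^ (S k))%R /\
  (snd (corner k) <= snd (corner (S k)) <= snd (corner k) + h / 2 ^ (S k))%R.
Proof.
assert (P : forall k, (0 < 2 ^ k)%R) by (intros n; apply pow_lt; lra).
assert (P4 : forall k, (0 < 4 ^ k)%R) by (intros n; apply pow_lt; lra).
assert (Wk : forall k, (0 <= w / 2 ^ k)%R) by (intros n; apply Rdiv_le_0_compat; [unfold w; lra|auto]).
assert (Hk : forall k, (0 <= h / 2 ^ k)%R) by (intros n; apply Rdiv_le_0_compat; [unfold h; lra|auto]).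
assert (S1 : forall k, (fst (corner k) <= fst (corner (S k)) <= fst (corner k) + w / 2 ^ (S k))%R /\
  (snd (corner k) <= snd (corner (S k)) <= snd (corner k) + h / 2 ^ (S k))%R).
{ intros n. simpl corner. unfold next_corner.
  assert (A := Wk (S n)). assert (B := Hk (S n)).
  repeat match goal with |- context [if ?b then _ else _] => destruct b end; cbn [fst snd]; lra. }
split; [|apply S1].
induction k as [|k IH].
- simpl. unfold quarter; simpl. unfold J0, w, h. rewrite !Rdiv_1_r.
  replace (x1 + (x2 - x1))%R with x2 by ring. replace (y1 + (y2 - y1))%R with y2 by ring. lra.
- destruct IH as (A1 & A2 & A3 & A4 & A5).
  assert (Ew : (w / 2 ^ k = 2 * (w / 2 ^ S k))%R) by (simpl; field; apply Rgt_not_eq, P).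
  assert (Eh : (h / 2 ^ k = 2 * (h / 2 ^ S k))%R) by (simpl; field; apply Rgt_not_eq, P).
  assert (E4 : (J0 / 4 ^ k = 4 * (J0 / 4 ^ S k))%R) by (simpl; field; apply Rgt_not_eq, P4).
  destruct (S1 k) as [[B1 B2] [B3 B4]].
  split; [lra|]. split; [lra|]. split; [lra|]. split; [lra|].
  assert (W' := Wk (S k)). assert (H' := Hk (S k)).
  remember (corner k) as p. simpl corner. rewrite <- Heqp.
  destruct p as [x y]. cbn [fst snd] in *.
  unfold next_corner. cbn [fst snd]. 
  set (a := (w / 2 ^ S k)%R) in *. set (b := (h / 2 ^ S k)%R) in *.
  destruct (Rle_dec _ _) as [G1|G1]; [exact G1|].
  destruct (Rle_dec _ _) as [G2|G2]; [exact G2|].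
  destruct (Rle_dec _ _) as [G3|G3]; [exact G3|].
  apply Rnot_le_lt in G1. apply Rnot_le_lt in G2. apply Rnot_le_lt in G3.
  cbn [fst snd] in *.
  unfold quarter in *. fold a in G1, G2, G3 |- *. fold b in G1, G2, G3 |- *.
  rewrite Ew, Eh, E4 in A5.
  rewrite (J_split_x f x (x + a)%R) in A5; try lra.
  2: { intros [u v] [U V']. apply Hf. unfold rect; simpl in *. lra. }
  rewrite (J_split_y f x (x + a)%R y (y + b)%R) in A5; try lra.
  2: { intros [u v] [U V']. apply Hf. unfold rect; simpl in *. lra. }
  rewrite (J_split_y f (x + a)%R (x + 2 * a)%R y (y + b)%R) in A5; try lra.
  2: { intros [u v] [U V']. apply Hf. unfold rect; simpl in *. lra. }
  replace (x + 2 * a)%R with (x + a + a)%R in A5 by ring.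
  replace (y + 2 * b)%R with (y + b + b)%R in A5 by ring.
  assert (T1 := Cmod_triangle (J f x (x + a) y (y + b) + J f x (x + a) (y + b) (y + b + b)) (J f (x + a) (x + a + a) y (y + b) + J f (x + a) (x + a + a) (y + b) (y + b + b))).
  assert (T2 := Cmod_triangle (J f x (x + a) y (y + b)) (J f x (x + a) (y + b) (y + b + b))).
  assert (T3 := Cmod_triangle (J f (x + a) (x + a + a) y (y + b)) (J f (x + a) (x + a + a) (y + b) (y + b + b))).
  lra.
Qed.

Theorem Goursat : J f x1 x2 y1 y2 = 0.
Proof.
apply Cmod_eq_0. fold J0. apply Rle_antisym; [|apply Cmod_ge_0].
apply Rnot_lt_le. intros P0.
assert (w0 : (0 <= w)%R) by (unfold w; lra). assert (h0 : (0 <= h)%R) by (unfold h; lra).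
destruct (nested_intervals (fun k => fst (corner k)) w w0) as [X HX].
{ intros k. apply corner_spec. }
destruct (nested_intervals (fun k => snd (corner k)) h h0) as [Y HY].
{ intros k. apply corner_spec. }
destruct (proj1 (cd_cder f (X, Y)) ) as [l Hl].
{ apply Hf. destruct (corner_spec O) as [K _]. generalize (HX O) (HY O). simpl.
  unfold rect; simpl. unfold w, h. rewrite !Rdiv_1_r. lra. }
(* With this precision, level k yields J0 / 4^k <= 2 e ((w + h) / 2^k)^2, that is J0 <= 2 e (w +
   h)^2, which is at most J0 / 2; the summand 1 keeps the denominator positive for a degenerate
   rectangle. *)
assert (Pe : (0 < J0 / (4 * ((w + h) * (w + h) + 1)))%R).
{ apply Rdiv_lt_0_compat; [exact P0|nra]. }
destruct (proj1 (locally_Cmod _ _) (Hl (mkposreal _ Pe))) as [d Hd]. simpl in Hd.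
destruct (pow2_large (w + h) d (cond_pos d)) as [k Hk].
destruct (corner_spec k) as [(A1 & A2 & A3 & A4 & A5) _].
specialize (HX k). specialize (HY k). simpl in HX, HY.
set (x := fst (corner k)) in *. set (y := snd (corner k)) in *.
assert (P : (0 < 2 ^ k)%R) by (apply pow_lt; lra).
assert (Ewh : ((w + h) / 2 ^ k = w / 2 ^ k + h / 2 ^ k)%R) by (field; lra).
assert (Wk : (0 <= w / 2 ^ k)%R) by (apply Rdiv_le_0_compat; auto).
assert (Hkk : (0 <= h / 2 ^ k)%R) by (apply Rdiv_le_0_compat; auto).
set (e := (J0 / (4 * ((w + h) * (w + h) + 1)))%R) in *.
assert (Q : (quarter k x y <= 2 * (e * ((w + h) / 2 ^ k)) * ((w + h) / 2 ^ k))%R).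
{ unfold quarter.
  eapply Rle_trans; [apply (J_small f x _ y _ (f (X, Y) - l * (X, Y)) l (e * ((w + h) / 2 ^ k)))|].
  - lra.
  - lra.
  - intros [u v] [U V]. apply Hf. unfold rect; simpl in *. lra.
  - intros z [U V].
    replace (f z - (f (X, Y) - l * (X, Y)) - l * z) with (f z - f (X, Y) - l * (z - (X, Y))) by ring.
    assert (Z : (Cmod (z - (X, Y)) <= (w + h) / 2 ^ k)%R).
    { eapply Rle_trans; [apply Cmod_le_Re_Im|]. destruct z as [u v]; simpl in *.
      rewrite Ewh. apply Rplus_le_compat; apply Rabs_le; lra. }
    eapply Rle_trans; [apply Hd; lra|]. apply Rmult_le_compat_l; lra.
  - right. rewrite Ewh. ring. }
assert (R1 := Rle_trans _ _ _ A5 Q).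
assert (E4 : (4 ^ k = 2 ^ k * 2 ^ k)%R) by (rewrite <- Rpow_mult_distr; f_equal; ring).
rewrite E4 in R1.
assert (R2 : (J0 <= 2 * e * ((w + h) * (w + h)))%R).
{ apply (Rmult_le_reg_r (/ (2 ^ k * 2 ^ k))).
  - apply Rinv_0_lt_compat. nra.
  - unfold Rdiv in R1. rewrite Rinv_mult in *. lra. }
assert (R3 : (J0 = 4 * ((w + h) * (w + h) + 1) * e)%R).
{ unfold e. field. nra. }
nra.
Qed.

End Goursat_theorem.

(** * Mean values over circles and Cauchy estimates *)

Lemma Cexp_plus (z w : C) : Cexp (z + w) = Cexp z * Cexp w.
Proof.
destruct z as [a b], w as [c d]. unfold Cexp; simpl.
rewrite exp_plus, cos_plus, sin_plus. apply injective_projections; simpl; ring.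
Qed.

Lemma Cexp_0 : Cexp 0 = 1.
Proof. unfold Cexp; simpl. rewrite exp_0, cos_0, sin_0. apply injective_projections; simpl; ring. Qed.

Lemma Cmod_Cexp (z : C) : Cmod (Cexp z) = exp (Re z).
Proof.
unfold Cexp, Cmod; simpl. rewrite !Rmult_1_r.
replace (exp (Re z) * cos (Im z) * (exp (Re z) * cos (Im z)) + exp (Re z) * sin (Im z) * (exp (Re z) * sin (Im z)))%R
  with (exp (Re z) * exp (Re z) * ((sin (Im z))² + (cos (Im z))²))%R by (unfold Rsqr; ring).
rewrite sin2_cos2, Rmult_1_r. apply sqrt_square. left; apply exp_pos.
Qed.

Lemma Cexp_neq_0 (z : C) : Cexp z <> 0.
Proof. apply Cmod_gt_0. rewrite Cmod_Cexp. apply exp_pos. Qed.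

Lemma Cexp_opp (z : C) : Cexp (- z) = / Cexp z.
Proof.
assert (H : Cexp (- z) * Cexp z = 1).
{ rewrite <- Cexp_plus, <- Cexp_0. f_equal. ring. }
apply (f_equal (fun u => u * / Cexp z)) in H.
rewrite <- Cmult_assoc, Cinv_r, Cmult_1_r, Cmult_1_l in H; [exact H|apply Cexp_neq_0].
Qed.

(** The lower bound is [1 + x <= exp x]; the same inequality at [- x] gives [exp x * (1 - x) <= 1]
    and with it the upper bounds. *)
Lemma exp_quad (x : R) : (Rabs x <= / 2)%R ->
  (Rabs (exp x - 1 - x) <= 2 * (x * x))%R /\ (Rabs (exp x - 1) <= 2 * Rabs x)%R /\ (exp x <= 2)%R.
Proof.
intros Hx.
assert (Hx' := Hx). apply Rabs_le_between in Hx'.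
assert (L : (1 + x <= exp x)%R) by apply exp_ineq1_le.
assert (U : (exp x * (1 - x) <= 1)%R).
{ assert (L' := exp_ineq1_le (- x)). assert (E : (exp x * exp (- x) = 1)%R).
  { rewrite <- exp_plus, Rplus_opp_r. apply exp_0. }
  assert (P := exp_pos x). nra. }
assert (P : (0 <= exp x - 1 - x <= 2 * (x * x))%R).
{ split; [lra|]. assert (Q : ((exp x - 1 - x) * (1 - x) <= x * x)%R) by nra. nra. }
split; [apply Rabs_le; nra|]. split; [|nra].
destruct (Rle_dec 0 x) as [H0|H0].
- rewrite (Rabs_pos_eq x) by lra. rewrite Rabs_pos_eq by lra. nra.
- rewrite (Rabs_left x) by lra. apply Rabs_le. nra.
Qed.

Lemma Rabs_sin_le (y : R) : (Rabs (sin y) <= Rabs y)%R.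
Proof.
assert (H := bounded_variation sin cos 1 0 y).
rewrite sin_0, !Rminus_0_r, Rmult_1_l in H. apply H.
intros t _. split; [auto_derive; [auto|ring]|].
apply Rabs_le. generalize (COS_bound t); lra.
Qed.

Lemma one_minus_cos (y : R) : (0 <= 1 - cos y <= y * y / 2)%R.
Proof.
split; [generalize (COS_bound y); lra|].
replace y with (2 * (y / 2))%R at 1 by field.
rewrite cos_2a_sin. assert (H := Rabs_sin_le (y / 2)).
assert (K : (sin (y/2) * sin (y/2) <= (y/2) * (y/2))%R).
{ rewrite <- (Rabs_pos_eq (sin (y/2) * sin (y/2))) by nra. rewrite <- (Rabs_pos_eq (y/2 * (y/2))) by nra.
  rewrite !Rabs_mult. apply Rmult_le_compat; auto; apply Rabs_pos. }
nra.
Qed.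

Lemma sin_cubic (y : R) : (Rabs (sin y - y) <= y * y / 2 * Rabs y)%R.
Proof.
assert (H := bounded_variation (fun t => sin t - t)%R (fun t => cos t - 1)%R (y * y / 2) 0 y).
cbv beta in H. rewrite sin_0, !Rminus_0_r in H. apply H.
intros t Ht. split; [auto_derive; [auto|ring]|].
rewrite Rabs_left1 by (generalize (COS_bound t); lra).
assert (Q := one_minus_cos t). rewrite Rminus_0_r in Ht.
assert (K : (t * t <= y * y)%R).
{ rewrite <- (Rabs_pos_eq (t * t)) by nra. rewrite <- (Rabs_pos_eq (y * y)) by nra.
  rewrite !Rabs_mult. apply Rmult_le_compat; auto; apply Rabs_pos. }
lra.
Qed.

Lemma im_le_Cmod (z : C) : (Rabs (Im z) <= Cmod z)%R.
Proof. eapply Rle_trans; [|apply Rmax_Cmod]. apply Rmax_r. Qed.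

Lemma Cexp_quad (z : C) : (Cmod z <= / 2)%R -> (Cmod (Cexp z - 1 - z) <= 6 * (Cmod z * Cmod z))%R.
Proof.
intros Hz. assert (A := re_le_Cmod z). assert (B := im_le_Cmod z).
destruct z as [x y]; simpl in A, B. set (m := Cmod (x, y)) in *.
destruct (exp_quad x) as (E1 & E2 & E3); [lra|].
assert (Cy := one_minus_cos y). assert (Sy := sin_cubic y). assert (Sy' := Rabs_sin_le y).
assert (Ax := Rabs_pos x). assert (Ay := Rabs_pos y). assert (Pe := exp_pos x).
assert (xx : (x * x <= m * m)%R) by (rewrite <- (Rabs_pos_eq (x * x)) by nra; rewrite Rabs_mult; nra).
assert (yy : (y * y <= m * m)%R) by (rewrite <- (Rabs_pos_eq (y * y)) by nra; rewrite Rabs_mult; nra).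
eapply Rle_trans; [apply Cmod_le_Re_Im|]. unfold Cexp; simpl.
replace (exp x * cos y + - (1) + - x)%R with ((exp x - 1 - x) + - (exp x * (1 - cos y)))%R by ring.
replace (exp x * sin y + - 0 + - y)%R with ((exp x - 1) * sin y + (sin y - y))%R by ring.
assert (T1 := Rabs_triang (exp x - 1 - x) (- (exp x * (1 - cos y)))).
assert (T2 := Rabs_triang ((exp x - 1) * sin y) (sin y - y)).
rewrite Rabs_Ropp, Rabs_mult, (Rabs_pos_eq (exp x)), (Rabs_pos_eq (1 - cos y)) in T1 by lra.
rewrite Rabs_mult in T2.
assert (Q1 : (exp x * (1 - cos y) <= m * m)%R) by nra.
assert (Q2 : (Rabs (exp x - 1) * Rabs (sin y) <= 2 * (m * m))%R).
{ apply Rle_trans with (2 * Rabs x * Rabs y)%R.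
  - apply Rmult_le_compat; auto; apply Rabs_pos.
  - nra. }
assert (Q3 : (y * y / 2 * Rabs y <= m * m / 2)%R) by nra.
lra.
Qed.

Lemma cder_Cexp (z : C) : cder Cexp z (Cexp z).
Proof.
intros eps. assert (Pe := exp_pos (Re z)).
assert (P : (0 < Rmin (/2) (eps / (6 * exp (Re z))))%R).
{ apply Rmin_case; [lra|]. apply Rdiv_lt_0_compat; [apply cond_pos|lra]. }
apply locally_Cmod. exists (mkposreal _ P). simpl. intros w Hw.
assert (H1 := Rlt_le_trans _ _ _ Hw (Rmin_l _ _)).
assert (H2 := Rlt_le_trans _ _ _ Hw (Rmin_r _ _)).
replace (Cexp w - Cexp z - Cexp z * (w - z)) with (Cexp z * (Cexp (w - z) - 1 - (w - z))).
2: { replace (Cexp w) with (Cexp (z + (w - z))) by (f_equal; ring). rewrite Cexp_plus. ring. }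
rewrite Cmod_mult, Cmod_Cexp.
assert (Q := Cexp_quad (w - z) ltac:(lra)).
assert (N := Cmod_ge_0 (w - z)).
apply Rle_trans with (exp (Re z) * (6 * (Cmod (w - z) * Cmod (w - z))))%R; [apply Rmult_le_compat_l; lra|].
apply (Rmult_lt_compat_r (6 * exp (Re z))) in H2; [|lra].
unfold Rdiv in H2. rewrite Rmult_assoc, Rinv_l, Rmult_1_r in H2 by lra. nra.
Qed.

Definition circ (r t : R) : C := RtoC r * Cexp (Ci * RtoC t).

Lemma circ_eq r t : circ r t = (r * cos t, r * sin t)%R.
Proof.
unfold circ, Cexp; simpl.
replace (0 * t - 1 * 0)%R with 0%R by ring. replace (0 * 0 + 1 * t)%R with t by ring.
rewrite exp_0. apply injective_projections; simpl; ring.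
Qed.

Lemma Cmod_circ r t : (0 <= r)%R -> Cmod (circ r t) = r.
Proof.
intros Hr. unfold circ. rewrite Cmod_mult, Cmod_R, Cmod_Cexp, Rabs_pos_eq by exact Hr.
simpl. replace (0 * t - 1 * 0)%R with 0%R by ring. rewrite exp_0. ring.
Qed.

Lemma ccont_circ r t : ccont (circ r) t.
Proof.
apply (continuous_ext (fun t => (r * cos t, r * sin t)%R : C)).
{ intros x. symmetry. apply circ_eq. }
apply continuous_pair; (apply @ex_derive_continuous; auto_derive; auto).
Qed.

Definition Cmean (g : C -> C) (r : R) : C :=
  / RtoC (2 * PI) * CInt (fun t => g (circ r t)) 0 (2 * PI).

Lemma two_PI_pos : (0 < 2 * PI)%R. Proof. generalize PI_RGT_0; lra. Qed.

Lemma two_PI_C : RtoC (2 * PI) <> 0.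
Proof. intros E. apply RtoC_inj in E. generalize two_PI_pos; lra. Qed.

(* The rectangle [x1, ln r] x [0, 2 pi] is mapped by [exp] onto an annulus; on it
   Goursat's theorem says that the mean over a circle does not depend on the radius. *)
Theorem mean_value_punctured (g : C -> C) (l : C) (rho r : R) :
  (0 < r < rho)%R ->
  (forall z, 0 < Cmod z < rho -> cd g z)%R ->
  (forall eps : posreal, exists d : posreal, forall z, (0 < Cmod z < d)%R -> (Cmod (g z - l) <= eps)%R) ->
  Cmean g r = l.
Proof.
intros Hr Hg Hl.
set (psi := fun w => g (Cexp w)).
assert (Hpsi : forall w, (Re w < ln rho)%R -> cd psi w).
{ intros w Hw. apply (cd_comp (V := C_NormedModule) Cexp g).
  - apply (cder_cd _ _ _ (cder_Cexp w)).
  - apply Hg. rewrite Cmod_Cexp. split; [apply exp_pos|].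
    rewrite <- (exp_ln rho) by lra. now apply exp_increasing. }
assert (Hln : (ln r < ln rho)%R) by (apply ln_increasing; lra).
set (W := fun x => CInt (fun t => psi (x, t)) 0 (2 * PI)).
assert (Ex : forall x, (x <= ln r)%R -> ex_CInt (fun t => psi (x, t)) 0 (2 * PI)).
{ intros x Hx. apply ex_CInt_vert; [generalize two_PI_pos; lra|].
  intros z [Hz _]. apply Hpsi. lra. }
assert (HW : forall x, (x <= ln r)%R -> W x = W (ln r)).
{ intros x Hx.
  assert (G := Goursat psi x (ln r) 0 (2 * PI) Hx ltac:(generalize two_PI_pos; lra)).
  rewrite <- (Cplus_0_l (W x)).
  assert (G0 := G ltac:(intros z [Hz _]; apply Hpsi; lra)). clear G.
  unfold J in G0.
  (* The horizontal sides cancel because exp has period 2 pi i; what is left of Goursat says that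
     the two vertical integrals agree. *)
  replace (CInt (fun s => psi (s, 2 * PI)%R) x (ln r)) with (CInt (fun s => psi (s, 0%R)) x (ln r)) in G0.
  2: { apply CInt_ext. intros t _. unfold psi, Cexp; simpl. now rewrite cos_2PI, sin_2PI, cos_0, sin_0. }
  fold (W x) (W (ln r)) in G0.
  assert (I2 : Ci * Ci = -1) by (apply injective_projections; simpl; ring).
  transitivity (W x + - Ci * (CInt (fun s : R => psi (s, 0%R)) x (ln r) + Ci * W (ln r) -
       CInt (fun s : R => psi (s, 0%R)) x (ln r) - Ci * W x)); [rewrite G0; ring|].
  transitivity (W x - (Ci * Ci) * W (ln r) + (Ci * Ci) * W x); [ring|]. rewrite I2. ring. }
(* Moving the left side far to the left shrinks its circle into the punctured disc where [g] is
   close to [l]. *)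
assert (HV : W (ln r) = RtoC (2 * PI) * l).
{ apply NNPP. intros N.
  assert (P : (0 < Cmod (W (ln r) - RtoC (2 * PI) * l))%R).
  { apply Cmod_gt_0. intros E. apply N.
    transitivity (W (ln r) - RtoC (2 * PI) * l + RtoC (2 * PI) * l); [ring|]. rewrite E; ring. }
  assert (TP := two_PI_pos).
  assert (Pe : (0 < Cmod (W (ln r) - RtoC (2 * PI) * l) / (2 * (2 * PI)))%R) by (apply Rdiv_lt_0_compat; lra).
  destruct (Hl (mkposreal _ Pe)) as [d Hd]. simpl in Hd.
  set (x := Rmin (ln r) (ln (d / 2))).
  assert (D := cond_pos d).
  assert (X1 : (x <= ln r)%R) by apply Rmin_l.
  assert (X2 : (exp x < d)%R).
  { apply Rle_lt_trans with (exp (ln (d / 2))).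
    - destruct (Rmin_r (ln r) (ln (d / 2))) as [L|L]; [left; now apply exp_increasing|].
      unfold x. rewrite L. lra.
    - rewrite exp_ln by lra. lra. }
  assert (Q : (Cmod (W (ln r) - RtoC (2 * PI) * l) <= Cmod (W (ln r) - RtoC (2 * PI) * l) / (2 * (2 * PI)) * (2 * PI - 0))%R).
  { rewrite <- (HW x X1) at 1. unfold W at 1.
    replace (RtoC (2 * PI) * l) with (CInt (fun _ => l) 0 (2 * PI)) at 1.
    2: { rewrite CInt_const. now rewrite Rminus_0_r. }
    rewrite <- CInt_minus; [|now apply Ex|apply (ex_RInt_const (V := C_R_NormedModule))].
    apply CInt_bound; [lra| |].
    - apply (ex_RInt_minus (V := C_R_NormedModule)); [now apply Ex|apply (ex_RInt_const (V := C_R_NormedModule))].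
    - intros t _. apply Hd. rewrite Cmod_Cexp. simpl. split; [apply exp_pos|exact X2]. }
  rewrite Rminus_0_r in Q. unfold Rdiv in Q.
  replace (Cmod (W (ln r) - RtoC (2 * PI) * l) * / (2 * (2 * PI)) * (2 * PI))%R
    with (Cmod (W (ln r) - RtoC (2 * PI) * l) / 2)%R in Q by (field; lra).
  lra. }
unfold Cmean.
replace (CInt (fun t => g (circ r t)) 0 (2 * PI)) with (W (ln r)).
- rewrite HV. field. apply two_PI_C.
- apply CInt_ext. intros t _. unfold psi. f_equal. rewrite circ_eq. unfold Cexp; simpl.
  rewrite exp_ln by lra. reflexivity.
Qed.

Lemma ex_CInt_circle (g : C -> C) r :
  (forall t, cd g (circ r t)) -> ex_CInt (fun t => g (circ r t)) 0 (2 * PI).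
Proof.
intros H. apply ex_CInt_cont. intros t _.
apply (continuous_C_comp (circ r) g); [apply ccont_circ|apply H].
Qed.

Lemma Cmean_bound (g : C -> C) r M :
  (forall t, cd g (circ r t)) -> (forall t, Cmod (g (circ r t)) <= M)%R -> (Cmod (Cmean g r) <= M)%R.
Proof.
intros H HM. unfold Cmean. assert (P := two_PI_pos).
rewrite Cmod_mult, Cmod_inv by apply two_PI_C. rewrite Cmod_R, (Rabs_pos_eq (2 * PI)) by lra.
apply (Rmult_le_reg_l (2 * PI)); [exact P|]. rewrite <- Rmult_assoc, Rinv_r, Rmult_1_l by lra.
eapply Rle_trans; [apply (CInt_bound _ _ _ M)|].
- lra.
- now apply ex_CInt_circle.
- intros t _. apply HM.
- lra.
Qed.

Lemma mean_value (g : C -> C) (rho r : R) : (0 < r < rho)%R ->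
  (forall z, Cmod z < rho -> cd g z)%R -> Cmean g r = g 0.
Proof.
intros Hr Hg. apply (mean_value_punctured g (g 0) rho r Hr).
- intros z Hz. apply Hg. lra.
- intros eps.
  assert (Cg := cd_continuous (V := C_NormedModule) g (RtoC 0) (Hg (RtoC 0) ltac:(rewrite Cmod_0; lra))).
  assert (L := continuous_C_eps_inv g _ Cg eps).
  apply locally_Cmod in L. destruct L as [d Hd]. exists d. intros z Hz.
  left. apply Hd. replace (z - 0) with z by ring. apply Hz.
Qed.

Lemma fun_choice {A B : Type} (P : A -> B -> Prop) :
  (forall a, exists b, P a b) -> exists f, forall a, P a (f a).
Proof.
intros H. exists (fun a => proj1_sig (constructive_indefinite_description _ (H a))).
intros a. now destruct (constructive_indefinite_description _ (H a)).
Qed.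

Lemma Re_le_Cmod (z : C) : (Re z <= Cmod z)%R.
Proof. eapply Rle_trans; [apply Rle_abs|apply re_le_Cmod]. Qed.

(** * Mean value inequalities along complex segments *)

Lemma seg_deriv (f : C -> C) (z0 h d u : C) (s : R) :
  cder f (z0 + RtoC s * h)%C d ->
  is_derive (fun s => Re (u * f (z0 + RtoC s * h)%C)%C) s (Re (u * d * h)%C).
Proof.
intros H. apply is_derive_Reals. intros eps Heps.
assert (Hu := Cmod_ge_0 u). assert (Hh := Cmod_ge_0 h).
assert (P : (0 < eps / (2 * (Cmod u + 1) * (Cmod h + 1)))%R).
{ apply Rdiv_lt_0_compat; nra. }
destruct (proj1 (locally_Cmod _ _) (H (mkposreal _ P))) as [r Hr]. simpl in Hr.
assert (P2 : (0 < r / (Cmod h + 1))%R) by (apply Rdiv_lt_0_compat; [apply cond_pos|lra]).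
exists (mkposreal _ P2). intros k Hk Hkr. simpl in Hkr.
assert (Pk := Rabs_pos_lt _ Hk).
replace (z0 + RtoC (s + k) * h) with (z0 + RtoC s * h + RtoC k * h) by (rewrite RtoC_plus; ring).
set (z := z0 + RtoC s * h) in *.
assert (Q := Hr (z + RtoC k * h)).
replace (z + RtoC k * h - z) with (RtoC k * h) in Q by ring.
rewrite Cmod_mult, Cmod_R in Q.
assert (Q1 : (Rabs k * Cmod h < r)%R).
{ apply (Rmult_lt_compat_r (Cmod h + 1)) in Hkr; [|lra].
  unfold Rdiv in Hkr. rewrite Rmult_assoc, Rinv_l, Rmult_1_r in Hkr by lra. nra. }
specialize (Q Q1).
set (X := f (z + RtoC k * h)%C - f z - d * (RtoC k * h)) in *.
replace ((Re (u * f (z + RtoC k * h)%C)%C - Re (u * f z)%C) / k - Re (u * d * h)%C)%R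
  with (Re (u * X)%C / k)%R.
2: { assert (E : Re (u * X)%C = (Re (u * f (z + k * h)%C)%C - Re (u * f z)%C - k * Re (u * d * h)%C)%R).
     { unfold X. unfold Re; simpl. ring. }
     rewrite E. field. exact Hk. }
rewrite Rabs_div by exact Hk.
apply (Rmult_lt_reg_r (Rabs k)); [exact Pk|].
unfold Rdiv at 1. rewrite Rmult_assoc, Rinv_l, Rmult_1_r by lra.
eapply Rle_lt_trans; [apply re_le_Cmod|]. rewrite Cmod_mult.
set (e := (eps / (2 * (Cmod u + 1) * (Cmod h + 1)))%R) in *.
assert (Ee : (eps = 2 * (Cmod u + 1) * (Cmod h + 1) * e)%R) by (unfold e; field; lra).
apply Rle_lt_trans with (Cmod u * (e * (Rabs k * Cmod h)))%R; [apply Rmult_le_compat_l; auto|].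
rewrite Ee.
assert (R1 : (Cmod u * Cmod h <= (Cmod u + 1) * (Cmod h + 1))%R) by nra.
assert (R2 : (0 < e * Rabs k)%R) by nra.
assert (R3 : (0 < (Cmod u + 1) * (Cmod h + 1))%R) by nra.
nra.
Qed.

(** Multiplying by the unit number conj D / |D| turns the increment D into its modulus, so the real
    mean value theorem applies to the real part minus c0 s^(k+1), whose derivative is not positive.
    The factor 1 / (k+1) is kept because iterating the lemma must produce 1 / k!. *)
Lemma mean_value_power (f : C -> C) (z0 h : C) (d : R -> C) (A : R) (k : nat) :
  (forall s, 0 <= s <= 1 -> cder f (z0 + RtoC s * h)%C (d s) /\ Cmod (d s) <= A * s ^ k)%R ->
  (Cmod (f (z0 + h)%C - f z0) <= A * Cmod h / INR (S k))%R.
Proof.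
intros H.
set (D := f (z0 + h)%C - f z0).
assert (NS : (0 < INR (S k))%R) by (apply lt_0_INR; lia).
assert (A0 : (0 <= A)%R).
{ destruct (H 1%R) as [_ HH]; [lra|]. rewrite pow1 in HH. generalize (Cmod_ge_0 (d 1%R)); lra. }
destruct (Req_dec (Cmod D) 0) as [E|E].
{ rewrite E. apply Rdiv_le_0_compat; [|exact NS]. apply Rmult_le_pos; [exact A0|apply Cmod_ge_0]. }
assert (PD : (0 < Cmod D)%R) by (generalize (Cmod_ge_0 D); lra).
set (u := Cconj D / RtoC (Cmod D)).
assert (CD : RtoC (Cmod D) <> 0) by (intros Q; apply RtoC_inj in Q; lra).
assert (Hu : Cmod u = 1%R).
{ unfold u. rewrite Cmod_div by exact CD. rewrite Cmod_conj, Cmod_R, Rabs_pos_eq by lra. field. exact E. }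
assert (HuD : Re (u * D) = Cmod D).
{ replace (u * D) with (RtoC (Cmod D)); [reflexivity|].
  unfold u. transitivity (D * Cconj D / RtoC (Cmod D)); [|field; exact CD].
  rewrite <- Cmod2_conj. rewrite <- RtoC_div by exact E. f_equal. field. exact E. }
set (c0 := (A * Cmod h / INR (S k))%R) in *.
assert (Ec : (A * Cmod h = c0 * INR (S k))%R) by (unfold c0; field; lra).
set (g := fun s => (Re (u * f (z0 + RtoC s * h)%C)%C - c0 * s ^ S k)%R).
destruct (MVT_gen g 0 1 (fun s => Re (u * d s * h)%C - A * Cmod h * s ^ k)%R) as [c [Hc Eg]].
- intros s Hs. rewrite Rmin_left, Rmax_right in Hs by lra.
  unfold g. apply (is_derive_minus (fun s => Re (u * f (z0 + RtoC s * h)%C)%C)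
    (fun s => c0 * s ^ S k)%R s (Re (u * d s * h)%C) (A * Cmod h * s ^ k)%R).
  + apply seg_deriv. apply H. lra.
  + rewrite Ec. auto_derive; [auto|]. simpl. ring.
- intros s Hs. rewrite Rmin_left, Rmax_right in Hs by lra.
  apply continuity_pt_filterlim. apply (ex_derive_continuous g).
  eexists. unfold g. apply (is_derive_minus (fun s => Re (u * f (z0 + RtoC s * h)%C)%C)
    (fun s => c0 * s ^ S k)%R s (Re (u * d s * h)%C) (A * Cmod h * s ^ k)%R).
  + apply seg_deriv. apply H. lra.
  + rewrite Ec. auto_derive; [auto|]. simpl. ring.
- rewrite Rmin_left, Rmax_right in Hc by lra.
  assert (B : (Re (u * d c * h)%C <= A * Cmod h * c ^ k)%R).
  { eapply Rle_trans; [apply Re_le_Cmod|]. rewrite !Cmod_mult, Hu, Rmult_1_l.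
    destruct (H c Hc) as [_ HH]. generalize (Cmod_ge_0 h); nra. }
  unfold g in Eg. rewrite pow1, pow_ne_zero in Eg by lia.
  assert (E2 : (Re (u * f (z0 + RtoC 1 * h)%C)%C - Re (u * f (z0 + RtoC 0 * h)%C)%C = Cmod D)%R).
  { rewrite <- HuD. unfold D. 
    replace (z0 + RtoC 1 * h) with (z0 + h) by ring. replace (z0 + RtoC 0 * h) with z0 by ring.
    unfold Re; simpl. ring. }
  lra.
Qed.

Lemma mean_value_ineq (f : C -> C) (z0 h l : C) (B : R) :
  (forall s : R, 0 <= s <= 1 -> exists d, cder f (z0 + RtoC s * h)%C d /\ Cmod (d - l) <= B)%R ->
  (Cmod (f (z0 + h)%C - f z0 - l * h) <= B * Cmod h)%R.
Proof.
intros H.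
assert (C0 : forall s : R, exists d : C, (0 <= s <= 1)%R -> cder f (z0 + RtoC s * h)%C d /\ (Cmod (d - l) <= B)%R).
{ intros s. destruct (Rle_dec 0 s) as [A|A]; [destruct (Rle_dec s 1) as [A'|A']|].
  - destruct (H s (conj A A')) as [d Hd]. now exists d.
  - exists (RtoC 0). lra.
  - exists (RtoC 0). lra. }
destruct (fun_choice _ C0) as [d Hd].
assert (K := mean_value_power (fun z => f z - l * z) z0 h (fun s => d s - l) B 0).
simpl in K. rewrite Rdiv_1_r in K.
replace (f (z0 + h)%C - f z0 - l * h) with (f (z0 + h)%C - l * (z0 + h) - (f z0 - l * z0)) by ring.
apply K. intros s Hs. destruct (Hd s Hs) as [D1 D2]. split; [|lra].
apply cder_minus; [exact D1|]. replace l with (l * 1) at 2 by ring. apply cder_scal, cder_id.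
Qed.

Lemma cder_shift (f : C -> C) (z0 h d : C) : cder f (z0 + h)%C d -> cder (fun t => f (z0 + t)%C) h d.
Proof.
intros H. replace d with (d * (0 + 1)) by ring.
apply (cder_comp (fun t => z0 + t) f); [|exact H].
apply cder_plus; [apply cder_const|apply cder_id].
Qed.

Lemma cd_shiftC (f : C -> C) (z0 h : C) : cd f (z0 + h)%C -> cd (fun t => f (z0 + t)%C) h.
Proof.
intros H. apply cd_cder in H. destruct H as [d Hd]. now apply (cder_cd _ _ d), cder_shift.
Qed.

Lemma cd_idC (z : C) : cd (fun w : C => w) z.
Proof. apply (cder_cd _ _ 1), cder_id. Qed.

(** The difference quotient extends over the puncture with value [l], so every mean of it over a
    circle is [l]. This takes the place of Cauchy's integral formula for the derivative. *)
Lemma deriv_as_mean (f : C -> C) (z0 l : C) (rho r : R) : (0 < r < rho)%R ->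
  (forall z, Cmod (z - z0) < rho -> cd f z)%R -> cder f z0 l ->
  l = Cmean (fun t => (f (z0 + t)%C - f z0) / t) r.
Proof.
intros Hr Hf Hl. symmetry. apply (mean_value_punctured _ l rho r Hr).
- intros z Hz. apply (cd_div (V := C_NormedModule) (fun t => f (z0 + t)%C - f z0) (fun t => t)).
  + apply (cd_minus (V := C_NormedModule) (fun t => f (z0 + t)%C) (fun _ => f z0)).
    * apply cd_shiftC, Hf. replace (z0 + z - z0) with z by ring. lra.
    * apply (cd_const (V := C_NormedModule)).
  + apply cd_idC.
  + apply Cmod_gt_0. lra.
- intros eps. destruct (proj1 (locally_Cmod _ _) (Hl eps)) as [d Hd]. exists d. intros z Hz.
  assert (Hz0 : z <> 0) by (apply Cmod_gt_0; lra).
  replace ((f (z0 + z)%C - f z0) / z - l) with ((f (z0 + z)%C - f z0 - l * z) / z) by (field; exact Hz0).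
  rewrite Cmod_div by exact Hz0.
  assert (Q := Hd (z0 + z)). replace (z0 + z - z0) with z in Q by ring.
  apply (Rmult_le_reg_r (Cmod z)); [lra|].
  unfold Rdiv. rewrite Rmult_assoc, Rinv_l, Rmult_1_r by lra. apply Q. lra.
Qed.

Lemma cd_quot_circ (f : C -> C) (z0 : C) (rho r : R) : (0 < r < rho)%R ->
  (forall z, Cmod (z - z0) < rho -> cd f z)%R ->
  forall t, cd (fun t => (f (z0 + t)%C - f z0) / t) (circ r t).
Proof.
intros Hr Hf t. assert (Hc := Cmod_circ r t ltac:(lra)).
apply (cd_div (V := C_NormedModule) (fun t => f (z0 + t)%C - f z0) (fun t => t)).
- apply (cd_minus (V := C_NormedModule) (fun t => f (z0 + t)%C) (fun _ => f z0)).
  + apply cd_shiftC, Hf. replace (z0 + circ r t - z0) with (circ r t) by ring. lra.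
  + apply (cd_const (V := C_NormedModule)).
- apply cd_idC.
- apply Cmod_gt_0. lra.
Qed.

(** The averaged quotient has the numerator f(z0 + t) - f(z0), bounded by 2 M, which explains the
    factor 2. Radii r below rho are used first, and rho is reached at the end. *)
Lemma cauchy_estimate (f : C -> C) (z0 l : C) (rho M : R) : (0 < rho)%R ->
  (forall z, Cmod (z - z0) < rho -> cd f z)%R -> (forall z, Cmod (z - z0) < rho -> Cmod (f z) <= M)%R ->
  cder f z0 l -> (Cmod l <= 2 * M / rho)%R.
Proof.
intros Hrho Hf HM Hl.
assert (K : forall r, (0 < r < rho)%R -> (Cmod l * r <= 2 * M)%R).
{ intros r Hr. rewrite (deriv_as_mean f z0 l rho r Hr Hf Hl).
  assert (B : (Cmod (Cmean (fun t => (f (z0 + t) - f z0) / t)%C r) <= 2 * M / r)%R).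
  { apply Cmean_bound.
    - now apply (cd_quot_circ f z0 rho).
    - intros t. assert (Hc := Cmod_circ r t ltac:(lra)).
      rewrite Cmod_div by (apply Cmod_gt_0; lra). rewrite Hc.
      apply Rmult_le_compat_r; [left; apply Rinv_0_lt_compat; lra|].
      assert (T := Cmod_triangle (f (z0 + circ r t)%C) (- f z0)). rewrite Cmod_opp in T.
      assert (M1 := HM (z0 + circ r t)). replace (z0 + circ r t - z0) with (circ r t) in M1 by ring.
      assert (M2 := HM z0). replace (z0 - z0) with (RtoC 0) in M2 by ring. rewrite Cmod_0 in M2.
      unfold Cminus at 1. lra. }
  apply (Rmult_le_compat_r r) in B; [|lra]. unfold Rdiv in B. rewrite Rmult_assoc, Rinv_l in B by lra. lra. }
apply (Rmult_le_reg_r rho); [exact Hrho|]. unfold Rdiv. rewrite Rmult_assoc, Rinv_l, Rmult_1_r by lra.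
apply Rnot_lt_le. intros N.
assert (L := Cmod_ge_0 l).
assert (M0 : (0 <= M)%R).
{ assert (M2 := HM z0). replace (z0 - z0) with (RtoC 0) in M2 by ring. rewrite Cmod_0 in M2.
  generalize (Cmod_ge_0 (f z0)); lra. }
destruct (Req_dec (Cmod l) 0) as [E|E]; [rewrite E in N; lra|].
(* If the bound failed, 2 M / |l| would lie below rho, and the midpoint of the two is a radius that
   contradicts [K]. *)
assert (Hr : (0 < (2 * M / Cmod l + rho) / 2 < rho)%R).
{ assert (X : (2 * M / Cmod l < rho)%R).
  { apply (Rmult_lt_reg_r (Cmod l)); [lra|]. unfold Rdiv. rewrite Rmult_assoc, Rinv_l by lra. lra. }
  assert (0 <= 2 * M / Cmod l)%R by (apply Rdiv_le_0_compat; lra). lra. }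
assert (Q := K _ Hr).
assert (X : (Cmod l * ((2 * M / Cmod l + rho) / 2) = M + Cmod l * rho / 2)%R) by (field; lra).
lra.
Qed.

(** Both derivatives are means over circles of the same radius rho / 4, so their difference is a
    mean of differences. Each increment of [f] by [h] is at most 8 M |h| / rho, by the Cauchy
    estimate on discs of radius rho / 4; two of them, generously counted as three, divided by rho /
    4 give 96. *)
Lemma deriv_lipschitz (f : C -> C) (z0 l : C) (rho M : R) : (0 < rho)%R ->
  (forall z, Cmod (z - z0) < rho -> cd f z)%R -> (forall z, Cmod (z - z0) < rho -> Cmod (f z) <= M)%R ->
  cder f z0 l -> forall h d, (Cmod h <= rho / 4)%R -> cder f (z0 + h)%C d ->
  (Cmod (d - l) <= 96 * M / (rho * rho) * Cmod h)%R.
Proof.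
intros Hrho Hf HM Hl h d Hh Hd.
set (r := (rho / 4)%R).
assert (E1 := deriv_as_mean f z0 l rho r ltac:(unfold r; lra) Hf Hl).
assert (Hf' : forall z, (Cmod (z - (z0 + h)) < rho / 2)%R -> (Cmod (z - z0) < 3 * rho / 4)%R).
{ intros z Hz. replace (z - z0) with (z - (z0 + h) + h) by ring.
  eapply Rle_lt_trans; [apply Cmod_triangle|]. lra. }
assert (Hf2 : forall z, (Cmod (z - (z0 + h)) < rho / 2)%R -> cd f z).
{ intros z Hz. apply Hf. specialize (Hf' z Hz). lra. }
assert (E2 := deriv_as_mean f (z0 + h)%C d (rho / 2) r ltac:(unfold r; lra) Hf2 Hd).
assert (Lip : forall z, (Cmod (z - z0) <= rho / 4)%R -> (Cmod (f (z + h)%C - f z) <= 8 * M / rho * Cmod h)%R).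
{ intros z Hz.
  assert (K := mean_value_ineq f z h 0 (8 * M / rho)).
  replace (f (z + h)%C - f z) with (f (z + h)%C - f z - 0 * h) by ring. apply K.
  intros s Hs.
  assert (Hs' : (Cmod (z + RtoC s * h - z0) <= rho / 2)%R).
  { replace (z + RtoC s * h - z0) with (z - z0 + RtoC s * h) by ring.
    eapply Rle_trans; [apply Cmod_triangle|]. rewrite Cmod_mult, Cmod_R, Rabs_pos_eq by lra.
    generalize (Cmod_ge_0 h). nra. }
  destruct (proj1 (cd_cder f (z + RtoC s * h)%C) (Hf (z + RtoC s * h) ltac:(lra))) as [e He].
  exists e. split; [exact He|]. replace (e - 0) with e by ring.
  replace (8 * M / rho)%R with (2 * M / (rho / 4))%R by (field; lra).
  assert (In : forall w, (Cmod (w - (z + RtoC s * h)) < rho / 4)%R -> (Cmod (w - z0) < rho)%R).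
  { intros w Hw. replace (w - z0) with (w - (z + RtoC s * h) + (z + RtoC s * h - z0)) by ring.
    eapply Rle_lt_trans; [apply Cmod_triangle|]. lra. }
  apply (cauchy_estimate f (z + RtoC s * h)%C e (rho / 4) M); [lra| | |exact He].
  - intros w Hw. now apply Hf, In.
  - intros w Hw. now apply HM, In. }
assert (C1 := cd_quot_circ f z0 rho r ltac:(unfold r; lra) Hf).
assert (C2 := cd_quot_circ f (z0 + h)%C (rho / 2) r ltac:(unfold r; lra) Hf2).
assert (E : d - l = Cmean (fun t => (f (z0 + h + t)%C - f (z0 + h)%C) / t - (f (z0 + t)%C - f z0) / t) r).
{ rewrite E1, E2 at 1. unfold Cmean. rewrite CInt_minus.
  - ring.
  - now apply (ex_CInt_circle (fun t => (f (z0 + h + t)%C - f (z0 + h)%C) / t)).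
  - now apply (ex_CInt_circle (fun t => (f (z0 + t)%C - f z0) / t)). }
rewrite E. apply Cmean_bound.
- intros t. apply (cd_minus (V := C_NormedModule)); auto.
- intros t. assert (Hc := Cmod_circ r t ltac:(unfold r; lra)).
  assert (Hc0 : circ r t <> 0) by (apply Cmod_gt_0; rewrite Hc; unfold r; lra).
  replace ((f (z0 + h + circ r t)%C - f (z0 + h)%C) / circ r t - (f (z0 + circ r t)%C - f z0) / circ r t)
    with ((f (z0 + circ r t + h)%C - f (z0 + circ r t)%C - (f (z0 + h)%C - f z0)) / circ r t).
  2: { replace (z0 + h + circ r t) with (z0 + circ r t + h) by ring. field. exact Hc0. }
  rewrite Cmod_div, Hc by exact Hc0.
  assert (L1 := Lip (z0 + circ r t)). assert (L2 := Lip z0).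
  replace (z0 + circ r t - z0) with (circ r t) in L1 by ring. rewrite Hc in L1.
  replace (z0 - z0) with (RtoC 0) in L2 by ring. rewrite Cmod_0 in L2.
  specialize (L1 ltac:(unfold r; lra)). specialize (L2 ltac:(lra)).
  apply (Rmult_le_reg_r r); [unfold r; lra|]. unfold Rdiv at 1.
  rewrite Rmult_assoc, Rinv_l, Rmult_1_r by (unfold r; lra).
  unfold Cminus at 1. eapply Rle_trans; [apply Cmod_triangle|]. rewrite Cmod_opp.
  replace (96 * M / (rho * rho) * Cmod h * r)%R with (3 * (8 * M / rho * Cmod h))%R by (unfold r; field; lra).
  assert (0 <= 8 * M / rho * Cmod h)%R by (generalize (Cmod_ge_0 (f (z0 + h)%C - f z0)); lra).
  lra.
Qed.

Lemma quadratic_estimate (f : C -> C) (z0 l : C) (rho M : R) : (0 < rho)%R ->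
  (forall z, Cmod (z - z0) < rho -> cd f z)%R -> (forall z, Cmod (z - z0) < rho -> Cmod (f z) <= M)%R ->
  cder f z0 l -> forall h, (Cmod h <= rho / 4)%R ->
  (Cmod (f (z0 + h)%C - f z0 - l * h) <= 96 * M / (rho * rho) * (Cmod h * Cmod h))%R.
Proof.
intros Hrho Hf HM Hl h Hh. rewrite <- Rmult_assoc.
assert (M0 : (0 <= M)%R).
{ assert (M2 := HM z0). replace (z0 - z0) with (RtoC 0) in M2 by ring. rewrite Cmod_0 in M2.
  generalize (Cmod_ge_0 (f z0)); lra. }
apply mean_value_ineq. intros s Hs.
assert (N := Cmod_ge_0 h).
assert (Hs' : (Cmod (RtoC s * h) <= Cmod h)%R).
{ rewrite Cmod_mult, Cmod_R, Rabs_pos_eq by lra. nra. }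
destruct (proj1 (cd_cder f (z0 + RtoC s * h)%C)) as [d Hd].
{ apply Hf. replace (z0 + RtoC s * h - z0) with (RtoC s * h) by ring. lra. }
exists d. split; [exact Hd|].
eapply Rle_trans; [apply (deriv_lipschitz f z0 l rho M Hrho Hf HM Hl (RtoC s * h) d); [lra|exact Hd]|].
apply Rmult_le_compat_l; [|exact Hs'].
apply Rdiv_le_0_compat; nra.
Qed.

(** * Limits and integrals of holomorphic functions of several variables *)

Definition Clim (u : nat -> C) (l : C) : Prop :=
  forall eps : posreal, exists N : nat, forall n, (N <= n)%nat -> (Cmod (u n - l) < eps)%R.

Lemma Clim_unique u l1 l2 : Clim u l1 -> Clim u l2 -> l1 = l2.
Proof.
intros H1 H2. apply NNPP. intros N.
assert (P : (0 < Cmod (l1 - l2))%R).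
{ apply Cmod_gt_0. intros E. apply N. replace l1 with (l1 - l2 + l2) by ring. rewrite E; ring. }
assert (P2 : (0 < Cmod (l1 - l2) / 2)%R) by lra.
destruct (H1 (mkposreal _ P2)) as [N1 K1]. destruct (H2 (mkposreal _ P2)) as [N2 K2]. simpl in K1, K2.
assert (A := K1 (max N1 N2) ltac:(lia)). assert (B := K2 (max N1 N2) ltac:(lia)).
set (v := u (max N1 N2)) in *.
assert (T := Cmod_triangle (- (v - l1)) (v - l2)). rewrite Cmod_opp in T.
replace (- (v - l1) + (v - l2)) with (l1 - l2) in T by ring. lra.
Qed.

Lemma Clim_ext u v l : (forall n, u n = v n) -> Clim u l -> Clim v l.
Proof. intros E H eps. destruct (H eps) as [N HN]. exists N. intros n Hn. rewrite <- E. auto. Qed.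

Lemma Clim_const c : Clim (fun _ => c) c.
Proof.
intros eps. exists O. intros n _. replace (c - c) with (RtoC 0) by ring. rewrite Cmod_0. apply cond_pos.
Qed.

Lemma Clim_plus u v a b : Clim u a -> Clim v b -> Clim (fun n => u n + v n) (a + b).
Proof.
intros H1 H2 eps. destruct (H1 (pos_div_2 eps)) as [N1 K1]. destruct (H2 (pos_div_2 eps)) as [N2 K2].
simpl in K1, K2. exists (max N1 N2). intros n Hn.
replace (u n + v n - (a + b)) with ((u n - a) + (v n - b)) by ring.
eapply Rle_lt_trans; [apply Cmod_triangle|].
assert (A := K1 n ltac:(lia)). assert (B := K2 n ltac:(lia)). lra.
Qed.

Lemma Clim_scal k u a : Clim u a -> Clim (fun n => k * u n) (k * a).
Proof.
intros H eps. assert (K := Cmod_ge_0 k).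
assert (P : (0 < eps / (Cmod k + 1))%R) by (apply Rdiv_lt_0_compat; [apply cond_pos|lra]).
destruct (H (mkposreal _ P)) as [N HN]. simpl in HN. exists N. intros n Hn.
replace (k * u n - k * a) with (k * (u n - a)) by ring. rewrite Cmod_mult.
specialize (HN n Hn). apply (Rmult_lt_compat_r (Cmod k + 1)) in HN; [|lra].
unfold Rdiv in HN. rewrite Rmult_assoc, Rinv_l, Rmult_1_r in HN by lra.
generalize (Cmod_ge_0 (u n - a)). nra.
Qed.

Lemma Clim_minus u v a b : Clim u a -> Clim v b -> Clim (fun n => u n - v n) (a - b).
Proof.
intros H1 H2. replace (a - b) with (a + (-1) * b) by ring.
apply (Clim_ext (fun n => u n + (-1) * v n)); [intros n; ring|].
apply Clim_plus; [exact H1|now apply Clim_scal].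
Qed.

Lemma Clim_le (u : nat -> C) (l : C) (B : nat -> R) (b : R) :
  Clim u l -> (forall eps : posreal, exists N, forall n, (N <= n)%nat -> (Cmod (u n) <= b + eps)%R) -> (Cmod l <= b)%R.
Proof.
intros H HB. apply Rnot_lt_le. intros N.
assert (P : (0 < (Cmod l - b) / 2)%R) by lra.
destruct (H (mkposreal _ P)) as [N1 K1]. destruct (HB (mkposreal _ P)) as [N2 K2]. simpl in K1, K2.
assert (A := K1 (max N1 N2) ltac:(lia)). assert (D := K2 (max N1 N2) ltac:(lia)).
set (v := u (max N1 N2)) in *.
assert (T := Cmod_triangle (- (v - l)) v). rewrite Cmod_opp in T.
replace (- (v - l) + v) with l in T by ring. lra.
Qed.

Lemma Clim_le_const (u : nat -> C) (l : C) (b : R) (N : nat) :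
  Clim u l -> (forall n, (N <= n)%nat -> (Cmod (u n) <= b)%R) -> (Cmod l <= b)%R.
Proof.
intros H HB. apply (Clim_le u l (fun _ => b) b H). intros eps. exists N. intros n Hn.
generalize (HB n Hn) (cond_pos eps). lra.
Qed.

Lemma Clim_cauchy (u : nat -> C) :
  (forall eps : posreal, exists N : nat, forall n m, (N <= n)%nat -> (N <= m)%nat -> (Cmod (u n - u m) < eps)%R) ->
  exists l, Clim u l.
Proof.
intros H.
assert (HR : ex_finite_lim_seq (fun n => Re (u n))).
{ apply ex_lim_seq_cauchy_corr. intros eps. destruct (H eps) as [N HN]. exists N. intros n m Hn Hm.
  eapply Rle_lt_trans; [|apply (HN n m Hn Hm)]. apply (re_le_Cmod (u n - u m)). }
assert (HI : ex_finite_lim_seq (fun n => Im (u n))).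
{ apply ex_lim_seq_cauchy_corr. intros eps. destruct (H eps) as [N HN]. exists N. intros n m Hn Hm.
  eapply Rle_lt_trans; [|apply (HN n m Hn Hm)]. apply (im_le_Cmod (u n - u m)). }
destruct HR as [x Hx], HI as [y Hy]. exists (x, y). intros eps.
apply is_lim_seq_spec in Hx. apply is_lim_seq_spec in Hy.
destruct (Hx (pos_div_2 eps)) as [N1 K1]. destruct (Hy (pos_div_2 eps)) as [N2 K2]. simpl in K1, K2.
exists (max N1 N2). intros n Hn.
eapply Rle_lt_trans; [apply Cmod_le_Re_Im|].
assert (A := K1 n ltac:(lia)). assert (B := K2 n ltac:(lia)).
unfold Re, Im in *. simpl. unfold Rminus in *. lra.
Qed.

Lemma inv_INR_small (B : R) (eps : posreal) : exists N, forall n, (N <= n)%nat -> (B * / INR (S n) < eps)%R.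
Proof.
destruct (nfloor_ex (Rmax 0 (B / eps))) as [N [_ HN]]; [apply Rmax_l|].
exists N. intros n Hn.
assert (P := cond_pos eps).
assert (Q : (0 < INR (S n))%R) by (apply lt_0_INR; lia).
apply (Rmult_lt_reg_r (INR (S n))); [exact Q|].
rewrite Rmult_assoc, Rinv_l, Rmult_1_r by lra.
assert (X : (B / eps < INR (S n))%R).
{ eapply Rle_lt_trans; [apply (Rmax_r 0)|]. eapply Rlt_le_trans; [exact HN|].
  rewrite S_INR. apply le_INR in Hn. lra. }
apply (Rmult_lt_compat_r eps) in X; [|exact P]. unfold Rdiv in X.
rewrite Rmult_assoc, Rinv_l, Rmult_1_r in X by lra. lra.
Qed.

Lemma minus_plus_cancel {G : AbelianGroup} (x h : G) : minus (plus x h) x = h.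
Proof.
transitivity (plus (plus h x) (opp x)); [unfold minus; f_equal; apply plus_comm|].
transitivity (plus h (plus x (opp x))); [symmetry; apply plus_assoc|].
transitivity (plus h zero); [f_equal; apply plus_opp_r|apply plus_zero_r].
Qed.

Lemma plus_minus_cancel {G : AbelianGroup} (x y : G) : plus x (minus y x) = y.
Proof.
transitivity (plus x (plus (opp x) y)); [f_equal; apply plus_comm|].
transitivity (plus (plus x (opp x)) y); [apply plus_assoc|].
transitivity (plus zero y); [f_equal; apply plus_opp_r|apply plus_zero_l].
Qed.

Lemma norm_minus_self {K : AbsRing} {V : NormedModule K} (x : V) : norm (minus x x) = 0%R.
Proof. transitivity (norm (zero : V)); [f_equal; exact (minus_eq_zero x)|apply norm_zero]. Qed.

Section Quadratic.
Context {V : NormedModule C_AbsRing}.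

(* Up to the constants, [F] is [F x] plus a linear form plus O(|h|^2).  Unlike the existence
   of that linear form, these inequalities visibly pass to limits and integrals. *)
Definition quad (F : V -> C) (x : V) (r K : R) : Prop :=
  (forall h k : V, norm h + norm k <= r -> Cmod (F (plus x (plus h k)) - F (plus x h) - F (plus x k) + F x)%C <= K * (norm h + norm k) ^ 2)%R /\
  (forall (c : C) (h : V), norm h <= r -> Cmod c * norm h <= r ->
     Cmod (F (plus x (scal c h)) - F x - c * (F (plus x h) - F x))%C <= K * ((Cmod c ^ 2 + Cmod c) * norm h ^ 2))%R /\
  (forall h : V, norm h <= r -> Cmod (F (plus x h) - F x)%C <= K * norm h)%R.

Lemma norm_scal_C (c : C) (h : V) : norm (scal c h) = (Cmod c * norm h)%R.
Proof.
apply Rle_antisym; [apply (norm_scal c h)|].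
destruct (Req_dec (Cmod c) 0) as [E|E].
{ rewrite E, Rmult_0_l. apply norm_ge_0. }
assert (c0 : c <> 0) by (intros Q; apply E; rewrite Q; apply Cmod_0).
assert (P : (0 < Cmod c)%R) by (generalize (Cmod_ge_0 c); lra).
replace h with (scal (/ c) (scal c h)) at 1.
2: { rewrite scal_assoc. replace (mult (/ c) c) with (one : C_AbsRing); [apply (scal_one h)|].
     change (RtoC 1 = / c * c). field. exact c0. }
apply Rle_trans with (Cmod c * (Cmod (/ c) * norm (scal c h)))%R.
- apply Rmult_le_compat_l; [lra|]. apply (norm_scal (/ c) (scal c h)).
- rewrite Cmod_inv by exact c0. right. field. lra.
Qed.

(** The derivative is constructed as the limit of n (F(x + h / n) - F(x)). The homogeneity
    inequality with c = n / m makes this a Cauchy sequence and the limit homogeneous, the first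
    inequality makes it additive, the third bounded. *)
Lemma quad_cd (F : V -> C) (x : V) (r K : R) : (0 < r)%R -> quad F x r K -> cd F x.
Proof.
intros Hr (Q1 & Q2 & Q3).
assert (nn : forall h : V, (0 <= norm h)%R) by (intros h; apply norm_ge_0).
set (iv := fun n : nat => RtoC (/ INR (S n))).
assert (Pn : forall n, (0 < / INR (S n))%R) by (intros n; apply Rinv_0_lt_compat, lt_0_INR; lia).
assert (Civ : forall n, Cmod (iv n) = (/ INR (S n))%R).
{ intros n. unfold iv. rewrite Cmod_R. apply Rabs_pos_eq. left. apply Pn. }
assert (Niv : forall n (h : V), norm (scal (iv n) h) = (/ INR (S n) * norm h)%R).
{ intros n h. now rewrite norm_scal_C, Civ. }
set (D := fun (n : nat) (h : V) => RtoC (INR (S n)) * (F (plus x (scal (iv n) h)) - F x)).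
assert (Hiv : forall n, RtoC (INR (S n)) * iv n = 1).
{ intros n. unfold iv. rewrite <- RtoC_mult. f_equal. field. apply not_0_INR; lia. }
assert (Cin : forall n, Cmod (RtoC (INR (S n))) = INR (S n)).
{ intros n. rewrite Cmod_R. apply Rabs_pos_eq. apply pos_INR. }
assert (K0 : (0 <= K)%R \/ forall h : V, norm h = 0%R).
{ destruct (classic (exists h : V, norm h <> 0%R)) as [[h Hh]|N].
  - left. assert (P : (0 < norm h)%R) by (generalize (nn h); lra).
    set (c := RtoC (r / norm h)).
    assert (Pc : (0 < r / norm h)%R) by (apply Rdiv_lt_0_compat; lra).
    assert (E : norm (scal c h) = r).
    { rewrite norm_scal_C. unfold c. rewrite Cmod_R, Rabs_pos_eq by lra. field. lra. }
    assert (Y := Q3 (scal c h) ltac:(lra)). rewrite E in Y.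
    assert (Z := Cmod_ge_0 (F (plus x (scal c h)) - F x)). nra.
  - right. intros h. apply NNPP. intros Q. apply N. now exists h. }
assert (small : forall (h : V) (n : nat), (norm h * / r <= INR (S n))%R -> (/ INR (S n) * norm h <= r)%R).
{ intros h n Hn. apply (Rmult_le_reg_l (INR (S n))); [apply lt_0_INR; lia|].
  rewrite <- Rmult_assoc, Rinv_r, Rmult_1_l by (apply not_0_INR; lia).
  apply (Rmult_le_compat_r r) in Hn; [|lra]. rewrite Rmult_assoc, Rinv_l in Hn by lra. lra. }
assert (CC : forall (h : V) n m, (norm h * / r <= INR (S n))%R -> (norm h * / r <= INR (S m))%R ->
  (Cmod (D m h - D n h) <= K * norm h ^ 2 * (/ INR (S m) + / INR (S n)))%R).
{ intros h n m Hn Hm. apply small in Hn. apply small in Hm.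
  set (c := RtoC (INR (S n) * / INR (S m))).
  assert (Hc : Cmod c = (INR (S n) * / INR (S m))%R).
  { unfold c. rewrite Cmod_R. apply Rabs_pos_eq. apply Rmult_le_pos; [apply pos_INR|left; apply Pn]. }
  assert (E : scal c (scal (iv n) h) = scal (iv m) h).
  { rewrite scal_assoc. f_equal. change (c * iv n = iv m). unfold c, iv. rewrite <- RtoC_mult.
    f_equal. field. split; apply not_0_INR; lia. }
  assert (Y := Q2 c (scal (iv n) h)). rewrite Niv, E, Hc in Y.
  assert (X1 : (INR (S n) * / INR (S m) * (/ INR (S n) * norm h) = / INR (S m) * norm h)%R).
  { field. split; apply not_0_INR; lia. }
  rewrite X1 in Y. specialize (Y Hn Hm).
  replace (D m h - D n h) with (RtoC (INR (S m)) *
     (F (plus x (scal (iv m) h)) - F x - c * (F (plus x (scal (iv n) h)) - F x))).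
  2: { unfold D, c. rewrite RtoC_mult, RtoC_inv by (apply not_0_INR; lia).
       field. intros Z. apply RtoC_inj in Z. revert Z. apply not_0_INR; lia. }
  rewrite Cmod_mult, Cin.
  apply (Rmult_le_compat_l (INR (S m))) in Y; [|apply pos_INR].
  eapply Rle_trans; [exact Y|]. right. field. split; apply not_0_INR; lia. }
assert (LL : forall h : V, exists l, Clim (fun n => D n h) l).
{ intros h. apply Clim_cauchy. intros eps.
  destruct (inv_INR_small (K * norm h ^ 2) (pos_div_2 eps)) as [N1 HN1]. unfold pos_div_2 in HN1; cbn [pos] in HN1.
  destruct (nfloor_ex (norm h * / r)) as [N2 [_ HN2]].
  { apply Rmult_le_pos; [apply nn|left; now apply Rinv_0_lt_compat]. }
  exists (max N1 N2). intros n m Hn Hm.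
  eapply Rle_lt_trans; [apply CC|].
  - rewrite S_INR. assert (H := le_INR N2 m ltac:(lia)). lra.
  - rewrite S_INR. assert (H := le_INR N2 n ltac:(lia)). lra.
  - assert (A := HN1 n ltac:(lia)). assert (B := HN1 m ltac:(lia)). nra. }
destruct (fun_choice _ LL) as [L HL].
(* At index 0 the difference quotient is F(x + h) - F(x) itself, so the Cauchy bound between index 0
   and infinity is the second-order remainder estimate. *)
assert (EL : forall h : V, (norm h <= r)%R -> (Cmod (F (plus x h) - F x - L h) <= K * norm h ^ 2)%R).
{ intros h Hh. rewrite <- Cmod_opp.
  apply (Clim_le (fun n => D n h - D O h) _ (fun _ => 0%R)).
  - assert (E : - (F (plus x h) - F x - L h) = L h - D O h).
    { unfold D, iv. simpl INR. rewrite Rinv_1. replace (scal (RtoC 1) h) with h by (symmetry; apply (scal_one h)). ring. }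
    rewrite E. apply Clim_minus; [apply HL|apply Clim_const].
  - intros eps. destruct (inv_INR_small (K * norm h ^ 2) eps) as [N1 HN1]. exists N1. intros n Hn.
    assert (Hr1 : (norm h * / r <= 1)%R).
    { apply (Rmult_le_reg_r r); [lra|]. rewrite Rmult_assoc, Rinv_l by lra. lra. }
    eapply Rle_trans; [apply CC|].
    + simpl INR. lra.
    + rewrite S_INR. generalize (pos_INR n). lra.
    + simpl (INR 1). rewrite Rinv_1. specialize (HN1 n Hn). lra. }
apply cd_iff. exists L. split; [split|].
- intros h k. apply (Clim_unique (fun n => D n (plus h k))); [apply HL|].
  apply (Clim_ext (fun n => (D n h + D n k) + (D n (plus h k) - D n h - D n k))); [intros n; ring|].
  match goal with |- Clim _ ?z => replace z with ((L h + L k) + 0) by apply Cplus_0_r end.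
  apply Clim_plus; [apply Clim_plus; apply HL|].
  intros eps. destruct (inv_INR_small (K * (norm h + norm k) ^ 2) eps) as [N1 HN1].
  destruct (nfloor_ex ((norm h + norm k) * / r)) as [N2 [_ HN2]].
  { apply Rmult_le_pos; [generalize (nn h) (nn k); lra|left; now apply Rinv_0_lt_compat]. }
  exists (max N1 N2). intros n Hn.
  assert (Sm : (/ INR (S n) * norm h + / INR (S n) * norm k <= r)%R).
  { apply (Rmult_le_reg_l (INR (S n))); [apply lt_0_INR; lia|].
    replace (INR (S n) * (/ INR (S n) * norm h + / INR (S n) * norm k))%R with (norm h + norm k)%R
      by (field; apply not_0_INR; lia).
    assert (H := le_INR N2 n ltac:(lia)). rewrite S_INR.
    assert (H2 : ((norm h + norm k) * / r < INR n + 1)%R) by lra.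
    apply (Rmult_lt_compat_r r) in H2; [|lra]. rewrite Rmult_assoc, Rinv_l in H2 by lra. lra. }
  assert (Y := Q1 (scal (iv n) h) (scal (iv n) k)). rewrite !Niv in Y. specialize (Y Sm).
  replace (D n (plus h k) - D n h - D n k - 0) with (RtoC (INR (S n)) *
    (F (plus x (plus (scal (iv n) h) (scal (iv n) k))) - F (plus x (scal (iv n) h)) - F (plus x (scal (iv n) k)) + F x)).
  2: { unfold D. replace (scal (iv n) (plus h k)) with (plus (scal (iv n) h) (scal (iv n) k)) by (symmetry; apply (scal_distr_l (iv n) h k)). ring. }
  rewrite Cmod_mult, Cin.
  apply (Rmult_le_compat_l (INR (S n))) in Y; [|apply pos_INR].
  eapply Rle_lt_trans; [exact Y|].
  replace (INR (S n) * (K * (/ INR (S n) * norm h + / INR (S n) * norm k) ^ 2))%R with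
    (K * (norm h + norm k) ^ 2 * / INR (S n))%R by (field; apply not_0_INR; lia).
  apply HN1; lia.
- intros c h. apply (Clim_unique (fun n => D n (scal c h))); [apply HL|].
  apply (Clim_ext (fun n => c * D n h + (D n (scal c h) - c * D n h))); [intros n; ring|].
  match goal with |- Clim _ ?z => replace z with (c * L h + 0) by apply Cplus_0_r end.
  apply Clim_plus; [apply Clim_scal, HL|].
  intros eps. destruct (inv_INR_small (K * ((Cmod c ^ 2 + Cmod c) * norm h ^ 2)) eps) as [N1 HN1].
  destruct (nfloor_ex ((1 + Cmod c) * norm h * / r)) as [N2 [_ HN2]].
  { apply Rmult_le_pos; [generalize (nn h) (Cmod_ge_0 c); nra|left; now apply Rinv_0_lt_compat]. }
  exists (max N1 N2). intros n Hn.
  assert (Sm : (/ INR (S n) * norm h <= r /\ Cmod c * (/ INR (S n) * norm h) <= r)%R).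
  { assert (H := le_INR N2 n ltac:(lia)).
    assert (H2 : ((1 + Cmod c) * norm h * / r < INR (S n))%R) by (rewrite S_INR; lra).
    apply (Rmult_lt_compat_r r) in H2; [|lra]. rewrite Rmult_assoc, Rinv_l, Rmult_1_r in H2 by lra.
    assert (PP : (0 < INR (S n))%R) by (apply lt_0_INR; lia).
    assert (c0 := Cmod_ge_0 c). assert (h0 := nn h).
    split; apply (Rmult_le_reg_l (INR (S n))); auto.
    - rewrite <- Rmult_assoc, Rinv_r, Rmult_1_l by lra. nra.
    - replace (INR (S n) * (Cmod c * (/ INR (S n) * norm h)))%R with (Cmod c * norm h)%R by (field; lra). nra. }
  destruct Sm as [Sm1 Sm2].
  assert (Y := Q2 c (scal (iv n) h)). rewrite !Niv in Y. specialize (Y Sm1 Sm2).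
  replace (D n (scal c h) - c * D n h - 0) with (RtoC (INR (S n)) *
    (F (plus x (scal c (scal (iv n) h))) - F x - c * (F (plus x (scal (iv n) h)) - F x))).
  2: { unfold D. replace (scal (iv n) (scal c h)) with (scal c (scal (iv n) h)); [ring|].
       rewrite !scal_assoc. f_equal. apply Cmult_comm. }
  rewrite Cmod_mult, Cin.
  apply (Rmult_le_compat_l (INR (S n))) in Y; [|apply pos_INR].
  eapply Rle_lt_trans; [exact Y|].
  replace (INR (S n) * (K * ((Cmod c ^ 2 + Cmod c) * (/ INR (S n) * norm h) ^ 2)))%R with
    (K * ((Cmod c ^ 2 + Cmod c) * norm h ^ 2) * / INR (S n))%R by (field; apply not_0_INR; lia).
  apply HN1; lia.
- exists (Rabs K + 1)%R. split; [generalize (Rabs_pos K); lra|]. intros h.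
  change (Cmod (L h) <= (Rabs K + 1) * norm h)%R.
  destruct (nfloor_ex (norm h * / r)) as [N2 [_ HN2]].
  { apply Rmult_le_pos; [apply nn|left; now apply Rinv_0_lt_compat]. }
  apply (Clim_le_const (fun n => D n h) (L h) _ N2 (HL h)). intros n Hn.
  assert (Y := Q3 (scal (iv n) h)). rewrite Niv in Y.
  assert (Sm : (/ INR (S n) * norm h <= r)%R).
  { apply small. rewrite S_INR. assert (H := le_INR N2 n ltac:(lia)). lra. }
  specialize (Y Sm). unfold D. rewrite Cmod_mult, Cin.
  apply (Rmult_le_compat_l (INR (S n))) in Y; [|apply pos_INR].
  eapply Rle_trans; [exact Y|].
  replace (INR (S n) * (K * (/ INR (S n) * norm h)))%R with (K * norm h)%R by (field; apply not_0_INR; lia).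
  generalize (nn h) (Rle_abs K). nra.
- intros eps. apply locally_norm_ball.
  assert (P : (0 < Rmin r (eps / (Rabs K + 1)))%R).
  { apply Rmin_case; [exact Hr|]. apply Rdiv_lt_0_compat; [apply cond_pos|generalize (Rabs_pos K); lra]. }
  exists (mkposreal _ P). simpl. intros y Hy.
  assert (H1 := Rlt_le_trans _ _ _ Hy (Rmin_l _ _)).
  assert (H2 := Rlt_le_trans _ _ _ Hy (Rmin_r _ _)).
  assert (E := EL (minus y x) ltac:(lra)).
  replace (plus x (minus y x)) with y in E.
  2: { symmetry. apply (plus_minus_cancel x y). }
  eapply Rle_trans; [exact E|].
  apply (Rmult_lt_compat_r (Rabs K + 1)) in H2; [|generalize (Rabs_pos K); lra].
  unfold Rdiv in H2. rewrite Rmult_assoc, Rinv_l, Rmult_1_r in H2 by (generalize (Rabs_pos K); lra).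
  assert (h0 := nn (minus y x)). assert (R1 := Rle_abs K). simpl. rewrite Rmult_1_r. nra.
Qed.

(** On the complex line t -> x + t h the radius of holomorphy becomes rho / |h|. Inserting this
    radius in the one-variable estimates produces the powers |h| and |h|^2, with constants
    independent of the direction. *)
Lemma hol_linear_part (F : V -> C) (x : V) (rho M : R) : (0 < rho)%R ->
  (forall y, norm (minus y x) < rho -> cd F y)%R -> (forall y, norm (minus y x) < rho -> Cmod (F y) <= M)%R ->
  exists L : V -> C, @is_linear C_AbsRing V C_NormedModule L /\
   (forall h : V, Cmod (L h) <= 2 * M / rho * norm h)%R /\
   (forall h : V, norm h <= rho / 4 -> Cmod (F (plus x h) - F x - L h)%C <= 96 * M / (rho * rho) * norm h ^ 2)%R.
Proof.
intros Hrho Hc HM.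
assert (nx : norm (minus x x) = 0%R) by apply norm_minus_self.
destruct (proj1 (cd_iff F x) (Hc x ltac:(lra))) as [L [HL Hd]].
exists L. split; [exact HL|].
assert (mp : forall h : V, minus (plus x h) x = h).
{ intros h. apply (minus_plus_cancel x h). }
assert (Der : forall h : V, cder (fun t => F (plus x (scal t h))) 0 (L h)).
{ intros h eps. assert (nh := norm_ge_0 h).
  assert (P : (0 < eps / (norm h + 1))%R) by (apply Rdiv_lt_0_compat; [apply cond_pos|lra]).
  destruct (proj1 (locally_norm_ball _ _) (Hd (mkposreal _ P))) as [d Hdd]. simpl in Hdd.
  assert (P2 : (0 < d / (norm h + 1))%R) by (apply Rdiv_lt_0_compat; [apply cond_pos|lra]).
  apply locally_Cmod. exists (mkposreal _ P2). simpl. intros t Ht.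
  replace (t - 0) with t in * by ring.
  assert (E := Hdd (plus x (scal t h))). rewrite mp, norm_scal_C in E.
  replace (plus x (scal (RtoC 0) h)) with x.
  2: { symmetry. transitivity (plus x zero); [f_equal; exact (scal_zero_l h)|exact (plus_zero_r x)]. }
  rewrite (linear_scal L HL) in E.
  replace (L h * t) with (scal t (L h)) by apply Cmult_comm.
  assert (t0 := Cmod_ge_0 t).
  eapply Rle_trans; [apply E|].
  - apply (Rmult_lt_compat_r (norm h + 1)) in Ht; [|lra].
    unfold Rdiv in Ht. rewrite Rmult_assoc, Rinv_l, Rmult_1_r in Ht by lra. nra.
  - unfold Rdiv. rewrite Rmult_assoc. apply Rmult_le_compat_l; [left; apply cond_pos|].
    apply (Rmult_le_reg_l (norm h + 1)); [lra|]. rewrite <- Rmult_assoc, Rinv_r, Rmult_1_l by lra. nra. }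
assert (z0 : scal (RtoC 0) = fun h : V => zero) by (apply FunctionalExtensionality.functional_extensionality; intros h; apply (scal_zero_l h)).
assert (one_ : forall h : V, scal (RtoC 1) h = h) by (intros h; apply (scal_one h)).
assert (M0 : (0 <= M)%R) by (generalize (HM x ltac:(lra)) (Cmod_ge_0 (F x)); lra).
split; intros h; assert (nh := norm_ge_0 h).
- destruct (Req_dec (norm h) 0) as [E|E].
  { rewrite E, Rmult_0_r. apply norm_eq_zero in E. rewrite E, (linear_zero L HL).
    change (Cmod 0 <= 0)%R. rewrite Cmod_0. lra. }
  assert (P : (0 < rho / norm h)%R) by (apply Rdiv_lt_0_compat; lra).
  assert (In : forall t : C, (Cmod (t - 0) < rho / norm h)%R -> (norm (minus (plus x (scal t h)) x) < rho)%R).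
  { intros t Ht. rewrite mp, norm_scal_C. replace (t - 0) with t in Ht by ring.
    apply (Rmult_lt_compat_r (norm h)) in Ht; [|lra]. unfold Rdiv in Ht. rewrite Rmult_assoc, Rinv_l in Ht by lra. lra. }
  replace (2 * M / rho * norm h)%R with (2 * M / (rho / norm h))%R by (field; lra).
  apply (cauchy_estimate (fun t => F (plus x (scal t h))) 0 (L h) (rho / norm h) M P); [| |apply Der].
  + intros t Ht. apply cd_line, Hc, In, Ht.
  + intros t Ht. apply HM, In, Ht.
- intros Hh. destruct (Req_dec (norm h) 0) as [E|E].
  { rewrite E. apply norm_eq_zero in E. rewrite E, (linear_zero L HL), plus_zero_r.
    change (Cmod (F x - F x - 0) <= 96 * M / (rho * rho) * 0 ^ 2)%R.
    replace (F x - F x - 0) with (RtoC 0) by ring. rewrite Cmod_0. lra. }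
  assert (P : (0 < rho / norm h)%R) by (apply Rdiv_lt_0_compat; lra).
  assert (In : forall t : C, (Cmod (t - 0) < rho / norm h)%R -> (norm (minus (plus x (scal t h)) x) < rho)%R).
  { intros t Ht. rewrite mp, norm_scal_C. replace (t - 0) with t in Ht by ring.
    apply (Rmult_lt_compat_r (norm h)) in Ht; [|lra]. unfold Rdiv in Ht. rewrite Rmult_assoc, Rinv_l in Ht by lra. lra. }
  assert (Y := quadratic_estimate (fun t => F (plus x (scal t h))) 0 (L h) (rho / norm h) M P).
  assert (Y' := Y (fun t Ht => cd_line F x h t (Hc _ (In t Ht))) (fun t Ht => HM _ (In t Ht)) (Der h) (RtoC 1)).
  cbv beta in Y'. rewrite Cplus_0_l, one_, z0, plus_zero_r, Cmult_1_r, Cmod_1 in Y'.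
  eapply Rle_trans; [apply Y'|].
  + apply (Rmult_le_reg_r (norm h)); [lra|].
    replace (rho / norm h / 4 * norm h)%R with (rho / 4)%R by (field; lra). lra.
  + right. field. lra.
Qed.

(** With K0 = 96 M / rho^2: the three second-order errors in the additivity clause cost 3 K0, and
    the Lipschitz clause costs 2 M / rho for the linear part and K0 rho for the remainder. The sum
    serves all clauses. *)
Definition quad_const (rho M : R) : R := (3 * (96 * M / (rho * rho)) + 2 * M / rho + 96 * M / (rho * rho) * rho)%R.

Lemma hol_quad (F : V -> C) (x : V) (rho M : R) : (0 < rho)%R ->
  (forall y, norm (minus y x) < rho -> cd F y)%R -> (forall y, norm (minus y x) < rho -> Cmod (F y) <= M)%R ->
  quad F x (rho / 4) (quad_const rho M).
Proof.
intros Hrho Hc HM.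
destruct (hol_linear_part F x rho M Hrho Hc HM) as (L & HL & HB & HQ).
set (K0 := (96 * M / (rho * rho))%R) in *.
assert (M0 : (0 <= M)%R).
{ assert (nx : norm (minus x x) = 0%R) by apply norm_minus_self.
  generalize (HM x ltac:(lra)) (Cmod_ge_0 (F x)); lra. }
assert (K0p : (0 <= K0)%R) by (unfold K0; apply Rdiv_le_0_compat; nra).
assert (B0 : (0 <= 2 * M / rho)%R) by (apply Rdiv_le_0_compat; lra).
assert (KK : (3 * K0 <= quad_const rho M /\ 2 * M / rho + K0 * rho <= quad_const rho M)%R).
{ unfold quad_const. fold K0. nra. }
assert (nn : forall h : V, (0 <= norm h)%R) by (intros h; apply norm_ge_0).
split; [|split].
- intros h k Hhk. assert (h0 := nn h). assert (k0 := nn k).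
  assert (T := norm_triangle h k).
  assert (E1 := HQ h ltac:(lra)). assert (E2 := HQ k ltac:(lra)). assert (E3 := HQ (plus h k) ltac:(lra)).
  rewrite (linear_plus L HL) in E3. change (plus (L h) (L k)) with (L h + L k) in E3.
  replace (F (plus x (plus h k)) - F (plus x h) - F (plus x k) + F x) with
   ((F (plus x (plus h k)) - F x - (L h + L k)) + - (F (plus x h) - F x - L h) + - (F (plus x k) - F x - L k)) by ring.
  eapply Rle_trans; [apply Cmod_triangle|]. eapply Rle_trans; [apply Rplus_le_compat_r, Cmod_triangle|].
  rewrite !Cmod_opp.
  assert (S1 : (norm (plus h k) ^ 2 <= (norm h + norm k) ^ 2)%R) by (apply pow_incr; split; [apply nn|exact T]).
  assert (S2 : (norm h ^ 2 + norm k ^ 2 <= (norm h + norm k) ^ 2)%R) by (simpl; nra).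
  assert (S3 : (0 <= (norm h + norm k) ^ 2)%R) by (apply pow_le; lra).
  nra.
- intros c h Hh Hch. assert (h0 := nn h). assert (c0 := Cmod_ge_0 c).
  assert (E1 := HQ h ltac:(lra)). assert (E2 := HQ (scal c h)). rewrite norm_scal_C in E2. specialize (E2 ltac:(lra)).
  rewrite (linear_scal L HL) in E2. change (scal c (L h)) with (c * L h) in E2.
  replace (F (plus x (scal c h)) - F x - c * (F (plus x h) - F x)) with
    ((F (plus x (scal c h)) - F x - c * L h) + - (c * (F (plus x h) - F x - L h))) by ring.
  eapply Rle_trans; [apply Cmod_triangle|]. rewrite Cmod_opp, Cmod_mult.
  assert (S1 : (0 <= norm h ^ 2)%R) by (apply pow_le; lra).
  apply (Rmult_le_compat_l (Cmod c)) in E1; [|lra].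
  replace ((Cmod c * norm h) ^ 2)%R with (Cmod c ^ 2 * norm h ^ 2)%R in E2 by ring.
  assert (S2 : (0 <= Cmod c ^ 2)%R) by (apply pow_le; lra).
  apply Rle_trans with (K0 * ((Cmod c ^ 2 + Cmod c) * norm h ^ 2))%R; [lra|].
  apply Rmult_le_compat_r; [|lra]. apply Rmult_le_pos; lra.
- intros h Hh. assert (h0 := nn h). assert (E1 := HQ h ltac:(lra)). assert (E2 := HB h).
  replace (F (plus x h) - F x) with ((F (plus x h) - F x - L h) + L h) by ring.
  eapply Rle_trans; [apply Cmod_triangle|].
  assert (S1 : (norm h ^ 2 <= rho * norm h)%R) by (simpl; nra).
  assert (S2 : (K0 * norm h ^ 2 <= K0 * rho * norm h)%R) by nra.
  nra.
Qed.

(** The constant of [quad] depends only on [rho] and [M], so its inequalities survive a merely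
    pointwise limit of uniformly bounded functions; no uniform convergence has to be checked in
    later applications. *)
Theorem cd_bounded_limit (f : nat -> V -> C) (F : V -> C) (x : V) (rho M : R) : (0 < rho)%R ->
  (forall n y, norm (minus y x) < rho -> cd (f n) y)%R ->
  (forall n y, norm (minus y x) < rho -> Cmod (f n y) <= M)%R ->
  (forall y, norm (minus y x) < rho -> Clim (fun n => f n y) (F y))%R ->
  cd F x.
Proof.
intros Hrho Hc HM Hl.
assert (Q := fun n => hol_quad (f n) x rho M Hrho (Hc n) (HM n)).
assert (mp : forall h : V, minus (plus x h) x = h).
{ intros h. apply (minus_plus_cancel x h). }
assert (Lx : forall h : V, (norm h <= rho / 4)%R -> Clim (fun n => f n (plus x h)) (F (plus x h))).
{ intros h Hh. apply Hl. rewrite mp. lra. }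
assert (L0 : Clim (fun n => f n x) (F x)).
{ apply Hl. rewrite norm_minus_self. exact Hrho. }
assert (nn : forall h : V, (0 <= norm h)%R) by (intros h; apply norm_ge_0).
apply (quad_cd F x (rho / 4) (quad_const rho M)); [lra|]. split; [|split].
- intros h k Hhk. assert (h0 := nn h). assert (k0 := nn k). assert (T := norm_triangle h k).
  eapply (Clim_le_const _ _ _ O); [|intros n _; apply (Q n); exact Hhk].
  apply Clim_plus; [apply Clim_minus; [apply Clim_minus|]|]; auto; apply Lx; lra.
- intros c h Hh Hch. eapply (Clim_le_const _ _ _ O); [|intros n _; apply (Q n); assumption].
  apply Clim_minus; [apply Clim_minus; [apply Lx; rewrite norm_scal_C; exact Hch|exact L0]|].
  apply Clim_scal, Clim_minus; [apply Lx; exact Hh|exact L0].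
- intros h Hh. eapply (Clim_le_const _ _ _ O); [|intros n _; apply (Q n); assumption].
  apply Clim_minus; [apply Lx; exact Hh|exact L0].
Qed.

(** Each inequality of [quad] bounds an expression linear in the function, so it can be integrated
    over t at the cost of a factor b - a. Only integrability in t is needed, not joint
    continuity. *)
Theorem cd_integral (f : R -> V -> C) (a b : R) (x : V) (rho M : R) : (0 < rho)%R -> (a <= b)%R ->
  (forall t y, a <= t <= b -> norm (minus y x) < rho -> cd (f t) y)%R ->
  (forall t y, a <= t <= b -> norm (minus y x) < rho -> Cmod (f t y) <= M)%R ->
  (forall y, norm (minus y x) < rho -> ex_CInt (fun t => f t y) a b)%R ->
  cd (fun y => CInt (fun t => f t y) a b) x.
Proof.
intros Hrho Hab Hc HM He.
assert (Q := fun t Ht => hol_quad (f t) x rho M Hrho (fun y Hy => Hc t y Ht Hy) (fun y Hy => HM t y Ht Hy)).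
assert (mp : forall h : V, minus (plus x h) x = h).
{ intros h. apply (minus_plus_cancel x h). }
assert (Ex : forall h : V, (norm h <= rho / 4)%R -> ex_CInt (fun t => f t (plus x h)) a b).
{ intros h Hh. apply He. rewrite mp. lra. }
assert (E0 : ex_CInt (fun t => f t x) a b).
{ apply He. rewrite norm_minus_self. exact Hrho. }
assert (nn : forall h : V, (0 <= norm h)%R) by (intros h; apply norm_ge_0).
assert (exm : forall g1 g2 : R -> C, ex_CInt g1 a b -> ex_CInt g2 a b -> ex_CInt (fun t => g1 t - g2 t) a b).
{ intros. now apply (ex_RInt_minus (V := C_R_NormedModule)). }
assert (exp_ : forall g1 g2 : R -> C, ex_CInt g1 a b -> ex_CInt g2 a b -> ex_CInt (fun t => g1 t + g2 t) a b).
{ intros. now apply (ex_RInt_plus (V := C_R_NormedModule)). }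
assert (exs : forall (k : C) (g1 : R -> C), ex_CInt g1 a b -> ex_CInt (fun t => k * g1 t) a b).
{ intros k g1 [l Hl]. exists (k * l). now apply is_CInt_mult. }
assert (ba : (0 <= b - a)%R) by lra.
apply (quad_cd _ x (rho / 4) (quad_const rho M * (b - a))); [lra|]. split; [|split].
- intros h k Hhk. assert (h0 := nn h). assert (k0 := nn k). assert (T := norm_triangle h k).
  assert (X1 := Ex h ltac:(lra)). assert (X2 := Ex k ltac:(lra)). assert (X3 := Ex (plus h k) ltac:(lra)).
  rewrite <- CInt_minus, <- CInt_minus, <- CInt_plus by auto.
  rewrite (Rmult_assoc (quad_const rho M)), (Rmult_comm (b - a)), <- Rmult_assoc.
  apply CInt_bound; auto. intros t Ht. now apply (Q t Ht).
- intros c h Hh Hch.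
  assert (X1 := Ex h ltac:(lra)). assert (X2 := Ex (scal c h) ltac:(rewrite norm_scal_C; lra)).
  rewrite <- CInt_minus, <- CInt_minus, <- CInt_mult, <- CInt_minus by auto.
  rewrite (Rmult_assoc (quad_const rho M)), (Rmult_comm (b - a)), <- Rmult_assoc.
  apply CInt_bound; auto. intros t Ht. now apply (Q t Ht).
- intros h Hh. assert (X1 := Ex h ltac:(lra)).
  rewrite <- CInt_minus by auto.
  rewrite (Rmult_assoc (quad_const rho M)), (Rmult_comm (b - a)), <- Rmult_assoc.
  apply CInt_bound; auto. intros t Ht. now apply (Q t Ht).
Qed.

End Quadratic.

(** * Identity theorem *)

Definition hol {V : NormedModule C_AbsRing} (f : V -> C) (x : V) : Prop := locally x (fun y => cd f y).

Lemma minus_plus_plus {G : AbelianGroup} (y a x b : G) :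
  minus (plus y a) (plus x b) = plus (minus y x) (minus a b).
Proof.
transitivity (plus (plus y a) (plus (opp x) (opp b))); [unfold minus; f_equal; exact (opp_plus x b)|].
transitivity (plus y (plus a (plus (opp x) (opp b)))); [symmetry; apply plus_assoc|].
transitivity (plus y (plus (opp x) (plus a (opp b)))); [f_equal|apply plus_assoc].
transitivity (plus (plus a (opp x)) (opp b)); [apply plus_assoc|].
transitivity (plus (plus (opp x) a) (opp b)); [f_equal; apply plus_comm|symmetry; apply plus_assoc].
Qed.

Section Hol.
Context {V : NormedModule C_AbsRing}.

Lemma hol_cd (f : V -> C) x : hol f x -> cd f x.
Proof. intros H. exact (locally_singleton _ _ H). Qed.

Lemma hol_bounded (f : V -> C) x : hol f x ->
  exists (d : posreal) (M : R), forall y, (norm (minus y x) < d)%R -> cd f y /\ (Cmod (f y) <= M)%R.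
Proof.
intros H. assert (H1 := continuous_C_eps_inv f x (cd_continuous f x (hol_cd f x H)) (mkposreal 1 Rlt_0_1)).
destruct (proj1 (locally_norm_ball _ _) (filter_and _ _ H H1)) as [d Hd].
exists d, (Cmod (f x) + 1)%R. intros y Hy. destruct (Hd y Hy) as [A B]. split; [exact A|]. simpl in B.
replace (f y) with (f x + (f y - f x)) by ring. eapply Rle_trans; [apply Cmod_triangle|]. lra.
Qed.

Lemma norm_minus_triangle (x y z : V) : (norm (minus x z) <= norm (minus x y) + norm (minus y z))%R.
Proof.
replace (minus x z) with (plus (minus x y) (minus y z)); [exact (norm_triangle (minus x y) (minus y z))|].
symmetry. exact (minus_trans y x z).
Qed.

Lemma cd_integral_hol (f : R -> V -> C) (a b : R) (x : V) (rho M : R) : (0 < rho)%R -> (a <= b)%R ->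
  (forall t y, a <= t <= b -> norm (minus y x) < rho -> cd (f t) y)%R ->
  (forall t y, a <= t <= b -> norm (minus y x) < rho -> Cmod (f t y) <= M)%R ->
  (forall y, norm (minus y x) < rho -> ex_CInt (fun t => f t y) a b)%R ->
  hol (fun y => CInt (fun t => f t y) a b) x.
Proof.
intros Hrho Hab Hc HM He. apply locally_norm_ball. exists (mkposreal _ Hrho). simpl. intros z Hz.
assert (T : forall y, (norm (minus y z) < rho - norm (minus z x))%R -> (norm (minus y x) < rho)%R).
{ intros y Hy. eapply Rle_lt_trans; [apply (norm_minus_triangle y z x)|]. lra. }
apply (cd_integral f a b z (rho - norm (minus z x)) M); auto. lra.
Qed.

(** A Lebesgue number argument: finitely many of the local radii suffice on the compact interval,
    and monotonicity allows the smallest to be used everywhere. The covering statement of the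
    library carries a double negation, whence the classical step. *)
Lemma compact_interval_bound (P : R -> R -> Prop) (a b : R) :
  (forall t e e', (0 < e' <= e)%R -> P t e -> P t e') ->
  (forall t, (a <= t <= b)%R -> exists d : posreal, forall t', (Rabs (t' - t) < d)%R -> P t' d) ->
  exists d : posreal, forall t, (a <= t <= b)%R -> P t d.
Proof.
intros Hm H.
assert (H' : forall t, exists d : posreal, (a <= t <= b)%R -> forall t', (Rabs (t' - t) < d)%R -> P t' d).
{ intros t. destruct (classic (a <= t <= b)%R) as [Ht|Ht].
  - destruct (H t Ht) as [d Hd]. now exists d.
  - now exists (mkposreal 1 Rlt_0_1). }
destruct (fun_choice _ H') as [dl Hdl].
destruct (compactness_value_1d a b dl) as [d Hd]. exists d. intros t Ht.
apply NNPP. intros N. apply (Hd t Ht). intros [s [Hs [Hs2 Hs3]]]. apply N.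
apply (Hm t (dl s)); [|now apply Hdl]. split; [apply cond_pos|exact Hs3].
Qed.

Lemma ccont_eps (g : R -> C) t : ccont g t -> forall eps : posreal, exists d : posreal,
  forall t', (Rabs (t' - t) < d)%R -> (Cmod (g t' - g t) < eps)%R.
Proof. intros H eps. destruct (continuous_C_eps_inv g t H eps) as [d Hd]. exists d. exact Hd. Qed.

Lemma circle_integral_hol (k : R -> C) (F : V -> C) (x v : V) (r : R) : (0 <= r)%R ->
  (forall t, ccont k t) ->
  (forall t, hol F (plus x (scal (circ r t) v))) ->
  hol (fun y => CInt (fun t => k t * F (plus y (scal (circ r t) v))) 0 (2 * PI)) x.
Proof.
intros Hr Hk HF.
assert (sh : forall y t t', (norm (minus (plus y (scal (circ r t') v)) (plus x (scal (circ r t) v))) <=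
   norm (minus y x) + Cmod (circ r t' - circ r t) * norm v)%R).
{ intros y t t'. rewrite <- norm_scal_C.
  replace (minus (plus y (scal (circ r t') v)) (plus x (scal (circ r t) v))) with
    (plus (minus y x) (scal (circ r t' - circ r t) v)); [exact (norm_triangle (minus y x) (scal (circ r t' - circ r t) v))|].
  transitivity (plus (minus y x) (minus (scal (circ r t') v) (scal (circ r t) v))).
  - f_equal. exact (scal_minus_distr_r (circ r t') (circ r t) v).
  - symmetry. apply (minus_plus_plus y (scal (circ r t') v) x (scal (circ r t) v)). }
(* One number e encodes both a radius and the bound 1 / e on the integrand, so the property is
   monotone in e and a single compactness argument gives both. *)
destruct (compact_interval_bound (fun t e => forall y, (norm (minus y x) < e)%R ->
   cd F (plus y (scal (circ r t) v)) /\ (Cmod (k t * F (plus y (scal (circ r t) v)))%C * e <= 1)%R) 0 (2 * PI)) as [d Hd].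
- intros t e e' He H y Hy. destruct (H y) as [A B]; [lra|]. split; [exact A|].
  eapply Rle_trans; [|exact B]. apply Rmult_le_compat_l; [apply Cmod_ge_0|lra].
- intros t _. destruct (hol_bounded F _ (HF t)) as (d1 & M & H1).
  assert (nv := norm_ge_0 v). assert (D1 := cond_pos d1).
  assert (P : (0 < d1 / (2 * (norm v + 1)))%R) by (apply Rdiv_lt_0_compat; lra).
  destruct (ccont_eps _ _ (ccont_circ r t) (mkposreal _ P)) as [d2 H2]. simpl in H2.
  destruct (ccont_eps _ _ (Hk t) (mkposreal 1 Rlt_0_1)) as [d3 H3]. simpl in H3.
  set (B := ((Cmod (k t) + 1) * (Rabs M + 1))%R).
  assert (PB : (0 < B)%R) by (unfold B; generalize (Cmod_ge_0 (k t)) (Rabs_pos M); nra).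
  assert (Q : (0 < Rmin (Rmin (d1 / 2) (/ B)) (Rmin d2 d3))%R).
  { repeat apply Rmin_case; try apply cond_pos; [lra|now apply Rinv_0_lt_compat]. }
  exists (mkposreal _ Q). simpl. intros t' Ht' y Hy.
  assert (m1 := Rmin_l (Rmin (d1 / 2) (/ B)) (Rmin d2 d3)).
  assert (m2 := Rmin_r (Rmin (d1 / 2) (/ B)) (Rmin d2 d3)).
  assert (m3 := Rmin_l (d1 / 2) (/ B)). assert (m4 := Rmin_r (d1 / 2) (/ B)).
  assert (m5 := Rmin_l d2 d3). assert (m6 := Rmin_r d2 d3).
  destruct (H1 (plus y (scal (circ r t') v))) as [E1 E2].
  { eapply Rle_lt_trans; [apply sh|].
    assert (Y := H2 t' ltac:(lra)).
    assert (Z : (Cmod (circ r t' - circ r t) * norm v <= d1 / 2)%R).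
    { apply (Rmult_lt_compat_r (norm v + 1)) in Y; [|lra].
      replace (d1 / (2 * (norm v + 1)) * (norm v + 1))%R with (d1 / 2)%R in Y by (field; lra).
      generalize (Cmod_ge_0 (circ r t' - circ r t)). nra. }
    apply Rlt_le_trans with (d1 / 2 + d1 / 2)%R; [|lra].
    apply Rplus_lt_le_compat; [|exact Z]. eapply Rlt_le_trans; [exact Hy|lra]. }
  split; [exact E1|].
  rewrite Cmod_mult.
  assert (E3 : (Cmod (k t') <= Cmod (k t) + 1)%R).
  { replace (k t') with (k t + (k t' - k t)) by ring. eapply Rle_trans; [apply Cmod_triangle|].
    assert (Y := H3 t' ltac:(lra)). lra. }
  apply Rle_trans with (B * / B)%R; [|right; field; lra].
  apply Rmult_le_compat; [apply Rmult_le_pos; apply Cmod_ge_0|left; exact Q| |lra].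
  unfold B. apply Rmult_le_compat; [apply Cmod_ge_0|apply Cmod_ge_0|exact E3|].
  eapply Rle_trans; [exact E2|]. generalize (Rle_abs M); lra.
- assert (D := cond_pos d).
  apply (cd_integral_hol (fun t y => k t * F (plus y (scal (circ r t) v))) 0 (2 * PI) x d (/ d)).
  + exact D.
  + generalize two_PI_pos; lra.
  + intros t y Ht Hy. apply cd_mult; [apply cd_const|]. apply cd_shift. now apply (Hd t Ht).
  + intros t y Ht Hy. destruct (Hd t Ht y Hy) as [_ B].
    apply (Rmult_le_reg_r d); [exact D|]. rewrite Rinv_l by lra. exact B.
  + intros y Hy. apply ex_CInt_cont. intros t Ht.
    rewrite Rmin_left, Rmax_right in Ht by (generalize two_PI_pos; lra).
    apply ccont_mult; [apply Hk|].
    destruct (Hd t Ht y Hy) as [A _].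
    apply (continuous_C_comp (circ r) (fun z => F (plus y (scal z v)))); [apply ccont_circ|].
    apply cd_line. exact A.
Qed.

Lemma circle_mean_hol (F : V -> C) (x v : V) (r : R) : (0 <= r)%R ->
  (forall t, hol F (plus x (scal (circ r t) v))) ->
  hol (fun y => Cmean (fun z => F (plus y (scal z v))) r) x.
Proof.
intros Hr HF.
assert (H := circle_integral_hol (fun _ => 1) F x v r Hr (fun t => continuous_const (V := C_UniformSpace) _ _) HF).
unfold hol in *. generalize H. apply filter_imp. intros y Hy. unfold Cmean.
apply cd_mult; [apply cd_const|].
apply (cd_ext (fun y => CInt (fun t => 1 * F (plus y (scal (circ r t) v))) 0 (2 * PI))); [|exact Hy].
intros w. apply CInt_ext. intros t _. apply Cmult_1_l.
Qed.

End Hol.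

(** On circles of a fixed small radius the derivative at w is the mean of (f(w + t) - f(w)) / t, and
    such an integral is holomorphic in w. So f' is again complex differentiable. *)
Lemma cd_derivative (f : C -> C) (z0 : C) (rho : R) :
  (forall z, Cmod (z - z0) < rho -> cd f z)%R ->
  exists f1 : C -> C, forall z, (Cmod (z - z0) < rho)%R -> cder f z (f1 z) /\ cd f1 z.
Proof.
intros Hf.
assert (E : forall z, exists l, (Cmod (z - z0) < rho)%R -> cder f z l).
{ intros z. destruct (Rlt_dec (Cmod (z - z0)) rho) as [H|H].
  - destruct (proj1 (cd_cder f z) (Hf z H)) as [l Hl]. now exists l.
  - exists (RtoC 0). lra. }
destruct (fun_choice _ E) as [f1 Hf1]. exists f1. intros z Hz. split; [now apply Hf1|].
set (r := ((rho - Cmod (z - z0)) / 4)%R).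
assert (Pr : (0 < r)%R) by (unfold r; lra).
assert (kc : forall t, ccont (fun t => / circ r t) t).
{ intros t. apply (continuous_C_comp (circ r) Cinv); [apply ccont_circ|].
  apply (cder_cd _ _ _ (cder_inv (circ r t) ltac:(apply Cmod_gt_0; rewrite Cmod_circ; lra))). }
assert (H := circle_integral_hol (V := C_NormedModule) (fun t => / circ r t) f z (RtoC 1) r ltac:(lra) kc).
assert (Hh : forall t, hol (V := C_NormedModule) f (plus z (scal (circ r t) (RtoC 1 : C_NormedModule)))).
{ intros t. apply locally_Cmod. exists (mkposreal _ Pr). simpl. intros w Hw. apply Hf.
  replace (w - z0) with ((w - (z + circ r t * 1)) + (z - z0) + circ r t) by ring.
  eapply Rle_lt_trans; [apply Cmod_triangle|]. rewrite Cmod_circ by lra.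
  assert (T := Cmod_triangle (w - (z + circ r t * 1)) (z - z0)).
  assert (Hw' : (Cmod (w - (z + circ r t * 1)) < r)%R) by exact Hw.
  unfold r in *. lra. }
specialize (H Hh). apply (hol_cd (V := C_NormedModule)) in H.
apply (cd_ext_locally (V := C_NormedModule) (fun w : C => / RtoC (2 * PI) *
  (CInt (fun t => / circ r t * f (w + circ r t * 1)) 0 (2 * PI) - f w * CInt (fun t => / circ r t) 0 (2 * PI)))).
- apply locally_Cmod. exists (mkposreal _ Pr). simpl. intros w Hw.
  assert (Hw2 : (Cmod (w - z0) < rho - 3 * r)%R).
  { replace (w - z0) with ((w - z) + (z - z0)) by ring. eapply Rle_lt_trans; [apply Cmod_triangle|]. unfold r in *. lra. }
  assert (In : forall u, (Cmod (u - w) < 2 * r)%R -> (Cmod (u - z0) < rho)%R).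
  { intros u Hu. replace (u - z0) with ((u - w) + (w - z0)) by ring. eapply Rle_lt_trans; [apply Cmod_triangle|]. lra. }
  assert (D := deriv_as_mean f w (f1 w) (2 * r) r ltac:(lra) (fun u Hu => Hf u (In u Hu)) (Hf1 w ltac:(lra))).
  rewrite D. unfold Cmean.
  assert (X1 : ex_CInt (fun t => / circ r t) 0 (2 * PI)) by (apply ex_CInt_cont; intros; apply kc).
  assert (X2 : ex_CInt (fun t => / circ r t * f (w + circ r t * 1)) 0 (2 * PI)).
  { apply ex_CInt_cont. intros t _. apply ccont_mult; [apply kc|].
    apply (continuous_C_comp (circ r) (fun u => f (w + u * 1))); [apply ccont_circ|].
    apply (cd_comp (V := C_NormedModule) (fun u => w + u * 1) f).
    - apply (cd_plus (V := C_NormedModule) (fun _ => w) (fun u => u * 1)); [apply (cd_const (V := C_NormedModule))|].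
      apply (cd_mult (V := C_NormedModule) (fun u => u) (fun _ => 1)); [apply cd_idC|apply (cd_const (V := C_NormedModule))].
    - apply Hf, In. replace (w + circ r t * 1 - w) with (circ r t) by ring. rewrite Cmod_circ; lra. }
  rewrite <- CInt_mult by exact X1. rewrite <- CInt_minus.
  + ceq. f_equal. apply CInt_ext. intros t _.
    replace (w + circ r t * 1) with (w + circ r t) by ring. unfold Cdiv. ring.
  + exact X2.
  + destruct X1 as [l Hl]. exists (f w * l). now apply is_CInt_mult.
- apply (cd_mult (V := C_NormedModule) (fun _ => / RtoC (2 * PI))); [apply (cd_const (V := C_NormedModule))|].
  apply (cd_minus (V := C_NormedModule)); [exact H|].
  apply (cd_mult (V := C_NormedModule) f); [now apply Hf|apply (cd_const (V := C_NormedModule))].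
Qed.

(** Each differentiation costs d of the radius and a factor 2 / d by the Cauchy estimate.
    Integrating back from [z0], where all derivatives vanish, supplies |h| / (k+1) each time and
    thus |h|^k / k! in total. *)
Lemma vanishing_bound (k : nat) : forall (f : C -> C) (z0 : C) (R0 d M : R), (0 < d)%R ->
  (forall z, Cmod (z - z0) < R0 + INR k * d -> cd f z)%R ->
  (forall z, Cmod (z - z0) < R0 + INR k * d -> Cmod (f z) <= M)%R ->
  locally z0 (fun z => f z = 0) ->
  forall h, (Cmod h < R0)%R -> (Cmod (f (z0 + h)%C) <= M * (2 / d) ^ k * Cmod h ^ k / INR (fact k))%R.
Proof.
induction k as [|k IH]; intros f z0 R0 d M Hd Hf HM H0 h Hh.
- simpl in *. rewrite Rmult_0_l, Rplus_0_r in HM. replace (M * 1 * 1 / 1)%R with M by field.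
  apply HM. replace (z0 + h - z0) with h by ring. exact Hh.
- destruct (cd_derivative f z0 _ Hf) as [f1 Hf1].
  assert (Sk : (INR (S k) * d = INR k * d + d)%R) by (rewrite S_INR; ring).
  assert (kd : (0 <= INR k * d)%R) by (apply Rmult_le_pos; [apply pos_INR|lra]).
  assert (M0 : (0 <= M)%R).
  { assert (Y := HM z0). replace (z0 - z0) with (RtoC 0) in Y by ring. rewrite Cmod_0 in Y.
    generalize (Cmod_ge_0 h) (Cmod_ge_0 (f z0)). lra. }
  assert (K := IH f1 z0 R0 d (2 * M / d)%R Hd).
  assert (K1 : forall z, (Cmod (z - z0) < R0 + INR k * d)%R -> cd f1 z) by (intros z Hz; apply Hf1; lra).
  assert (K2 : forall z, (Cmod (z - z0) < R0 + INR k * d)%R -> (Cmod (f1 z) <= 2 * M / d)%R).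
  { intros z Hz. apply (cauchy_estimate f z (f1 z) d M Hd).
    - intros w Hw. apply Hf. replace (w - z0) with (w - z + (z - z0)) by ring.
      eapply Rle_lt_trans; [apply Cmod_triangle|]. lra.
    - intros w Hw. apply HM. replace (w - z0) with (w - z + (z - z0)) by ring.
      eapply Rle_lt_trans; [apply Cmod_triangle|]. lra.
    - apply Hf1. lra. }
  assert (K3 : locally z0 (fun z => f1 z = 0)).
  { assert (L := locally_locally _ _ H0).
    assert (L2 : locally z0 (fun z => (Cmod (z - z0) < R0 + INR (S k) * d)%R)).
    { apply locally_Cmod. assert (P : (0 < R0 + INR (S k) * d)%R) by (generalize (Cmod_ge_0 h); lra).
      now exists (mkposreal _ P). }
    generalize (filter_and _ _ L L2). apply filter_imp. intros z [A B].
    apply (cder_unique f z); [now apply Hf1|].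
    apply (cder_ext_locally (fun _ => 0)); [|apply cder_const].
    generalize A. apply filter_imp. intros w Hw. now symmetry. }
  specialize (K K1 K2 K3).
  assert (f0 : f z0 = 0) by exact (locally_singleton _ _ H0).
  assert (nh := Cmod_ge_0 h).
  assert (Q := mean_value_power f z0 h (fun s => f1 (z0 + RtoC s * h)) (2 * M / d * (2 / d) ^ k * Cmod h ^ k / INR (fact k))%R k).
  assert (Q2 : (Cmod (f (z0 + h)%C - f z0) <= 2 * M / d * (2 / d) ^ k * Cmod h ^ k / INR (fact k) * Cmod h / INR (S k))%R).
  { apply Q. intros s Hs.
    assert (Cs : Cmod (RtoC s * h) = (s * Cmod h)%R) by (rewrite Cmod_mult, Cmod_R, Rabs_pos_eq; lra).
    split.
    - apply Hf1. replace (z0 + RtoC s * h - z0) with (RtoC s * h) by ring. rewrite Cs. nra.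
    - eapply Rle_trans; [apply K; rewrite Cs; nra|]. rewrite Cs, Rpow_mult_distr. right. field.
      split; first [lra | apply INR_fact_neq_0]. }
  rewrite f0 in Q2. replace (f (z0 + h) - 0) with (f (z0 + h)) in Q2 by ring.
  eapply Rle_trans; [exact Q2|]. right.
  rewrite fact_simpl, mult_INR. cbn [pow]. field.
  repeat split; first [lra | apply INR_fact_neq_0 | apply not_0_INR; lia].
Qed.

(** The induction step is (1 + 1/n)^n <= exp 1 <= 3. *)
Lemma pow_self_le_fact (k : nat) : (INR k ^ k <= 3 ^ k * INR (fact k))%R.
Proof.
induction k as [|k IH]; [simpl; lra|].
destruct k as [|k]; [simpl; lra|].
set (n := S k) in *.
assert (Pn : (0 < INR n)%R) by (apply lt_0_INR; unfold n; lia).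
rewrite fact_simpl, mult_INR. cbn [pow].
assert (E : (INR (S n) ^ n <= 3 * INR n ^ n)%R).
{ assert (Q : (INR (S n) = INR n * (1 + / INR n))%R) by (rewrite S_INR; field; lra).
  rewrite Q, Rpow_mult_distr, Rmult_comm. apply Rmult_le_compat_r; [apply pow_le; lra|].
  apply Rle_trans with (exp (/ INR n) ^ n)%R.
  - apply pow_incr. split; [generalize (Rinv_0_lt_compat _ Pn); lra|apply exp_ineq1_le].
  - rewrite <- Rpower_pow by apply exp_pos. unfold Rpower. rewrite ln_exp.
    replace (INR n * / INR n)%R with 1%R by (field; lra). apply exp_le_3. }
assert (PS : (0 < INR (S n))%R) by (apply lt_0_INR; lia).
apply Rle_trans with (INR (S n) * (3 * INR n ^ n))%R; [apply Rmult_le_compat_l; lra|].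
apply Rle_trans with (INR (S n) * (3 * (3 ^ n * INR (fact n))))%R; [|right; ring].
apply Rmult_le_compat_l; lra.
Qed.

(** Spending half the radius on n equal losses d = rho / (2 n) bounds |f(z0 + h)| by M (4 n |h| /
    rho)^n / n!, which is at most M (12 |h| / rho)^n since n^n <= 3^n n!. For |h| < rho / 24 this
    tends to 0. *)
Lemma vanishing_disc (f : C -> C) (z0 : C) (rho M : R) : (0 < rho)%R ->
  (forall z, Cmod (z - z0) < rho -> cd f z)%R -> (forall z, Cmod (z - z0) < rho -> Cmod (f z) <= M)%R ->
  locally z0 (fun z => f z = 0) -> forall h, (Cmod h < rho / 24)%R -> f (z0 + h) = 0.
Proof.
intros Hrho Hf HM H0 h Hh. assert (nh := Cmod_ge_0 h).
assert (M0 : (0 <= M)%R).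
{ assert (Y := HM z0). replace (z0 - z0) with (RtoC 0) in Y by ring. rewrite Cmod_0 in Y.
  generalize (Cmod_ge_0 (f z0)). lra. }
assert (B : forall k, (Cmod (f (z0 + h)%C) <= M * (/ 2) ^ S k)%R).
{ intros k. set (n := S k).
  assert (Pn : (0 < INR n)%R) by (apply lt_0_INR; unfold n; lia).
  assert (E : (rho / 2 + INR n * (rho / (2 * INR n)) = rho)%R) by (field; lra).
  assert (K := vanishing_bound n f z0 (rho / 2) (rho / (2 * INR n)) M).
  rewrite E in K. specialize (K ltac:(apply Rdiv_lt_0_compat; lra) Hf HM H0 h ltac:(lra)).
  eapply Rle_trans; [exact K|].
  assert (PF := INR_fact_lt_0 n).
  replace (2 / (rho / (2 * INR n)))%R with (4 / rho * INR n)%R by (field; lra).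
  rewrite Rpow_mult_distr. unfold Rdiv. rewrite !Rmult_assoc. apply Rmult_le_compat_l; [exact M0|].
  apply Rle_trans with ((4 * / rho) ^ n * ((3 ^ n * INR (fact n)) * (Cmod h ^ n * / INR (fact n))))%R.
  - apply Rmult_le_compat_l; [apply pow_le; left; apply Rdiv_lt_0_compat; lra|].
    apply Rmult_le_compat_r; [|apply pow_self_le_fact].
    apply Rmult_le_pos; [apply pow_le; lra|left; now apply Rinv_0_lt_compat].
  - replace ((4 * / rho) ^ n * (3 ^ n * INR (fact n) * (Cmod h ^ n * / INR (fact n))))%R
     with ((4 * / rho) ^ n * 3 ^ n * Cmod h ^ n)%R by (field; repeat split; lra).
    rewrite <- !Rpow_mult_distr. apply pow_incr. 
    replace (4 * / rho * 3 * Cmod h)%R with (12 * Cmod h / rho)%R by (field; lra).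
    split; [apply Rdiv_le_0_compat; lra|]. apply (Rmult_le_reg_r rho); [exact Hrho|].
    unfold Rdiv. rewrite Rmult_assoc, Rinv_l by lra. lra. }
apply Cmod_eq_0. apply Rle_antisym; [|apply Cmod_ge_0].
apply Rnot_lt_le. intros N.
destruct (pow_lt_1_zero (/2) ltac:(rewrite Rabs_pos_eq; lra) (Cmod (f (z0 + h)%C) / (M + 1))) as [n Hn].
{ apply Rdiv_lt_0_compat; lra. }
specialize (Hn (S n) ltac:(lia)). rewrite Rabs_pos_eq in Hn by (apply pow_le; lra).
specialize (B n).
apply (Rmult_lt_compat_l (M + 1)) in Hn; [|lra].
replace ((M + 1) * (Cmod (f (z0 + h)%C) / (M + 1)))%R with (Cmod (f (z0 + h)%C)) in Hn by (field; lra).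
assert (0 <= (/ 2) ^ S n)%R by (apply pow_le; lra). lra.
Qed.

(** Connectedness of [0, 1] for a locally constant property: the supremum of the points of [0, 1]
    where it holds cannot be smaller than 1. *)
Lemma seg_connected (P : R -> Prop) : P 0%R ->
  (forall s, (0 <= s <= 1)%R -> exists d : posreal, forall s' s'', (0 <= s' <= 1)%R -> (0 <= s'' <= 1)%R ->
     (Rabs (s' - s) < d)%R -> (Rabs (s'' - s) < d)%R -> P s' -> P s'') -> P 1%R.
Proof.
intros P0 H.
destruct (completeness (fun s => (0 <= s <= 1)%R /\ P s)) as [m [Hm1 Hm2]].
- exists 1%R. intros s [Hs _]. lra.
- exists 0%R. split; [lra|exact P0].
- assert (Hm : (0 <= m <= 1)%R).
  { split; [apply Hm1; split; [lra|exact P0]|]. apply Hm2. intros s [Hs _]. lra. }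
  destruct (H m Hm) as [d Hd]. assert (D := cond_pos d).
  assert (Ex : exists s', (0 <= s' <= 1)%R /\ P s' /\ (m - d < s')%R).
  { apply NNPP. intros N. assert (Y := Hm2 (m - d)%R). 
    assert (m <= m - d)%R; [|lra]. apply Y. intros s [Hs Ps].
    apply Rnot_lt_le. intros Q. apply N. now exists s. }
  destruct Ex as (s' & Hs' & Ps' & Q).
  assert (L : (s' <= m)%R) by (apply Hm1; now split).
  assert (X : P (Rmin 1 (m + d / 2))).
  { apply (Hd s'); [exact Hs'| | |  |exact Ps'].
    - split; [apply Rmin_case; lra|apply Rmin_l].
    - rewrite Rabs_left1; lra.
    - unfold Rmin. destruct (Rle_dec 1 (m + d / 2)); [rewrite Rabs_pos_eq; lra|rewrite Rabs_pos_eq; lra]. }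
  unfold Rmin in X. destruct (Rle_dec 1 (m + d / 2)) as [Y|Y]; [exact X|].
  exfalso. assert (m + d / 2 <= m)%R; [|lra]. apply Hm1. split; [lra|exact X].
Qed.

Lemma identity_01 (f : C -> C) :
  (forall s, (0 <= s <= 1)%R -> hol (V := C_NormedModule) f (RtoC s)) ->
  locally (RtoC 0) (fun z => f z = 0) -> f 1 = 0.
Proof.
intros Hf H0.
assert (X : locally (RtoC 1) (fun z => f z = 0)).
{ apply (seg_connected (fun s => locally (RtoC s) (fun z => f z = 0))); [exact H0|].
  intros s Hs. destruct (hol_bounded (V := C_NormedModule) f _ (Hf s Hs)) as (d & M & H).
  assert (D := cond_pos d).
  (* A point within d / 100 of [s''] is within d / 100 + d / 200 + d / 200 = d / 50 of [s'];
     [vanishing_disc] with radius d / 2 reaches d / 48. *)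
  assert (P : (0 < d / 200)%R) by lra. exists (mkposreal _ P). simpl. intros s' s'' Hs' Hs'' A B L.
  apply locally_Cmod. assert (P2 : (0 < d / 100)%R) by lra. exists (mkposreal _ P2). simpl.
  intros w Hw.
  assert (In : forall z, (Cmod (z - RtoC s') < d / 2)%R -> (Cmod (z - RtoC s) < d)%R).
  { intros z Hz. replace (z - RtoC s) with ((z - RtoC s') + RtoC (s' - s)) by (rewrite RtoC_minus; ring).
    eapply Rle_lt_trans; [apply Cmod_triangle|]. rewrite Cmod_R. lra. }
  replace w with (RtoC s' + (w - RtoC s')) by ring.
  apply (vanishing_disc f (RtoC s') (d / 2) M); [lra| | |exact L|].
  - intros z Hz. apply H. apply In, Hz.
  - intros z Hz. apply H. apply In, Hz.
  - replace (w - RtoC s') with ((w - RtoC s'') + RtoC (s'' - s) - RtoC (s' - s)) by (rewrite !RtoC_minus; ring).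
    unfold Cminus at 1. eapply Rle_lt_trans; [apply Cmod_triangle|]. rewrite Cmod_opp, Cmod_R.
    assert (T := Cmod_triangle (w - RtoC s'') (RtoC (s'' - s))). rewrite Cmod_R in T. lra. }
exact (locally_singleton _ _ X).
Qed.

Section Identity.
Context {V : NormedModule C_AbsRing}.

Lemma line_continuous (x v : V) (t : C) : continuous (fun t : C => plus x (scal t v)) t.
Proof. apply @filterdiff_continuous. apply (cd_affine x v t). Qed.

Lemma hol_line (f : V -> C) (x v : V) (t : C) :
  hol f (plus x (scal t v)) -> hol (V := C_NormedModule) (fun t : C => f (plus x (scal t v))) t.
Proof.
intros H.
assert (K : locally t (fun t : C => cd f (plus x (scal t v)))) by exact (line_continuous x v t _ H).
unfold hol. generalize K. apply filter_imp. intros s Hs. apply (cd_line f x v s Hs).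
Qed.

Theorem identity_segment (f : V -> C) (x v : V) :
  (forall s : R, (0 <= s <= 1)%R -> hol f (plus x (scal (RtoC s) v))) ->
  locally x (fun y => f y = 0) -> f (plus x v) = 0.
Proof.
intros Hf H0.
assert (X := identity_01 (fun t : C => f (plus x (scal t v)))).
replace v with (scal (RtoC 1) v) by apply (scal_one v). apply X.
- intros s Hs. apply hol_line, Hf, Hs.
- assert (E : plus x (scal (RtoC 0) v) = x).
  { transitivity (plus x zero); [f_equal; exact (scal_zero_l v)|exact (plus_zero_r x)]. }
  assert (K := line_continuous x v (RtoC 0)). unfold continuous in K. cbv beta in K. rewrite E in K.
  exact (K _ H0).
Qed.

Definition convex (U : V -> Prop) : Prop :=
  forall x y (s : R), (0 <= s <= 1)%R -> U x -> U y -> U (plus x (scal (RtoC s) (minus y x))).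

Theorem identity_convex (U : V -> Prop) (f : V -> C) (x : V) : convex U -> open U ->
  (forall y, U y -> cd f y) -> U x -> locally x (fun y => f y = 0) -> forall y, U y -> f y = 0.
Proof.
intros Hc Ho Hf Hx H0 y Hy.
rewrite <- (plus_minus_cancel x y). apply identity_segment; [|exact H0].
intros s Hs. assert (L := Ho _ (Hc x y s Hs Hx Hy)). unfold hol. generalize L. apply filter_imp. exact Hf.
Qed.

End Identity.

(** Only z0 itself is in question. The estimate of f' to second order integrates to f(z0 + h) = l h
    + l2 h^2 / 2 + O(|h|^3), so the quotient has derivative l2 / 2 there, where l2 is the second
    derivative of f. *)
Lemma quotient_removable (f : C -> C) (z0 l : C) (rho : R) : (0 < rho)%R ->
  (forall z, Cmod (z - z0) < rho -> cd f z)%R -> f z0 = 0 -> cder f z0 l ->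
  forall q : C -> C, q z0 = l -> (forall z, z <> z0 -> q z = f z / (z - z0)) ->
  forall z, (Cmod (z - z0) < rho)%R -> cd q z.
Proof.
intros Hrho Hf f0 Hl q q0 Hq z Hz.
destruct (classic (z = z0)) as [E|E].
- subst z. destruct (cd_derivative f z0 rho Hf) as [f1 Hf1].
  assert (El : f1 z0 = l).
  { apply (cder_unique f z0); [|exact Hl]. apply Hf1. replace (z0 - z0) with (RtoC 0) by ring. now rewrite Cmod_0. }
  destruct (hol_bounded (V := C_NormedModule) f1 z0) as (d & M & H1).
  { apply locally_Cmod. exists (mkposreal _ Hrho). simpl. intros w Hw. now apply Hf1. }
  destruct (proj1 (cd_cder f1 z0)) as [l2 Hl2].
  { apply Hf1. replace (z0 - z0) with (RtoC 0) by ring. now rewrite Cmod_0. }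
  assert (D := cond_pos d).
  set (e := Rmin d rho).
  assert (Pe : (0 < e)%R) by (apply Rmin_case; lra).
  assert (QE : forall h, (Cmod h <= e / 4)%R -> (Cmod (f1 (z0 + h)%C - f1 z0 - l2 * h) <= 96 * M / (e * e) * (Cmod h * Cmod h))%R).
  { apply (quadratic_estimate f1 z0 l2 e M Pe).
    - intros w Hw. apply H1. eapply Rlt_le_trans; [exact Hw|apply Rmin_l].
    - intros w Hw. apply H1. eapply Rlt_le_trans; [exact Hw|apply Rmin_l].
    - exact Hl2. }
  set (K := (96 * M / (e * e))%R) in *.
  assert (K0 : (0 <= K)%R).
  { apply Rdiv_le_0_compat; [|nra]. destruct (H1 z0) as [_ Y].
    - change (Cmod (z0 - z0) < d)%R. replace (z0 - z0) with (RtoC 0) by ring. now rewrite Cmod_0.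
    - generalize (Cmod_ge_0 (f1 z0)). lra. }
  assert (CE : forall h, (Cmod h <= e / 4)%R -> (Cmod (f (z0 + h)%C - l * h - l2 / 2 * (h * h)) <= K * (Cmod h * Cmod h) * Cmod h)%R).
  { intros h Hh.
    assert (Y := mean_value_ineq (fun w => f w - l2 / 2 * ((w - z0) * (w - z0))) z0 h l (K * (Cmod h * Cmod h))).
    cbv beta in Y. rewrite f0 in Y.
    replace (f (z0 + h) - l2 / 2 * ((z0 + h - z0) * (z0 + h - z0)) - (0 - l2 / 2 * ((z0 - z0) * (z0 - z0))) - l * h)
      with (f (z0 + h) - l * h - l2 / 2 * (h * h)) in Y by ring.
    apply Y. intros s Hs. assert (nh := Cmod_ge_0 h).
    assert (Cs : (Cmod (RtoC s * h) <= Cmod h)%R) by (rewrite Cmod_mult, Cmod_R, Rabs_pos_eq by lra; nra).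
    set (k := RtoC s * h) in *.
    exists (f1 (z0 + k) - l2 * k). split.
    - apply cder_minus.
      + apply Hf1. replace (z0 + k - z0) with k by ring.
        eapply Rle_lt_trans; [exact Cs|]. assert (e <= rho)%R by apply Rmin_r. lra.
      + replace (l2 * k) with (l2 / 2 * (2 * k)) by field.
        apply (cder_scal (fun w => (w - z0) * (w - z0))).
        intros eps. apply locally_Cmod. exists eps. intros w Hw.
        replace ((w - z0) * (w - z0) - (z0 + k - z0) * (z0 + k - z0) - 2 * k * (w - (z0 + k)))
          with ((w - (z0 + k)) * (w - (z0 + k))) by ring.
        rewrite Cmod_mult. apply Rmult_le_compat_r; [apply Cmod_ge_0|lra].
    - rewrite <- El. replace (f1 (z0 + k) - l2 * k - f1 z0) with (f1 (z0 + k) - f1 z0 - l2 * k) by ring.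
      eapply Rle_trans; [apply QE; lra|]. apply Rmult_le_compat_l; [exact K0|].
      apply Rmult_le_compat; try apply Cmod_ge_0; exact Cs. }
  apply (cder_cd _ _ (l2 / 2)). intros eps.
  assert (P : (0 < Rmin (e / 4) (eps / (K + 1)))%R).
  { apply Rmin_case; [lra|]. apply Rdiv_lt_0_compat; [apply cond_pos|lra]. }
  apply locally_Cmod. exists (mkposreal _ P). simpl. intros w Hw.
  assert (W1 := Rlt_le_trans _ _ _ Hw (Rmin_l _ _)).
  assert (W2 := Rlt_le_trans _ _ _ Hw (Rmin_r _ _)).
  destruct (classic (w = z0)) as [Ew|Ew].
  { subst w. replace (q z0 - q z0 - l2 / 2 * (z0 - z0)) with (RtoC 0) by ring.
    rewrite Cmod_0. apply Rmult_le_pos; [left; apply cond_pos|apply Cmod_ge_0]. }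
  assert (w0 : w - z0 <> 0). { intros Y. apply Ew. replace w with (w - z0 + z0) by ring. rewrite Y; ring. }
  assert (w1 := proj1 (Cmod_gt_0 _) w0).
  rewrite Hq, q0 by exact Ew.
  assert (Y := CE (w - z0) ltac:(lra)). replace (z0 + (w - z0)) with w in Y by ring.
  replace (f w / (w - z0) - l - l2 / 2 * (w - z0)) with
    ((f w - l * (w - z0) - l2 / 2 * ((w - z0) * (w - z0))) / (w - z0)) by (field; exact w0).
  rewrite Cmod_div by exact w0. apply (Rmult_le_reg_r (Cmod (w - z0))); [exact w1|].
  unfold Rdiv. rewrite Rmult_assoc, Rinv_l, Rmult_1_r by lra.
  eapply Rle_trans; [exact Y|].
  apply (Rmult_lt_compat_r (K + 1)) in W2; [|lra].
  unfold Rdiv in W2. rewrite Rmult_assoc, Rinv_l, Rmult_1_r in W2 by lra.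
  assert (K * Cmod (w - z0) <= eps)%R by nra.
  apply Rle_trans with (K * Cmod (w - z0) * Cmod (w - z0) * Cmod (w - z0))%R; [right; ring|].
  apply Rmult_le_compat_r; [lra|]. apply Rmult_le_compat_r; lra.
- assert (z1 : z - z0 <> 0). { intros Y. apply E. replace z with (z - z0 + z0) by ring. rewrite Y; ring. }
  apply (cd_ext_locally (V := C_NormedModule) (fun w => f w / (w - z0))).
  + apply locally_Cmod. exists (mkposreal _ (proj1 (Cmod_gt_0 _) z1)). simpl. intros w Hw.
    symmetry. apply Hq. intros Y. subst w. rewrite <- Cmod_opp in Hw. replace (- (z0 - z)) with (z - z0) in Hw by ring. lra.
  + apply (cd_div (V := C_NormedModule)); [now apply Hf| |exact z1].
    apply (cd_minus (V := C_NormedModule) (fun w => w) (fun _ => z0)); [apply cd_idC|apply (cd_const (V := C_NormedModule))].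
Qed.

(** * Inverses, quotients and division by an affine form *)

Section Division.
Context {V : NormedModule C_AbsRing}.

Lemma hol_minus (f g : V -> C) x : hol f x -> hol g x -> hol (fun y => f y - g y) x.
Proof.
intros A B. unfold hol in *. generalize (filter_and _ _ A B). apply filter_imp.
intros y [H K]. now apply cd_minus.
Qed.

Lemma hol_mult (f g : V -> C) x : hol f x -> hol g x -> hol (fun y => f y * g y) x.
Proof.
intros A B. unfold hol in *. generalize (filter_and _ _ A B). apply filter_imp.
intros y [H K]. now apply cd_mult.
Qed.

Lemma cd_neq_0 (f : V -> C) x : cd f x -> f x <> 0 -> locally x (fun y => f y <> 0).
Proof.
intros Hf H0. assert (P := proj1 (Cmod_gt_0 _) H0).
assert (K := continuous_C_eps_inv f x (cd_continuous f x Hf) (mkposreal _ P)).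
generalize K. apply filter_imp. simpl. intros y Hy E. rewrite E in Hy.
replace (0 - f x) with (- f x) in Hy by ring. rewrite Cmod_opp in Hy. lra.
Qed.

Lemma hol_inv (f : V -> C) x : hol f x -> f x <> 0 -> hol (fun y => / f y) x.
Proof.
intros A B. assert (N := cd_neq_0 f x (hol_cd f x A) B).
unfold hol in *. generalize (filter_and _ _ A N). apply filter_imp.
intros y [H K]. now apply cd_inv.
Qed.

Lemma hol_div (f g : V -> C) x : hol f x -> hol g x -> g x <> 0 -> hol (fun y => f y / g y) x.
Proof. intros. apply hol_mult; [|apply hol_inv]; auto. Qed.

Lemma hol_all (f : V -> C) x : (forall y, cd f y) -> hol f x.
Proof. intros H. unfold hol. apply filter_forall. exact H. Qed.

(** The quotient is defined as the mean of F / lam over a circle in the direction [v], which is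
    holomorphic because [lam] does not vanish on the circle. On the line through x the only zero of
    [lam] is at the parameter - lam x, where F vanishes too; the singularity is removable and the
    mean equals F x / lam x when lam x <> 0. *)
Lemma division (F lam : V -> C) (v p : V) : transverse lam v -> (forall x, cd lam x) ->
  hol F p -> lam p = 0 -> locally p (fun x => lam x = 0 -> F x = 0) ->
  exists Q, hol Q p /\ locally p (fun x => F x = lam x * Q x).
Proof.
intros Ht Hl HF Hp H0. unfold hol in HF.
destruct (proj1 (locally_norm_ball _ _) (filter_and _ _ HF H0)) as [d Hd].
assert (D := cond_pos d). assert (nv := norm_ge_0 v).
(* The disc of radius 2 r about - lam x lies within 5 r / 2 of 0; times the norm of [v] this is
   below d / 2, so the line stays where [F] is under control. *)
set (r := (d / (8 * (norm v + 1)))%R).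
assert (Pr : (0 < r)%R) by (unfold r; apply Rdiv_lt_0_compat; lra).
assert (Er : (r * (8 * (norm v + 1)) = d)%R) by (unfold r; field; lra).
set (k := fun y => F y / lam y).
exists (fun x => Cmean (fun z => k (plus x (scal z v))) r).
assert (shn : forall x z, (norm (minus (plus x (scal z v)) p) <= norm (minus x p) + Cmod z * norm v)%R).
{ intros x z. eapply Rle_trans; [apply (norm_minus_triangle _ x)|].
  rewrite Rplus_comm. apply Rplus_le_compat_l. right.
  rewrite <- norm_scal_C. f_equal. exact (minus_plus_cancel x (scal z v)). }
split.
- apply circle_mean_hol; [lra|]. intros t.
  apply hol_div.
  + apply locally_norm_ball. assert (P : (0 < d / 2)%R) by lra. exists (mkposreal _ P). simpl. intros y Hy.
    apply Hd. eapply Rle_lt_trans; [apply (norm_minus_triangle _ (plus p (scal (circ r t) v)))|].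
    apply Rlt_le_trans with (d / 2 + d / 2)%R; [|lra]. apply Rplus_lt_le_compat; [exact Hy|].
    eapply Rle_trans; [apply shn|].
    apply Rle_trans with (0 + Cmod (circ r t) * norm v)%R; [apply Rplus_le_compat_r; right; exact (norm_minus_self p)|].
    rewrite Cmod_circ by lra. nra.
  + now apply hol_all.
  + rewrite Ht, Hp, Cplus_0_l. apply Cmod_gt_0. rewrite Cmod_circ; lra.
- assert (L1 : locally p (fun x => (Cmod (lam x - lam p) < r / 2)%R)).
  { assert (P : (0 < r / 2)%R) by lra.
    exact (continuous_C_eps_inv lam p (cd_continuous lam p (Hl p)) (mkposreal _ P)). }
  assert (L2 : locally p (fun x => (norm (minus x p) < d / 2)%R)).
  { apply locally_norm_ball. assert (P : (0 < d / 2)%R) by lra. now exists (mkposreal _ P). }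
  generalize (filter_and _ _ L1 L2). apply filter_imp. intros x [A B]. cbv beta.
  rewrite Hp in A. replace (lam x - 0) with (lam x) in A by ring.
  assert (z0 : plus x (scal (RtoC 0) v) = x).
  { transitivity (plus x zero); [f_equal; exact (scal_zero_l v)|exact (plus_zero_r x)]. }
  destruct (classic (lam x = 0)) as [E|E].
  { destruct (Hd x) as [_ K]; [eapply Rlt_trans; [exact B|lra]|]. rewrite K, E by exact E. ring. }
  set (tau := - lam x).
  assert (Ctau : Cmod tau = Cmod (lam x)) by apply Cmod_opp.
  assert (In : forall z, (Cmod (z - tau) < 2 * r)%R -> (norm (minus (plus x (scal z v)) p) < d)%R).
  { intros z Hz. eapply Rle_lt_trans; [apply shn|].
    assert (Cz : (Cmod z <= 5 / 2 * r)%R).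
    { replace z with (z - tau + tau) by ring. eapply Rle_trans; [apply Cmod_triangle|]. lra. }
    apply Rlt_le_trans with (d / 2 + d / 2)%R; [|lra]. apply Rplus_lt_le_compat; [exact B|]. nra. }
  set (f := fun z : C => F (plus x (scal z v))).
  assert (cf : forall z, (Cmod (z - tau) < 2 * r)%R -> cd f z).
  { intros z Hz. apply cd_line. apply Hd. now apply In. }
  assert (tt : (Cmod (tau - tau) < 2 * r)%R) by (replace (tau - tau) with (RtoC 0) by ring; rewrite Cmod_0; lra).
  assert (f0 : f tau = 0).
  { unfold f. destruct (Hd _ (In tau tt)) as [_ K]. apply K. rewrite Ht. unfold tau. ring. }
  destruct (proj1 (cd_cder f tau) (cf tau tt)) as [l Hlf].
  set (q := fun z => if excluded_middle_informative (z = tau) then l else f z / (z - tau)).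
  assert (q1 : q tau = l) by (unfold q; destruct (excluded_middle_informative _); [reflexivity|tauto]).
  assert (q2 : forall z, z <> tau -> q z = f z / (z - tau)).
  { intros z Hz. unfold q; destruct (excluded_middle_informative _); [tauto|reflexivity]. }
  assert (cq := quotient_removable f tau l (2 * r) ltac:(lra) cf f0 Hlf q q1 q2).
  assert (M := mean_value q (3 / 2 * r) r ltac:(lra)).
  assert (M' : Cmean q r = q 0).
  { apply M. intros z Hz. apply cq. unfold Cminus. eapply Rle_lt_trans; [apply Cmod_triangle|].
    rewrite Cmod_opp. lra. }
  assert (tau0 : RtoC 0 <> tau). { intros Y. apply E. unfold tau in Y. replace (lam x) with (- - lam x) by ring. rewrite <- Y. ring. }
  rewrite q2 in M' by exact tau0. unfold f in M' at 1. rewrite z0 in M'.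
  transitivity (lam x * Cmean q r); [|f_equal].
  + rewrite M'. unfold tau. field. intros Y. apply E. rewrite <- Y. ring.
  + unfold Cmean. f_equal. apply CInt_ext. intros t _.
    assert (Hc : Cmod (circ r t) = r) by (apply Cmod_circ; lra).
    rewrite q2.
    * unfold f, k. rewrite Ht. unfold tau. f_equal. ring.
    * intros Y. rewrite Y in Hc. lra.
Qed.

End Division.

(** * Meromorphic functions *)

Section Meromorphic.
Context {V : NormedModule C_AbsRing}.
(** Balls are those of the uniform structure, whose axioms imply neither openness nor convexity. For
    [V3] they are products of squares and both properties are verified there. *)
Hypothesis ball_open : forall (p : V) (eps : posreal), open (ball p eps).
Hypothesis ball_convex : forall (p : V) (eps : posreal), convex (ball p eps).

Lemma ball_in_ball (p : V) (eps : posreal) q : ball p eps q ->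
  exists d : posreal, forall y, ball q d y -> ball p eps y.
Proof. intros H. exact (ball_open p eps q H). Qed.

Lemma not_locally_zero (p : V) (eps : posreal) (h : V -> C) x : nonzero_holomorphic_on_ball p eps h -> ball p eps x ->
  ~ locally x (fun y => h y = 0).
Proof.
intros [H1 [y [Hy H2]]] Hx L. apply H2.
apply (identity_convex (ball p eps) h x); auto.
Qed.

(** By the identity theorem on the convex ball, a holomorphic function that vanishes near one point
    vanishes throughout; so thin sets have dense complement. *)
Lemma nonzero_dense (p : V) (eps : posreal) (h : V -> C) x (Q : V -> Prop) : nonzero_holomorphic_on_ball p eps h -> ball p eps x ->
  locally x Q -> exists y, Q y /\ ball p eps y /\ h y <> 0.
Proof.
intros H Hx L. apply NNPP. intros N. apply (not_locally_zero p eps h x H Hx).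
generalize (filter_and _ _ L (ball_open p eps x Hx)). apply filter_imp. intros y [A B].
apply NNPP. intros E. apply N. now exists y.
Qed.

Lemma nonzero_mult (p : V) (eps : posreal) (h1 h2 : V -> C) : nonzero_holomorphic_on_ball p eps h1 ->
  nonzero_holomorphic_on_ball p eps h2 -> nonzero_holomorphic_on_ball p eps (fun x => h1 x * h2 x).
Proof.
intros H1 H2. split.
- intros x Hx. apply cd_mult; [now apply H1|now apply H2].
- destruct H1 as [A [x [Hx Nx]]].
  destruct (nonzero_dense p eps h2 x (fun y => h1 y <> 0) H2 Hx) as (y & Hy1 & Hy2 & Hy3).
  + apply cd_neq_0; [now apply A|exact Nx].
  + exists y. split; [exact Hy2|]. now apply Cmult_neq_0.
Qed.

Lemma nonzero_sub (p : V) (eps : posreal) (h : V -> C) (q : V) (d : posreal) : (forall y, ball q d y -> ball p eps y) ->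
  nonzero_holomorphic_on_ball p eps h -> nonzero_holomorphic_on_ball q d h.
Proof.
intros S H. split.
- intros x Hx. apply H, S, Hx.
- destruct (nonzero_dense p eps h q (ball q d) H) as (y & A & B & D).
  + apply S, ball_center.
  + now exists d.
  + now exists y.
Qed.

Lemma eq_off_thin (p : V) (eps : posreal) (h f g : V -> C) : nonzero_holomorphic_on_ball p eps h ->
  holomorphic_on (ball p eps) f -> holomorphic_on (ball p eps) g ->
  (forall x, ball p eps x -> h x <> 0 -> f x = g x) -> forall x, ball p eps x -> f x = g x.
Proof.
intros H Hf Hg E x Hx. apply NNPP. intros N.
assert (L := cd_neq_0 (fun y => f y - g y) x (cd_minus f g x (Hf x Hx) (Hg x Hx))).
destruct (nonzero_dense p eps h x (fun y => f y - g y <> 0) H Hx) as (y & A & B & D).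
- apply L. intros Y. apply N. replace (f x) with (f x - g x + g x) by ring. rewrite Y; ring.
- apply A. rewrite (E y B D). ring.
Qed.

(* [T P = F] as meromorphic functions near [q]. *)
Definition agree (T P F : V -> C) (q : V) : Prop :=
  exists (eps : posreal) (h : V -> C), nonzero_holomorphic_on_ball q eps h /\
    forall x, ball q eps x -> h x <> 0 -> T x * P x = F x.

Lemma agree_here T P F q : locally q (fun x => T x * P x = F x) -> agree T P F q.
Proof.
intros [d Hd]. exists d, (fun _ => 1). split; [split|].
- intros x _. apply cd_const.
- exists q. split; [apply ball_center|]. apply C1_nz.
- intros x Hx _. now apply Hd.
Qed.

(** The identity theorem for meromorphic functions. Near a point of the segment T = g / h1 off a
    thin set, and there the claim is equivalent to g P - F h1 = 0, a holomorphic equation on a ball;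
    it holds on the whole ball as soon as it holds near one of its points. *)
Theorem agree_segment (T P F : V -> C) (x v : V) : meromorphic T ->
  (forall s : R, (0 <= s <= 1)%R -> hol F (plus x (scal (RtoC s) v)) /\ hol P (plus x (scal (RtoC s) v))) ->
  agree T P F x -> agree T P F (plus x v).
Proof.
intros HT HFP H0.
set (gam := fun s : R => plus x (scal (RtoC s) v)).
replace (plus x v) with (gam 1%R) by (unfold gam; f_equal; exact (scal_one v)).
apply (seg_connected (fun s => agree T P F (gam s))).
{ replace (gam 0%R) with x; [exact H0|]. unfold gam. symmetry.
  transitivity (plus x zero); [f_equal; exact (scal_zero_l v)|exact (plus_zero_r x)]. }
intros s Hs. destruct (HFP s Hs) as [HF HP]. fold (gam s) in HF, HP.
destruct (HT (gam s)) as (e1 & g & h1 & Hg & Hh1 & [h2 [Hh2 HE]]).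
destruct (filter_and _ _ HF HP) as [e2 He2].
assert (Pe : (0 < Rmin e1 e2)%R) by (apply Rmin_case; apply cond_pos).
set (e := mkposreal _ Pe).
assert (S1 : forall y, ball (gam s) e y -> ball (gam s) e1 y) by (intros y; apply ball_le, Rmin_l).
assert (S2 : forall y, ball (gam s) e y -> ball (gam s) e2 y) by (intros y; apply ball_le, Rmin_r).
assert (N1 := nonzero_sub _ _ _ _ e S1 Hh1). assert (N2 := nonzero_sub _ _ _ _ e S1 Hh2).
assert (N := nonzero_mult _ _ _ _ N1 N2).
assert (TE : forall y, ball (gam s) e y -> h1 y * h2 y <> 0 -> T y * h1 y = g y /\ h1 y <> 0).
{ intros y Hy Hn. assert (A : h1 y <> 0) by (intros Q; apply Hn; rewrite Q; ring).
  assert (B : h2 y <> 0) by (intros Q; apply Hn; rewrite Q; ring).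
  split; [|exact A]. rewrite (HE y (S1 y Hy) B). field. exact A. }
assert (Hk : forall y, ball (gam s) e y -> cd (fun y => g y * P y - F y * h1 y) y).
{ intros y Hy. destruct (He2 y (S2 y Hy)) as [B1 B2].
  apply cd_minus; apply cd_mult; first [exact B1 | exact B2 | exact (Hg y (S1 y Hy)) | exact (proj1 N1 y Hy)]. }
assert (GC : continuous gam s).
{ apply (continuous_comp RtoC (fun t : C => plus x (scal t v))); [|apply line_continuous].
  apply (ccont_RtoC (fun s => s)), continuous_id. }
assert (GL : locally s (fun s' => ball (gam s) e (gam s'))).
{ apply GC. now exists e. }
destruct GL as [d Hd]. exists d. intros s' s'' _ _ A B [e3 [h3 [Hh3 E3]]].
assert (B1 := Hd s' A). assert (B2 := Hd s'' B).
destruct (ball_in_ball _ _ _ B1) as [d1 Hd1]. destruct (ball_in_ball _ _ _ B2) as [d2 Hd2].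
assert (K0 : forall y, ball (gam s) e y -> g y * P y - F y * h1 y = 0).
{ apply (identity_convex (ball (gam s) e) _ (gam s')); auto.
  assert (Pe4 : (0 < Rmin d1 e3)%R) by (apply Rmin_case; apply cond_pos).
  set (e4 := mkposreal _ Pe4). exists e4.
  assert (S4 : forall y, ball (gam s') e4 y -> ball (gam s) e y).
  { intros y Hy. apply Hd1. revert Hy. apply ball_le, Rmin_l. }
  assert (S5 : forall y, ball (gam s') e4 y -> ball (gam s') e3 y) by (intros y; apply ball_le, Rmin_r).
  assert (N4 := nonzero_mult _ _ _ _ (nonzero_sub _ _ _ _ e4 S4 N) (nonzero_sub _ _ _ _ e4 S5 Hh3)).
  apply (eq_off_thin (gam s') e4 _ _ (fun _ => 0) N4).
  - intros y Hy. apply Hk, S4, Hy.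
  - intros y _. apply cd_const.
  - intros y Hy Hn.
    assert (Q1 : h1 y * h2 y <> 0) by (intros Q; apply Hn; rewrite Q; ring).
    assert (Q2 : h3 y <> 0) by (intros Q; apply Hn; rewrite Q; ring).
    destruct (TE y (S4 y Hy) Q1) as [T1 _]. rewrite <- T1, <- (E3 y (S5 y Hy) Q2). ring. }
exists d2, (fun y => h1 y * h2 y). split; [now apply (nonzero_sub _ _ _ _ d2 Hd2)|].
intros y Hy Hn. destruct (TE y (Hd2 y Hy) Hn) as [T1 T2].
assert (K1 := K0 y (Hd2 y Hy)).
assert (K2 : (T y * P y - F y) * h1 y = 0) by (rewrite <- K1, <- T1; ring).
destruct (classic (T y * P y - F y = 0)) as [Z|Z].
- replace (T y * P y) with (T y * P y - F y + F y) by ring. rewrite Z; ring.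
- exfalso. revert K2. now apply Cmult_neq_0.
Qed.

Lemma agree_ball T P F p : agree T P F p -> hol F p -> hol P p -> forall Q : V -> Prop, locally p Q ->
  exists (eps : posreal) (h : V -> C), nonzero_holomorphic_on_ball p eps h /\
    (forall x, ball p eps x -> h x <> 0 -> T x * P x = F x) /\
    (forall x, ball p eps x -> cd F x /\ cd P x /\ Q x).
Proof.
intros (e1 & h & Hh & E) HF HP Q HQ.
destruct (filter_and _ _ HF (filter_and _ _ HP HQ)) as [e2 He2].
assert (Pe : (0 < Rmin e1 e2)%R) by (apply Rmin_case; apply cond_pos).
exists (mkposreal _ Pe), h. split; [|split].
- apply (nonzero_sub p e1); [|exact Hh]. intros y. apply ball_le, Rmin_l.
- intros x Hx. apply E. revert Hx. apply ball_le, Rmin_l.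
- intros x Hx. apply He2. revert Hx. apply ball_le, Rmin_r.
Qed.

Lemma agree_regular T P F p : agree T P F p -> hol F p -> hol P p -> P p <> 0 -> regular_at T p.
Proof.
intros HA HF HP H0.
destruct (agree_ball T P F p HA HF HP (fun x => P x <> 0)) as (e & h & Hh & E & Hc).
{ apply cd_neq_0; [now apply hol_cd|exact H0]. }
exists e, (fun x => F x / P x). split.
- intros x Hx. destruct (Hc x Hx) as (A & B & D). now apply cd_div.
- exists h. split; [exact Hh|]. intros x Hx Hn. destruct (Hc x Hx) as (A & B & D).
  rewrite <- (E x Hx Hn). field. exact D.
Qed.

Lemma agree_pole T lam Q F p : agree T (fun x => lam x * Q x) F p ->
  hol F p -> hol lam p -> hol Q p -> Q p <> 0 -> F p <> 0 -> ~ locally p (fun x => lam x = 0) -> pole_order_at T lam p 1.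
Proof.
intros HA HF Hl HQ Q0 F0 Nl.
destruct (agree_ball T _ F p HA HF (hol_mult _ _ _ Hl HQ) (fun x => Q x <> 0 /\ cd lam x /\ cd Q x)) as (e & h & Hh & E & Hc).
{ apply filter_and; [apply cd_neq_0; [now apply hol_cd|exact Q0]|]. apply filter_and; [exact Hl|exact HQ]. }
exists e, (fun x => F x / Q x). split; [|split].
- intros x Hx. destruct (Hc x Hx) as (A & B & D & D2 & D3). now apply cd_div.
- intros Y. apply F0. replace (F p) with (F p / Q p * Q p) by (field; exact Q0). rewrite Y. ring.
- exists (fun x => h x * lam x). split.
  + apply nonzero_mult; [exact Hh|]. split.
    * intros x Hx. now apply (Hc x Hx).
    * apply NNPP. intros N. apply Nl. exists e. intros y Hy. apply NNPP. intros Y. apply N. now exists y.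
  + intros x Hx Hn. assert (A : h x <> 0) by (intros Y; apply Hn; rewrite Y; ring).
    assert (B : lam x <> 0) by (intros Y; apply Hn; rewrite Y; ring).
    destruct (Hc x Hx) as (_ & _ & D & _). rewrite <- (E x Hx A). simpl. field. now split.
Qed.

(** If T were equal to a holomorphic f, then F = f lam Q off a thin set, hence everywhere, and F
    would vanish at p together with [lam]. *)
Lemma agree_polar T lam Q F p : agree T (fun x => lam x * Q x) F p ->
  hol F p -> hol lam p -> hol Q p -> lam p = 0 -> F p <> 0 -> polar_set T p.
Proof.
intros HA HF Hl HQ l0 F0 (e1 & f & Hf & [h1 [Hh1 E1]]).
destruct (agree_ball T _ F p HA HF (hol_mult _ _ _ Hl HQ) (ball p e1)) as (e & h & Hh & E & Hc).
{ now exists e1. }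
assert (S : forall y, ball p e y -> ball p e1 y) by (intros y Hy; now apply Hc).
apply F0.
assert (K := eq_off_thin p e (fun x => h x * h1 x) F (fun x => f x * (lam x * Q x))).
rewrite K, l0; [ring| | | | |apply ball_center].
- apply nonzero_mult; [exact Hh|]. now apply (nonzero_sub p e1).
- intros x Hx. now apply Hc.
- intros x Hx. apply (cd_mult f (fun x => lam x * Q x)); [now apply Hf, S|now apply (Hc x Hx)].
- intros x Hx Hn. assert (A : h x <> 0) by (intros Y; apply Hn; rewrite Y; ring).
  assert (B : h1 x <> 0) by (intros Y; apply Hn; rewrite Y; ring).
  rewrite <- (E x Hx A), (E1 x (S x Hx) B). ring.
Qed.

(** With phi = F / Q and [pi] the projection along [v] onto the hyperplane, phi - phi o pi vanishes
    on the hyperplane and is divisible by [lam]. Thus T = G + (phi o pi) / lam with a single Laurent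
    coefficient, and [pi] fixes p. *)
Lemma agree_residue T lam Q F p : agree T (fun x => lam x * Q x) F p ->
  hol F p -> (forall x, cd lam x) -> hol Q p -> Q p <> 0 -> lam p = 0 -> residue_at T lam p (F p / Q p).
Proof.
intros HA HF Hl HQ Q0 l0 v Hv.
set (phi := fun x => F x / Q x).
assert (Hphi : hol phi p) by now apply hol_div.
set (pi := fun x => plus x (scal (- lam x) v)).
set (c0 := fun x => phi (pi x)).
assert (pip : pi p = p).
{ unfold pi. rewrite l0. replace (- (0)) with (RtoC 0) by ring.
  transitivity (plus p zero); [f_equal; exact (scal_zero_l v)|exact (plus_zero_r p)]. }
assert (dpi : forall x, @ex_filterdiff C_AbsRing V V pi (locally x)).
{ intros x. apply (ex_filterdiff_plus_fct (fun x => x) (fun x => scal (- lam x) v)).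
  - apply ex_filterdiff_id.
  - apply (ex_filterdiff_comp' (V := C_NormedModule) (fun x => - lam x) (fun t : C => scal t v)).
    + apply cd_opp, Hl.
    + apply ex_filterdiff_linear, is_linear_line. }
assert (Hc0 : hol c0 p).
{ assert (K : locally p (fun x => cd phi (pi x))).
  { assert (CP : continuous pi p) by (apply @filterdiff_continuous; apply dpi).
    apply (CP (fun y => cd phi y)). rewrite pip. exact Hphi. }
  unfold hol. generalize K. apply filter_imp. intros x Hx.
  apply (ex_filterdiff_comp' (U := V) (V := V) (W := C_NormedModule) pi phi x); [apply dpi|exact Hx]. }
assert (piv : forall x t, pi (plus x (scal t v)) = pi x).
{ intros x t. unfold pi. rewrite Hv.
  transitivity (plus x (plus (scal t v) (scal (- (lam x + t)) v))); [symmetry; apply plus_assoc|].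
  f_equal. transitivity (scal (t + - (lam x + t)) v); [symmetry; exact (scal_distr_r t (- (lam x + t)) v)|].
  f_equal. ring. }
destruct (division (fun x => phi x - c0 x) lam v p Hv Hl) as [G [HG EG]].
{ now apply hol_minus. }
{ exact l0. }
{ apply filter_forall. intros x Hx. unfold c0, pi. rewrite Hx.
  replace (plus x (scal (- (0)) v)) with x; [ring|]. symmetry.
  replace (- (0)) with (RtoC 0) by ring.
  transitivity (plus x zero); [f_equal; exact (scal_zero_l v)|exact (plus_zero_r x)]. }
assert (Nl : forall e : posreal, nonzero_holomorphic_on_ball p e lam).
{ intros e. split; [intros x _; apply Hl|].
  assert (L := line_continuous p v (RtoC 0) (ball p e)). cbv beta in L.
  replace (plus p (scal (RtoC 0) v)) with p in L.
  2: { symmetry. transitivity (plus p zero); [f_equal; exact (scal_zero_l v)|exact (plus_zero_r p)]. }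
  destruct (proj1 (locally_Cmod _ _) (L ltac:(now exists e))) as [d Hd].
  assert (D := cond_pos d).
  exists (plus p (scal (RtoC (d / 2)) v)). split.
  - apply Hd. replace (RtoC (d / 2) - 0) with (RtoC (d / 2)) by ring. rewrite Cmod_R, Rabs_pos_eq; lra.
  - rewrite Hv, l0, Cplus_0_l. intros Y. apply RtoC_inj in Y. lra. }
unfold hol in *.
destruct (agree_ball T _ F p HA HF (hol_mult _ _ _ (hol_all lam p Hl) HQ)
  (fun x => Q x <> 0 /\ phi x - c0 x = lam x * G x /\ cd c0 x /\ cd G x)) as (e & h & Hh & E & Hc).
{ apply filter_and; [apply cd_neq_0; [now apply hol_cd|exact Q0]|]. apply filter_and; [exact EG|]. now apply filter_and. }
exists e, O, (fun k => match k with O => c0 | S _ => fun _ => 0 end), G. split; [|split; [|split; [|split]]].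
- intros [|k] x Hx; [now apply (Hc x Hx)|apply cd_const].
- intros [|k] x t _ _; [|reflexivity]. unfold c0. now rewrite piv.
- intros x Hx. now apply (Hc x Hx).
- exists (fun x => h x * lam x). split; [now apply nonzero_mult|].
  intros x Hx Hn. assert (A : h x <> 0) by (intros Y; apply Hn; rewrite Y; ring).
  assert (B : lam x <> 0) by (intros Y; apply Hn; rewrite Y; ring).
  destruct (Hc x Hx) as (_ & _ & D1 & D2 & _ & _).
  rewrite sum_O. assert (E' := E x Hx A).
  replace (G x) with ((phi x - c0 x) / lam x) by (rewrite D2; field; exact B).
  unfold phi. rewrite <- E'. simpl. field. now split.
- unfold c0. rewrite pip. reflexivity.
Qed.

End Meromorphic.

(** * Analytic sets and their components *)

Section Analytic.
Context {V : NormedModule C_AbsRing}.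
Hypothesis ball_open : forall (p : V) (eps : posreal), open (ball p eps).

Lemma line_0 (x v : V) : plus x (scal (RtoC 0) v) = x.
Proof. transitivity (plus x zero); [f_equal; exact (scal_zero_l v)|exact (plus_zero_r x)]. Qed.

Lemma line_1 (x v : V) : plus x (scal (RtoC 1) v) = plus x v.
Proof. f_equal. exact (scal_one v). Qed.

Lemma analytic_zero_set (f : V -> C) : (forall x, cd f x) -> analytic_set (fun x => f x = 0).
Proof.
intros H p. exists (mkposreal 1 Rlt_0_1), 1%nat, (fun _ => f). split.
- intros _ _ x _. apply H.
- intros x _. split; [intros E k _; exact E|]. intros K. exact (K O Nat.lt_0_1).
Qed.

Lemma analytic_inter (A1 A2 : V -> Prop) : analytic_set A1 -> analytic_set A2 ->
  analytic_set (fun x => A1 x /\ A2 x).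
Proof.
intros H1 H2 p. destruct (H1 p) as (e1 & N1 & f1 & F1 & E1). destruct (H2 p) as (e2 & N2 & f2 & F2 & E2).
assert (Pe : (0 < Rmin e1 e2)%R) by (apply Rmin_case; apply cond_pos).
assert (S1 : forall y, ball p (mkposreal _ Pe) y -> ball p e1 y) by (intros y; apply ball_le, Rmin_l).
assert (S2 : forall y, ball p (mkposreal _ Pe) y -> ball p e2 y) by (intros y; apply ball_le, Rmin_r).
exists (mkposreal _ Pe), (N1 + N2)%nat, (fun k => if Nat.ltb k N1 then f1 k else f2 (k - N1)%nat). split.
- intros k Hk x Hx. destruct (Nat.ltb k N1) eqn:L.
  + apply Nat.ltb_lt in L. apply (F1 k L). now apply S1.
  + apply Nat.ltb_ge in L. apply (F2 (k - N1)%nat ltac:(lia)). now apply S2.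
- intros x Hx. rewrite (E1 x (S1 x Hx)), (E2 x (S2 x Hx)). split.
  + intros [K1 K2] k Hk. destruct (Nat.ltb k N1) eqn:L.
    * apply Nat.ltb_lt in L. now apply K1.
    * apply Nat.ltb_ge in L. apply K2. lia.
  + intros K. split; intros k Hk.
    * specialize (K k ltac:(lia)). apply Nat.ltb_lt in Hk. now rewrite Hk in K.
    * specialize (K (N1 + k)%nat ltac:(lia)). replace (Nat.ltb (N1 + k) N1) with false in K.
      -- now replace (N1 + k - N1)%nat with k in K by lia.
      -- symmetry. apply Nat.ltb_ge. lia.
Qed.

Lemma analytic_closed (A : V -> Prop) x : analytic_set A -> ~ A x -> locally x (fun y => ~ A y).
Proof.
intros H Hx. destruct (H x) as (e & N & f & F & E).
assert (K : exists k, (k < N)%nat /\ f k x <> 0).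
{ apply NNPP. intros Q. apply Hx. apply E; [apply ball_center|]. intros k Hk.
  apply NNPP. intros Y. apply Q. now exists k. }
destruct K as (k & Hk & Fk).
assert (L := cd_neq_0 (f k) x (F k Hk x (ball_center x e)) Fk).
assert (L2 : locally x (ball x e)) by (now exists e).
generalize (filter_and _ _ L L2). apply filter_imp. intros y [A1 A2] A3. apply A1.
now apply (E y A2).
Qed.

(** On a complex line the local equations become one-variable holomorphic functions, so an analytic
    set that contains a neighbourhood of one parameter contains the line all along the segment. *)
Lemma analytic_line (A : V -> Prop) (x v : V) : analytic_set A -> ~ A (plus x v) ->
  ~ locally (RtoC 0) (fun t : C => A (plus x (scal t v))).
Proof.
intros H Hv H0. apply Hv. rewrite <- line_1.
assert (X : locally (RtoC 1) (fun t : C => A (plus x (scal t v)))).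
2: exact (locally_singleton _ _ X).
apply (seg_connected (fun s => locally (RtoC s) (fun t : C => A (plus x (scal t v))))); [exact H0|].
intros s Hs. destruct (H (plus x (scal (RtoC s) v))) as (e & N & f & F & E).
assert (L : locally (RtoC s) (fun t : C => ball (plus x (scal (RtoC s) v)) e (plus x (scal t v)))).
{ assert (LL := line_continuous x v (RtoC s) (ball (plus x (scal (RtoC s) v)) e)). apply LL. now exists e. }
destruct (proj1 (locally_Cmod _ _) L) as [d Hd].
exists d. intros s' s'' _ _ A1 A2 K.
apply locally_Cmod. assert (Pd : (0 < d - Rabs (s'' - s))%R) by lra.
exists (mkposreal _ Pd). simpl. intros w Hw.
assert (Dw : (Cmod (w - RtoC s) < d)%R).
{ replace (w - RtoC s) with (w - RtoC s'' + RtoC (s'' - s)) by (rewrite RtoC_minus; ring).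
  eapply Rle_lt_trans; [apply Cmod_triangle|]. rewrite Cmod_R. lra. }
apply E; [now apply Hd|]. intros k Hk.
assert (Ds : (Cmod (RtoC s' - RtoC s) < d)%R) by (rewrite <- RtoC_minus, Cmod_R; exact A1).
apply (identity_convex (V := C_NormedModule) (fun t : C => (Cmod (t - RtoC s) < d)%R)
   (fun t : C => f k (plus x (scal t v))) (RtoC s')).
- intros a b u Hu Ha Hb.
  change (Cmod (a + RtoC u * (b - a) - RtoC s) < d)%R.
  replace (a + RtoC u * (b - a) - RtoC s) with (RtoC (1 - u) * (a - RtoC s) + RtoC u * (b - RtoC s))
    by (rewrite RtoC_minus; ring).
  eapply Rle_lt_trans; [apply Cmod_triangle|]. rewrite !Cmod_mult, !Cmod_R, !Rabs_pos_eq by lra.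
  destruct (Req_dec u 0) as [->|Hu0]; [lra|].
  assert (u * Cmod (b - RtoC s) < u * d)%R by (apply Rmult_lt_compat_l; lra).
  assert ((1 - u) * Cmod (a - RtoC s) <= (1 - u) * d)%R by (apply Rmult_le_compat_l; lra). lra.
- intros t Ht. apply locally_Cmod. assert (P : (0 < d - Cmod (t - RtoC s))%R) by lra.
  exists (mkposreal _ P). simpl. intros u Hu. replace (u - RtoC s) with (u - t + (t - RtoC s)) by ring.
  eapply Rle_lt_trans; [apply Cmod_triangle|]. lra.
- intros t Ht. apply cd_line. apply (F k Hk). now apply Hd.
- exact Ds.
- assert (L3 : locally (RtoC s') (fun t : C => (Cmod (t - RtoC s) < d)%R)).
  { apply locally_Cmod. assert (P : (0 < d - Cmod (RtoC s' - RtoC s))%R) by lra.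
    exists (mkposreal _ P). simpl. intros u Hu. replace (u - RtoC s) with (u - RtoC s' + (RtoC s' - RtoC s)) by ring.
    eapply Rle_lt_trans; [apply Cmod_triangle|]. lra. }
  generalize (filter_and _ _ K L3). apply filter_imp. intros t [B1 B2].
  now apply (E _ (Hd t B2)).
- exact Dw.
Qed.

Definition flat (H : V -> Prop) : Prop := forall x y (t : C), H x -> H y -> H (plus x (scal t (minus y x))).

(** The complex line from x to a point q outside Z lies in the flat set, and Z cannot contain a
    neighbourhood of x on it: proper analytic subsets have dense complement. *)
Lemma flat_dense (H Z : V -> Prop) (x q : V) (R0 : V -> Prop) : flat H -> analytic_set Z ->
  H x -> H q -> ~ Z q -> locally x R0 -> exists y, H y /\ ~ Z y /\ R0 y.
Proof.
intros Hf HZ Hx Hq Zq HR. apply NNPP. intros N.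
apply (analytic_line Z x (minus q x) HZ).
{ intros Y. apply Zq. rewrite <- (plus_minus_cancel x q). exact Y. }
assert (L := line_continuous x (minus q x) (RtoC 0) R0). cbv beta in L. rewrite line_0 in L. specialize (L HR). unfold filtermap in L.
generalize L. apply filter_imp. intros t Ht.
apply NNPP. intros Y. apply N. exists (plus x (scal t (minus q x))). split; [now apply Hf|]. now split.
Qed.

(** If neither part is everything, then near a point outside A2 the complement of A2 is open, and by
    density it meets the complement of A1; such a point is not covered. *)
Lemma flat_irreducible (H : V -> Prop) : flat H -> analytic_set H -> (exists x, H x) -> irreducible_analytic_set H.
Proof.
intros Hf HA He. split; [exact HA|]. split; [exact He|].
intros A1 A2 HA1 HA2 E.
apply NNPP. intros N. apply not_or_and in N. destruct N as [N1 N2].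
apply not_all_ex_not in N1. apply not_all_ex_not in N2.
destruct N1 as [q1 N1], N2 as [q2 N2].
apply imply_to_and in N1. apply imply_to_and in N2.
destruct (flat_dense H A1 q2 q1 (fun y => ~ A2 y) Hf HA1) as (y & Y1 & Y2 & Y3); try tauto.
- now apply analytic_closed.
- apply E in Y1. tauto.
Qed.

Lemma irreducible_cover (D A1 A2 : V -> Prop) : irreducible_analytic_set D -> analytic_set A1 -> analytic_set A2 ->
  (forall x, D x -> A1 x \/ A2 x) -> (forall x, D x -> A1 x) \/ (forall x, D x -> A2 x).
Proof.
intros (HA & _ & Hi) H1 H2 Hc.
destruct (Hi (fun x => D x /\ A1 x) (fun x => D x /\ A2 x)) as [K|K].
- now apply analytic_inter.
- now apply analytic_inter.
- intros x. specialize (Hc x). tauto.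
- left. intros x Hx. now apply K.
- right. intros x Hx. now apply K.
Qed.

Section Family.
Variables (I : Type) (form : I -> V -> C).
Hypothesis form_cd : forall i x, cd (form i) x.
Hypothesis form_flat : forall i, flat (fun x => form i x = 0).
Hypothesis form_finite : forall p, exists (eps : posreal) (l : list I),
  forall x i, ball p eps x -> form i x = 0 -> In i l.

Lemma product_zero (S : I -> Prop) (l : list I) : exists f : V -> C, (forall x, cd f x) /\
  forall x, f x = 0 <-> exists i, In i l /\ S i /\ form i x = 0.
Proof.
induction l as [|i l [f [F1 F2]]].
- exists (fun _ => 1). split; [intros; apply cd_const|]. intros x. split.
  + intros E. exfalso. revert E. apply C1_nz.
  + intros (i & [] & _).
- destruct (classic (S i)) as [Hi|Hi].
  + exists (fun x => form i x * f x). split; [intros; apply cd_mult; auto|].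
    intros x. split.
    * intros E. destruct (classic (form i x = 0)) as [Z|Z]; [exists i; simpl; auto|].
      destruct (classic (f x = 0)) as [Z'|Z'].
      -- apply F2 in Z'. destruct Z' as (j & A & B). exists j. simpl; auto.
      -- exfalso. revert E. now apply Cmult_neq_0.
    * intros (j & [->|Hj] & B & D); [rewrite D; ring|].
      replace (f x) with (RtoC 0); [ring|]. symmetry. apply F2. now exists j.
  + exists f. split; [exact F1|]. intros x. rewrite F2. split.
    * intros (j & A & B). exists j. simpl; auto.
    * intros (j & [->|Hj] & B & D); [tauto|]. now exists j.
Qed.

Lemma analytic_union (S : I -> Prop) : analytic_set (fun x => exists i, S i /\ form i x = 0).
Proof.
intros p. destruct (form_finite p) as (e & l & Hl).
destruct (product_zero S l) as [f [F1 F2]].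
exists e, 1%nat, (fun _ => f). split; [intros _ _ x _; apply F1|].
intros x Hx. split.
- intros (i & Si & E) _ _. apply F2. exists i. split; [now apply (Hl x)|now split].
- intros K. specialize (K O Nat.lt_0_1). apply F2 in K. destruct K as (i & _ & K). now exists i.
Qed.

(** Irreducibility is applied to one form against the union of the others, and forms are discarded
    one by one. After those that vanish somewhere near a point x0 of D are gone, no remaining form
    can vanish at x0, so the process must have stopped earlier. *)
Lemma irreducible_in_one (D : V -> Prop) : irreducible_analytic_set D ->
  (forall x, D x -> exists i, form i x = 0) -> exists i, forall x, D x -> form i x = 0.
Proof.
intros HD Hc. destruct HD as (HA & [x0 Hx0] & Hi).
assert (HD : irreducible_analytic_set D) by (split; [exact HA|split; [now exists x0|exact Hi]]).
destruct (form_finite x0) as (e & l & Hl).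
assert (K : forall l' : list I, (exists i, forall x, D x -> form i x = 0) \/
   (forall x, D x -> exists i, ~ In i l' /\ form i x = 0)).
{ induction l' as [|i l' [IH|IH]]; [right; intros x Hx| now left|].
  - destruct (Hc x Hx) as [i Ei]. exists i. simpl; tauto.
  - destruct (irreducible_cover D (fun x => form i x = 0) (fun x => exists j, ~ In j (i :: l') /\ form j x = 0) HD) as [A|A].
    + apply analytic_zero_set, form_cd.
    + apply (analytic_union (fun j => ~ In j (i :: l'))).
    + intros x Hx. destruct (IH x Hx) as (j & A & B). destruct (classic (i = j)) as [->|Y]; [now left|].
      right. exists j. split; [simpl; tauto|exact B].
    + left. now exists i.
    + now right. }
destruct (K l) as [A|A]; [exact A|].
exfalso. destruct (A x0 Hx0) as (i & N & E). apply N. apply (Hl x0); [apply ball_center|exact E].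
Qed.

(** Irreducible subsets of the union lie in a single zero set, so the components are among these.
    The point lying on just one of them excludes inclusions between different zero sets, which makes
    each of them maximal. *)
Theorem polar_divisors_family (T : V -> C) :
  (forall i, exists q, form i q = 0 /\ forall j, form j q = 0 -> j = i) ->
  (forall x, polar_set T x <-> exists i, form i x = 0) ->
  forall D, polar_divisor T D <-> exists i, forall x, D x <-> form i x = 0.
Proof.
intros Hq HP D.
assert (Irr : forall i, irreducible_analytic_set (fun x => form i x = 0)).
{ intros i. apply flat_irreducible; [apply form_flat|apply analytic_zero_set, form_cd|].
  destruct (Hq i) as (q & E & _). now exists q. }
split.
- intros (HD & Hsub & Hmax).
  destruct (irreducible_in_one D HD) as [i Hi].
  { intros x Hx. now apply HP, Hsub. }
  exists i. intros x. split; [apply Hi|].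
  apply (Hmax (fun x => form i x = 0)); [apply Irr| |exact Hi].
  intros y Hy. apply HP. now exists i.
- intros [i Hi].
  assert (ED : D = (fun x => form i x = 0)).
  { apply functional_extensionality. intros x.
    apply propositional_extensionality. apply Hi. }
  subst D. split; [apply Irr|]. split.
  + intros x Hx. apply HP. now exists i.
  + intros D' HD' Hsub Hinc x Hx.
    destruct (irreducible_in_one D' HD') as [j Hj].
    { intros y Hy. now apply HP, Hsub. }
    destruct (Hq i) as (q & E & U). assert (j = i) by (apply U, Hj, Hinc, E). subst j. now apply Hj.
Qed.

End Family.
End Analytic.

(** * Real powers and the binomial expansion *)

Definition rder (f : R -> C) (x : R) (l : C) : Prop :=
  forall eps : posreal, locally x (fun y => (Cmod (f y - f x - l * RtoC (y - x)) <= eps * Rabs (y - x))%R).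

Lemma cder_linear k z : cder (fun w => k * w) z k.
Proof. assert (H := cder_scal (fun w => w) z 1 k (cder_id z)). rewrite Cmult_1_r in H. exact H. Qed.

Lemma rder_comp (f : R -> C) (g : C -> C) x l d : rder f x l -> cder g (f x) d -> rder (fun y => g (f y)) x (d * l).
Proof.
intros Hf Hg eps.
assert (Kl := Cmod_ge_0 l). assert (Kd := Cmod_ge_0 d).
assert (P1 : (0 < eps / (2 * (Cmod l + 1)))%R) by (apply Rdiv_lt_0_compat; [apply cond_pos|lra]).
assert (P2 : (0 < eps / (2 * (Cmod d + 1)))%R) by (apply Rdiv_lt_0_compat; [apply cond_pos|lra]).
assert (Lip : locally x (fun y => (Cmod (f y - f x) <= (Cmod l + 1) * Rabs (y - x))%R)).
{ generalize (Hf (mkposreal 1 Rlt_0_1)). apply filter_imp. simpl. intros y Hy.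
  replace (f y - f x) with ((f y - f x - l * RtoC (y - x)) + l * RtoC (y - x)) by ring.
  eapply Rle_trans; [apply Cmod_triangle|]. rewrite Cmod_mult, Cmod_R. lra. }
destruct (proj1 (locally_Cmod _ _) (Hg (mkposreal _ P1))) as [r Hr]. simpl in Hr.
assert (P3 : (0 < r / (Cmod l + 1))%R) by (apply Rdiv_lt_0_compat; [apply cond_pos|lra]).
assert (Near : locally x (fun y => (Rabs (y - x) < r / (Cmod l + 1))%R)) by (now exists (mkposreal _ P3)).
generalize (filter_and _ _ (Hf (mkposreal _ P2)) (filter_and _ _ Lip Near)).
apply filter_imp. simpl. intros y [B [D N]].
assert (A : (Cmod (g (f y) - g (f x) - d * (f y - f x)) <= eps / (2 * (Cmod l + 1)) * Cmod (f y - f x))%R).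
{ apply Hr. eapply Rle_lt_trans; [exact D|].
  apply (Rmult_lt_compat_r (Cmod l + 1)) in N; [|lra]. unfold Rdiv in N. rewrite Rmult_assoc, Rinv_l, Rmult_1_r in N by lra. lra. }
replace (g (f y) - g (f x) - d * l * RtoC (y - x)) with
  ((g (f y) - g (f x) - d * (f y - f x)) + d * (f y - f x - l * RtoC (y - x))) by ring.
eapply Rle_trans; [apply Cmod_triangle|]. rewrite Cmod_mult.
assert (W := Rabs_pos (y - x)).
apply Rle_trans with (eps / (2 * (Cmod l + 1)) * ((Cmod l + 1) * Rabs (y - x)) +
   (Cmod d + 1) * (eps / (2 * (Cmod d + 1)) * Rabs (y - x)))%R.
- apply Rplus_le_compat.
  + eapply Rle_trans; [exact A|]. apply Rmult_le_compat_l; [left; exact P1|exact D].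
  + apply Rmult_le_compat; [lra | apply Cmod_ge_0 | lra | exact B].
- right. field. split; lra.
Qed.

Lemma rder_plus f g x a b : rder f x a -> rder g x b -> rder (fun y => f y + g y) x (a + b).
Proof.
intros Hf Hg eps. generalize (filter_and _ _ (Hf (pos_div_2 eps)) (Hg (pos_div_2 eps))).
apply filter_imp. simpl. intros y [A B].
replace (f y + g y - (f x + g x) - (a + b) * RtoC (y - x)) with
  ((f y - f x - a * RtoC (y - x)) + (g y - g x - b * RtoC (y - x))) by ring.
eapply Rle_trans; [apply Cmod_triangle|]. lra.
Qed.

Lemma rder_scal k f x a : rder f x a -> rder (fun y => k * f y) x (k * a).
Proof.
intros Hf. apply (rder_comp f (fun w => k * w)); [exact Hf|]. apply cder_linear.
Qed.

Lemma rder_const c x : rder (fun _ => c) x 0.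
Proof.
intros eps. apply filter_forall. intros y. replace (c - c - 0 * RtoC (y - x)) with (RtoC 0) by ring.
rewrite Cmod_0. apply Rmult_le_pos; [left; apply cond_pos|apply Rabs_pos].
Qed.

Lemma rder_minus f g x a b : rder f x a -> rder g x b -> rder (fun y => f y - g y) x (a - b).
Proof.
intros Hf Hg. generalize (rder_plus _ _ _ _ _ Hf (rder_scal (-1) _ _ _ Hg)).
intros H eps. generalize (H eps). apply filter_imp. intros y A.
replace (f y - g y - (f x - g x) - (a - b) * RtoC (y - x)) with
 (f y + -1 * g y - (f x + -1 * g x) - (a + -1 * b) * RtoC (y - x)) by ring. exact A.
Qed.

Lemma rder_RtoC (f : R -> R) x (l : R) : is_derive f x l -> rder (fun y => RtoC (f y)) x (RtoC l).
Proof.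
intros [_ H] eps. generalize (H x (fun P HP => HP) eps). apply filter_imp. intros y Hy.
rewrite <- RtoC_minus, <- RtoC_mult, <- RtoC_minus, Cmod_R.
unfold norm, minus, plus, opp, scal in Hy; simpl in Hy. unfold abs, mult in Hy; simpl in Hy.
unfold Rminus. rewrite (Rmult_comm l). exact Hy.
Qed.

Lemma rder_is_derive f x l : rder f x l -> @is_derive R_AbsRing C_R_NormedModule f x l.
Proof.
intros H. split; [apply is_linear_scal_l|].
intros x' Hx'. apply (is_filter_lim_locally_unique (K := R_AbsRing) (V := AbsRing_NormedModule R_AbsRing)) in Hx'. subst x'. intros eps.
generalize (H eps). apply filter_imp. intros y Hy.
rewrite norm_C_R. change (norm (minus y x)) with (Rabs (y - x)).
eapply Rle_trans; [right|exact Hy]. f_equal.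
destruct (f y) as [a b], (f x) as [c d], l as [p q].
apply injective_projections; cbn; unfold minus, plus, opp, mult; cbn; ring.
Qed.

Lemma rder_ccont f x l : rder f x l -> ccont f x.
Proof.
intros H. apply (ex_derive_continuous (V := C_R_NormedModule) f x). exists l. now apply rder_is_derive.
Qed.

Lemma rder_ext_locally f g x l : locally x (fun y => f y = g y) -> rder f x l -> rder g x l.
Proof.
intros E H eps. assert (E0 := locally_singleton _ _ E).
generalize (filter_and _ _ E (H eps)). apply filter_imp. intros y [A B].
now rewrite <- A, <- E0.
Qed.

Lemma CInt_FTC (F f : R -> C) (a b : R) :
  (forall x, (Rmin a b <= x <= Rmax a b)%R -> rder F x (f x)) ->
  (forall x, (Rmin a b <= x <= Rmax a b)%R -> ccont f x) ->
  is_CInt f a b (F b - F a).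
Proof.
intros H1 H2. apply (is_RInt_derive (V := C_R_CompleteNormedModule) F f a b); [|exact H2].
intros x Hx. now apply rder_is_derive, H1.
Qed.

Lemma rder_mean_value (f : R -> C) (a b M : R) : (a <= b)%R ->
  (forall x, (a <= x <= b)%R -> exists l, rder f x l /\ (Cmod l <= M)%R) ->
  (Cmod (f b - f a) <= M * (b - a))%R.
Proof.
intros Hab H.
assert (C0 : forall s : R, exists l : C, (a <= s <= b)%R -> rder f s l /\ (Cmod l <= M)%R).
{ intros s. destruct (classic (a <= s <= b)%R) as [Hs|Hs].
  - destruct (H s Hs) as [l Hl]. now exists l.
  - exists (RtoC 0). tauto. }
destruct (fun_choice _ C0) as [d Hd].
set (D := f b - f a).
assert (M0 : (0 <= M)%R).
{ destruct (H a) as (l & _ & Hl); [lra|]. generalize (Cmod_ge_0 l); lra. }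
destruct (Req_dec (Cmod D) 0) as [E|E]; [rewrite E; apply Rmult_le_pos; lra|].
assert (PD : (0 < Cmod D)%R) by (generalize (Cmod_ge_0 D); lra).
assert (CD : RtoC (Cmod D) <> 0) by (intros Q; apply RtoC_inj in Q; lra).
set (u := Cconj D / RtoC (Cmod D)).
assert (Hu : Cmod u = 1%R).
{ unfold u. rewrite Cmod_div by exact CD. rewrite Cmod_conj, Cmod_R, Rabs_pos_eq by lra. field. exact E. }
assert (HuD : Re (u * D) = Cmod D).
{ replace (u * D) with (RtoC (Cmod D)); [reflexivity|].
  unfold u. transitivity (D * Cconj D / RtoC (Cmod D)); [|field; exact CD].
  rewrite <- Cmod2_conj. rewrite <- RtoC_div by exact E. f_equal. field. exact E. }
assert (DR : forall s l, rder f s l -> is_derive (fun y => Re (u * f y)) s (Re (u * l))).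
{ intros s l Hl. assert (Hl' := rder_scal u f s l Hl). split; [apply is_linear_scal_l|].
  intros x' Hx'. apply (is_filter_lim_locally_unique (K := R_AbsRing) (V := AbsRing_NormedModule R_AbsRing)) in Hx'. subst x'. intros eps.
  generalize (Hl' eps). apply filter_imp. intros y Hy.
  eapply Rle_trans; [|exact Hy].
  change (Rabs (Re (u * f y) - Re (u * f s) - (y - s) * Re (u * l)) <= Cmod (u * f y - u * f s - u * l * RtoC (y - s)))%R.
  eapply Rle_trans; [|apply re_le_Cmod]. right. f_equal. unfold Re; simpl. ring. }
destruct (MVT_gen (fun y => Re (u * f y)) a b (fun s => Re (u * d s))) as [c [Hc Eg]].
- intros s Hs. rewrite Rmin_left, Rmax_right in Hs by lra. apply DR. apply Hd. lra.
- intros s Hs. rewrite Rmin_left, Rmax_right in Hs by lra.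
  apply continuity_pt_filterlim. apply (ex_derive_continuous (fun y => Re (u * f y))).
  eexists. apply DR. apply Hd. lra.
- rewrite Rmin_left, Rmax_right in Hc by lra.
  assert (B : (Re (u * d c) <= M)%R).
  { eapply Rle_trans; [apply Re_le_Cmod|]. rewrite Cmod_mult, Hu, Rmult_1_l. now apply Hd. }
  assert (E2 : (Re (u * f b) - Re (u * f a) = Cmod D)%R).
  { rewrite <- HuD. unfold D, Re; simpl. ring. }
  rewrite E2 in Eg. rewrite Eg. apply Rmult_le_compat_r; lra.
Qed.

Lemma Cmod_Rcpow x s : Cmod (Rcpow x s) = exp (Re s * ln x).
Proof. unfold Rcpow. rewrite Cmod_Cexp. f_equal. unfold Re; simpl. ring. Qed.

Lemma Rcpow_plus x s t : Rcpow x (s + t) = Rcpow x s * Rcpow x t.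
Proof. unfold Rcpow. rewrite <- Cexp_plus. f_equal. ring. Qed.

Lemma Rcpow_0 x : Rcpow x 0 = 1.
Proof. unfold Rcpow. rewrite <- Cexp_0. f_equal. ring. Qed.

Lemma Rcpow_opp x s : Rcpow x (- s) = / Rcpow x s.
Proof. unfold Rcpow. rewrite <- Cexp_opp. f_equal. ring. Qed.

Lemma Rcpow_mult x y s : (0 < x)%R -> (0 < y)%R -> Rcpow (x * y) s = Rcpow x s * Rcpow y s.
Proof. intros Hx Hy. unfold Rcpow. rewrite ln_mult, RtoC_plus, <- Cexp_plus by assumption. f_equal. ring. Qed.

Lemma Rcpow_base_1 s : Rcpow 1 s = 1.
Proof. unfold Rcpow. rewrite ln_1, <- Cexp_0. f_equal. ring. Qed.

Lemma Cexp_RtoC (x : R) : Cexp (RtoC x) = RtoC (exp x).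
Proof. unfold Cexp; simpl. rewrite cos_0, sin_0. apply injective_projections; simpl; ring. Qed.

Lemma Rcpow_INR x n : (0 < x)%R -> Rcpow x (RtoC (INR n)) = RtoC (x ^ n).
Proof.
intros Hx. unfold Rcpow. rewrite <- RtoC_mult, Cexp_RtoC. f_equal.
rewrite <- Rpower_pow by exact Hx. reflexivity.
Qed.

Lemma Rcpow_1 x : (0 < x)%R -> Rcpow x 1 = RtoC x.
Proof. intros Hx. replace (RtoC 1) with (RtoC (INR 1)) by reflexivity. rewrite Rcpow_INR by exact Hx. f_equal. ring. Qed.

Lemma cder_Rcpow x s : cder (fun s => Rcpow x s) s (RtoC (ln x) * Rcpow x s).
Proof.
unfold Rcpow. rewrite Cmult_comm. apply (cder_comp (fun s => s * RtoC (ln x)) Cexp); [|apply cder_Cexp].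
apply (cder_ext_locally (fun s => RtoC (ln x) * s)); [apply filter_forall; intros w; apply Cmult_comm|].
apply cder_linear.
Qed.

Lemma cd_Rcpow {V : NormedModule C_AbsRing} x (f : V -> C) p : cd f p -> cd (fun y => Rcpow x (f y)) p.
Proof. intros H. apply (cd_comp f (fun s => Rcpow x s)); [exact H|]. apply (cder_cd _ _ _ (cder_Rcpow x (f p))). Qed.

Lemma rder_Rcpow x s : (0 < x)%R -> rder (fun x => Rcpow x s) x (s * Rcpow x (s - 1)).
Proof.
intros Hx. unfold Rcpow at 1.
replace (s * Rcpow x (s - 1)) with (Cexp (s * RtoC (ln x)) * (s * RtoC (/ x))).
- apply (rder_comp (fun x => s * RtoC (ln x)) Cexp); [|apply cder_Cexp].
  apply rder_scal, rder_RtoC. auto_derive; [exact Hx|]. field. lra.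
- unfold Cminus. rewrite Rcpow_plus, Rcpow_opp, Rcpow_1 by exact Hx.
  rewrite RtoC_inv by lra. unfold Rcpow. ring.
Qed.

Lemma ccont_Rcpow x s : (0 < x)%R -> ccont (fun x => Rcpow x s) x.
Proof. intros Hx. apply (rder_ccont _ _ _ (rder_Rcpow x s Hx)). Qed.

Lemma rder_mult f g x a b : rder f x a -> rder g x b -> rder (fun y => f y * g y) x (a * g x + f x * b).
Proof.
intros Hf Hg.
assert (Sq : forall h l, rder h x l -> rder (fun y => h y * h y) x (2 * h x * l)).
{ intros h l Hh. apply (rder_comp h (fun w => w * w)); [exact Hh|].
  intros eps. apply locally_Cmod. exists eps. intros w Hw.
  replace (w * w - h x * h x - 2 * h x * (w - h x)) with ((w - h x) * (w - h x)) by ring.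
  rewrite Cmod_mult. apply Rmult_le_compat_r; [apply Cmod_ge_0|lra]. }
replace (a * g x + f x * b) with (/ 4 * (2 * (f x + g x) * (a + b) - 2 * (f x - g x) * (a - b))) by field.
apply (rder_ext_locally (fun y => / 4 * ((f y + g y) * (f y + g y) - (f y - g y) * (f y - g y)))).
{ apply filter_forall. intros y. field. }
apply rder_scal, rder_minus.
- apply (Sq (fun y => f y + g y)). now apply rder_plus.
- apply (Sq (fun y => f y - g y)). now apply rder_minus.
Qed.

Fixpoint cbinom (s : C) (i : nat) : C :=
  match i with O => 1 | S j => cbinom s j * (s - RtoC (INR j)) / RtoC (INR (S j)) end.

Lemma RtoC_neq_0 (x : R) : x <> 0%R -> RtoC x <> 0.
Proof. intros H E. apply H. now apply RtoC_inj. Qed.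

Lemma cbinom_shift s i : RtoC (INR (S i)) * cbinom s (S i) = s * cbinom (s - 1) i.
Proof.
induction i as [|i IH].
- simpl. field.
- change (cbinom s (S (S i))) with (cbinom s (S i) * (s - RtoC (INR (S i))) / RtoC (INR (S (S i)))).
  assert (N2 : RtoC (INR (S (S i))) <> 0) by (apply RtoC_neq_0, not_0_INR; lia).
  assert (N1 : RtoC (INR (S i)) <> 0) by (apply RtoC_neq_0, not_0_INR; lia).
  change (cbinom (s - 1) (S i)) with (cbinom (s - 1) i * (s - 1 - RtoC (INR i)) / RtoC (INR (S i))).
  transitivity ((RtoC (INR (S i)) * cbinom s (S i)) * (s - RtoC (INR (S i))) / RtoC (INR (S i))); [field; split; assumption|].
  rewrite IH. rewrite (S_INR i), RtoC_plus in *. field. exact N1.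
Qed.

Lemma sum_n_C_mult (k : C) (u : nat -> C) n : sum_n (fun i => k * u i) n = k * sum_n u n.
Proof. apply (sum_n_mult_l (K := C_Ring)). Qed.

(** [K] counts the subtracted terms of the binomial series of (1 + v)^s; [sum_n] with bound k has k
    + 1 terms, whence the case distinction. *)
Definition bin_rem (s : C) (K : nat) (v : R) : C :=
  Rcpow (1 + v) s - match K with O => 0 | S k => sum_n (fun i => cbinom s i * RtoC (v ^ i)) k end.

Lemma bin_rem_S s K v : bin_rem s (S K) v = bin_rem s K v - cbinom s K * RtoC (v ^ K).
Proof.
unfold bin_rem. destruct K as [|K].
- rewrite sum_O. ring.
- rewrite sum_Sn. unfold plus; simpl. ring.
Qed.

Lemma bin_rem_0 s K : bin_rem s (S K) 0 = 0.
Proof.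
induction K as [|K IH].
- unfold bin_rem. rewrite sum_O, Rplus_0_r, Rcpow_base_1. simpl. ring.
- rewrite bin_rem_S, IH. simpl. rewrite Rmult_0_l. ring.
Qed.

Lemma rder_bin_rem s K v : (0 <= v)%R -> rder (bin_rem s (S K)) v (s * bin_rem (s - 1) K v).
Proof.
intros Hv. induction K as [|K IH].
- apply (rder_ext_locally (fun v => Rcpow (1 + v) s - 1)).
  { apply filter_forall. intros y. unfold bin_rem. rewrite sum_O. simpl. ring. }
  replace (s * bin_rem (s - 1) 0 v) with (s * Rcpow (1 + v) (s - 1) * RtoC 1 - 0) by (unfold bin_rem; ring).
  apply rder_minus; [|apply rder_const].
  assert (H := rder_Rcpow (1 + v) s ltac:(lra)).
  intros eps. destruct (H eps) as [d Hd]. exists d. intros y Hy.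
  assert (Q := Hd (1 + y)%R). replace (1 + y - (1 + v))%R with (y - v)%R in Q by ring.
  rewrite Cmult_1_r. apply Q.
  unfold ball in *; simpl in *. unfold AbsRing_ball, abs, minus, plus, opp in *; simpl in *.
  replace (1 + y + - (1 + v))%R with (y + - v)%R by ring. exact Hy.
- apply (rder_ext_locally (fun v => bin_rem s (S K) v - cbinom s (S K) * RtoC (v ^ S K))).
  { apply filter_forall. intros y. symmetry. apply bin_rem_S. }
  rewrite bin_rem_S.
  replace (s * (bin_rem (s - 1) K v - cbinom (s - 1) K * RtoC (v ^ K))) with
    (s * bin_rem (s - 1) K v - cbinom s (S K) * RtoC (INR (S K) * v ^ K)).
  2: { rewrite RtoC_mult. transitivity (s * bin_rem (s - 1) K v - (RtoC (INR (S K)) * cbinom s (S K)) * RtoC (v ^ K)); [ring|].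
       rewrite cbinom_shift. ring. }
  apply rder_minus; [exact IH|]. apply rder_scal, rder_RtoC.
  auto_derive; [auto|]. simpl. ring.
Qed.

(** The start is |(1 + v)^s| <= 2^rho. Each integration of the remainder brings the factor s, at
    most rho in modulus, and replaces s by s - 1, at most rho + 1. *)
Fixpoint bin_const (K : nat) (rho : R) : R :=
  match K with O => exp (rho * ln 2) | S k => rho * bin_const k (rho + 1) end.

Lemma exp_mono x y : (x <= y)%R -> (exp x <= exp y)%R.
Proof. intros [H| ->]; [left; now apply exp_increasing|right; reflexivity]. Qed.

Lemma ln2_pos : (0 < ln 2)%R.
Proof. rewrite <- ln_1. apply ln_increasing; lra. Qed.

Lemma bin_rem_bound (K : nat) : forall (s : C) (rho v : R), (Cmod s <= rho)%R -> (0 <= v <= 1)%R ->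
  (Cmod (bin_rem s K v) <= bin_const K rho * v ^ K)%R.
Proof.
induction K as [|K IH]; intros s rho v Hs Hv.
- unfold bin_rem. replace (Rcpow (1 + v) s - 0) with (Rcpow (1 + v) s) by ring.
  rewrite Cmod_Rcpow. simpl. rewrite Rmult_1_r. apply exp_mono.
  assert (L0 : (0 <= ln (1 + v))%R) by (rewrite <- ln_1; apply ln_le; lra).
  assert (L1 : (ln (1 + v) <= ln 2)%R) by (apply ln_le; lra).
  assert (R1 := Re_le_Cmod s). assert (R0 := Cmod_ge_0 s). assert (P2 := ln2_pos).
  apply Rle_trans with (rho * ln (1 + v))%R; [apply Rmult_le_compat_r; lra|apply Rmult_le_compat_l; lra].
- replace (bin_rem s (S K) v) with (bin_rem s (S K) v - bin_rem s (S K) 0) by (rewrite bin_rem_0; ring).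
  assert (R0 := Cmod_ge_0 s).
  replace (bin_const (S K) rho * v ^ S K)%R with (rho * (bin_const K (rho + 1) * v ^ K) * (v - 0))%R by (simpl; ring).
  apply rder_mean_value; [lra|]. intros x Hx.
  exists (s * bin_rem (s - 1) K x). split; [apply rder_bin_rem; lra|].
  rewrite Cmod_mult.
  assert (Q := IH (s - 1) (rho + 1)%R x).
  assert (Q1 : (Cmod (bin_rem (s - 1) K x) <= bin_const K (rho + 1) * x ^ K)%R).
  { apply Q; [|lra]. unfold Cminus. eapply Rle_trans; [apply Cmod_triangle|]. rewrite Cmod_opp, Cmod_1. lra. }
  assert (Z := Cmod_ge_0 (bin_rem (s - 1) K x)).
  assert (BC : (0 <= bin_const K (rho + 1))%R).
  { assert (Y := IH (s - 1) (rho + 1)%R 1%R). rewrite pow1, Rmult_1_r in Y.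
    eapply Rle_trans; [apply Cmod_ge_0|]. apply Y; [|lra].
    unfold Cminus. eapply Rle_trans; [apply Cmod_triangle|]. rewrite Cmod_opp, Cmod_1. lra. }
  apply Rmult_le_compat; [exact R0|exact Z|exact Hs|].
  eapply Rle_trans; [exact Q1|]. apply Rmult_le_compat_l; [exact BC|]. apply pow_incr. lra.
Qed.

(** * The Gamma function *)

Definition isZ (s : C) : Prop := exists k : Z, s = RtoC (IZR k).

Lemma isZ_plus_nat s n : isZ (s + RtoC (INR n)) -> isZ s.
Proof.
intros [k Hk]. exists (k - Z.of_nat n)%Z. rewrite minus_IZR, <- INR_IZR_INZ, RtoC_minus, <- Hk. ring.
Qed.

Lemma isZ_plus_1 s : isZ (s + 1) -> isZ s.
Proof. exact (isZ_plus_nat s 1). Qed.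

Lemma isZ_opp s : isZ (- s) -> isZ s.
Proof. intros [k Hk]. exists (- k)%Z. rewrite opp_IZR, RtoC_opp, <- Hk. ring. Qed.

Lemma isZ_minus_nat s n : isZ (s - RtoC (INR n)) -> isZ s.
Proof.
intros [k Hk]. exists (k + Z.of_nat n)%Z. rewrite plus_IZR, <- INR_IZR_INZ, RtoC_plus, <- Hk. ring.
Qed.

Lemma isZ_one_minus s : isZ (1 - s) -> isZ s.
Proof. intros H. apply isZ_opp, isZ_plus_1. replace (- s + 1) with (1 - s) by ring. exact H. Qed.

Lemma isZ_INR n : isZ (RtoC (INR n)).
Proof. exists (Z.of_nat n). now rewrite INR_IZR_INZ. Qed.

Lemma not_isZ_Im (s : C) : Im s <> 0%R -> ~ isZ s.
Proof. intros H [k Hk]. apply H. rewrite Hk. reflexivity. Qed.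

Lemma dist_Z (x : R) : (forall k, x <> IZR k) -> exists d : posreal, forall k, (d <= Rabs (x - IZR k))%R.
Proof.
intros H. destruct (archimed x) as [A1 A2].
set (m := up x) in *.
assert (H1 := H (m - 1)%Z). rewrite minus_IZR in H1.
assert (P : (0 < Rmin (IZR m - x) (x - (IZR m - 1)))%R) by (apply Rmin_case; lra).
exists (mkposreal _ P). simpl. intros k.
assert (M1 := Rmin_l (IZR m - x) (x - (IZR m - 1))). assert (M2 := Rmin_r (IZR m - x) (x - (IZR m - 1))).
destruct (Z_le_gt_dec m k) as [Hk|Hk].
- apply IZR_le in Hk. rewrite Rabs_left1; lra.
- assert (Hk' : (k <= m - 1)%Z) by lia. apply IZR_le in Hk'. rewrite minus_IZR in Hk'. rewrite Rabs_pos_eq; lra.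
Qed.

Lemma not_isZ_dist (s : C) : ~ isZ s -> exists d : posreal, forall k, (d <= Cmod (s - RtoC (IZR k)))%R.
Proof.
intros H. destruct (Req_dec (Im s) 0) as [E|E].
- destruct (dist_Z (Re s)) as [d Hd].
  + intros k Q. apply H. exists k. apply injective_projections; [exact Q|exact E].
  + exists d. intros k. eapply Rle_trans; [apply (Hd k)|]. apply (re_le_Cmod (s - RtoC (IZR k))).
- assert (P : (0 < Rabs (Im s))%R) by now apply Rabs_pos_lt.
  exists (mkposreal _ P). simpl. intros k. eapply Rle_trans; [|apply (im_le_Cmod (s - RtoC (IZR k)))].
  right. f_equal. simpl. unfold Im. ring.
Qed.

Lemma not_isZ_locally (s : C) : ~ isZ s -> locally s (fun z => ~ isZ z).
Proof.
intros H. destruct (not_isZ_dist s H) as [d Hd]. apply locally_Cmod. exists d.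
intros w Hw [k Hk]. specialize (Hd k). rewrite <- Hk, <- Cmod_opp in Hd.
replace (- (s - w)) with (w - s) in Hd by ring. lra.
Qed.

(** The plane without the integers is not convex, so two segments are used: a horizontal one from
    far right reaches every nonreal point, and a vertical one from s + i reaches a real nonintegral
    s. *)
Lemma identity_not_Z (f : C -> C) : (forall s, ~ isZ s -> cd f s) ->
  (forall s, ~ isZ s -> (2 < Re s)%R -> f s = 0) -> forall s, ~ isZ s -> f s = 0.
Proof.
intros Hf H0.
assert (Hh : forall s, ~ isZ s -> hol (V := C_NormedModule) f s).
{ intros s Hs. unfold hol. generalize (not_isZ_locally s Hs). apply filter_imp. exact Hf. }
assert (H1 : forall s, Im s <> 0%R -> f s = 0).
{ intros s Hs. set (D := (Rabs (Re s) + 3)%R).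
  replace s with (plus ((s + RtoC D) : C_NormedModule) ((- RtoC D) : C_NormedModule)).
  2: { change (s + RtoC D + - RtoC D = s). ring. }
  apply (identity_segment (V := C_NormedModule)).
  - intros u Hu. apply Hh. apply not_isZ_Im.
    change (Im (s + RtoC D + RtoC u * (- RtoC D)) <> 0%R). simpl. intros E. apply Hs. rewrite <- E. unfold Im. ring.
  - apply locally_Cmod. assert (P : (0 < Rmin 1 (Rabs (Im s)))%R).
    { apply Rmin_case; [lra|now apply Rabs_pos_lt]. }
    exists (mkposreal _ P). simpl. intros w Hw.
    assert (W1 := Rlt_le_trans _ _ _ Hw (Rmin_l _ _)). assert (W2 := Rlt_le_trans _ _ _ Hw (Rmin_r _ _)).
    apply H0.
    + apply not_isZ_Im. intros E.
      assert (Q := im_le_Cmod (w - (s + RtoC D))).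
      replace (Im (w - (s + RtoC D))) with (- Im s)%R in Q.
      * rewrite Rabs_Ropp in Q. lra.
      * transitivity (Im w - Im s)%R; [rewrite E; ring|]. unfold Im; simpl. ring.
    + assert (Q := re_le_Cmod (w - (s + RtoC D))). apply Rabs_le_between in Q.
      replace (Re (w - (s + RtoC D))) with (Re w - Re s - D)%R in Q by (unfold Re; simpl; ring).
      unfold D in *. assert (Y := Rle_abs (- Re s)). rewrite Rabs_Ropp in Y. lra. }
intros s Hs. destruct (Req_dec (Im s) 0) as [E|E]; [|now apply H1].
replace s with (plus ((s + Ci) : C_NormedModule) ((- Ci) : C_NormedModule)).
2: { change (s + Ci + - Ci = s). ring. }
apply (identity_segment (V := C_NormedModule)).
- intros u Hu. apply Hh. change (~ isZ (s + Ci + RtoC u * (- Ci))).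
  intros [k Hk]. apply (f_equal Re) in Hk. apply Hs. exists k.
  apply injective_projections; [|exact E]. simpl. simpl in Hk. rewrite <- Hk. ring.
- apply locally_Cmod. exists (mkposreal 1 Rlt_0_1). simpl. intros w Hw. apply H1.
  intros Q. assert (Y := im_le_Cmod (w - (s + Ci))).
  replace (Im (w - (s + Ci))) with (-1)%R in Y.
  + rewrite Rabs_left in Y; lra.
  + transitivity (Im w - (Im s + 1))%R; [rewrite E, Q; ring|]. unfold Im; simpl. ring.
Qed.

(* Improper integral over (0, oo). *)
Definition impr (f : R -> C) (l : C) : Prop :=
  forall eps : posreal, exists (d : posreal) (B : R), forall al be, (0 < al < d)%R -> (B < be)%R ->
    (Cmod (CInt f al be - l) < eps)%R.

Lemma pow_le_fact_exp n x : (0 <= x)%R -> (x ^ n <= INR (fact n) * exp x)%R.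
Proof.
revert x. induction n as [|n IH]; intros x Hx.
- simpl. rewrite Rmult_1_l. rewrite <- exp_0. now apply exp_mono.
- set (g := fun y => (INR (fact (S n)) * exp y - y ^ S n)%R).
  destruct (MVT_gen g 0 x (fun y => INR (fact (S n)) * exp y - INR (S n) * y ^ n)%R) as [c [Hc E]].
  + intros y Hy. unfold g. auto_derive; [auto|]. simpl. ring.
  + intros y Hy. apply continuity_pt_filterlim. apply (ex_derive_continuous g). unfold g. auto_derive. auto.
  + rewrite Rmin_left, Rmax_right in Hc by lra.
    assert (Q := IH c ltac:(lra)).
    assert (PS : (0 < INR (S n))%R) by (apply lt_0_INR; lia).
    assert (E2 : (0 <= INR (fact (S n)) * exp c - INR (S n) * c ^ n)%R).
    { rewrite fact_simpl, mult_INR. nra. }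
    assert (E3 : (0 <= (INR (fact (S n)) * exp c - INR (S n) * c ^ n) * (x - 0))%R) by (apply Rmult_le_pos; lra).
    rewrite <- E in E3. unfold g in E3. rewrite exp_0, pow_ne_zero in E3 by lia.
    generalize (INR_fact_lt_0 (S n)). lra.
Qed.

Lemma nat_above (x : R) : exists n : nat, (x <= INR n)%R.
Proof.
destruct (nfloor_ex (Rmax 0 x)) as [n [_ H]]; [apply Rmax_l|]. exists (S n). rewrite S_INR.
generalize (Rmax_r 0 x). lra.
Qed.

Lemma exp_ln_le_pow sg n x : (1 <= x)%R -> (sg <= INR n)%R -> (exp (sg * ln x) <= x ^ n)%R.
Proof.
intros Hx Hn. rewrite <- Rpower_pow by lra. unfold Rpower. apply exp_mono.
apply Rmult_le_compat_r; [|exact Hn]. rewrite <- ln_1. apply ln_le; lra.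
Qed.

Lemma decay_infty (sg tau : R) (eps : posreal) : (0 < tau)%R ->
  exists B, (1 <= B)%R /\ forall x, (B < x)%R -> (exp (sg * ln x) * exp (- (x * tau)) < eps)%R.
Proof.
intros Ht. destruct (nat_above sg) as [n Hn].
set (K := (INR (fact (S n)) * (/ tau) ^ S n)%R).
exists (Rmax 1 (K / eps)). split; [apply Rmax_l|]. intros x Hx.
assert (X1 : (1 < x)%R) by (eapply Rle_lt_trans; [apply Rmax_l|exact Hx]).
assert (X2 : (K / eps < x)%R) by (eapply Rle_lt_trans; [apply Rmax_r|exact Hx]).
assert (Q := pow_le_fact_exp (S n) (x * tau) ltac:(nra)).
assert (Pe := cond_pos eps).
assert (Px : (0 < exp (x * tau))%R) by apply exp_pos.
apply (Rle_lt_trans _ (x ^ n * exp (- (x * tau)))).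
{ apply Rmult_le_compat_r; [left; apply exp_pos|]. apply exp_ln_le_pow; lra. }
rewrite exp_Ropp.
assert (Pt : (0 < tau ^ S n)%R) by (apply pow_lt; lra).
rewrite Rpow_mult_distr in Q.
assert (Q2 : (x ^ n * x <= K * exp (x * tau))%R).
{ unfold K. rewrite pow_inv. apply (Rmult_le_reg_r (tau ^ S n)); [exact Pt|].
  replace (INR (fact (S n)) * / tau ^ S n * exp (x * tau) * tau ^ S n)%R with (INR (fact (S n)) * exp (x * tau))%R
    by (field; lra).
  replace (x ^ n * x)%R with (x ^ S n)%R by (simpl; ring). exact Q. }
assert (Q3 : (K < eps * x)%R).
{ apply (Rmult_lt_compat_r eps) in X2; [|exact Pe]. unfold Rdiv in X2. rewrite Rmult_assoc, Rinv_l in X2 by lra. lra. }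
apply (Rmult_lt_reg_r (exp (x * tau) * x)); [nra|].
replace (x ^ n * / exp (x * tau) * (exp (x * tau) * x))%R with (x ^ n * x)%R by (field; lra).
eapply Rle_lt_trans; [exact Q2|]. nra.
Qed.

Lemma decay_zero (sg : R) (eps : posreal) : (0 < sg)%R ->
  exists d : posreal, (d <= 1)%R /\ forall x, (0 < x < d)%R -> (exp (sg * ln x) < eps)%R.
Proof.
intros Hs. assert (Pe := cond_pos eps).
assert (P : (0 < Rmin 1 (exp (ln eps / sg)))%R) by (apply Rmin_case; [lra|apply exp_pos]).
exists (mkposreal _ P). simpl. split; [apply Rmin_l|]. intros x [Hx1 Hx2].
assert (X := Rlt_le_trans _ _ _ Hx2 (Rmin_r _ _)).
rewrite <- (exp_ln eps) by exact Pe. apply exp_increasing.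
assert (L := ln_increasing x _ Hx1 X). rewrite ln_exp in L.
apply (Rmult_lt_compat_l sg) in L; [|exact Hs].
replace (sg * (ln eps / sg))%R with (ln eps) in L by (field; lra). exact L.
Qed.

Lemma ex_CInt_pos (f : R -> C) a b : (0 < a)%R -> (0 < b)%R -> (forall t, (0 < t)%R -> ccont f t) -> ex_CInt f a b.
Proof.
intros Ha Hb H. apply ex_CInt_cont. intros t [Ht _]. apply H.
eapply Rlt_le_trans; [|exact Ht]. now apply Rmin_case.
Qed.

Lemma ccont_scal (k : C) (f : R -> C) t : ccont f t -> ccont (fun x => k * f x) t.
Proof. intros H. apply (ccont_mult (fun _ => k) f); [apply continuous_const|exact H]. Qed.

(** The Euler integrand with scaled exponential; its integral over (0, oo) is Gamma(s) tau^-s. *)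
Definition gint (tau : R) (s : C) (t : R) : C := Rcpow t (s - 1) * RtoC (exp (- (t * tau))).

Lemma ccont_gint tau s t : (0 < t)%R -> ccont (gint tau s) t.
Proof.
intros Ht. apply ccont_mult; [now apply ccont_Rcpow|]. apply ccont_RtoC.
apply (ex_derive_continuous (fun t => exp (- (t * tau)))). auto_derive. auto.
Qed.

Lemma Cmod_gint tau s t : Cmod (gint tau s t) = (exp ((Re s - 1) * ln t) * exp (- (t * tau)))%R.
Proof.
unfold gint. rewrite Cmod_mult, Cmod_Rcpow, Cmod_R, (Rabs_pos_eq (exp _)) by (left; apply exp_pos).
reflexivity.
Qed.

Lemma gint_parts tau s al be : (0 < al)%R -> (0 < be)%R ->
  RtoC tau * CInt (gint tau (s + 1)) al be = s * CInt (gint tau s) al be + gint tau (s + 1) al - gint tau (s + 1) be.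
Proof.
intros Ha Hb.
assert (E1 := ex_CInt_pos (gint tau s) al be Ha Hb (ccont_gint tau s)).
assert (E2 := ex_CInt_pos (gint tau (s + 1)) al be Ha Hb (ccont_gint tau (s + 1))).
assert (H : is_CInt (fun t => s * gint tau s t - RtoC tau * gint tau (s + 1) t) al be
   (gint tau (s + 1) be - gint tau (s + 1) al)).
{ apply CInt_FTC; intros x [Hx _]; assert (Px : (0 < x)%R) by (eapply Rlt_le_trans; [|exact Hx]; now apply Rmin_case).
  - replace (s * gint tau s x - RtoC tau * gint tau (s + 1) x) with
     ((s + 1 - 1) * Rcpow x (s + 1 - 1 - 1) * RtoC (exp (- (x * tau))) + Rcpow x (s + 1 - 1) * RtoC (- tau * exp (- (x * tau)))).
    + apply (rder_mult (fun t => Rcpow t (s + 1 - 1)) (fun t => RtoC (exp (- (t * tau)))) x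
        ((s + 1 - 1) * Rcpow x (s + 1 - 1 - 1)) (RtoC (- tau * exp (- (x * tau)))) (rder_Rcpow x (s + 1 - 1) Px)).
      apply rder_RtoC. auto_derive; [auto|]. ring.
    + unfold gint. replace (s + 1 - 1 - 1) with (s - 1) by ring. replace (s + 1 - 1) with s by ring.
      rewrite RtoC_mult, RtoC_opp. ring.
  - apply (ccont_minus (fun t => s * gint tau s t) (fun t => RtoC tau * gint tau (s + 1) t)); apply ccont_scal; now apply ccont_gint. }
apply CInt_unique in H.
rewrite CInt_minus, !CInt_mult in H; [|exact E2|exact E1| |].
- replace (RtoC tau * CInt (gint tau (s + 1)) al be) with
    (s * CInt (gint tau s) al be - (s * CInt (gint tau s) al be - RtoC tau * CInt (gint tau (s + 1)) al be)) by ring.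
  rewrite H. ring.
- destruct E1 as [l Hl]. exists (s * l). now apply is_CInt_mult.
- destruct E2 as [l Hl]. exists (RtoC tau * l). now apply is_CInt_mult.
Qed.

Lemma impr_unique f l1 l2 : impr f l1 -> impr f l2 -> l1 = l2.
Proof.
intros H1 H2. apply NNPP. intros N.
assert (P : (0 < Cmod (l1 - l2))%R).
{ apply Cmod_gt_0. intros E. apply N. replace l1 with (l1 - l2 + l2) by ring. rewrite E; ring. }
assert (P2 : (0 < Cmod (l1 - l2) / 2)%R) by lra.
destruct (H1 (mkposreal _ P2)) as (d1 & B1 & K1). destruct (H2 (mkposreal _ P2)) as (d2 & B2 & K2). simpl in K1, K2.
assert (D1 := cond_pos d1). assert (D2 := cond_pos d2).
set (al := (Rmin d1 d2 / 2)%R). set (be := (Rmax B1 B2 + 1)%R).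
assert (M1 := Rmin_l d1 d2). assert (M2 := Rmin_r d1 d2). assert (M3 : (0 < Rmin d1 d2)%R) by (apply Rmin_case; lra).
assert (M4 := Rmax_l B1 B2). assert (M5 := Rmax_r B1 B2).
assert (A := K1 al be ltac:(unfold al; lra) ltac:(unfold be; lra)).
assert (B := K2 al be ltac:(unfold al; lra) ltac:(unfold be; lra)).
set (v := CInt f al be) in *.
assert (T := Cmod_triangle (- (v - l1)) (v - l2)). rewrite Cmod_opp in T.
replace (- (v - l1) + (v - l2)) with (l1 - l2) in T by ring. lra.
Qed.

Section Gamma.
Variable Gam : C -> C.
Hypothesis HGam : is_gamma Gam.

Lemma Gam_impr s : (0 < Re s)%R -> impr (gint 1 s) (Gam s).
Proof.
intros Hs eps. destruct HGam as [_ H]. specialize (H s Hs).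
assert (HL : locally (T := C_R_NormedModule) (Gam s) (fun z => (Cmod (z - Gam s) < eps)%R)).
{ apply (proj2 (locally_Cmod (Gam s) _)). now exists eps. }
destruct (H _ HL) as [Q1 Q2 [d Hd] [B HB] HQ].
exists d, B. intros al be Hal Hbe.
destruct (HQ al be) as [y [Hy1 Hy2]].
- apply Hd; [|lra]. unfold ball; simpl. unfold AbsRing_ball, abs, minus, plus, opp; simpl.
  rewrite Rabs_pos_eq; lra.
- now apply HB.
- rewrite (CInt_unique (gint 1 s) al be y); [exact Hy2|].
  simpl in Hy1. apply (is_RInt_ext _ _ _ _ _ (fun t _ => eq_sym _) Hy1) || idtac.
  apply (is_RInt_ext (V := C_R_NormedModule) (fun t : R => Rcpow t (s - 1) * exp (- t))); [|exact Hy1].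
  intros t _. unfold gint. now rewrite Rmult_1_r.
Qed.

Lemma Gam_cd s : (forall n : nat, s <> - RtoC (INR n)) -> cd Gam s.
Proof. intros H. apply HGam. exact H. Qed.

Lemma Gam_cd_pos s : (0 < Re s)%R -> cd Gam s.
Proof.
intros H. apply Gam_cd. intros n E. rewrite E in H. simpl in H. generalize (pos_INR n). lra.
Qed.

Lemma Gam_cd_Z s : ~ isZ s -> cd Gam s.
Proof. intros H. apply Gam_cd. intros n E. apply H. rewrite E. apply isZ_opp. replace (- - RtoC (INR n)) with (RtoC (INR n)) by ring. apply isZ_INR. Qed.

Lemma Gam_feq_pos s : (0 < Re s)%R -> Gam (s + 1) = s * Gam s.
Proof.
intros Hs.
assert (Hs1 : (0 < Re (s + 1))%R) by (unfold Re in *; simpl; lra).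
apply (impr_unique (gint 1 (s + 1))); [now apply Gam_impr|].
intros eps. assert (K := Cmod_ge_0 s).
assert (P : (0 < eps / 3 / (Cmod s + 1))%R) by (generalize (cond_pos eps); intros; repeat apply Rdiv_lt_0_compat; lra).
assert (P3 : (0 < eps / 3)%R) by (generalize (cond_pos eps); lra).
destruct (Gam_impr s Hs (mkposreal _ P)) as (d1 & B1 & H1). simpl in H1.
destruct (decay_zero (Re s) (mkposreal _ P3) Hs) as (d2 & D2 & H2). simpl in H2.
destruct (decay_infty (Re s) 1 (mkposreal _ P3) Rlt_0_1) as (B2 & B2' & H3). simpl in H3.
assert (Pd : (0 < Rmin d1 d2)%R) by (apply Rmin_case; apply cond_pos).
exists (mkposreal _ Pd), (Rmax B1 B2). simpl. intros al be Hal Hbe.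
assert (M1 := Rmin_l d1 d2). assert (M2 := Rmin_r d1 d2). assert (M4 := Rmax_l B1 B2). assert (M5 := Rmax_r B1 B2).
assert (E := gint_parts 1 s al be ltac:(lra) ltac:(lra)). rewrite Cmult_1_l in E. rewrite E.
replace (s * CInt (gint 1 s) al be + gint 1 (s + 1) al - gint 1 (s + 1) be - s * Gam s) with
  (s * (CInt (gint 1 s) al be - Gam s) + gint 1 (s + 1) al + - gint 1 (s + 1) be) by ring.
eapply Rle_lt_trans; [apply Cmod_triangle|]. eapply Rle_lt_trans; [apply Rplus_le_compat_r, Cmod_triangle|].
rewrite Cmod_opp, Cmod_mult, !Cmod_gint.
replace (Re (s + 1) - 1)%R with (Re s) by (unfold Re; simpl; ring).
assert (X1 := H1 al be ltac:(lra) ltac:(lra)). assert (X2 := H2 al ltac:(lra)). assert (X3 := H3 be ltac:(lra)).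
assert (X4 : (exp (- (al * 1)) <= 1)%R) by (apply Rle_trans with (exp 0); [apply exp_mono; lra|right; apply exp_0]).
assert (X5 : (exp (Re s * ln al) * exp (- (al * 1)) < eps / 3)%R).
{ generalize (exp_pos (Re s * ln al)) (exp_pos (- (al * 1))). nra. }
assert (X6 : (Cmod s * Cmod (CInt (gint 1 s) al be - Gam s) <= eps / 3)%R).
{ apply Rle_trans with ((Cmod s + 1) * (eps / 3 / (Cmod s + 1)))%R; [|right; field; lra].
  apply Rmult_le_compat; [lra|apply Cmod_ge_0|lra|lra]. }
lra.
Qed.

Lemma Gam_feq s : ~ isZ s -> Gam (s + 1) = s * Gam s.
Proof.
intros Hs.
assert (H := identity_not_Z (fun s => Gam (s + 1) - s * Gam s)).
assert (E : Gam (s + 1) - s * Gam s = 0).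
{ apply H; [| |exact Hs].
  - intros z Hz. apply (cd_minus (V := C_NormedModule)).
    + apply (cd_comp (V := C_NormedModule) (fun z => z + 1) Gam).
      * apply (cd_plus (V := C_NormedModule) (fun z => z)); [apply cd_idC|apply (cd_const (V := C_NormedModule))].
      * apply Gam_cd_Z. intros Q. now apply Hz, isZ_plus_1.
    + apply (cd_mult (V := C_NormedModule) (fun z => z)); [apply cd_idC|now apply Gam_cd_Z].
  - intros z Hz Hr. rewrite Gam_feq_pos by lra. ring. }
replace (Gam (s + 1)) with (Gam (s + 1) - s * Gam s + s * Gam s) by ring. rewrite E. ring.
Qed.

Lemma Gam_pochhammer s n : ~ isZ s -> Gam (s + RtoC (INR n)) = pochhammer s n * Gam s.
Proof.
intros Hs. induction n as [|n IH].
- simpl. rewrite Cplus_0_r. ring.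
- rewrite S_INR, RtoC_plus, Cplus_assoc, Gam_feq.
  + rewrite IH. simpl. ring.
  + intros Q. now apply Hs, (isZ_plus_nat s n).
Qed.

Lemma Gam_pochhammer_pos s n : (0 < Re s)%R -> Gam (s + RtoC (INR n)) = pochhammer s n * Gam s.
Proof.
intros Hs. induction n as [|n IH].
- simpl. rewrite Cplus_0_r. ring.
- rewrite S_INR, RtoC_plus, Cplus_assoc, Gam_feq_pos.
  + rewrite IH. simpl. ring.
  + generalize (pos_INR n). unfold Re in *; simpl. lra.
Qed.

Lemma Gam_scaled s tau : (0 < Re s)%R -> (0 < tau)%R -> impr (gint tau s) (Gam s * Rcpow tau (- s)).
Proof.
intros Hs Ht eps.
assert (P1 : (0 < eps / (exp (- Re s * ln tau)))%R) by (apply Rdiv_lt_0_compat; [apply cond_pos|apply exp_pos]).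
destruct (Gam_impr s Hs (mkposreal _ P1)) as (d & B & H). simpl in H.
assert (P2 : (0 < d / tau)%R) by (apply Rdiv_lt_0_compat; [apply cond_pos|exact Ht]).
exists (mkposreal _ P2), (Rmax 1 (B / tau)). simpl. intros al be Hal Hbe.
assert (Be1 : (1 < be)%R) by (eapply Rle_lt_trans; [apply Rmax_l|exact Hbe]).
assert (Be2 : (B / tau < be)%R) by (eapply Rle_lt_trans; [apply Rmax_r|exact Hbe]).
assert (E : CInt (gint tau s) al be = Rcpow tau (- s) * CInt (gint 1 s) (tau * al) (tau * be)).
{ assert (Ex : ex_CInt (gint 1 s) (tau * al) (tau * be)).
  { apply ex_CInt_pos; [nra|nra|apply ccont_gint]. }
  apply CInt_unique.
  assert (K := is_RInt_comp_lin (V := C_R_NormedModule) (gint 1 s) tau 0 al be (CInt (gint 1 s) (tau * al) (tau * be))).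
  rewrite !Rplus_0_r in K. specialize (K (CInt_correct _ _ _ Ex)).
  apply (is_CInt_mult _ _ _ (Rcpow tau (- s))) in K.
  refine (is_RInt_ext (V := C_R_NormedModule) _ _ _ _ _ _ K).
  intros t [Ht' _].
  assert (Pt : (0 < t)%R) by (eapply Rlt_trans; [|exact Ht']; apply Rmin_case; lra). rewrite Rplus_0_r. ceq.
  transitivity (Rcpow tau (- s) * (RtoC tau * gint 1 s (tau * t))).
  - f_equal. destruct (gint 1 s (tau * t)) as [u v]. apply injective_projections; cbn; unfold mult; cbn; ring.
  - unfold gint. rewrite Rcpow_mult by lra. replace (tau * t * 1)%R with (t * tau)%R by ring.
    rewrite <- (Rcpow_1 tau) by exact Ht.
    transitivity ((Rcpow tau (- s) * Rcpow tau 1 * Rcpow tau (s - 1)) * (Rcpow t (s - 1) * RtoC (exp (- (t * tau))))); [ring|].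
    rewrite <- !Rcpow_plus. replace (- s + 1 + (s - 1)) with (RtoC 0) by ring. rewrite Rcpow_0. ring. }
rewrite E. replace (Rcpow tau (- s) * CInt (gint 1 s) (tau * al) (tau * be) - Gam s * Rcpow tau (- s)) with
  (Rcpow tau (- s) * (CInt (gint 1 s) (tau * al) (tau * be) - Gam s)) by ring.
rewrite Cmod_mult, Cmod_Rcpow. replace (Re (- s)) with (- Re s)%R by reflexivity.
assert (X := H (tau * al)%R (tau * be)%R).
assert (X1 : (Cmod (CInt (gint 1 s) (tau * al) (tau * be) - Gam s) < eps / exp (- Re s * ln tau))%R).
{ apply X.
  - split; [nra|]. destruct Hal as [_ Hal]. apply (Rmult_lt_compat_r tau) in Hal; [|exact Ht].
    unfold Rdiv in Hal. rewrite Rmult_assoc, Rinv_l in Hal by lra. lra.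
  - apply (Rmult_lt_compat_r tau) in Be2; [|exact Ht].
    unfold Rdiv in Be2. rewrite Rmult_assoc, Rinv_l in Be2 by lra. lra. }
assert (Pe := exp_pos (- Re s * ln tau)).
apply (Rmult_lt_compat_l (exp (- Re s * ln tau))) in X1; [|exact Pe].
eapply Rlt_le_trans; [exact X1|]. right. field. lra.
Qed.

Lemma CInt_Re (f : R -> C) a b : ex_CInt f a b -> is_RInt (fun t => Re (f t)) a b (Re (CInt f a b)).
Proof.
intros H. apply (is_RInt_fct_extend_fst (U := R_NormedModule) (V := R_NormedModule) f a b (CInt f a b)).
now apply CInt_correct.
Qed.

Lemma impr_scal f l (k : C) : (forall t, (0 < t)%R -> ccont f t) -> impr f l -> impr (fun t => k * f t) (k * l).
Proof.
intros Hc H eps. assert (K := Cmod_ge_0 k).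
assert (P : (0 < eps / (Cmod k + 1))%R) by (apply Rdiv_lt_0_compat; [apply cond_pos|lra]).
destruct (H (mkposreal _ P)) as (d & B & HB). simpl in HB. exists d, (Rmax B 0). intros al be Hal Hbe.
assert (M1 := Rmax_l B 0). assert (M2 := Rmax_r B 0).
rewrite CInt_mult by (apply ex_CInt_pos; [lra|lra|exact Hc]).
replace (k * CInt f al be - k * l) with (k * (CInt f al be - l)) by ring. rewrite Cmod_mult.
specialize (HB al be Hal ltac:(lra)). apply (Rmult_lt_compat_r (Cmod k + 1)) in HB; [|lra].
unfold Rdiv in HB. rewrite Rmult_assoc, Rinv_l in HB by lra. generalize (Cmod_ge_0 (CInt f al be - l)). nra.
Qed.

Lemma impr_plus f g l m : (forall t, (0 < t)%R -> ccont f t) -> (forall t, (0 < t)%R -> ccont g t) ->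
  impr f l -> impr g m -> impr (fun t => f t + g t) (l + m).
Proof.
intros Cf Cg Hf Hg eps.
destruct (Hf (pos_div_2 eps)) as (d1 & B1 & H1). destruct (Hg (pos_div_2 eps)) as (d2 & B2 & H2). simpl in H1, H2.
assert (Pd : (0 < Rmin d1 d2)%R) by (apply Rmin_case; apply cond_pos).
exists (mkposreal _ Pd), (Rmax 0 (Rmax B1 B2)). simpl. intros al be Hal Hbe.
assert (M1 := Rmin_l d1 d2). assert (M2 := Rmin_r d1 d2). assert (M4 := Rmax_l B1 B2). assert (M5 := Rmax_r B1 B2).
assert (M6 := Rmax_l 0 (Rmax B1 B2)). assert (M7 := Rmax_r 0 (Rmax B1 B2)).
rewrite CInt_plus by (apply ex_CInt_pos; [lra|lra|assumption]).
replace (CInt f al be + CInt g al be - (l + m)) with ((CInt f al be - l) + (CInt g al be - m)) by ring.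
eapply Rle_lt_trans; [apply Cmod_triangle|].
assert (X1 := H1 al be ltac:(lra) ltac:(lra)). assert (X2 := H2 al be ltac:(lra) ltac:(lra)). lra.
Qed.

Lemma impr_Re_le f g l m : (forall t, (0 < t)%R -> ccont f t) -> (forall t, (0 < t)%R -> ccont g t) ->
  impr f l -> impr g m -> (forall t, (0 < t)%R -> (Re (f t) <= Re (g t))%R) -> (Re l <= Re m)%R.
Proof.
intros Cf Cg Hf Hg H. apply Rnot_lt_le. intros N.
assert (P : (0 < (Re l - Re m) / 2)%R) by lra.
destruct (Hf (mkposreal _ P)) as (d1 & B1 & H1). destruct (Hg (mkposreal _ P)) as (d2 & B2 & H2). simpl in H1, H2.
assert (D1 := cond_pos d1). assert (D2 := cond_pos d2).
set (al := (Rmin 1 (Rmin d1 d2) / 2)%R). set (be := (Rmax 1 (Rmax B1 B2) + 1)%R).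
assert (M0 := Rmin_l 1 (Rmin d1 d2)). assert (M00 := Rmin_r 1 (Rmin d1 d2)).
assert (M1 := Rmin_l d1 d2). assert (M2 := Rmin_r d1 d2).
assert (M3 : (0 < Rmin 1 (Rmin d1 d2))%R) by (repeat apply Rmin_case; lra).
assert (M4 := Rmax_l B1 B2). assert (M5 := Rmax_r B1 B2).
assert (M6 := Rmax_l 1 (Rmax B1 B2)). assert (M7 := Rmax_r 1 (Rmax B1 B2)).
assert (A := H1 al be ltac:(unfold al; lra) ltac:(unfold be; lra)).
assert (B := H2 al be ltac:(unfold al; lra) ltac:(unfold be; lra)).
assert (Ef : ex_CInt f al be) by (apply ex_CInt_pos; [unfold al; lra|unfold be; lra|exact Cf]).
assert (Eg : ex_CInt g al be) by (apply ex_CInt_pos; [unfold al; lra|unfold be; lra|exact Cg]).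
assert (Le : (Re (CInt f al be) <= Re (CInt g al be))%R).
{ apply (is_RInt_le (fun t => Re (f t)) (fun t => Re (g t)) al be); [unfold al, be; lra|now apply CInt_Re|now apply CInt_Re|].
  intros t Ht. apply H. unfold al in Ht; lra. }
assert (Q1 := re_le_Cmod (CInt f al be - l)). assert (Q2 := re_le_Cmod (CInt g al be - m)).
replace (Re (CInt f al be - l)) with (Re (CInt f al be) - Re l)%R in Q1 by (unfold Re; simpl; ring).
replace (Re (CInt g al be - m)) with (Re (CInt g al be) - Re m)%R in Q2 by (unfold Re; simpl; ring).
apply Rabs_le_between in Q1. apply Rabs_le_between in Q2. lra.
Qed.

Lemma gint_real (x t : R) : gint 1 (RtoC x) t = RtoC (exp ((x - 1) * ln t) * exp (- t)).
Proof.
unfold gint, Rcpow. rewrite <- RtoC_minus, <- RtoC_mult, Cexp_RtoC, <- RtoC_mult. now rewrite Rmult_1_r.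
Qed.

(** The piece of the integral over [1, 2] is a fixed positive amount, and the rest of the integrand
    is nonnegative. *)
Lemma Gam_Re_pos (x : R) : (0 < x)%R -> (0 < Re (Gam (RtoC x)))%R.
Proof.
intros Hx. assert (HG := Gam_impr (RtoC x) Hx).
set (f := fun t : R => (exp ((x - 1) * ln t) * exp (- t))%R).
assert (Cr : forall t, (0 < t)%R -> ccont (gint 1 (RtoC x)) t) by (intros; now apply ccont_gint).
set (I1 := CInt (gint 1 (RtoC x)) 1 2).
assert (E1 : ex_CInt (gint 1 (RtoC x)) 1 2) by (apply ex_CInt_pos; [lra|lra|exact Cr]).
assert (P1 : (0 < Re I1)%R).
{ assert (K := CInt_Re _ _ _ E1). fold I1 in K.
  apply (is_RInt_ext _ f) in K.
  2: { intros t _. rewrite gint_real. reflexivity. }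
  assert (Y := RInt_gt_0 f 1 2 ltac:(lra)). rewrite (is_RInt_unique _ _ _ _ K) in Y. apply Y.
  - intros t _. unfold f. apply Rmult_lt_0_compat; apply exp_pos.
  - intros t Ht. apply (ex_derive_continuous f). unfold f. auto_derive. lra. }
apply Rnot_le_lt. intros N.
assert (P2 : (0 < Re I1)%R) by exact P1.
destruct (HG (mkposreal _ P2)) as (d & B & H). simpl in H.
assert (D := cond_pos d).
set (al := (Rmin 1 d / 2)%R). set (be := (Rmax 2 B + 1)%R).
assert (M1 := Rmin_l 1 d). assert (M2 := Rmin_r 1 d). assert (M3 : (0 < Rmin 1 d)%R) by (apply Rmin_case; lra).
assert (M4 := Rmax_l 2 B). assert (M5 := Rmax_r 2 B).
assert (A := H al be ltac:(unfold al; lra) ltac:(unfold be; lra)).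
assert (Pos : forall u v, (0 < u <= v)%R -> (0 <= Re (CInt (gint 1 (RtoC x)) u v))%R).
{ intros u v Huv. 
  assert (K := CInt_Re (gint 1 (RtoC x)) u v ltac:(apply ex_CInt_pos; [lra|lra|exact Cr])).
  apply (is_RInt_ge_0 (fun t => Re (gint 1 (RtoC x) t)) u v); [lra|exact K|].
  intros t _. rewrite gint_real. simpl. left. apply Rmult_lt_0_compat; apply exp_pos. }
assert (E : CInt (gint 1 (RtoC x)) al be = CInt (gint 1 (RtoC x)) al 1 + (I1 + CInt (gint 1 (RtoC x)) 2 be)).
{ unfold I1.
  assert (X : forall u v, (0 < u)%R -> (0 < v)%R -> ex_CInt (gint 1 (RtoC x)) u v).
  { intros u v Hu Hv. now apply ex_CInt_pos. }
  rewrite <- (CInt_Chasles (gint 1 (RtoC x)) 1 2 be), <- (CInt_Chasles (gint 1 (RtoC x)) al 1 be); try reflexivity; apply X; unfold al, be; lra. }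
assert (Q := re_le_Cmod (CInt (gint 1 (RtoC x)) al be - Gam (RtoC x))). apply Rabs_le_between in Q.
replace (Re (CInt (gint 1 (RtoC x)) al be - Gam (RtoC x))) with
  (Re (CInt (gint 1 (RtoC x)) al 1) + Re I1 + Re (CInt (gint 1 (RtoC x)) 2 be) - Re (Gam (RtoC x)))%R in Q
  by (rewrite E; unfold Re; simpl; ring).
assert (X1 := Pos al 1%R ltac:(unfold al; lra)). assert (X2 := Pos 2%R be ltac:(unfold be; lra)). lra.
Qed.

(** With w = (ln r) / 2 the right side is (exp w - exp (- w))^2, so the claim is |w| <= sinh |w|. *)
Lemma ln_square_le (r : R) : (0 < r)%R -> (ln r * ln r <= r - 2 + / r)%R.
Proof.
intros Hr. set (w := (ln r / 2)%R).
assert (S1 : forall z, (0 <= z)%R -> (2 * z <= exp z - exp (- z))%R).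
{ intros z Hz. set (g := fun y => (exp y - exp (- y) - 2 * y)%R).
  destruct (MVT_gen g 0 z (fun y => exp y + exp (- y) - 2)%R) as [c [Hc E]].
  - intros y Hy. unfold g. auto_derive; [auto|]. ring.
  - intros y Hy. apply continuity_pt_filterlim. apply (ex_derive_continuous g). unfold g. auto_derive. auto.
  - assert (P : (0 <= exp c + exp (- c) - 2)%R).
    { assert (Y : (exp c * exp (- c) = 1)%R) by (rewrite <- exp_plus, Rplus_opp_r; apply exp_0).
      assert (Y1 := exp_pos c).
      apply (Rmult_le_reg_l (exp c)); [exact Y1|]. rewrite Rmult_0_r.
      replace (exp c * (exp c + exp (- c) - 2))%R with ((exp c - 1) * (exp c - 1))%R; [apply Rle_0_sqr|].
      transitivity (exp c * exp c + exp c * exp (- c) - 2 * exp c)%R; [rewrite Y|]; ring. }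
    unfold g in E. rewrite Ropp_0, exp_0 in E.
    assert (0 <= (exp c + exp (- c) - 2) * (z - 0))%R by (apply Rmult_le_pos; lra). lra. }
assert (S2 : (4 * (w * w) <= (exp w - exp (- w)) * (exp w - exp (- w)))%R).
{ destruct (Rle_dec 0 w) as [H|H].
  - assert (Y := S1 w H). nra.
  - assert (Y := S1 (- w)%R ltac:(lra)). rewrite Ropp_involutive in Y. nra. }
assert (E1 : (exp w * exp w = r)%R).
{ rewrite <- exp_plus. replace (w + w)%R with (ln r) by (unfold w; field). now apply exp_ln. }
assert (E2 : (exp (- w) * exp w = 1)%R) by (rewrite <- exp_plus, Rplus_opp_l; apply exp_0).
assert (E3 : (exp (- w) * exp (- w) = / r)%R).
{ rewrite <- E1. rewrite Rinv_mult, <- exp_Ropp. reflexivity. }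
replace (ln r) with (2 * w)%R by (unfold w; field). nra.
Qed.

(* With s = x + iy, the phase of t^(iy) at the bulk t ~ x of the Gamma distribution varies little
   once x is large compared with y^2. *)
Lemma Gam_neq_0_large (s : C) : (1 + Im s * Im s / 2 < Re s)%R -> Gam s <> 0.
Proof.
intros Hs E. destruct s as [x y]. simpl in Hs.
assert (x1 : (1 < x)%R) by nra.
set (u := Rcpow x (- (0, y)%R)).
set (k := (y * y / 2)%R).
assert (H1 : impr (fun t => u * gint 1 (x, y) t) (u * Gam (x, y))).
{ apply impr_scal; [intros; now apply ccont_gint|]. apply Gam_impr. simpl. lra. }
(* The factor [u] removes the phase at t = x, so Re (u t^(iy)) = cos (y ln (t/x)) >= 1 - k (t/x - 2
   + x/t) with k = y^2 / 2. Integrated against t^(x-1) e^(-t), the right side gives the present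
   combination of Gamma values, which equals (x - 1 - k) Gamma(x - 1) and is positive. *)
assert (H2 : impr (fun t => RtoC (1 + 2 * k) * gint 1 (RtoC x) t + (RtoC (- (k / x)) * gint 1 (RtoC x + 1) t + RtoC (- (k * x)) * gint 1 (RtoC (x - 1)) t))
   (RtoC (1 + 2 * k) * Gam (RtoC x) + (RtoC (- (k / x)) * Gam (RtoC x + 1) + RtoC (- (k * x)) * Gam (RtoC (x - 1))))).
{ assert (Cs : forall c z t, (0 < t)%R -> ccont (fun t => c * gint 1 z t) t).
  { intros c z t Ht. apply ccont_scal. now apply ccont_gint. }
  apply impr_plus; [auto| | |].
  - intros t Ht. apply ccont_plus; auto.
  - apply impr_scal; [intros; now apply ccont_gint|]. apply Gam_impr. simpl. lra.
  - apply impr_plus; auto; (apply impr_scal; [intros; now apply ccont_gint|]); apply Gam_impr; simpl; lra. }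
assert (L := impr_Re_le _ _ _ _ (fun t Ht => ccont_plus _ _ t (ccont_scal _ _ t (ccont_gint 1 (RtoC x) t Ht))
     (ccont_plus _ _ t (ccont_scal _ _ t (ccont_gint 1 (RtoC x + 1) t Ht)) (ccont_scal _ _ t (ccont_gint 1 (RtoC (x - 1)) t Ht))))
   (fun t Ht => ccont_scal u _ t (ccont_gint 1 (x, y) t Ht)) H2 H1).
assert (G0 := Gam_feq_pos (RtoC (x - 1)) ltac:(simpl; lra)).
replace (RtoC (x - 1) + 1) with (RtoC x) in G0 by (rewrite RtoC_minus; ring).
assert (G1 := Gam_feq_pos (RtoC x) ltac:(simpl; lra)).
rewrite E, G1 in L.
assert (GP := Gam_Re_pos (x - 1) ltac:(lra)).
rewrite G0 in L.
replace (Re (u * 0)) with 0%R in L by (unfold Re; simpl; ring).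
set (g := Gam (RtoC (x - 1))) in *.
assert (E5 : Re (RtoC (1 + 2 * k) * (RtoC (x - 1) * g) + (RtoC (- (k / x)) * (RtoC x * (RtoC (x - 1) * g)) + RtoC (- (k * x)) * g)) = ((x - 1 - k) * Re g)%R).
{ unfold Re; simpl. field. lra. }
rewrite E5 in L.
assert (0 < (x - 1 - k) * Re g)%R by (apply Rmult_lt_0_compat; [unfold k; lra|exact GP]).
assert (Goal0 : ((x - 1 - k) * Re g <= 0)%R); [apply L|lra].
intros t Ht.
replace (RtoC x + 1) with (RtoC (x + 1)) by apply RtoC_plus.
rewrite !gint_real, <- !RtoC_mult, <- !RtoC_plus.
set (w := (exp ((x - 1) * ln t) * exp (- t))%R).
assert (Pw : (0 < w)%R) by (apply Rmult_lt_0_compat; apply exp_pos).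
assert (Y1 : (exp ((x + 1 - 1) * ln t) * exp (- t) = t * w)%R).
{ unfold w. replace ((x + 1 - 1) * ln t)%R with ((x - 1) * ln t + ln t)%R by ring. rewrite exp_plus, exp_ln by exact Ht. ring. }
assert (Y2 : (exp ((x - 1 - 1) * ln t) * exp (- t) = / t * w)%R).
{ unfold w. replace ((x - 1 - 1) * ln t)%R with ((x - 1) * ln t + - ln t)%R by ring.
  rewrite exp_plus, exp_Ropp, exp_ln by exact Ht. ring. }
rewrite Y1, Y2.
assert (Y3 : Re (u * gint 1 (x, y) t) = (w * cos (y * (ln t - ln x)))%R).
{ unfold u, gint, Rcpow. rewrite Cmult_assoc, <- Cexp_plus, Rmult_1_r.
  replace (- (0, y)%R * RtoC (ln x) + ((x, y) - 1) * RtoC (ln t)) with (((x - 1) * ln t)%R, (y * (ln t - ln x))%R).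
  - unfold Cexp, Re; simpl. unfold w. ring.
  - apply injective_projections; simpl; ring. }
rewrite Y3.
assert (Q := ln_square_le (t / x) ltac:(apply Rdiv_lt_0_compat; lra)).
rewrite ln_div in Q by lra.
assert (O := one_minus_cos (y * (ln t - ln x))).
assert (Z : (1 - k * (t / x - 2 + / (t / x)) <= cos (y * (ln t - ln x)))%R).
{ unfold k. assert (y * y * ((ln t - ln x) * (ln t - ln x)) <= y * y * (t / x - 2 + / (t / x)))%R by (apply Rmult_le_compat_l; [nra|exact Q]). lra. }
change (Re (RtoC ?z)) with z.
replace ((1 + 2 * k) * w + (- (k / x) * (t * w) + - (k * x) * (/ t * w)))%R with (w * (1 - k * (t / x - 2 + / (t / x))))%R.
- apply Rmult_le_compat_l; lra.
- field. lra.
Qed.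

End Gamma.

(** * Polylogarithms [sum n^-a e^(-n t)] *)

Lemma sum_n_S (u : nat -> C) N : sum_n u (S N) = sum_n u N + u (S N).
Proof. exact (sum_Sn u N). Qed.

Lemma INR_S_pos n : (0 < INR (S n))%R.
Proof. apply lt_0_INR; lia. Qed.

(** * Series majorised by a multiple of 1 / n^2 *)

Section Mtest.
Variables (u : nat -> C) (A : R).
Hypothesis Hu : forall n, (Cmod (u n) <= A * / INR (S n) ^ 2)%R.

Lemma mtest_nonneg : (0 <= A)%R.
Proof.
assert (H := Hu O). simpl in H. rewrite !Rmult_1_r, Rinv_1 in H. generalize (Cmod_ge_0 (u O)). lra.
Qed.

(** The majorant telescopes: 1 / (x+1)^2 <= 1/x - 1/(x+1). The resulting tail bound A / (N+1) serves
    as an explicit rate in later limit exchanges. *)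
Lemma mtest_diff N k : (Cmod (sum_n u (N + k) - sum_n u N) <= A * (/ INR (S N) - / INR (S (N + k))))%R.
Proof.
assert (A0 := mtest_nonneg).
induction k as [|k IH].
- rewrite Nat.add_0_r. replace (sum_n u N - sum_n u N) with (RtoC 0) by ring. rewrite Cmod_0. lra.
- rewrite Nat.add_succ_r, sum_n_S.
  replace (sum_n u (N + k) + u (S (N + k)) - sum_n u N) with ((sum_n u (N + k) - sum_n u N) + u (S (N + k))) by ring.
  eapply Rle_trans; [apply Cmod_triangle|].
  assert (H := Hu (S (N + k))).
  set (x := INR (S (N + k))) in *.
  assert (Px : (0 < x)%R) by apply INR_S_pos.
  assert (E : INR (S (S (N + k))) = (x + 1)%R) by (rewrite S_INR; reflexivity). rewrite E in *.
  assert (Q : (/ (x + 1) ^ 2 <= / x - / (x + 1))%R).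
  { apply (Rmult_le_reg_r (x * (x + 1) ^ 2)); [apply Rmult_lt_0_compat; [exact Px|apply pow_lt; lra]|].
    replace (/ (x + 1) ^ 2 * (x * (x + 1) ^ 2))%R with x by (field; lra).
    replace ((/ x - / (x + 1)) * (x * (x + 1) ^ 2))%R with (x + 1)%R by (field; lra). lra. }
  apply (Rmult_le_compat_l A) in Q; [|exact A0]. lra.
Qed.

Lemma mtest_diff_le N M : (N <= M)%nat -> (Cmod (sum_n u M - sum_n u N) <= A * / INR (S N))%R.
Proof.
intros H. assert (E : exists k, M = (N + k)%nat) by (exists (M - N)%nat; lia). destruct E as [k ->].
eapply Rle_trans; [apply mtest_diff|].
apply Rmult_le_compat_l; [apply mtest_nonneg|].
assert (P := Rinv_0_lt_compat _ (INR_S_pos (N + k))). lra.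
Qed.

Lemma mtest_partial N : (Cmod (sum_n u N) <= 2 * A)%R.
Proof.
replace (sum_n u N) with ((sum_n u N - sum_n u O) + sum_n u O) by ring.
eapply Rle_trans; [apply Cmod_triangle|].
assert (H := mtest_diff_le O N ltac:(lia)). assert (H0 := Hu O).
change (INR 1) with 1%R in *. rewrite pow1, Rinv_1 in *.
rewrite (sum_O u) in *. lra.
Qed.

Lemma mtest_ex : exists l, Clim (sum_n u) l.
Proof.
apply Clim_cauchy. intros eps. destruct (inv_INR_small A eps) as [N HN]. exists N.
assert (K : forall n m, (N <= n <= m)%nat -> (Cmod (sum_n u m - sum_n u n) < eps)%R).
{ intros n m H. eapply Rle_lt_trans; [apply mtest_diff_le; lia|]. apply HN; lia. }
intros n m Hn Hm. destruct (Nat.le_ge_cases n m) as [H|H].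
- rewrite <- Cmod_opp. replace (- (sum_n u n - sum_n u m)) with (sum_n u m - sum_n u n) by ring. apply K; lia.
- apply K; lia.
Qed.

Lemma mtest_tail l N : Clim (sum_n u) l -> (Cmod (sum_n u N - l) <= A * / INR (S N))%R.
Proof.
intros H. rewrite <- Cmod_opp. replace (- (sum_n u N - l)) with (l - sum_n u N) by ring.
apply (Clim_le_const (fun M => sum_n u M - sum_n u N) _ _ N).
- apply Clim_minus; [exact H|apply Clim_const].
- intros M HM. now apply mtest_diff_le.
Qed.

Lemma mtest_sum l : Clim (sum_n u) l -> (Cmod l <= 2 * A)%R.
Proof. intros H. apply (Clim_le_const (sum_n u) l _ O H). intros n _. apply mtest_partial. Qed.

End Mtest.

Definition Csum (u : nat -> C) : C := epsilon (inhabits (RtoC 0)) (Clim (sum_n u)).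

Lemma Csum_correct u A : (forall n, (Cmod (u n) <= A * / INR (S n) ^ 2)%R) -> Clim (sum_n u) (Csum u).
Proof. intros H. unfold Csum. apply epsilon_spec. now apply (mtest_ex u A). Qed.

Definition pl_term (a : C) (t : R) (n : nat) : C := Rcpow (INR (S n)) (- a) * RtoC (exp (- (INR (S n) * t))).
Definition pl_sum (a : C) (t : R) (N : nat) : C := sum_n (pl_term a t) N.
Definition polylog (a : C) (t : R) : C := Csum (pl_term a t).

(** Half of the exponential absorbs the power growth, n^k e^(-n t / 2) <= k! (2 / t)^k, and the
    other half is at most e^(-t / 2) and kept for decay at infinity. With k >= 2 - Re a a summable
    factor 1 / n^2 is left over. *)
Definition pl_const (k : nat) (t : R) : R := (INR (fact k) * 2 ^ k * (/ t) ^ k * exp (- (t / 2)))%R.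

Lemma exp_ln_INR_le (sg : R) (n k : nat) : (- sg <= INR k - 2)%R ->
  (exp (- sg * ln (INR (S n))) <= INR (S n) ^ k * / INR (S n) ^ 2)%R.
Proof.
intros H. assert (P := INR_S_pos n).
assert (L0 : (0 <= ln (INR (S n)))%R).
{ rewrite <- ln_1. apply ln_le; [lra|]. rewrite S_INR. generalize (pos_INR n). lra. }
apply Rle_trans with (exp ((INR k - 2) * ln (INR (S n)))).
- apply exp_mono. now apply Rmult_le_compat_r.
- right. replace ((INR k - 2) * ln (INR (S n)))%R with (INR k * ln (INR (S n)) + - (INR 2 * ln (INR (S n))))%R by (simpl; ring).
  rewrite exp_plus, exp_Ropp. f_equal; [|f_equal]; (rewrite <- Rpower_pow by exact P; reflexivity).
Qed.

Lemma pl_term_bound a t k n : (2 - Re a <= INR k)%R -> (0 < t)%R ->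
  (Cmod (pl_term a t n) <= pl_const k t * / INR (S n) ^ 2)%R.
Proof.
intros Hk Ht. unfold pl_term. rewrite Cmod_mult, Cmod_Rcpow, Cmod_R, (Rabs_pos_eq (exp (- (INR (S n) * t)))) by (left; apply exp_pos).
assert (P := INR_S_pos n). set (x := INR (S n)) in *.
assert (Px1 : (1 <= x)%R) by (unfold x; rewrite S_INR; generalize (pos_INR n); lra).
assert (B1 := exp_ln_INR_le (Re a) n k ltac:(lra)). fold x in B1.
replace (Re (- a)) with (- Re a)%R by reflexivity.
assert (B2 : (x ^ k * exp (- (x * t)) <= pl_const k t)%R).
{ assert (Q := pow_le_fact_exp k (x * t / 2) ltac:(nra)).
  unfold pl_const.
  replace (exp (- (x * t))) with (exp (- (x * t / 2)) * exp (- (x * t / 2)))%R by (rewrite <- exp_plus; f_equal; field).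
  assert (Q2 : (x ^ k * exp (- (x * t / 2)) <= INR (fact k) * 2 ^ k * (/ t) ^ k)%R).
  { rewrite exp_Ropp. apply (Rmult_le_reg_r (exp (x * t / 2) * (t / 2) ^ k)).
    { apply Rmult_lt_0_compat; [apply exp_pos|apply pow_lt; lra]. }
    replace (x ^ k * / exp (x * t / 2) * (exp (x * t / 2) * (t / 2) ^ k))%R with (x ^ k * (t / 2) ^ k)%R
      by (field; apply Rgt_not_eq, exp_pos).
    rewrite <- Rpow_mult_distr. replace (x * (t / 2))%R with (x * t / 2)%R by field.
    eapply Rle_trans; [exact Q|]. right.
    replace (INR (fact k) * 2 ^ k * (/ t) ^ k * (exp (x * t / 2) * (t / 2) ^ k))%R with
      (INR (fact k) * exp (x * t / 2) * (2 ^ k * (/ t) ^ k * (t / 2) ^ k))%R by ring.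
    rewrite <- !Rpow_mult_distr. replace (2 * / t * (t / 2))%R with 1%R by (field; lra). rewrite pow1. ring. }
  rewrite <- Rmult_assoc. apply Rmult_le_compat; [|left; apply exp_pos|exact Q2|].
  - apply Rmult_le_pos; [apply pow_le; lra|left; apply exp_pos].
  - apply exp_mono. nra. }
assert (Px2 : (0 < / x ^ 2)%R) by (apply Rinv_0_lt_compat, pow_lt; lra).
apply Rle_trans with (x ^ k * / x ^ 2 * exp (- (x * t)))%R.
- apply Rmult_le_compat_r; [left; apply exp_pos|exact B1].
- replace (x ^ k * / x ^ 2 * exp (- (x * t)))%R with (x ^ k * exp (- (x * t)) * / x ^ 2)%R by ring.
  apply Rmult_le_compat_r; [lra|exact B2].
Qed.

Lemma polylog_lim a t : (0 < t)%R -> Clim (pl_sum a t) (polylog a t).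
Proof.
intros Ht. destruct (nat_above (2 - Re a)) as [k Hk].
apply (Csum_correct _ (pl_const k t)). intros n. now apply pl_term_bound.
Qed.

Lemma polylog_tail a t k N : (2 - Re a <= INR k)%R -> (0 < t)%R ->
  (Cmod (pl_sum a t N - polylog a t) <= pl_const k t * / INR (S N))%R.
Proof.
intros Hk Ht. apply (mtest_tail (pl_term a t)); [intros n; now apply pl_term_bound|now apply polylog_lim].
Qed.

Lemma pl_sum_bound a t k N : (2 - Re a <= INR k)%R -> (0 < t)%R -> (Cmod (pl_sum a t N) <= 2 * pl_const k t)%R.
Proof. intros Hk Ht. apply mtest_partial. intros n; now apply pl_term_bound. Qed.

Lemma polylog_bound a t k : (2 - Re a <= INR k)%R -> (0 < t)%R -> (Cmod (polylog a t) <= 2 * pl_const k t)%R.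
Proof.
intros Hk Ht. apply (mtest_sum (pl_term a t)); [intros n; now apply pl_term_bound|now apply polylog_lim].
Qed.

Lemma pl_const_mono k s t : (0 < s <= t)%R -> (pl_const k t <= pl_const k s)%R.
Proof.
intros H. unfold pl_const. apply Rmult_le_compat.
- repeat apply Rmult_le_pos; try (apply pow_le; try lra); [left; apply INR_fact_lt_0|].
  left; apply Rinv_0_lt_compat; lra.
- left; apply exp_pos.
- apply Rmult_le_compat_l; [apply Rmult_le_pos; [left; apply INR_fact_lt_0|apply pow_le; lra]|].
  apply pow_incr. split; [left; apply Rinv_0_lt_compat; lra|]. apply Rinv_le_contravar; lra.
- apply exp_mono. lra.
Qed.

Lemma cd_sum_n {V : NormedModule C_AbsRing} (f : nat -> V -> C) x N :
  (forall n, (n <= N)%nat -> cd (f n) x) -> cd (fun y => sum_n (fun n => f n y) N) x.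
Proof.
induction N as [|N IH]; intros H.
- apply (cd_ext (f O)); [intros y; now rewrite sum_O|]. now apply H.
- apply (cd_ext (fun y => sum_n (fun n => f n y) N + f (S N) y)); [intros y; now rewrite sum_n_S|].
  apply cd_plus; [apply IH; intros; apply H; lia|apply H; lia].
Qed.

Lemma pl_sum_cd t N a : cd (fun a => pl_sum a t N) a.
Proof.
apply (cd_sum_n (V := C_NormedModule)). intros n _. unfold pl_term.
apply (cd_mult (V := C_NormedModule)); [|apply (cd_const (V := C_NormedModule))].
apply (cd_Rcpow (V := C_NormedModule)). apply (cd_opp (V := C_NormedModule) (fun a => a)), cd_idC.
Qed.

Lemma Re_lower (a b : C) (r : R) : (Cmod (b - a) < r)%R -> (Re a - r < Re b)%R.
Proof.
intros H. assert (Q := re_le_Cmod (b - a)). apply Rabs_le_between in Q.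
replace (Re (b - a)) with (Re b - Re a)%R in Q by (unfold Re; simpl; ring). lra.
Qed.

Lemma polylog_cd t a : (0 < t)%R -> cd (fun a => polylog a t) a.
Proof.
intros Ht. destruct (nat_above (3 - Re a)) as [k Hk].
apply (cd_bounded_limit (V := C_NormedModule) (fun N a => pl_sum a t N) _ a 1 (2 * pl_const k t)); [lra| | |].
- intros n y _. apply pl_sum_cd.
- intros n y Hy. apply pl_sum_bound; [|exact Ht].
  assert (Q := Re_lower a y 1 Hy). lra.
- intros y _. now apply polylog_lim.
Qed.

Lemma rder_sum_n (f d : nat -> R -> C) x N : (forall n, rder (f n) x (d n x)) ->
  rder (fun y => sum_n (fun n => f n y) N) x (sum_n (fun n => d n x) N).
Proof.
intros H. induction N as [|N IH].
- rewrite sum_O. apply (rder_ext_locally (f O)); [apply filter_forall; intros y; now rewrite sum_O|apply H].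
- rewrite sum_n_S. apply (rder_ext_locally (fun y => sum_n (fun n => f n y) N + f (S N) y)).
  { apply filter_forall; intros y; now rewrite sum_n_S. }
  now apply rder_plus.
Qed.

Lemma rder_pl_term a t n : rder (fun t => pl_term a t n) t (- pl_term (a - 1) t n).
Proof.
unfold pl_term. assert (P := INR_S_pos n).
replace (- (Rcpow (INR (S n)) (- (a - 1)) * RtoC (exp (- (INR (S n) * t))))) with
  (Rcpow (INR (S n)) (- a) * RtoC (- INR (S n) * exp (- (INR (S n) * t)))).
- apply rder_scal, rder_RtoC. set (x := INR (S n)). auto_derive; [auto|]. ring.
- replace (- (a - 1)) with (- a + 1) by ring. rewrite Rcpow_plus, (Rcpow_1 _ P), RtoC_mult, RtoC_opp. ring.
Qed.

Lemma sum_n_opp (u : nat -> C) N : sum_n (fun n => - u n) N = - sum_n u N.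
Proof.
induction N as [|N IH]; [now rewrite !sum_O|]. rewrite !sum_n_S, IH. ceq. ring.
Qed.

Lemma rder_pl_sum a t N : rder (fun t => pl_sum a t N) t (- pl_sum (a - 1) t N).
Proof.
unfold pl_sum. rewrite <- sum_n_opp. apply (rder_sum_n (fun n t => pl_term a t n) (fun n t => - pl_term (a - 1) t n)).
intros n. apply rder_pl_term.
Qed.

Lemma rder_mean_value_sym (f : R -> C) (x y M : R) :
  (forall z, (Rmin x y <= z <= Rmax x y)%R -> exists l, rder f z l /\ (Cmod l <= M)%R) ->
  (Cmod (f y - f x) <= M * Rabs (y - x))%R.
Proof.
intros H. destruct (Rle_dec x y) as [L|L].
- rewrite Rmin_left, Rmax_right in H by lra. rewrite Rabs_pos_eq by lra. now apply rder_mean_value.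
- rewrite Rmin_right, Rmax_left in H by lra. rewrite Rabs_left by lra.
  rewrite <- Cmod_opp. replace (- (f y - f x)) with (f x - f y) by ring.
  replace (- (y - x))%R with (x - y)%R by ring. apply rder_mean_value; [lra|exact H].
Qed.

(** The second derivatives of the partial sums are partial sums at a - 2, bounded on [t/2, oo)
    uniformly in N. Two mean value estimates give a second-order remainder bound independent of N,
    which passes to the limit. *)
Lemma rder_polylog a t : (0 < t)%R -> rder (polylog a) t (- polylog (a - 1) t).
Proof.
intros Ht. destruct (nat_above (2 - Re (a - 2))) as [k Hk].
set (B := (2 * pl_const k (t / 2))%R).
assert (B0 : (0 <= B)%R).
{ eapply Rle_trans; [apply Cmod_ge_0|]. apply (pl_sum_bound (a - 2) (t / 2) k O Hk). lra. }
assert (H2 : forall N x, (t / 2 <= x)%R -> (Cmod (pl_sum (a - 2) x N) <= B)%R).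
{ intros N x Hx. eapply Rle_trans; [apply (pl_sum_bound (a - 2) x k N Hk); lra|].
  unfold B. apply Rmult_le_compat_l; [lra|]. apply pl_const_mono. lra. }
assert (H1 : forall N x y, (t / 2 <= x)%R -> (t / 2 <= y)%R -> (Cmod (pl_sum (a - 1) y N - pl_sum (a - 1) x N) <= B * Rabs (y - x))%R).
{ intros N x y Hx Hy. apply (rder_mean_value_sym (fun t => pl_sum (a - 1) t N)). intros z Hz.
  exists (- pl_sum (a - 1 - 1) z N). split; [apply rder_pl_sum|]. rewrite Cmod_opp.
  replace (a - 1 - 1) with (a - 2) by ring. apply H2. eapply Rle_trans; [|apply Hz]. now apply Rmin_case. }
assert (H0 : forall N y, (t / 2 <= y)%R -> (Cmod (pl_sum a y N - pl_sum a t N - (- pl_sum (a - 1) t N) * RtoC (y - t)) <= B * Rabs (y - t) * Rabs (y - t))%R).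
{ intros N y Hy.
  replace (pl_sum a y N - pl_sum a t N - - pl_sum (a - 1) t N * RtoC (y - t)) with
    ((pl_sum a y N + pl_sum (a - 1) t N * RtoC y) - (pl_sum a t N + pl_sum (a - 1) t N * RtoC t)) by (rewrite RtoC_minus; ring).
  apply (rder_mean_value_sym (fun x => pl_sum a x N + pl_sum (a - 1) t N * RtoC x)). intros z Hz.
  exists (- pl_sum (a - 1) z N + pl_sum (a - 1) t N * RtoC 1). split.
  - apply rder_plus; [apply rder_pl_sum|]. apply rder_scal, (rder_RtoC (fun x => x)). auto_derive; auto.
  - assert (Hz2 : (t / 2 <= z)%R) by (eapply Rle_trans; [|apply Hz]; apply Rmin_case; lra).
    replace (- pl_sum (a - 1) z N + pl_sum (a - 1) t N * RtoC 1) with (- (pl_sum (a - 1) z N - pl_sum (a - 1) t N)) by ring.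
    rewrite Cmod_opp. eapply Rle_trans; [apply H1; lra|]. apply Rmult_le_compat_l; [exact B0|].
    unfold Rmin, Rmax in Hz. destruct (Rle_dec t y); [rewrite !Rabs_pos_eq by lra; lra|rewrite !Rabs_left1 by lra; lra]. }
intros eps. assert (P : (0 < Rmin (t / 2) (eps / (B + 1)))%R).
{ apply Rmin_case; [lra|]. apply Rdiv_lt_0_compat; [apply cond_pos|lra]. }
exists (mkposreal _ P). intros y Hy. change (Rabs (y - t) < Rmin (t / 2) (eps / (B + 1)))%R in Hy.
assert (Y1 := Rlt_le_trans _ _ _ Hy (Rmin_l _ _)). assert (Y2 := Rlt_le_trans _ _ _ Hy (Rmin_r _ _)).
assert (Y3 : (t / 2 <= y)%R) by (apply Rabs_lt_between in Y1; lra).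
assert (Z := Rabs_pos (y - t)).
apply Rle_trans with (B * Rabs (y - t) * Rabs (y - t))%R.
- apply (Clim_le_const (fun N => pl_sum a y N - pl_sum a t N - - pl_sum (a - 1) t N * RtoC (y - t)) _ _ O).
  + apply Clim_minus; [apply Clim_minus; apply polylog_lim; lra|].
    apply (Clim_ext (fun N => - RtoC (y - t) * pl_sum (a - 1) t N)); [intros; ring|].
    replace (- polylog (a - 1) t * RtoC (y - t)) with (- RtoC (y - t) * polylog (a - 1) t) by ring.
    apply Clim_scal, polylog_lim. exact Ht.
  + intros N _. now apply H0.
- apply Rmult_le_compat_r; [exact Z|].
  apply (Rmult_lt_compat_r (B + 1)) in Y2; [|lra]. unfold Rdiv in Y2. rewrite Rmult_assoc, Rinv_l in Y2 by lra. nra.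
Qed.

Lemma ccont_polylog a t : (0 < t)%R -> ccont (polylog a) t.
Proof. intros Ht. apply (rder_ccont _ _ _ (rder_polylog a t Ht)). Qed.

(* Only small [t] matters: large [t] is controlled by exponential decay. *)
Definition loc_bounded (f : C -> R -> C) (a0 : C) : Prop :=
  exists M : R, locally a0 (fun a => forall t, (0 < t <= 1)%R -> (Cmod (f a t) <= M)%R).

Lemma loc_bounded_ext f g a0 : locally a0 (fun a => forall t, (0 < t <= 1)%R -> f a t = g a t) -> loc_bounded f a0 -> loc_bounded g a0.
Proof.
intros E [M H]. exists M. generalize (filter_and _ _ E H). apply filter_imp.
intros a [A B] t Ht. rewrite <- A by exact Ht. now apply B.
Qed.

Lemma loc_bounded_plus f g a0 : loc_bounded f a0 -> loc_bounded g a0 -> loc_bounded (fun a t => f a t + g a t) a0.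
Proof.
intros [M H] [N K]. exists (M + N)%R. generalize (filter_and _ _ H K). apply filter_imp.
intros a [A B] t Ht. eapply Rle_trans; [apply Cmod_triangle|]. specialize (A t Ht). specialize (B t Ht). lra.
Qed.

Lemma loc_bounded_mult f g a0 : loc_bounded f a0 -> loc_bounded g a0 -> loc_bounded (fun a t => f a t * g a t) a0.
Proof.
intros [M H] [N K]. exists (M * N)%R. generalize (filter_and _ _ H K). apply filter_imp.
intros a [A B] t Ht. rewrite Cmod_mult. apply Rmult_le_compat; try apply Cmod_ge_0; auto.
Qed.

Lemma loc_bounded_opp f a0 : loc_bounded f a0 -> loc_bounded (fun a t => - f a t) a0.
Proof.
intros [M H]. exists M. generalize H. apply filter_imp. intros a A t Ht. rewrite Cmod_opp. auto.
Qed.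

Lemma loc_bounded_cont (f : C -> C) a0 : cd f a0 -> loc_bounded (fun a _ => f a) a0.
Proof.
intros H. exists (Cmod (f a0) + 1)%R.
assert (K := continuous_C_eps_inv f a0 (cd_continuous (V := C_NormedModule) f a0 H) (mkposreal 1 Rlt_0_1)).
simpl in K. generalize K. apply filter_imp. intros a Ha t _.
replace (f a) with (f a0 + (f a - f a0)) by ring. eapply Rle_trans; [apply Cmod_triangle|]. lra.
Qed.

Lemma loc_bounded_bound (f : C -> R -> C) a0 M : (forall a t, (0 < t <= 1)%R -> (Cmod (f a t) <= M)%R) -> loc_bounded f a0.
Proof. intros H. exists M. apply filter_forall. intros a t Ht. now apply H. Qed.

Lemma locally_shift (a0 c : C) (P : C -> Prop) : locally (a0 + c) P -> locally a0 (fun a => P (a + c)).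
Proof.
intros H. apply locally_Cmod in H. destruct H as [d Hd]. apply locally_Cmod. exists d.
intros w Hw. apply Hd. replace (w + c - (a0 + c)) with (w - a0) by ring. exact Hw.
Qed.

Lemma loc_bounded_shift f a0 c : loc_bounded f (a0 + c) -> loc_bounded (fun a t => f (a + c) t) a0.
Proof. intros [M H]. exists M. apply (locally_shift a0 c _ H). Qed.

Lemma loc_bounded_sum_n (f : nat -> C -> R -> C) a0 k : (forall i, (i <= k)%nat -> loc_bounded (f i) a0) ->
  loc_bounded (fun a t => sum_n (fun i => f i a t) k) a0.
Proof.
induction k as [|k IH]; intros H.
- apply (loc_bounded_ext (f O)); [apply filter_forall; intros a t _; now rewrite sum_O|apply H; lia].
- apply (loc_bounded_ext (fun a t => sum_n (fun i => f i a t) k + f (S k) a t)).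
  + apply filter_forall; intros a t _; now rewrite sum_n_S.
  + apply loc_bounded_plus; [apply IH; intros; apply H; lia|apply H; lia].
Qed.

Lemma is_CInt_sum_n (f : nat -> R -> C) (l : nat -> C) a b k : (forall i, is_CInt (f i) a b (l i)) ->
  is_CInt (fun t => sum_n (fun i => f i t) k) a b (sum_n l k).
Proof.
intros H. induction k as [|k IH].
- rewrite sum_O. apply (is_RInt_ext (V := C_R_NormedModule) (f O)); [|apply H]. intros t _. symmetry. exact (sum_O (fun i => f i t)).
- rewrite sum_n_S. apply (is_RInt_ext (V := C_R_NormedModule) (fun t => sum_n (fun i => f i t) k + f (S k) t)).
  + intros t _. symmetry. exact (sum_n_S (fun i => f i t) k).
  + apply (is_RInt_plus (V := C_R_NormedModule)); [exact IH|apply H].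
Qed.

Lemma sum_n_plus_C (u v : nat -> C) k : sum_n (fun i => u i + v i) k = sum_n u k + sum_n v k.
Proof. exact (sum_n_plus u v k). Qed.

Lemma Clim_sum_n (u : nat -> nat -> C) (l : nat -> C) k : (forall i, Clim (fun n => u n i) (l i)) ->
  Clim (fun n => sum_n (u n) k) (sum_n l k).
Proof.
intros H. induction k as [|k IH].
- rewrite sum_O. apply (Clim_ext (fun n => u n O)); [intros n; now rewrite sum_O|apply H].
- rewrite sum_n_S. apply (Clim_ext (fun n => sum_n (u n) k + u n (S k))); [intros n; now rewrite sum_n_S|].
  now apply Clim_plus.
Qed.

(** The moments of e^(-u t) on the unit interval; they are the coefficients that arise when a unit
    cell is expanded in powers of the offset u. *)
Definition mu (i : nat) (t : R) : C := CInt (fun u => RtoC (u ^ i * exp (- (u * t)))) 0 1.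

Lemma ccont_mu i t u : ccont (fun u => RtoC (u ^ i * exp (- (u * t)))) u.
Proof. apply ccont_RtoC. apply (ex_derive_continuous (fun u => u ^ i * exp (- (u * t)))%R). auto_derive. auto. Qed.

Lemma is_CInt_mu i t : is_CInt (fun u => RtoC (u ^ i * exp (- (u * t)))) 0 1 (mu i t).
Proof. apply CInt_correct, ex_CInt_cont. intros u _. apply ccont_mu. Qed.

Lemma mu_bound i t : (0 <= t)%R -> (Cmod (mu i t) <= 1)%R.
Proof.
intros Ht. replace 1%R with (1 * (1 - 0))%R by ring. apply CInt_bound; [lra|eexists; apply is_CInt_mu|].
intros u Hu. rewrite Cmod_R, Rabs_pos_eq.
- assert (u ^ i <= 1)%R by (rewrite <- (pow1 i); apply pow_incr; lra).
  assert (0 <= u ^ i)%R by (apply pow_le; lra).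
  assert (exp (- (u * t)) <= 1)%R by (rewrite <- exp_0; apply exp_mono; nra).
  assert (0 < exp (- (u * t)))%R by apply exp_pos. nra.
- apply Rmult_le_pos; [apply pow_le; lra|left; apply exp_pos].
Qed.

Lemma mu_0_lower t : (0 <= t <= 1)%R -> (exp (-1) <= Cmod (mu 0 t))%R.
Proof.
intros Ht. eapply Rle_trans; [|apply Re_le_Cmod].
assert (K := CInt_Re _ _ _ (ex_intro _ _ (is_CInt_mu 0 t))). fold (mu 0 t) in K.
assert (K1 := is_RInt_const (V := R_NormedModule) 0 1 (exp (-1))).
replace (exp (-1)) with (scal (1 - 0)%R (exp (-1))) at 1.
2: { unfold scal; simpl. unfold mult; simpl. ring. }
apply (is_RInt_le _ _ 0 1 _ _ ltac:(lra) K1 K).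
intros u Hu. simpl. rewrite Rmult_1_l. apply exp_mono. nra.
Qed.

Definition exp_rem (K : nat) (x : R) : R := (exp x - match K with O => 0 | S k => sum_n (fun i => x ^ i / INR (fact i)) k end)%R.

Lemma exp_rem_S K x : exp_rem (S K) x = (exp_rem K x - x ^ K / INR (fact K))%R.
Proof.
unfold exp_rem. destruct K as [|K].
- rewrite sum_O. simpl. field.
- rewrite sum_Sn. unfold plus; simpl. ring.
Qed.

Lemma exp_rem_bound K : forall x, (0 <= x <= 1)%R -> (Rabs (exp_rem K x) <= exp 1 * x ^ K)%R.
Proof.
assert (D : forall K x, is_derive (exp_rem (S K)) x (exp_rem K x)).
{ clear K. induction K as [|K IH]; intros x.
  - apply (is_derive_ext (fun y => exp y - 1)%R); [intros y; unfold exp_rem; rewrite sum_O; simpl; field|].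
    unfold exp_rem. auto_derive; [auto|]. ring.
  - apply (is_derive_ext (fun y => exp_rem (S K) y - y ^ S K / INR (fact (S K)))%R).
    { intros y. now rewrite (exp_rem_S (S K)). }
    rewrite (exp_rem_S K).
    apply (is_derive_minus (exp_rem (S K)) (fun y => y ^ S K / INR (fact (S K)))%R); [apply IH|].
    assert (F := INR_fact_neq_0 (S K)). assert (F0 := INR_fact_neq_0 K).
    replace (x ^ K / INR (fact K))%R with (INR (S K) * x ^ K / INR (fact (S K)))%R.
    + unfold Rdiv. generalize (/ INR (fact (S K)))%R. intros r. auto_derive; [auto|]. rewrite S_INR. cbn [Init.Nat.pred pow]. simpl. destruct K; simpl; ring.
    + rewrite fact_simpl, mult_INR. field. split; [exact F0|apply not_0_INR; lia]. }
assert (Z : forall K, exp_rem (S K) 0 = 0%R).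
{ intros n. induction n as [|n IH].
  - unfold exp_rem. rewrite sum_O, exp_0. simpl. field.
  - rewrite exp_rem_S, IH. rewrite pow_ne_zero by lia. unfold Rdiv. ring. }
induction K as [|K IH]; intros x Hx.
- unfold exp_rem. rewrite Rminus_0_r, Rabs_pos_eq by (left; apply exp_pos). simpl. rewrite Rmult_1_r. apply exp_mono; lra.
- replace (exp 1 * x ^ S K)%R with (exp 1 * x ^ K * x)%R by (simpl; ring).
  destruct (MVT_gen (exp_rem (S K)) 0 x (exp_rem K)) as [c [Hc E]].
  + intros y _. apply D.
  + intros y _. apply continuity_pt_filterlim. apply (ex_derive_continuous (exp_rem (S K))). eexists. apply D.
  + rewrite Rmin_left, Rmax_right in Hc by lra. rewrite Z, !Rminus_0_r in E. rewrite E, Rabs_mult, (Rabs_pos_eq x) by lra.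
    apply Rmult_le_compat_r; [lra|]. eapply Rle_trans; [apply IH; lra|].
    apply Rmult_le_compat_l; [left; apply exp_pos|]. apply pow_incr. lra.
Qed.

Lemma RtoC_sum_n (u : nat -> R) k : RtoC (sum_n u k) = sum_n (fun i => RtoC (u i)) k.
Proof.
induction k as [|k IH]; [now rewrite !sum_O|].
rewrite sum_n_S, <- IH, <- RtoC_plus. f_equal. exact (sum_Sn u k).
Qed.

(** Expand the factor e^(u t) in 1 = e^(-u t) e^(u t) and integrate over u in [0, 1]. *)
Lemma mu_taylor k t : (0 <= t <= 1)%R ->
  (Cmod (1 - sum_n (fun i => (mu i t * RtoC (t ^ i / INR (fact i)))%C) k) <= exp 1 * t ^ S k)%R.
Proof.
intros Ht.
assert (H : is_CInt (fun u => RtoC (exp (- (u * t)) * exp_rem (S k) (u * t))) 0 1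
  (1 - sum_n (fun i => mu i t * RtoC (t ^ i / INR (fact i))) k)).
{ apply (is_RInt_ext (V := C_R_NormedModule) (fun u => 1 - sum_n (fun i => RtoC (t ^ i / INR (fact i)) * RtoC (u ^ i * exp (- (u * t)))) k)).
  - intros u _. ceq. unfold exp_rem.
    rewrite (RtoC_mult (exp (- (u * t)))), RtoC_minus, RtoC_sum_n.
    assert (E : RtoC (exp (- (u * t))) * RtoC (exp (u * t)) = 1).
    { rewrite <- RtoC_mult, <- exp_plus, Rplus_opp_l, exp_0. reflexivity. }
    transitivity (RtoC (exp (- (u * t))) * RtoC (exp (u * t)) - RtoC (exp (- (u * t))) * sum_n (fun i => RtoC ((u * t) ^ i / INR (fact i))) k); [|ring].
    rewrite E. f_equal. f_equal. rewrite <- sum_n_C_mult. apply sum_n_ext. intros i.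
    rewrite <- !RtoC_mult. f_equal. rewrite Rpow_mult_distr. field. apply INR_fact_neq_0.
  - apply (is_RInt_minus (V := C_R_NormedModule)).
    + assert (K := is_RInt_const (V := C_R_NormedModule) 0 1 (RtoC 1)).
      replace (scal (1 - 0)%R (RtoC 1 : C_R_NormedModule)) with (RtoC 1) in K; [exact K|].
      apply injective_projections; cbn; unfold mult; cbn; ring.
    + replace (sum_n (fun i => mu i t * RtoC (t ^ i / INR (fact i))) k) with (sum_n (fun i => RtoC (t ^ i / INR (fact i)) * mu i t) k).
      * apply is_CInt_sum_n. intros i. apply is_CInt_mult, is_CInt_mu.
      * apply sum_n_ext. intros i. apply Cmult_comm. }
rewrite <- (CInt_unique _ _ _ _ H).
replace (exp 1 * t ^ S k)%R with (exp 1 * t ^ S k * (1 - 0))%R by ring.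
apply CInt_bound; [lra|now eexists; apply H|].
intros u Hu. rewrite Cmod_R, Rabs_mult, (Rabs_pos_eq (exp _)) by (left; apply exp_pos).
assert (Q := exp_rem_bound (S k) (u * t) ltac:(nra)).
assert (Q1 : (exp (- (u * t)) <= 1)%R) by (rewrite <- exp_0; apply exp_mono; nra).
assert (Q2 : ((u * t) ^ S k <= t ^ S k)%R) by (apply pow_incr; nra).
assert (E1 := exp_pos (- (u * t))). assert (E2 := exp_pos 1). assert (E3 := Rabs_pos (exp_rem (S k) (u * t))).
apply Rle_trans with (1 * Rabs (exp_rem (S k) (u * t)))%R; [apply Rmult_le_compat_r; lra|].
rewrite Rmult_1_l. eapply Rle_trans; [exact Q|]. apply Rmult_le_compat_l; lra.
Qed.

(* On the cell [[n+1, n+2]] expand [(x + u)^-a] binomially in [u / x], [x = n + 1]. *)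
Lemma unit_cell a t n k rho : (Cmod (- a) <= rho)%R -> (0 < t)%R ->
  (Cmod (CInt (gint t (1 - a)) (INR (S n)) (INR (S n) + 1) - sum_n (fun i => (cbinom (- a) i * mu i t * pl_term (a + RtoC (INR i)) t n)%C) k)
   <= bin_const (S k) rho * (exp (- Re a * ln (INR (S n))) * / INR (S n) ^ S k))%R.
Proof.
intros Hrho Ht. set (x := INR (S n)). assert (Px : (0 < x)%R) by apply INR_S_pos.
assert (x1 : (1 <= x)%R) by (unfold x; rewrite S_INR; generalize (pos_INR n); lra).
set (pre := Rcpow x (- a) * RtoC (exp (- (x * t)))).
assert (Ex : ex_CInt (gint t (1 - a)) x (x + 1)) by (apply ex_CInt_pos; [lra|lra|intros; now apply ccont_gint]).
assert (E1 : is_CInt (fun u => gint t (1 - a) (1 * u + x)) 0 1 (CInt (gint t (1 - a)) x (x + 1))).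
{ assert (K := is_RInt_comp_lin (V := C_R_NormedModule) (gint t (1 - a)) 1 x 0 1 (CInt (gint t (1 - a)) x (x + 1))).
  replace (1 * 0 + x)%R with x in K by ring. replace (1 * 1 + x)%R with (x + 1)%R in K by ring.
  specialize (K (CInt_correct _ _ _ Ex)).
  refine (is_RInt_ext (V := C_R_NormedModule) _ _ _ _ _ _ K).
  intros u _. destruct (gint t (1 - a) (1 * u + x)) as [p q]. apply injective_projections; cbn; unfold mult; cbn; ring. }
assert (E2 : is_CInt (fun u => pre * sum_n (fun i => (cbinom (- a) i * RtoC (/ x ^ i)) * RtoC (u ^ i * exp (- (u * t)))) k) 0 1
   (pre * sum_n (fun i => (cbinom (- a) i * RtoC (/ x ^ i)) * mu i t) k)).
{ apply is_CInt_mult, is_CInt_sum_n. intros i. apply is_CInt_mult, is_CInt_mu. }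
assert (E3 := is_RInt_minus (V := C_R_NormedModule) _ _ _ _ _ _ E1 E2).
apply (is_RInt_ext (V := C_R_NormedModule) _ (fun u => pre * (RtoC (exp (- (u * t))) * bin_rem (- a) (S k) (u / x)))) in E3.
- assert (E4 : pre * sum_n (fun i => (cbinom (- a) i * RtoC (/ x ^ i)) * mu i t) k =
    sum_n (fun i => cbinom (- a) i * mu i t * pl_term (a + RtoC (INR i)) t n) k).
  { rewrite <- sum_n_C_mult. apply sum_n_ext. intros i. unfold pl_term. fold x.
    replace (- (a + RtoC (INR i))) with (- a + - RtoC (INR i)) by ring.
    rewrite Rcpow_plus, (Rcpow_opp x (RtoC (INR i))), Rcpow_INR by exact Px.
    rewrite RtoC_inv by (apply pow_nonzero; lra). unfold pre. ceq. ring. }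
  rewrite E4 in E3.
  change (minus (CInt (gint t (1 - a)) x (x + 1)) (sum_n (fun i => cbinom (- a) i * mu i t * pl_term (a + RtoC (INR i)) t n) k))
    with (CInt (gint t (1 - a)) x (x + 1) - sum_n (fun i => cbinom (- a) i * mu i t * pl_term (a + RtoC (INR i)) t n) k) in E3.
  rewrite <- (CInt_unique _ _ _ _ E3).
  replace (bin_const (S k) rho * (exp (- Re a * ln x) * / x ^ S k))%R with
    (bin_const (S k) rho * (exp (- Re a * ln x) * / x ^ S k) * (1 - 0))%R by ring.
  apply CInt_bound; [lra|now eexists; apply E3|].
  intros u Hu. unfold pre. rewrite !Cmod_mult, Cmod_Rcpow, !Cmod_R, !(Rabs_pos_eq (exp _)) by (left; apply exp_pos).
  assert (ux : (0 <= u / x <= 1)%R).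
  { split; [apply Rdiv_le_0_compat; lra|]. apply (Rmult_le_reg_r x); [lra|].
    unfold Rdiv. rewrite Rmult_assoc, Rinv_l by lra. lra. }
  assert (Q := bin_rem_bound (S k) (- a) rho (u / x) Hrho ux).
  replace (Re (- a)) with (- Re a)%R by reflexivity.
  assert (X1 : (exp (- (x * t)) <= 1)%R) by (rewrite <- exp_0; apply exp_mono; nra).
  assert (X2 : (exp (- (u * t)) <= 1)%R) by (rewrite <- exp_0; apply exp_mono; nra).
  assert (BC : (0 <= bin_const (S k) rho)%R).
  { assert (Y := bin_rem_bound (S k) (- a) rho 1%R Hrho ltac:(lra)). rewrite pow1, Rmult_1_r in Y.
    eapply Rle_trans; [apply Cmod_ge_0|exact Y]. }
  assert (X3 : ((u / x) ^ S k <= / x ^ S k)%R).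
  { unfold Rdiv. rewrite Rpow_mult_distr, pow_inv.
    assert (Y : (u ^ S k <= 1)%R) by (rewrite <- (pow1 (S k)); apply pow_incr; lra).
    assert (0 < / x ^ S k)%R by (apply Rinv_0_lt_compat, pow_lt; lra). nra. }
  assert (Z0 := Cmod_ge_0 (bin_rem (- a) (S k) (u / x))).
  assert (Z1 := exp_pos (- Re a * ln x)). assert (Z2 := exp_pos (- (x * t))). assert (Z3 := exp_pos (- (u * t))).
  apply Rle_trans with (exp (- Re a * ln x) * 1 * (1 * (bin_const (S k) rho * / x ^ S k)))%R.
  + apply Rmult_le_compat; [nra|nra|nra|]. apply Rmult_le_compat; [lra|lra|lra|].
    eapply Rle_trans; [exact Q|]. now apply Rmult_le_compat_l.
  + right. ring.
- intros u Hu. rewrite Rmin_left, Rmax_right in Hu by lra.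
  change (gint t (1 - a) (1 * u + x) - pre * sum_n (fun i => (cbinom (- a) i * RtoC (/ x ^ i)) * RtoC (u ^ i * exp (- (u * t)))) k =
    pre * (RtoC (exp (- (u * t))) * bin_rem (- a) (S k) (u / x))).
  unfold bin_rem.
  assert (S1 : sum_n (fun i => (cbinom (- a) i * RtoC (/ x ^ i)) * RtoC (u ^ i * exp (- (u * t)))) k =
    RtoC (exp (- (u * t))) * sum_n (fun i => cbinom (- a) i * RtoC ((u / x) ^ i)) k).
  { rewrite <- sum_n_C_mult. apply sum_n_ext. intros i. ceq. unfold Rdiv. rewrite Rpow_mult_distr, pow_inv, !RtoC_mult. ring. }
  rewrite S1.
  assert (S2 : gint t (1 - a) (1 * u + x) = pre * (RtoC (exp (- (u * t))) * Rcpow (1 + u / x) (- a))).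
  { unfold gint, pre. replace (1 - a - 1) with (- a) by ring.
    replace (1 * u + x)%R with (x * (1 + u / x))%R by (field; lra).
    rewrite Rcpow_mult; [|lra|apply Rplus_lt_0_compat; [lra|apply Rdiv_lt_0_compat; lra]].
    replace (- (x * (1 + u / x) * t))%R with (- (x * t) + - (u * t))%R by (field; lra).
    rewrite exp_plus, RtoC_mult. ring. }
  rewrite S2. ring.
Qed.

(** * Boundedness of the polylogarithm minus its singular part *)

Section Polylog.
Variable Gam : C -> C.
Hypothesis HGam : is_gamma Gam.

Definition sub_polylog (a : C) (t : R) : C := polylog a t - Gam (1 - a) * Rcpow t (a - 1).

Lemma sub_polylog_cd t a : (0 < t)%R -> ~ isZ a -> cd (fun a => sub_polylog a t) a.
Proof.
intros Ht Ha. unfold sub_polylog. apply (cd_minus (V := C_NormedModule)); [now apply polylog_cd|].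
apply (cd_mult (V := C_NormedModule)).
- apply (cd_comp (V := C_NormedModule) (fun a => 1 - a) Gam).
  + apply (cd_minus (V := C_NormedModule) (fun _ => 1) (fun a => a)); [apply (cd_const (V := C_NormedModule))|apply cd_idC].
  + apply (Gam_cd_Z Gam HGam). intros Q. now apply Ha, isZ_one_minus.
- apply (cd_Rcpow (V := C_NormedModule)).
  apply (cd_minus (V := C_NormedModule) (fun a => a)); [apply cd_idC|apply (cd_const (V := C_NormedModule))].
Qed.

Lemma rder_sub_polylog a t : (0 < t)%R -> ~ isZ a -> rder (sub_polylog a) t (- sub_polylog (a - 1) t).
Proof.
intros Ht Ha. unfold sub_polylog.
assert (F := Gam_feq Gam HGam (1 - a) ltac:(intros Q; now apply Ha, isZ_one_minus)).
replace (1 - (a - 1)) with (1 - a + 1) by ring. rewrite F.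
replace (- (polylog (a - 1) t - (1 - a) * Gam (1 - a) * Rcpow t (a - 1 - 1))) with
  (- polylog (a - 1) t - Gam (1 - a) * ((a - 1) * Rcpow t (a - 1 - 1))) by ring.
apply rder_minus; [now apply rder_polylog|]. apply rder_scal. now apply rder_Rcpow.
Qed.

(** Says that the integral of u^(s-1) e^(-u t) over [1, oo) differs from its continuation Gamma(s)
    t^-s by at most M, uniformly in small t. Large finite upper limits avoid asserting convergence
    separately. *)
Definition inc_gamma_bound (s : C) (M : R) : Prop := forall t, (0 < t <= 1)%R -> forall eps : posreal,
  exists B, forall be, (B < be)%R -> (Cmod (CInt (gint t s) 1 be - Gam s * Rcpow t (- s)) <= M + eps)%R.

(** For Re s > 0 the difference is minus the integral over (0, 1), which is at most 1 / Re s. *)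
Lemma inc_gamma_pos s s0 : (0 < s0 <= Re s)%R -> inc_gamma_bound s (/ s0).
Proof.
intros Hs t Ht eps.
destruct (Gam_scaled Gam HGam s t ltac:(lra) ltac:(lra) eps) as (d & B & H).
exists (Rmax 1 B). intros be Hbe.
assert (D := cond_pos d).
assert (B1 := Rmax_l 1 B). assert (B2 := Rmax_r 1 B).
set (al := (Rmin 1 d / 2)%R).
assert (M1 := Rmin_l 1 d). assert (M2 := Rmin_r 1 d). assert (M3 : (0 < Rmin 1 d)%R) by (apply Rmin_case; lra).
assert (Al : (0 < al < 1)%R) by (unfold al; lra).
assert (K := H al be ltac:(unfold al; lra) ltac:(lra)).
assert (Cg : forall u, (0 < u)%R -> ccont (gint t s) u) by (intros; now apply ccont_gint).
rewrite (CInt_Chasles _ al 1 be) in K by (apply ex_CInt_pos; [lra|lra|exact Cg]).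
assert (I1 : (Cmod (CInt (gint t s) al 1) <= / s0)%R).
{ set (g := fun x => exp ((Re s - 1) * ln x)).
  assert (Ig : is_RInt g al 1 (minus (exp (Re s * ln 1) / Re s) (exp (Re s * ln al) / Re s))%R).
  { apply (is_RInt_derive (V := R_CompleteNormedModule) (fun x => exp (Re s * ln x) / Re s)%R g).
    - intros x Hx. rewrite Rmin_left, Rmax_right in Hx by lra. unfold g. auto_derive; [lra|].
      replace ((Re s - 1) * ln x)%R with (Re s * ln x + - ln x)%R by ring.
      rewrite exp_plus, exp_Ropp, exp_ln by lra. field. lra.
    - intros x Hx. rewrite Rmin_left, Rmax_right in Hx by lra.
      apply (ex_derive_continuous g). unfold g. auto_derive. lra. }
  eapply Rle_trans; [apply (CInt_bound_fct _ g); [lra| | |]|].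
  - apply ex_CInt_pos; [lra|lra|exact Cg].
  - eexists. exact Ig.
  - intros x Hx. rewrite Cmod_gint. unfold g.
    assert (exp (- (x * t)) <= 1)%R by (rewrite <- exp_0; apply exp_mono; nra).
    assert (0 < exp ((Re s - 1) * ln x))%R by apply exp_pos. nra.
  - rewrite (is_RInt_unique _ _ _ _ Ig). unfold minus, plus, opp; simpl. rewrite ln_1, Rmult_0_r, exp_0.
    apply Rle_trans with (/ Re s)%R; [|apply Rinv_le_contravar; lra].
    assert (0 < exp (Re s * ln al) / Re s)%R by (apply Rdiv_lt_0_compat; [apply exp_pos|lra]). lra. }
replace (CInt (gint t s) 1 be - Gam s * Rcpow t (- s)) with
  ((CInt (gint t s) al 1 + CInt (gint t s) 1 be - Gam s * Rcpow t (- s)) + - CInt (gint t s) al 1) by ring.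
eapply Rle_trans; [apply Cmod_triangle|]. rewrite Cmod_opp. lra.
Qed.

(** Integration by parts and Gamma(s + 1) = s Gamma(s) move the bound one unit to the left; the
    summand 1 pays for the boundary term at u = 1, and the division is by s. *)
Lemma inc_gamma_down s M : ~ isZ s -> inc_gamma_bound (s + 1) M -> inc_gamma_bound s ((M + 1) / Cmod s).
Proof.
intros Hs H t Ht eps.
assert (s0 : s <> 0) by (intros E; apply Hs; exists 0%Z; exact E).
assert (Ps := proj1 (Cmod_gt_0 s) s0). assert (Pe := cond_pos eps).
assert (P : (0 < eps * Cmod s / 2)%R) by (apply Rdiv_lt_0_compat; [apply Rmult_lt_0_compat; lra|lra]).
destruct (H t Ht (mkposreal _ P)) as [B1 H1]. simpl in H1.
destruct (decay_infty (Re s) t (mkposreal _ P) ltac:(lra)) as (B2 & B2' & H2). simpl in H2.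
exists (Rmax B1 B2). intros be Hbe.
assert (M4 := Rmax_l B1 B2). assert (M5 := Rmax_r B1 B2).
specialize (H1 be ltac:(lra)). specialize (H2 be ltac:(lra)).
assert (E := gint_parts t s 1 be ltac:(lra) ltac:(lra)).
assert (F := Gam_feq Gam HGam s Hs). rewrite F in H1.
assert (T1 : Rcpow t (- s) = RtoC t * Rcpow t (- (s + 1))).
{ rewrite <- (Rcpow_1 t) by lra. rewrite <- Rcpow_plus. f_equal. ring. }
replace (CInt (gint t s) 1 be - Gam s * Rcpow t (- s)) with
  ((RtoC t * (CInt (gint t (s + 1)) 1 be - s * Gam s * Rcpow t (- (s + 1))) + - gint t (s + 1) 1 + gint t (s + 1) be) / s).
2: { rewrite T1. transitivity ((RtoC t * CInt (gint t (s + 1)) 1 be - s * Gam s * (RtoC t * Rcpow t (- (s + 1))) + - gint t (s + 1) 1 + gint t (s + 1) be) / s); [field; exact s0|].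
     rewrite E. field. exact s0. }
rewrite Cmod_div by exact s0. apply (Rmult_le_reg_r (Cmod s)); [exact Ps|].
unfold Rdiv at 1. rewrite Rmult_assoc, Rinv_l, Rmult_1_r by lra.
replace (((M + 1) / Cmod s + eps) * Cmod s)%R with (M + 1 + eps * Cmod s)%R by (field; lra).
eapply Rle_trans; [apply Cmod_triangle|]. eapply Rle_trans; [apply Rplus_le_compat_r, Cmod_triangle|].
rewrite Cmod_opp, Cmod_mult, !Cmod_gint, Cmod_R, Rabs_pos_eq by lra.
replace (Re (s + 1) - 1)%R with (Re s) by (unfold Re; simpl; ring).
rewrite ln_1, Rmult_0_r, exp_0, Rmult_1_l, Rmult_1_l.
assert (X1 : (exp (- t) <= 1)%R) by (apply Rle_trans with (exp 0); [apply exp_mono; lra|right; apply exp_0]).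
assert (X2 := Cmod_ge_0 (CInt (gint t (s + 1)) 1 be - s * Gam s * Rcpow t (- (s + 1)))).
nra.
Qed.

Lemma inc_gamma_locally n : forall s0, ~ isZ s0 -> (- INR n < Re s0)%R ->
  exists M, locally s0 (fun s => inc_gamma_bound s M).
Proof.
induction n as [|n IH]; intros s0 Hs Hr.
- simpl in Hr. exists (/ (Re s0 / 2))%R. apply locally_Cmod.
  assert (P : (0 < Re s0 / 2)%R) by lra. exists (mkposreal _ P). simpl. intros w Hw.
  apply inc_gamma_pos. assert (Q := Re_lower s0 w _ Hw). lra.
- rewrite S_INR in Hr.
  destruct (IH (s0 + 1)) as [M HM].
  + intros Q. now apply Hs, isZ_plus_1.
  + unfold Re in *; simpl. lra.
  + assert (s00 : s0 <> 0) by (intros E; apply Hs; exists 0%Z; exact E).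
    assert (Ps := proj1 (Cmod_gt_0 s0) s00).
    exists ((Rmax M 0 + 1) / (Cmod s0 / 2))%R.
    assert (L1 := locally_shift s0 1 _ HM).
    assert (L2 : locally s0 (fun s => (Cmod (s - s0) < Cmod s0 / 2)%R)).
    { apply locally_Cmod. assert (P : (0 < Cmod s0 / 2)%R) by lra. now exists (mkposreal _ P). }
    generalize (filter_and _ _ L1 (filter_and _ _ L2 (not_isZ_locally s0 Hs))). apply filter_imp.
    intros s (A & B & D) t Ht eps.
    destruct (inc_gamma_down s M D A t Ht eps) as [B0 HB]. exists B0. intros be Hbe.
    eapply Rle_trans; [apply HB, Hbe|]. apply Rplus_le_compat_r.
    assert (Cs : (Cmod s0 / 2 <= Cmod s)%R).
    { assert (T := Cmod_triangle s (- (s - s0))). rewrite Cmod_opp in T. replace (s + - (s - s0)) with s0 in T by ring. lra. }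
    assert (MM := Rmax_l M 0). assert (MM0 := Rmax_r M 0).
    unfold Rdiv at 1 2. apply Rle_trans with ((Rmax M 0 + 1) * / Cmod s)%R.
    * apply Rmult_le_compat_r; [left; apply Rinv_0_lt_compat; lra|lra].
    * apply Rmult_le_compat_l; [lra|]. apply Rinv_le_contravar; lra.
Qed.

(** Sum [unit_cell] over all cells: the integrals join to one over [1, oo), the expansions to
    polylogarithms. The condition on k makes the cell errors at most a constant over n^2, and
    [inc_gamma_bound] replaces the integral by its Gamma term. *)
Lemma polylog_vs_gamma a t k rho M : (Cmod (- a) <= rho)%R -> (2 - Re a <= INR (S k))%R -> (0 < t <= 1)%R ->
  inc_gamma_bound (1 - a) M ->
  (Cmod (Gam (1 - a) * Rcpow t (a - 1) - sum_n (fun i => (cbinom (- a) i * mu i t * polylog (a + RtoC (INR i)) t)%C) k)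
    <= M + 2 * bin_const (S k) rho)%R.
Proof.
intros Hrho Hk Ht HJ.
assert (Cg : forall u, (0 < u)%R -> ccont (gint t (1 - a)) u) by (intros; now apply ccont_gint).
set (u := fun n => CInt (gint t (1 - a)) (INR (S n)) (INR (S n) + 1) - sum_n (fun i => cbinom (- a) i * mu i t * pl_term (a + RtoC (INR i)) t n) k).
assert (BC : (0 <= bin_const (S k) rho)%R).
{ assert (Y := bin_rem_bound (S k) (- a) rho 1%R Hrho ltac:(lra)). rewrite pow1, Rmult_1_r in Y.
  eapply Rle_trans; [apply Cmod_ge_0|exact Y]. }
assert (Hu : forall n, (Cmod (u n) <= bin_const (S k) rho * / INR (S n) ^ 2)%R).
{ intros n. eapply Rle_trans; [apply (unit_cell a t n k rho Hrho); lra|].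
  apply Rmult_le_compat_l; [exact BC|].
  assert (Q := exp_ln_INR_le (Re a) n (S k) ltac:(lra)).
  assert (P := INR_S_pos n). set (x := INR (S n)) in *.
  assert (Px : (0 < x ^ S k)%R) by (apply pow_lt; lra).
  apply (Rmult_le_reg_r (x ^ S k)); [exact Px|]. rewrite Rmult_assoc, Rinv_l, Rmult_1_r by lra. lra. }
assert (Hsum : forall N, CInt (gint t (1 - a)) 1 (INR (S N) + 1) - sum_n (fun i => cbinom (- a) i * mu i t * pl_sum (a + RtoC (INR i)) t N) k = sum_n u N).
{ induction N as [|N IH].
  - rewrite sum_O. unfold u. f_equal. apply sum_n_ext. intros i. unfold pl_sum. now rewrite sum_O.
  - rewrite sum_n_S, <- IH. unfold u.
    assert (PN := INR_S_pos N).
    replace (INR (S (S N))) with (INR (S N) + 1)%R by (rewrite (S_INR (S N)); reflexivity).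
    rewrite (CInt_Chasles _ 1 (INR (S N) + 1) (INR (S N) + 1 + 1)) by (apply ex_CInt_pos; [lra|lra|exact Cg]).
    replace (sum_n (fun i => cbinom (- a) i * mu i t * pl_sum (a + RtoC (INR i)) t (S N)) k) with
      (sum_n (fun i => cbinom (- a) i * mu i t * pl_sum (a + RtoC (INR i)) t N) k + sum_n (fun i => cbinom (- a) i * mu i t * pl_term (a + RtoC (INR i)) t (S N)) k).
    + ring.
    + rewrite <- sum_n_plus_C. apply sum_n_ext. intros i. unfold pl_sum. ceq. rewrite sum_n_S. ring. }
apply (Clim_le (fun N => (Gam (1 - a) * Rcpow t (a - 1) - CInt (gint t (1 - a)) 1 (INR (S N) + 1)) + sum_n u N) _ (fun _ => 0%R)).
- apply (Clim_ext (fun N => Gam (1 - a) * Rcpow t (a - 1) - sum_n (fun i => cbinom (- a) i * mu i t * pl_sum (a + RtoC (INR i)) t N) k)).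
  { intros N. rewrite <- Hsum. ring. }
  apply Clim_minus; [apply Clim_const|].
  apply (Clim_sum_n (fun N i => cbinom (- a) i * mu i t * pl_sum (a + RtoC (INR i)) t N)).
  intros i. apply Clim_scal, polylog_lim. lra.
- intros eps. destruct (HJ t Ht eps) as [B HB]. destruct (nat_above B) as [N0 HN0].
  exists N0. intros N HN.
  eapply Rle_trans; [apply Cmod_triangle|].
  assert (Q := mtest_partial u _ Hu N).
  assert (Q2 := HB (INR (S N) + 1)%R).
  rewrite <- Cmod_opp. replace (- (Gam (1 - a) * Rcpow t (a - 1) - CInt (gint t (1 - a)) 1 (INR (S N) + 1))) with
    (CInt (gint t (1 - a)) 1 (INR (S N) + 1) - Gam (1 - a) * Rcpow t (- (1 - a))).
  2: { replace (- (1 - a)) with (a - 1) by ring. ring. }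
  assert (Q3 : (B < INR (S N) + 1)%R) by (rewrite S_INR; apply le_INR in HN; lra).
  specialize (Q2 Q3). lra.
Qed.

(** This makes the singular parts of L_(a+i) recombine: weighted by the binomial coefficients they
    all become multiples Gamma(1-a) t^(a-1+i) / i! of the singular part at a. *)
Lemma cbinom_Gam a i : ~ isZ a -> cbinom (- a) i * Gam (1 - (a + RtoC (INR i))) = Gam (1 - a) * RtoC (/ INR (fact i)).
Proof.
intros Ha. induction i as [|i IH].
- simpl. rewrite Rinv_1. replace (1 - (a + 0)) with (1 - a) by ring. ring.
- assert (Hs : ~ isZ (1 - (a + RtoC (INR (S i))))).
  { intros Q. apply isZ_one_minus in Q. now apply Ha, (isZ_plus_nat a (S i)). }
  assert (F := Gam_feq Gam HGam _ Hs).
  replace (1 - (a + RtoC (INR (S i))) + 1) with (1 - (a + RtoC (INR i))) in F by (rewrite S_INR, RtoC_plus; ring).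
  rewrite F in IH. clear F.
  assert (NS : RtoC (INR (S i)) <> 0) by (apply RtoC_neq_0, not_0_INR; lia).
  assert (NF : INR (fact i) <> 0%R) by apply INR_fact_neq_0.
  rewrite fact_simpl, mult_INR, Rinv_mult, RtoC_mult, (RtoC_inv (INR (S i))) by (apply not_0_INR; lia).
  transitivity ((cbinom (- a) i * ((1 - (a + RtoC (INR (S i)))) * Gam (1 - (a + RtoC (INR (S i)))))) / RtoC (INR (S i))).
  + change (cbinom (- a) (S i)) with (cbinom (- a) i * (- a - RtoC (INR i)) / RtoC (INR (S i))).
    replace (1 - (a + RtoC (INR (S i)))) with (- a - RtoC (INR i)) at 2 by (rewrite S_INR, RtoC_plus; ring).
    field. exact NS.
  + rewrite IH. field. exact NS.
Qed.

Lemma sub_polylog_bounded_large a0 : ~ isZ a0 -> (2 < Re a0)%R -> loc_bounded sub_polylog a0.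
Proof.
intros Ha Hr.
assert (G : loc_bounded (fun a _ => Gam (1 - a)) a0).
{ apply loc_bounded_cont. apply (cd_comp (V := C_NormedModule) (fun a => 1 - a) Gam).
  - apply (cd_minus (V := C_NormedModule) (fun _ => 1) (fun a => a)); [apply (cd_const (V := C_NormedModule))|apply cd_idC].
  - apply (Gam_cd_Z Gam HGam). intros Q. now apply Ha, isZ_one_minus. }
assert (L : locally a0 (fun a => (2 <= Re a)%R)).
{ apply locally_Cmod. assert (P : (0 < Re a0 - 2)%R) by lra. exists (mkposreal _ P). simpl. intros w Hw.
  assert (Q := Re_lower a0 w _ Hw). lra. }
apply loc_bounded_plus.
- exists 2%R. generalize L. apply filter_imp. intros a Hra t Ht.
  eapply Rle_trans; [apply (polylog_bound a t 0); simpl; lra|].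
  unfold pl_const. simpl. rewrite !Rmult_1_l.
  assert (exp (- (t / 2)) <= 1)%R by (rewrite <- exp_0; apply exp_mono; lra). lra.
- apply loc_bounded_opp, loc_bounded_mult; [exact G|].
  exists 1%R. generalize L. apply filter_imp. intros a Hra t Ht. rewrite Cmod_Rcpow.
  apply Rle_trans with (exp 0); [apply exp_mono|right; apply exp_0].
  assert (ln t <= 0)%R by (rewrite <- ln_1; apply ln_le; lra).
  replace (Re (a - 1)) with (Re a - 1)%R by reflexivity. nra.
Qed.

Lemma cd_cbinom_opp i (a : C) : ex_filterdiff (V := C_NormedModule) (fun a : C => cbinom (- a) i) (locally a).
Proof.
induction i as [|i IH].
- apply (cd_ext (V := C_NormedModule) (fun _ => RtoC 1)); [reflexivity|]. apply (cd_const (V := C_NormedModule)).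
- apply (cd_ext (V := C_NormedModule) (fun a : C => cbinom (- a) i * ((- a - RtoC (INR i)) / RtoC (INR (S i))))).
  + intros z. unfold Cdiv. apply Cmult_assoc.
  + apply (cd_mult (V := C_NormedModule) (fun a : C => cbinom (- a) i) (fun a => (- a - RtoC (INR i)) / RtoC (INR (S i)))); [exact IH|].
    unfold Cdiv. apply (cd_mult (V := C_NormedModule) (fun a : C => - a - RtoC (INR i)) (fun _ => / RtoC (INR (S i)))); [|apply (cd_const (V := C_NormedModule))].
    apply (cd_minus (V := C_NormedModule) (fun a : C => - a) (fun _ => RtoC (INR i))); [|apply (cd_const (V := C_NormedModule))].
    apply (cd_opp (V := C_NormedModule) (fun a : C => a)), cd_idC.
Qed.

(** Write L_(a+i) as E_(a+i) plus singular part in [polylog_vs_gamma]. The singular parts sum to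
    Gamma(1-a) t^(a-1) times the sum of the mu_i t^i / i!, which by [mu_taylor] differs from
    Gamma(1-a) t^(a-1) by a bounded amount once k + 1 >= 2 - Re a. What remains is a bounded
    combination of the E_(a+i) with leading term mu_0 E_a, and mu_0 >= 1/e can be divided out. *)
Lemma sub_polylog_bounded_step a0 : ~ isZ a0 -> (forall i, loc_bounded sub_polylog (a0 + RtoC (INR (S i)))) -> loc_bounded sub_polylog a0.
Proof.
intros Ha HE.
destruct (nat_above (3 - Re a0)) as [k Hk].
destruct (nat_above (- Re (1 - a0) + 1)) as [n Hn].
destruct (inc_gamma_locally n (1 - a0)) as [M HM].
{ intros Q. now apply Ha, isZ_one_minus. }
{ lra. }
assert (L1 : locally a0 (fun a => inc_gamma_bound (1 - a) M)).
{ apply locally_Cmod in HM. destruct HM as [d Hd]. apply locally_Cmod. exists d. intros w Hw.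
  apply Hd. rewrite <- Cmod_opp. replace (- (1 - w - (1 - a0))) with (w - a0) by ring. exact Hw. }
set (rho := (Cmod a0 + 1)%R).
assert (L2 : locally a0 (fun a => (Cmod (- a) <= rho)%R /\ (2 - Re a <= INR (S k))%R)).
{ apply locally_Cmod. exists (mkposreal 1 Rlt_0_1). cbn [pos]. intros w Hw. split.
  - rewrite Cmod_opp. replace w with (a0 + (w - a0)) by ring. eapply Rle_trans; [apply Cmod_triangle|]. unfold rho. lra.
  - assert (Q := Re_lower a0 w 1 Hw). rewrite S_INR. lra. }
assert (X : loc_bounded (fun a t => Gam (1 - a) * Rcpow t (a - 1) - sum_n (fun i => cbinom (- a) i * mu i t * polylog (a + RtoC (INR i)) t) k) a0).
{ exists (M + 2 * bin_const (S k) rho)%R. generalize (filter_and _ _ L1 L2). apply filter_imp.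
  intros a (A & B & D) t Ht. now apply polylog_vs_gamma. }
assert (G : loc_bounded (fun a _ => Gam (1 - a)) a0).
{ apply loc_bounded_cont. apply (cd_comp (V := C_NormedModule) (fun a => 1 - a) Gam).
  - apply (cd_minus (V := C_NormedModule) (fun _ => 1) (fun a => a)); [apply (cd_const (V := C_NormedModule))|apply cd_idC].
  - apply (Gam_cd_Z Gam HGam). intros Q. now apply Ha, isZ_one_minus. }
assert (Y : loc_bounded (fun a t => Gam (1 - a) * (Rcpow t (a - 1) * (1 - sum_n (fun i => mu i t * RtoC (t ^ i / INR (fact i))) k))) a0).
{ apply loc_bounded_mult; [exact G|]. exists (exp 1). generalize L2. apply filter_imp. intros a (_ & B) t Ht.
  rewrite Cmod_mult, Cmod_Rcpow.
  apply Rle_trans with (exp (Re (a - 1) * ln t) * (exp 1 * t ^ S k))%R.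
  - apply Rmult_le_compat_l; [left; apply exp_pos|]. apply mu_taylor. lra.
  - rewrite <- Rpower_pow by lra. unfold Rpower.
    replace (exp (Re (a - 1) * ln t) * (exp 1 * exp (INR (S k) * ln t)))%R with (exp 1 * (exp (Re (a - 1) * ln t) * exp (INR (S k) * ln t)))%R by ring.
    rewrite <- exp_plus. rewrite <- (Rmult_1_r (exp 1)) at 2. apply Rmult_le_compat_l; [left; apply exp_pos|].
    apply Rle_trans with (exp 0); [apply exp_mono|right; apply exp_0].
    assert (ln t <= 0)%R by (rewrite <- ln_1; apply ln_le; lra).
    replace (Re (a - 1)) with (Re a - 1)%R by reflexivity. nra. }
assert (cb : forall i, loc_bounded (fun a _ => cbinom (- a) i) a0) by (intros i; apply loc_bounded_cont, cd_cbinom_opp).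
assert (Z : loc_bounded (fun a t => sum_n (fun i => cbinom (- a) (S i) * mu (S i) t * sub_polylog (a + RtoC (INR (S i))) t) k) a0).
{ apply (loc_bounded_sum_n (fun i a t => cbinom (- a) (S i) * mu (S i) t * sub_polylog (a + RtoC (INR (S i))) t)). intros i _.
  apply loc_bounded_mult; [apply loc_bounded_mult; [apply cb|]|].
  - apply (loc_bounded_bound _ _ 1). intros a t Ht. apply mu_bound. lra.
  - apply (loc_bounded_shift sub_polylog). apply HE. }
(* the E-part of the sum over 0 <= i <= k+1, with the i = k+1 term added on both sides *)
assert (W : loc_bounded (fun a t => mu 0 t * sub_polylog a t) a0).
{ assert (X1 : loc_bounded (fun a t => cbinom (- a) (S k) * mu (S k) t * sub_polylog (a + RtoC (INR (S k))) t) a0).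
  { apply loc_bounded_mult; [apply loc_bounded_mult; [apply cb|]|].
    - apply (loc_bounded_bound _ _ 1). intros a t Ht. apply mu_bound. lra.
    - apply (loc_bounded_shift sub_polylog). apply HE. }
  generalize (loc_bounded_plus _ _ _ (loc_bounded_plus _ _ _ (loc_bounded_opp _ _ X) Y) (loc_bounded_opp _ _ (loc_bounded_plus _ _ _ Z (loc_bounded_opp _ _ X1)))).
  apply loc_bounded_ext. generalize (not_isZ_locally a0 Ha). apply filter_imp. intros a Hna t Ht.
  assert (S1 : sum_n (fun i => cbinom (- a) i * mu i t * polylog (a + RtoC (INR i)) t) k =
    Gam (1 - a) * Rcpow t (a - 1) * sum_n (fun i => mu i t * RtoC (t ^ i / INR (fact i))) k
    + sum_n (fun i => cbinom (- a) i * mu i t * sub_polylog (a + RtoC (INR i)) t) k).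
  { rewrite <- sum_n_C_mult, <- sum_n_plus_C. apply sum_n_ext. intros i. ceq. unfold sub_polylog.
    replace (a + RtoC (INR i) - 1) with ((a - 1) + RtoC (INR i)) by ring.
    rewrite Rcpow_plus, Rcpow_INR by lra. unfold Rdiv. rewrite (RtoC_mult (t ^ i)).
    assert (CG := cbinom_Gam a i Hna).
    transitivity (cbinom (- a) i * mu i t * polylog (a + RtoC (INR i)) t - (cbinom (- a) i * Gam (1 - (a + RtoC (INR i)))) * mu i t * (Rcpow t (a - 1) * RtoC (t ^ i)) + (Gam (1 - a) * RtoC (/ INR (fact i))) * mu i t * (Rcpow t (a - 1) * RtoC (t ^ i))).
    - rewrite CG. ring.
    - ring. }
  assert (S2 : forall m, sum_n (fun i => cbinom (- a) i * mu i t * sub_polylog (a + RtoC (INR i)) t) m + cbinom (- a) (S m) * mu (S m) t * sub_polylog (a + RtoC (INR (S m))) t =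
     mu 0 t * sub_polylog a t + sum_n (fun i => cbinom (- a) (S i) * mu (S i) t * sub_polylog (a + RtoC (INR (S i))) t) m).
  { induction m as [|m IH].
    - rewrite !sum_O. change (cbinom (- a) 0) with (RtoC 1). change (RtoC (INR 0)) with (RtoC 0). rewrite (Cplus_0_r a). ring.
    - rewrite !sum_n_S. rewrite IH. ring. }
  rewrite S1. specialize (S2 k).
  transitivity ((sum_n (fun i => cbinom (- a) i * mu i t * sub_polylog (a + RtoC (INR i)) t) k + cbinom (- a) (S k) * mu (S k) t * sub_polylog (a + RtoC (INR (S k))) t)
     - sum_n (fun i => cbinom (- a) (S i) * mu (S i) t * sub_polylog (a + RtoC (INR (S i))) t) k).
  - ring.
  - rewrite S2. ring. }
destruct W as [B HB]. exists (B * exp 1)%R. generalize HB. apply filter_imp. intros a A t Ht.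
specialize (A t Ht). rewrite Cmod_mult in A.
assert (ML := mu_0_lower t ltac:(lra)).
assert (EE : (exp (-1) * exp 1 = 1)%R) by (rewrite <- exp_plus; replace (-1 + 1)%R with 0%R by ring; apply exp_0).
assert (P1 := exp_pos 1). assert (P2 := Cmod_ge_0 (sub_polylog a t)).
apply Rle_trans with (Cmod (mu 0 t) * Cmod (sub_polylog a t) * exp 1)%R; [|apply Rmult_le_compat_r; lra].
assert (Q : (exp (-1) * Cmod (sub_polylog a t) <= Cmod (mu 0 t) * Cmod (sub_polylog a t))%R) by (apply Rmult_le_compat_r; lra).
apply (Rmult_le_compat_r (exp 1)) in Q; [|lra].
replace (exp (-1) * Cmod (sub_polylog a t) * exp 1)%R with (Cmod (sub_polylog a t))%R in Q; [exact Q|].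
transitivity (exp (-1) * exp 1 * Cmod (sub_polylog a t))%R; [rewrite EE|]; ring.
Qed.

(** Induction over half planes Re a > 2 - M: the step at a only uses a + 1, a + 2, and so on, which
    lie in the previous half plane. *)
Theorem sub_polylog_bounded a0 : ~ isZ a0 -> loc_bounded sub_polylog a0.
Proof.
assert (K : forall M : nat, forall a0, ~ isZ a0 -> (2 - INR M < Re a0)%R -> loc_bounded sub_polylog a0).
{ induction M as [|M IH]; intros a Ha Hr.
  - simpl in Hr. apply sub_polylog_bounded_large; [exact Ha|lra].
  - rewrite S_INR in Hr. apply sub_polylog_bounded_step; [exact Ha|]. intros i. apply IH.
    + intros Q. now apply Ha, (isZ_plus_nat a (S i)).
    + rewrite S_INR. unfold Re in *; simpl. generalize (pos_INR i). lra. }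
intros Ha. destruct (nat_above (3 - Re a0)) as [M HM]. apply (K M); [exact Ha|lra].
Qed.

End Polylog.

(** * Taylor expansion with zeta coefficients *)

(** Exactly K terms, so that the empty sum is available, unlike for [sum_n]. *)
Fixpoint csum (u : nat -> C) (K : nat) : C :=
  match K with O => 0 | S k => csum u k + u k end.

(** Limits as t tends to 0 are taken along this sequence, so that the results on sequences of
    holomorphic functions apply. *)
Definition node (n : nat) : R := (/ INR (S n))%R.

Lemma node_bounds n : (0 < node n <= 1)%R.
Proof.
unfold node. assert (P := INR_S_pos n). split; [now apply Rinv_0_lt_compat|].
rewrite <- Rinv_1. apply Rinv_le_contravar; [lra|]. rewrite S_INR. generalize (pos_INR n). lra.
Qed.

Lemma node_small (eps : posreal) : exists N, forall n, (N <= n)%nat -> (node n < eps)%R.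
Proof.
destruct (inv_INR_small 1 eps) as [N HN]. exists N. intros n Hn. specialize (HN n Hn). unfold node. lra.
Qed.

Lemma Clim_node (f : R -> C) : ccont f 0 -> Clim (fun n => f (node n)) (f 0%R).
Proof.
intros H eps. destruct (ccont_eps f 0 H eps) as [d Hd]. destruct (node_small d) as [N HN].
exists N. intros n Hn. apply Hd. rewrite Rminus_0_r, Rabs_pos_eq by (left; apply node_bounds). now apply HN.
Qed.

Lemma Clim_of_is_series (u : nat -> C) (l : C) : is_series u l -> Clim (sum_n u) l.
Proof.
intros H eps.
assert (K : locally l (fun z : C => (Cmod (z - l) < eps)%R)) by (apply locally_Cmod; now exists eps).
apply H in K. destruct K as [N HN]. exists N. exact HN.
Qed.

Lemma Clim_0_le (u : nat -> C) (b : nat -> R) : (forall n, (Cmod (u n) <= b n)%R) ->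
  (forall eps : posreal, exists N, forall n, (N <= n)%nat -> (b n < eps)%R) -> Clim u 0.
Proof.
intros H Hb eps. destruct (Hb eps) as [N HN]. exists N. intros n Hn.
replace (u n - 0) with (u n) by ring. eapply Rle_lt_trans; [apply H|now apply HN].
Qed.

Lemma polylog_at_0 (zeta : C -> C) a : is_riemann_zeta zeta -> (2 < Re a)%R ->
  Clim (fun n => polylog a (node n)) (zeta a).
Proof.
intros [_ Hz] Ha eps.
assert (S0 : Clim (pl_sum a 0) (zeta a)).
{ apply (Clim_ext (sum_n (fun n => Rcpow (INR (S n)) (- a)))).
  - intros n. unfold pl_sum. apply sum_n_ext. intros i. unfold pl_term.
    rewrite Rmult_0_r, Ropp_0, exp_0. ceq. ring.
  - apply Clim_of_is_series, Hz. lra. }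
assert (P : (0 < eps / 3)%R) by (generalize (cond_pos eps); lra).
set (e := mkposreal _ P).
destruct (S0 e) as [N1 H1]. destruct (inv_INR_small 1 e) as [N2 H2].
set (N := max N1 N2). specialize (H1 N (Nat.le_max_l _ _)). specialize (H2 N (Nat.le_max_r _ _)).
destruct (Clim_node (fun t => pl_sum a t N) (rder_ccont _ _ _ (rder_pl_sum a 0 N)) e) as [N3 H3].
exists N3. intros n Hn. specialize (H3 n Hn). destruct (node_bounds n) as [B1 B2].
assert (T := polylog_tail a (node n) 0 N ltac:(simpl; lra) B1).
assert (C0 : (pl_const 0 (node n) <= 1)%R).
{ unfold pl_const. simpl. rewrite !Rmult_1_l. apply Rle_trans with (exp 0); [apply exp_mono; lra|right; apply exp_0]. }
assert (C1 : (pl_const 0 (node n) * / INR (S N) <= 1 * / INR (S N))%R).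
{ apply Rmult_le_compat_r; [left; apply Rinv_0_lt_compat, INR_S_pos|exact C0]. }
replace (polylog a (node n) - zeta a) with
  (- (pl_sum a (node n) N - polylog a (node n)) + ((pl_sum a (node n) N - pl_sum a 0 N) + (pl_sum a 0 N - zeta a))) by ring.
eapply Rle_lt_trans; [apply Cmod_triangle|]. rewrite Cmod_opp.
assert (T2 := Cmod_triangle (pl_sum a (node n) N - pl_sum a 0 N) (pl_sum a 0 N - zeta a)).
change (pos e) with (eps / 3)%R in *. lra.
Qed.

Section Zeta.
Variables (zeta Gam : C -> C).
Hypothesis Hzeta : is_riemann_zeta zeta.
Hypothesis HGam : is_gamma Gam.
Let Epl := sub_polylog Gam.

Lemma zeta_cd (s : C) : s <> 1 -> cd zeta s.
Proof. intros H. apply (proj1 Hzeta). exact H. Qed.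

Lemma zeta_cd_Z (s : C) : ~ isZ s -> cd zeta s.
Proof. intros H. apply zeta_cd. intros E. apply H. exists 1%Z. exact E. Qed.

Lemma sub_polylog_lipschitz a0 : ~ isZ a0 -> exists M, locally a0 (fun a => forall s t, (0 < s <= 1)%R -> (0 < t <= 1)%R ->
  (Cmod (Epl a t - Epl a s) <= M * Rabs (t - s))%R).
Proof.
intros Ha.
assert (Ha1 : ~ isZ (a0 + - (1))) by (intros Q; apply Ha, (isZ_minus_nat a0 1); exact Q).
destruct (loc_bounded_shift Epl a0 (- (1)) (sub_polylog_bounded Gam HGam _ Ha1)) as [M HM]. exists M.
generalize (filter_and _ _ HM (not_isZ_locally a0 Ha)). apply filter_imp. intros a [A B] s t Hs Ht.
apply (rder_mean_value_sym (Epl a)). intros x Hx.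
assert (H0 : (0 < x <= 1)%R).
{ split; [eapply Rlt_le_trans; [|apply Hx]; now apply Rmin_case|eapply Rle_trans; [apply Hx|]; now apply Rmax_case]. }
exists (- Epl (a - 1) x). split; [now apply rder_sub_polylog|]. rewrite Cmod_opp. now apply (A x).
Qed.

Lemma sub_polylog_at_0_ex a0 : ~ isZ a0 -> exists l, Clim (fun n => Epl a0 (node n)) l.
Proof.
intros Ha. destruct (sub_polylog_lipschitz a0 Ha) as [M HM]. apply locally_singleton in HM.
apply Clim_cauchy. intros eps.
assert (P : (0 < eps / (2 * (Rabs M + 1)))%R).
{ apply Rdiv_lt_0_compat; [apply cond_pos|]. generalize (Rabs_pos M). lra. }
destruct (node_small (mkposreal _ P)) as [N HN]. exists N. intros n m Hn Hm.
eapply Rle_lt_trans; [apply HM; apply node_bounds|].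
assert (A := HN n Hn). assert (B := HN m Hm). cbn [pos] in A, B.
assert (D : (Rabs (node n - node m) < eps / (Rabs M + 1))%R).
{ replace (eps / (Rabs M + 1))%R with (2 * (eps / (2 * (Rabs M + 1))))%R by (field; generalize (Rabs_pos M); lra).
  apply Rabs_def1; generalize (node_bounds n) (node_bounds m); lra. }
apply Rle_lt_trans with ((Rabs M + 1) * Rabs (node n - node m))%R.
- apply Rmult_le_compat_r; [apply Rabs_pos|]. generalize (Rle_abs M). lra.
- replace (pos eps) with ((Rabs M + 1) * (eps / (Rabs M + 1)))%R by (field; generalize (Rabs_pos M); lra).
  apply Rmult_lt_compat_l; [generalize (Rabs_pos M); lra|exact D].
Qed.

(** The limit at 0 exists because E_a is Lipschitz in t, its derivative being - E_(a-1). As a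
    function of a it is a pointwise limit of locally bounded holomorphic functions, hence
    holomorphic off the integers; for Re a > 2 the subtracted t^(a-1) tends to 0 and the limit is
    the zeta series. *)
Theorem sub_polylog_at_0 a0 : ~ isZ a0 -> Clim (fun n => Epl a0 (node n)) (zeta a0).
Proof.
set (kap := fun a => epsilon (inhabits (RtoC 0)) (Clim (fun n => Epl a (node n)))).
assert (Hk : forall a, ~ isZ a -> Clim (fun n => Epl a (node n)) (kap a)).
{ intros a Ha. apply (epsilon_spec (inhabits (RtoC 0)) (Clim (fun n => Epl a (node n)))). now apply sub_polylog_at_0_ex. }
assert (Dk : forall a, ~ isZ a -> cd kap a).
{ intros a Ha. destruct (sub_polylog_bounded Gam HGam a Ha) as [M HM].
  destruct (proj1 (locally_Cmod _ _) (filter_and _ _ HM (not_isZ_locally a Ha))) as [d Hd].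
  apply (cd_bounded_limit (V := C_NormedModule) (fun n a => Epl a (node n)) kap a d M (cond_pos d)).
  - intros n y Hy. apply sub_polylog_cd; [exact HGam|apply node_bounds|]. now apply (Hd y).
  - intros n y Hy. apply (Hd y); [exact Hy|apply node_bounds].
  - intros y Hy. apply Hk. now apply (Hd y). }
intros Ha. replace (zeta a0) with (kap a0); [now apply Hk|].
cut (kap a0 - zeta a0 = 0).
{ intros E. rewrite <- (Cplus_0_l (zeta a0)), <- E. ring. }
apply (identity_not_Z (fun a => kap a - zeta a)); [| |exact Ha]; clear a0 Ha.
- intros s Hs. apply (cd_minus (V := C_NormedModule)); [now apply Dk|now apply zeta_cd_Z].
- intros s Hs Hr.
  assert (E : Clim (fun n => Epl s (node n)) (zeta s - 0)).
  { unfold Epl, sub_polylog. apply Clim_minus; [now apply polylog_at_0|].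
    replace (RtoC 0) with (Gam (1 - s) * 0) by ring. apply Clim_scal.
    apply (Clim_0_le _ node); [|apply node_small].
    intros n. destruct (node_bounds n) as [B1 B2]. rewrite Cmod_Rcpow.
    rewrite <- (exp_ln (node n)) at 2 by exact B1. apply exp_mono.
    assert (L : (ln (node n) <= 0)%R) by (rewrite <- ln_1; apply ln_le; lra).
    replace (Re (s - 1)) with (Re s - 1)%R by reflexivity. nra. }
  rewrite (Clim_unique _ _ _ (Hk s Hs) E). ring.
Qed.

Definition zeta_coef (a : C) (k : nat) : C := zeta (a - RtoC (INR k)) * RtoC ((-1) ^ k / INR (fact k)).

Definition taylor_rem (K : nat) (a : C) (t : R) : C := Epl a t - csum (fun k => zeta_coef a k * RtoC (t ^ k)) K.

Lemma taylor_rem_S K a t : taylor_rem (S K) a t = taylor_rem K a t - zeta_coef a K * RtoC (t ^ K).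
Proof. unfold taylor_rem. simpl csum. ring. Qed.

Lemma zeta_coef_cd a k : ~ isZ a -> cd (fun a => zeta_coef a k) a.
Proof.
intros Ha. unfold zeta_coef. apply (cd_mult (V := C_NormedModule)); [|apply (cd_const (V := C_NormedModule))].
apply (cd_comp (V := C_NormedModule) (fun a => a - RtoC (INR k)) zeta).
- apply (cd_minus (V := C_NormedModule) (fun a => a)); [apply cd_idC|apply (cd_const (V := C_NormedModule))].
- apply zeta_cd_Z. intros Q. now apply Ha, (isZ_minus_nat a k).
Qed.

Lemma zeta_coef_shift a k : zeta_coef a (S k) * RtoC (INR (S k)) = - zeta_coef (a - 1) k.
Proof.
unfold zeta_coef. replace (a - RtoC (INR (S k))) with (a - 1 - RtoC (INR k)) by (rewrite S_INR, RtoC_plus; ring).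
assert (E : RtoC ((-1) ^ S k / INR (fact (S k))) * RtoC (INR (S k)) = - RtoC ((-1) ^ k / INR (fact k))).
{ rewrite <- RtoC_mult, <- RtoC_opp. f_equal. rewrite fact_simpl, mult_INR. simpl pow. field.
  split; [apply INR_fact_neq_0|apply not_0_INR; lia]. }
rewrite <- Cmult_assoc, E. ring.
Qed.

Lemma taylor_rem_cd K t a : (0 < t)%R -> ~ isZ a -> cd (fun a => taylor_rem K a t) a.
Proof.
intros Ht Ha. induction K as [|K IH].
- apply (cd_ext (V := C_NormedModule) (fun a => Epl a t)); [intros y; unfold taylor_rem; simpl; ring|]. now apply sub_polylog_cd.
- apply (cd_ext (V := C_NormedModule) (fun a => taylor_rem K a t - zeta_coef a K * RtoC (t ^ K))); [intros y; symmetry; apply taylor_rem_S|].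
  apply (cd_minus (V := C_NormedModule)); [exact IH|].
  apply (cd_mult (V := C_NormedModule)); [now apply zeta_coef_cd|apply (cd_const (V := C_NormedModule))].
Qed.

Lemma rder_taylor_rem K a t : (0 < t)%R -> ~ isZ a -> rder (taylor_rem (S K) a) t (- taylor_rem K (a - 1) t).
Proof.
intros Ht Ha. induction K as [|K IH].
- apply (rder_ext_locally (fun t => Epl a t - zeta_coef a 0)).
  { apply filter_forall. intros y. rewrite taylor_rem_S. unfold taylor_rem. simpl. ring. }
  replace (- taylor_rem 0 (a - 1) t) with (- Epl (a - 1) t - 0) by (unfold taylor_rem; simpl; ring).
  apply rder_minus; [now apply rder_sub_polylog|apply rder_const].
- apply (rder_ext_locally (fun t => taylor_rem (S K) a t - zeta_coef a (S K) * RtoC (t ^ S K))).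
  { apply filter_forall. intros y. now rewrite (taylor_rem_S (S K)). }
  replace (- taylor_rem (S K) (a - 1) t) with (- taylor_rem K (a - 1) t - zeta_coef a (S K) * RtoC (INR (S K) * t ^ K)).
  + apply rder_minus; [exact IH|]. apply rder_scal, rder_RtoC. auto_derive; [auto|].
    rewrite Rmult_1_l. reflexivity.
  + rewrite taylor_rem_S, RtoC_mult, Cmult_assoc, zeta_coef_shift. ring.
Qed.

Lemma taylor_rem_at_0 K a : ~ isZ a -> Clim (fun n => taylor_rem (S K) a (node n)) 0.
Proof.
intros Ha. induction K as [|K IH].
- apply (Clim_ext (fun n => Epl a (node n) - zeta_coef a 0)); [intros n; rewrite taylor_rem_S; unfold taylor_rem; simpl; ring|].
  replace (RtoC 0) with (zeta a - zeta_coef a 0).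
  + apply Clim_minus; [now apply sub_polylog_at_0|apply Clim_const].
  + unfold zeta_coef. simpl. replace (a - 0) with a by ring. unfold Rdiv. rewrite Rinv_1, Rmult_1_r. ring.
- apply (Clim_ext (fun n => taylor_rem (S K) a (node n) - zeta_coef a (S K) * RtoC (node n ^ S K))); [intros n; now rewrite (taylor_rem_S (S K))|].
  replace (RtoC 0) with (0 - zeta_coef a (S K) * 0) by ring.
  apply Clim_minus; [exact IH|]. apply Clim_scal. apply (Clim_0_le _ node); [|apply node_small].
  intros n. destruct (node_bounds n) as [B1 B2]. rewrite Cmod_R, Rabs_pos_eq by (apply pow_le; lra).
  simpl. rewrite <- (Rmult_1_r (node n)) at 3. apply Rmult_le_compat_l; [lra|]. rewrite <- (pow1 K). apply pow_incr. lra.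
Qed.

Theorem taylor_rem_bound K : forall a0, ~ isZ a0 -> exists M, (0 <= M)%R /\
  locally a0 (fun a => forall t, (0 < t <= 1)%R -> (Cmod (taylor_rem K a t) <= M * t ^ K)%R).
Proof.
induction K as [|K IH]; intros a0 Ha.
- destruct (sub_polylog_bounded Gam HGam a0 Ha) as [M HM]. exists (Rmax M 0). split; [apply Rmax_r|].
  generalize HM. apply filter_imp. intros a A t Ht. unfold taylor_rem. simpl. rewrite Rmult_1_r.
  replace (Epl a t - 0) with (Epl a t) by ring. eapply Rle_trans; [now apply A|apply Rmax_l].
- assert (Ha1 : ~ isZ (a0 + - (1))) by (intros Q; apply Ha, (isZ_minus_nat a0 1); exact Q).
  destruct (IH _ Ha1) as (M & M0 & HM). exists M. split; [exact M0|].
  generalize (filter_and _ _ (locally_shift _ _ _ HM) (not_isZ_locally a0 Ha)). apply filter_imp.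
  intros a [A B] t Ht.
  destruct (node_small (mkposreal t (proj1 Ht))) as [N HN].
  (* The remainder is not differentiable at t = 0, so its increment from 1 / (n+1) to t is estimated
     and then n tends to infinity. *)
  apply (Clim_le_const (fun n => taylor_rem (S K) a t - taylor_rem (S K) a (node n)) _ _ N).
  + replace (taylor_rem (S K) a t) with (taylor_rem (S K) a t - 0) at 1 by ring.
    apply Clim_minus; [apply Clim_const|now apply taylor_rem_at_0].
  + intros n Hn. specialize (HN n Hn). cbn [pos] in HN. destruct (node_bounds n) as [B1 B2].
    replace (M * t ^ S K)%R with (M * t ^ K * t)%R by (simpl; ring).
    assert (P : (0 <= M * t ^ K)%R) by (apply Rmult_le_pos; [exact M0|apply pow_le; lra]).
    apply Rle_trans with (M * t ^ K * (t - node n))%R; [|apply Rmult_le_compat_l; lra].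
    apply rder_mean_value; [lra|]. intros x Hx. exists (- taylor_rem K (a - 1) x).
    split; [apply rder_taylor_rem; [lra|exact B]|]. rewrite Cmod_opp.
    apply Rle_trans with (M * x ^ K)%R; [apply (A x); lra|].
    apply Rmult_le_compat_l; [exact M0|]. apply pow_incr. lra.
Qed.

End Zeta.

(** * The Mellin transform of [L_a L_b] *)

Definition pcont (f : R -> C) : Prop := forall t, (0 < t)%R -> ccont f t.

Definition int_01 (f : R -> C) (n : nat) : C := CInt f (node n) 1.
Definition int_1oo (f : R -> C) (n : nat) : C := CInt f 1 (INR (S n) + 1).
(** Chosen limits make the improper integrals total functions of the integrand; convergence is
    supplied separately by bounds. *)
Definition I01 (f : R -> C) : C := epsilon (inhabits (RtoC 0)) (Clim (int_01 f)).
Definition I1oo (f : R -> C) : C := epsilon (inhabits (RtoC 0)) (Clim (int_1oo f)).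

Lemma int_01_bound f M n : pcont f -> (forall t, (0 < t <= 1)%R -> (Cmod (f t) <= M)%R) -> (Cmod (int_01 f n) <= M)%R.
Proof.
intros Cf Hf. destruct (node_bounds n) as [B1 B2].
assert (M0 : (0 <= M)%R) by (eapply Rle_trans; [apply Cmod_ge_0|apply (Hf 1%R); lra]).
apply Rle_trans with (M * (1 - node n))%R; [|nra].
apply CInt_bound; [exact B2|apply ex_CInt_pos; [exact B1|lra|exact Cf]|]. intros t Ht. apply Hf. lra.
Qed.

Lemma int_01_lim f M : pcont f -> (forall t, (0 < t <= 1)%R -> (Cmod (f t) <= M)%R) -> Clim (int_01 f) (I01 f).
Proof.
intros Cf Hf. apply (epsilon_spec (inhabits (RtoC 0)) (Clim (int_01 f))). apply Clim_cauchy. intros eps.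
assert (M0 : (0 <= M)%R) by (eapply Rle_trans; [apply Cmod_ge_0|apply (Hf 1%R); lra]).
assert (P : (0 < eps / (M + 1))%R) by (apply Rdiv_lt_0_compat; [apply cond_pos|lra]).
destruct (node_small (mkposreal _ P)) as [N HN]. exists N.
assert (K : forall n m, (N <= n)%nat -> (N <= m)%nat -> (node n <= node m)%R -> (Cmod (int_01 f n - int_01 f m) < eps)%R).
{ intros n m Hn Hm L. destruct (node_bounds n) as [B1 B2]. destruct (node_bounds m) as [B3 B4].
  unfold int_01. rewrite (CInt_Chasles f (node n) (node m) 1) by (apply ex_CInt_pos; [lra|lra|exact Cf]).
  replace (CInt f (node n) (node m) + CInt f (node m) 1 - CInt f (node m) 1) with (CInt f (node n) (node m)) by ring.
  apply Rle_lt_trans with (M * (node m - node n))%R.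
  - apply CInt_bound; [exact L|apply ex_CInt_pos; [lra|lra|exact Cf]|]. intros t Ht. apply Hf. lra.
  - specialize (HN m Hm). cbn [pos] in HN.
    replace (pos eps) with ((M + 1) * (eps / (M + 1)))%R by (field; lra).
    apply Rle_lt_trans with ((M + 1) * node m)%R; [nra|]. apply Rmult_lt_compat_l; lra. }
intros n m Hn Hm. destruct (Rle_dec (node n) (node m)) as [L|L]; [now apply K|].
rewrite <- Cmod_opp. replace (- (int_01 f n - int_01 f m)) with (int_01 f m - int_01 f n) by ring. apply K; [exact Hm|exact Hn|lra].
Qed.

Definition cell (f : R -> C) (n : nat) : C := CInt f (INR (S n)) (INR (S n) + 1).

Lemma int_1oo_cells f n : pcont f -> int_1oo f n = sum_n (cell f) n.
Proof.
intros Cf. induction n as [|n IH]; [rewrite sum_O; reflexivity|].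
rewrite sum_n_S, <- IH. unfold int_1oo, cell.
assert (P := INR_S_pos n).
replace (INR (S (S n))) with (INR (S n) + 1)%R by (rewrite (S_INR (S n)); reflexivity).
apply CInt_Chasles; apply ex_CInt_pos; (lra || exact Cf).
Qed.

Lemma cell_bound f M n : pcont f -> (forall t, (1 <= t)%R -> (Cmod (f t) <= M * / t ^ 2)%R) ->
  (Cmod (cell f n) <= M * / INR (S n) ^ 2)%R.
Proof.
intros Cf Hf. assert (P : (1 <= INR (S n))%R) by (rewrite S_INR; generalize (pos_INR n); lra).
assert (M0 : (0 <= M)%R).
{ assert (Q := Hf 1%R ltac:(lra)). rewrite pow1, Rinv_1, Rmult_1_r in Q. eapply Rle_trans; [apply Cmod_ge_0|exact Q]. }
replace (M * / INR (S n) ^ 2)%R with (M * / INR (S n) ^ 2 * (INR (S n) + 1 - INR (S n)))%R by ring.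
apply CInt_bound; [lra|apply ex_CInt_pos; [lra|lra|exact Cf]|]. intros t Ht.
eapply Rle_trans; [apply Hf; lra|]. apply Rmult_le_compat_l; [exact M0|].
apply Rinv_le_contravar; [apply pow_lt; lra|]. apply pow_incr. lra.
Qed.

Lemma int_1oo_bound f M n : pcont f -> (forall t, (1 <= t)%R -> (Cmod (f t) <= M * / t ^ 2)%R) ->
  (Cmod (int_1oo f n) <= 2 * M)%R.
Proof.
intros Cf Hf. rewrite int_1oo_cells by exact Cf. apply mtest_partial. intros i. now apply cell_bound.
Qed.

Lemma int_1oo_lim f M : pcont f -> (forall t, (1 <= t)%R -> (Cmod (f t) <= M * / t ^ 2)%R) -> Clim (int_1oo f) (I1oo f).
Proof.
intros Cf Hf. apply (epsilon_spec (inhabits (RtoC 0)) (Clim (int_1oo f))).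
exists (Csum (cell f)). apply (Clim_ext (sum_n (cell f))); [intros n; symmetry; now apply int_1oo_cells|].
apply (Csum_correct _ M). intros n. now apply cell_bound.
Qed.

Section Dependence.
Context {V : NormedModule C_AbsRing}.

Lemma CInt_param_cd (f : R -> V -> C) (x : V) (rho M a b : R) : (0 < rho)%R -> (0 < a <= b)%R ->
  (forall t y, 0 < t -> norm (minus y x) < rho -> cd (f t) y)%R ->
  (forall y, norm (minus y x) < rho -> pcont (fun t => f t y))%R ->
  (forall t y, a <= t <= b -> norm (minus y x) < rho -> Cmod (f t y) <= M)%R ->
  forall y, (norm (minus y x) < rho)%R -> cd (fun y => CInt (fun t => f t y) a b) y.
Proof.
intros Hrho Hab Hd Hc Hb y Hy.
assert (T : forall z, (norm (minus z y) < rho - norm (minus y x))%R -> (norm (minus z x) < rho)%R).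
{ intros z Hz. eapply Rle_lt_trans; [apply (norm_minus_triangle z y x)|].
  assert (norm (minus z y) + norm (minus y x) < rho)%R; [|assumption].
  generalize dependent (norm (minus z y)). generalize dependent (norm (minus y x)). intros. lra. }
apply (cd_integral f a b y (rho - norm (minus y x)) M).
- generalize dependent (norm (minus y x)). intros. lra.
- lra.
- intros t z Ht Hz. apply Hd; [lra|now apply T].
- intros t z Ht Hz. apply Hb; [lra|now apply T].
- intros z Hz. apply ex_CInt_pos; [lra|lra|]. apply Hc. now apply T.
Qed.

Lemma I01_cd (f : R -> V -> C) (x : V) (rho M : R) : (0 < rho)%R ->
  (forall t y, 0 < t -> norm (minus y x) < rho -> cd (f t) y)%R ->
  (forall y, norm (minus y x) < rho -> pcont (fun t => f t y))%R ->
  (forall t y, 0 < t <= 1 -> norm (minus y x) < rho -> Cmod (f t y) <= M)%R ->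
  cd (fun y => I01 (fun t => f t y)) x.
Proof.
intros Hrho Hd Hc Hb.
apply (cd_bounded_limit (fun n y => int_01 (fun t => f t y) n) _ x rho M Hrho).
- intros n y Hy. destruct (node_bounds n) as [B1 B2].
  apply (CInt_param_cd f x rho M); try assumption; [lra|]. intros t z Ht. apply Hb. lra.
- intros n y Hy. apply int_01_bound; [now apply Hc|]. intros t Ht. now apply Hb.
- intros y Hy. apply (int_01_lim _ M); [now apply Hc|]. intros t Ht. now apply Hb.
Qed.

Lemma I1oo_cd (f : R -> V -> C) (x : V) (rho M : R) : (0 < rho)%R ->
  (forall t y, 0 < t -> norm (minus y x) < rho -> cd (f t) y)%R ->
  (forall y, norm (minus y x) < rho -> pcont (fun t => f t y))%R ->
  (forall t y, 1 <= t -> norm (minus y x) < rho -> Cmod (f t y) <= M * / t ^ 2)%R ->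
  cd (fun y => I1oo (fun t => f t y)) x.
Proof.
intros Hrho Hd Hc Hb.
apply (cd_bounded_limit (fun n y => int_1oo (fun t => f t y) n) _ x rho (2 * M) Hrho).
- intros n y Hy. assert (P := INR_S_pos n).
  apply (CInt_param_cd f x rho M); try assumption; [lra|]. intros t z Ht Hz.
  assert (M0 : (0 <= M)%R).
  { assert (Q := Hb 1%R z ltac:(lra) Hz). rewrite pow1, Rinv_1, Rmult_1_r in Q. eapply Rle_trans; [apply Cmod_ge_0|exact Q]. }
  eapply Rle_trans; [apply Hb; [lra|exact Hz]|]. rewrite <- (Rmult_1_r M) at 2. apply Rmult_le_compat_l; [exact M0|].
  rewrite <- Rinv_1. apply Rinv_le_contravar; [lra|]. rewrite <- (pow1 2) at 1. apply pow_incr. lra.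
- intros n y Hy. apply int_1oo_bound; [now apply Hc|]. intros t Ht. now apply Hb.
- intros y Hy. apply (int_1oo_lim _ M); [now apply Hc|]. intros t Ht. now apply Hb.
Qed.

End Dependence.

Definition int_0oo (f : R -> C) (n : nat) : C := CInt f (node n) (INR (S n) + 1).

Lemma int_0oo_split f n : pcont f -> int_0oo f n = int_01 f n + int_1oo f n.
Proof.
intros Cf. assert (P := INR_S_pos n). destruct (node_bounds n).
apply CInt_Chasles; apply ex_CInt_pos; (lra || exact Cf).
Qed.

Lemma impr_int_0oo f l : impr f l -> Clim (int_0oo f) l.
Proof.
intros H eps. destruct (H eps) as (d & B & Hd). destruct (node_small d) as [N1 H1]. destruct (nat_above B) as [N2 H2].
exists (max N1 N2). intros n Hn. apply Hd.
- split; [apply node_bounds|apply H1; lia].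
- assert (N2 <= n)%nat by lia. apply le_INR in H0. rewrite S_INR. lra.
Qed.

Lemma int_0oo_bound f M n : pcont f -> (forall t, (0 < t <= 1)%R -> (Cmod (f t) <= M)%R) ->
  (forall t, (1 <= t)%R -> (Cmod (f t) <= M * / t ^ 2)%R) -> (Cmod (int_0oo f n) <= 3 * M)%R.
Proof.
intros Cf H1 H2. rewrite int_0oo_split by exact Cf. eapply Rle_trans; [apply Cmod_triangle|].
assert (A := int_01_bound f M n Cf H1). assert (B := int_1oo_bound f M n Cf H2). lra.
Qed.

Lemma int_0oo_lim f M : pcont f -> (forall t, (0 < t <= 1)%R -> (Cmod (f t) <= M)%R) ->
  (forall t, (1 <= t)%R -> (Cmod (f t) <= M * / t ^ 2)%R) -> Clim (int_0oo f) (I01 f + I1oo f).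
Proof.
intros Cf H1 H2. apply (Clim_ext (fun n => int_01 f n + int_1oo f n)); [intros n; symmetry; now apply int_0oo_split|].
apply Clim_plus; [now apply (int_01_lim f M)|now apply (int_1oo_lim f M)].
Qed.

(** The product of two polylogarithms is at most (2 pl_const)^2, which gives 4 (k! 2^k)^2; the
    factorial comes from t^(n+2) <= (n+2)! e^t and leaves 1 / t^2 at infinity. *)
Definition mellin_const (k n : nat) : R := (4 * (INR (fact k) * 2 ^ k) ^ 2 * INR (fact (n + 2)))%R.

Lemma pl_const_pos k t : (0 < t)%R -> (0 < pl_const k t)%R.
Proof.
intros Ht. unfold pl_const. repeat apply Rmult_lt_0_compat; [apply INR_fact_lt_0|apply pow_lt; lra|apply pow_lt, Rinv_0_lt_compat; lra|apply exp_pos].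
Qed.

Lemma exp_ln_inv_pow n t : (0 < t)%R -> exp (- INR n * ln t) = ((/ t) ^ n)%R.
Proof.
intros Ht. rewrite <- Rpower_pow by now apply Rinv_0_lt_compat. unfold Rpower. rewrite ln_Rinv by exact Ht. f_equal. ring.
Qed.

Lemma pl_const_sq k t : (0 < t)%R ->
  (4 * (pl_const k t * pl_const k t) = 4 * (INR (fact k) * 2 ^ k) ^ 2 * (exp (- INR (2 * k) * ln t) * exp (- t)))%R.
Proof.
intros Ht. unfold pl_const. rewrite exp_ln_inv_pow by exact Ht.
replace (2 * k)%nat with (k + k)%nat by lia. rewrite pow_add.
replace (- t)%R with (- (t / 2) + - (t / 2))%R by field. rewrite exp_plus. ring.
Qed.

Lemma mellin_decay k n sg t : (sg - 1 - INR (2 * k) <= INR n)%R -> (1 <= t)%R ->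
  (exp ((sg - 1) * ln t) * (4 * (pl_const k t * pl_const k t)) <= mellin_const k n * / t ^ 2)%R.
Proof.
intros Hn Ht. rewrite pl_const_sq by lra. unfold mellin_const.
set (c := (4 * (INR (fact k) * 2 ^ k) ^ 2)%R).
assert (c0 : (0 <= c)%R) by (unfold c; apply Rmult_le_pos; [lra|apply pow2_ge_0]).
replace (exp ((sg - 1) * ln t) * (c * (exp (- INR (2 * k) * ln t) * exp (- t))))%R
  with (c * (exp ((sg - 1 - INR (2 * k)) * ln t) * exp (- t)))%R.
2: { replace ((sg - 1 - INR (2 * k)) * ln t)%R with ((sg - 1) * ln t + - INR (2 * k) * ln t)%R by ring. rewrite exp_plus. ring. }
rewrite Rmult_assoc. apply Rmult_le_compat_l; [exact c0|].
assert (A := exp_ln_le_pow _ n t Ht Hn). assert (B := pow_le_fact_exp (n + 2) t ltac:(lra)).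
assert (P := exp_pos (- t)). assert (P2 : (0 < t ^ 2)%R) by (apply pow_lt; lra).
apply (Rmult_le_reg_r (t ^ 2)); [exact P2|]. rewrite (Rmult_assoc _ (/ t ^ 2)), Rinv_l, Rmult_1_r by lra.
apply Rle_trans with (t ^ n * exp (- t) * t ^ 2)%R.
- apply Rmult_le_compat_r; [lra|]. apply Rmult_le_compat_r; lra.
- replace (t ^ n * exp (- t) * t ^ 2)%R with (t ^ (n + 2) * exp (- t))%R by (rewrite pow_add; ring).
  apply Rle_trans with (INR (fact (n + 2)) * exp t * exp (- t))%R; [apply Rmult_le_compat_r; lra|].
  rewrite Rmult_assoc, <- exp_plus, Rplus_opp_r, exp_0. lra.
Qed.

Lemma mellin_small k n sg t : (INR (2 * k) <= sg - 1)%R -> (0 < t <= 1)%R ->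
  (exp ((sg - 1) * ln t) * (4 * (pl_const k t * pl_const k t)) <= mellin_const k n)%R.
Proof.
intros Hn Ht. rewrite pl_const_sq by lra. unfold mellin_const.
set (c := (4 * (INR (fact k) * 2 ^ k) ^ 2)%R).
assert (c0 : (0 <= c)%R) by (unfold c; apply Rmult_le_pos; [lra|apply pow2_ge_0]).
replace (exp ((sg - 1) * ln t) * (c * (exp (- INR (2 * k) * ln t) * exp (- t))))%R
  with (c * (exp ((sg - 1 - INR (2 * k)) * ln t) * exp (- t)))%R.
2: { replace ((sg - 1 - INR (2 * k)) * ln t)%R with ((sg - 1) * ln t + - INR (2 * k) * ln t)%R by ring. rewrite exp_plus. ring. }
apply Rmult_le_compat_l; [exact c0|].
assert (L : (ln t <= 0)%R) by (rewrite <- ln_1; apply ln_le; lra).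
assert (F : (1 <= INR (fact (n + 2)))%R) by (change 1%R with (INR 1); apply le_INR, lt_O_fact).
apply Rle_trans with 1%R; [|exact F]. rewrite <- (Rmult_1_l 1). apply Rmult_le_compat; try (left; apply exp_pos).
- apply Rle_trans with (exp 0); [apply exp_mono; nra|right; apply exp_0].
- apply Rle_trans with (exp 0); [apply exp_mono; lra|right; apply exp_0].
Qed.

Definition mell (c : C) (f : R -> C) (t : R) : C := Rcpow t (c - 1) * f t.

Lemma pcont_mell c f : pcont f -> pcont (mell c f).
Proof. intros H t Ht. apply (ccont_mult (fun t => Rcpow t (c - 1)) f); [now apply ccont_Rcpow|now apply H]. Qed.

Lemma Cmod_mell c f t : Cmod (mell c f t) = (exp ((Re c - 1) * ln t) * Cmod (f t))%R.
Proof. unfold mell. rewrite Cmod_mult, Cmod_Rcpow. reflexivity. Qed.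

Definition polyprod (a b : C) (t : R) : C := polylog a t * polylog b t.
Definition sumprod (N : nat) (a b : C) (t : R) : C := pl_sum a t N * pl_sum b t N.

Lemma pcont_polyprod a b : pcont (polyprod a b).
Proof. intros t Ht. apply (ccont_mult (polylog a) (polylog b)); now apply ccont_polylog. Qed.

Lemma pcont_sumprod N a b : pcont (sumprod N a b).
Proof.
intros t Ht. apply (ccont_mult (fun t => pl_sum a t N) (fun t => pl_sum b t N)); eapply rder_ccont, rder_pl_sum.
Qed.

Section Large.
Variables (a b c : C) (k : nat).
Hypothesis Ha : (2 - Re a <= INR k)%R.
Hypothesis Hb : (2 - Re b <= INR k)%R.

Lemma polyprod_bound t : (0 < t)%R -> (Cmod (polyprod a b t) <= 4 * (pl_const k t * pl_const k t))%R.
Proof.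
intros Ht. unfold polyprod. rewrite Cmod_mult.
assert (A := polylog_bound a t k Ha Ht). assert (B := polylog_bound b t k Hb Ht). assert (P := pl_const_pos k t Ht).
assert (A0 := Cmod_ge_0 (polylog a t)). assert (B0 := Cmod_ge_0 (polylog b t)). nra.
Qed.

Lemma sumprod_diff N t : (0 < t)%R ->
  (Cmod (sumprod N a b t - polyprod a b t) <= / INR (S N) * (4 * (pl_const k t * pl_const k t)))%R.
Proof.
intros Ht. unfold sumprod, polyprod.
replace (pl_sum a t N * pl_sum b t N - polylog a t * polylog b t) with
  (pl_sum a t N * (pl_sum b t N - polylog b t) + (pl_sum a t N - polylog a t) * polylog b t) by ring.
eapply Rle_trans; [apply Cmod_triangle|]. rewrite !Cmod_mult.
assert (A1 := pl_sum_bound a t k N Ha Ht). assert (A2 := polylog_tail a t k N Ha Ht).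
assert (B1 := polylog_bound b t k Hb Ht). assert (B2 := polylog_tail b t k N Hb Ht).
assert (P := pl_const_pos k t Ht). assert (Q : (0 < / INR (S N))%R) by apply Rinv_0_lt_compat, INR_S_pos.
replace (/ INR (S N) * (4 * (pl_const k t * pl_const k t)))%R with
  (2 * pl_const k t * (pl_const k t * / INR (S N)) + pl_const k t * / INR (S N) * (2 * pl_const k t))%R by ring.
apply Rplus_le_compat; apply Rmult_le_compat; try apply Cmod_ge_0; assumption.
Qed.

Hypothesis Hc : (INR (2 * k) <= Re c - 1)%R.

(** Since Re c >= 2 k, the factor (m + n)^-c is at most m^-k n^-k, which swallows the growth m^(k-2)
    and n^(k-2) allowed to the other two factors. *)
Lemma MT_term_bound m n : (Cmod (MT_term a b c m n) <= / INR (S m) ^ 2 * / INR (S n) ^ 2)%R.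
Proof.
unfold MT_term. rewrite !Cmod_mult, !Cmod_Rcpow.
assert (A := exp_ln_INR_le (Re a) m k ltac:(lra)). assert (B := exp_ln_INR_le (Re b) n k ltac:(lra)).
replace (Re (- a)) with (- Re a)%R by reflexivity. replace (Re (- b)) with (- Re b)%R by reflexivity.
replace (Re (- c)) with (- Re c)%R by reflexivity.
assert (X := INR_S_pos m). assert (Y := INR_S_pos n).
set (x := INR (S m)) in *. set (y := INR (S n)) in *.
assert (X1 : (1 <= x)%R) by (unfold x; rewrite S_INR; generalize (pos_INR m); lra).
assert (Y1 : (1 <= y)%R) by (unfold y; rewrite S_INR; generalize (pos_INR n); lra).
replace (INR (S m + S n)) with (x + y)%R by (unfold x, y; symmetry; apply plus_INR).
assert (Z : (exp (- Re c * ln (x + y)) <= (/ x) ^ k * (/ y) ^ k)%R).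
{ apply Rle_trans with (exp (- INR (2 * k) * ln (x + y))).
  - apply exp_mono. assert (0 <= ln (x + y))%R by (rewrite <- ln_1; apply ln_le; lra). nra.
  - rewrite exp_ln_inv_pow by lra. replace (2 * k)%nat with (k + k)%nat by lia. rewrite pow_add.
    assert (I0 : (0 <= / (x + y))%R) by (left; apply Rinv_0_lt_compat; lra).
    apply Rmult_le_compat; try (apply pow_le; exact I0).
    + apply pow_incr. split; [exact I0|]. apply Rinv_le_contravar; lra.
    + apply pow_incr. split; [exact I0|]. apply Rinv_le_contravar; lra. }
rewrite !pow_inv in Z.
assert (Px : (0 < x ^ k)%R) by (apply pow_lt; lra). assert (Py : (0 < y ^ k)%R) by (apply pow_lt; lra).
assert (Px2 : (0 < / x ^ 2)%R) by (apply Rinv_0_lt_compat, pow_lt; lra). assert (Py2 : (0 < / y ^ 2)%R) by (apply Rinv_0_lt_compat, pow_lt; lra).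
apply Rle_trans with (x ^ k * / x ^ 2 * (y ^ k * / y ^ 2) * (/ x ^ k * / y ^ k))%R.
- apply Rmult_le_compat; [|left; apply exp_pos| |exact Z].
  + apply Rmult_le_pos; left; apply exp_pos.
  + apply Rmult_le_compat; try (left; apply exp_pos); assumption.
- right. field. repeat split; lra.
Qed.

Lemma inv_sq_sum N : (sum_n (fun n => / INR (S n) ^ 2) N <= 2)%R.
Proof.
assert (H := mtest_partial (fun n => RtoC (/ INR (S n) ^ 2)) 1).
rewrite <- (Rmult_1_r 2). eapply Rle_trans; [apply Rle_abs|].
rewrite <- Cmod_R, RtoC_sum_n. apply H. intros n. rewrite Cmod_R, Rabs_pos_eq; [lra|].
left. apply Rinv_0_lt_compat, pow_lt, INR_S_pos.
Qed.

Lemma MT_abs_bound N : (sum_n (fun m => sum_n (fun n => Cmod (MT_term a b c m n)) N) N <= 4)%R.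
Proof.
assert (H : forall m, (sum_n (fun n => Cmod (MT_term a b c m n)) N <= 2 * / INR (S m) ^ 2)%R).
{ intros m. apply Rle_trans with (sum_n (fun n => scal (/ INR (S m) ^ 2)%R (/ INR (S n) ^ 2)%R) N).
  - apply sum_n_m_le. intros n. apply MT_term_bound.
  - rewrite sum_n_scal_l. change (/ INR (S m) ^ 2 * sum_n (fun n => / INR (S n) ^ 2) N <= 2 * / INR (S m) ^ 2)%R.
    rewrite Rmult_comm. apply Rmult_le_compat_r; [left; apply Rinv_0_lt_compat, pow_lt, INR_S_pos|].
    apply inv_sq_sum. }
apply Rle_trans with (sum_n (fun m => scal 2%R (/ INR (S m) ^ 2)%R) N); [apply sum_n_m_le, H|].
rewrite sum_n_scal_l. change (2 * sum_n (fun m => / INR (S m) ^ 2) N <= 4)%R.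
assert (Q := inv_sq_sum N). lra.
Qed.

End Large.

Lemma sum_n_prod (u v : nat -> C) N : sum_n u N * sum_n v N = sum_n (fun m => sum_n (fun n => u m * v n) N) N.
Proof.
rewrite Cmult_comm, <- sum_n_C_mult. apply sum_n_ext. intros m.
transitivity (u m * sum_n v N); [apply Cmult_comm|]. symmetry. apply (sum_n_C_mult (u m) v).
Qed.

(** * Holomorphic model near an arbitrary point *)

Definition V3 : NormedModule C_AbsRing :=
  prod_NormedModule C_AbsRing (prod_NormedModule C_AbsRing C_NormedModule C_NormedModule) C_NormedModule.

Definition pa (x : V3) : C := fst (fst x).
Definition pb (x : V3) : C := snd (fst x).
Definition pc (x : V3) : C := snd x.

Lemma pa_cd (x : V3) : cd pa x.
Proof.
apply ex_filterdiff_linear. apply (is_linear_comp (K := C_AbsRing) (fst : V3 -> _) (fst : prod_NormedModule C_AbsRing C_NormedModule C_NormedModule -> C)); apply is_linear_fst.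
Qed.

Lemma pb_cd (x : V3) : cd pb x.
Proof.
apply ex_filterdiff_linear. apply (is_linear_comp (K := C_AbsRing) (fst : V3 -> _) (snd : prod_NormedModule C_AbsRing C_NormedModule C_NormedModule -> C)); [apply is_linear_fst|apply is_linear_snd].
Qed.

Lemma pc_cd (x : V3) : cd pc x.
Proof. apply ex_filterdiff_linear. apply (is_linear_snd (K := C_AbsRing)). Qed.

Lemma cd_comp_scalar {V : NormedModule C_AbsRing} (g : C -> C) (p : V -> C) x : cd p x -> cd g (p x) -> cd (fun y => g (p y)) x.
Proof. intros A B. exact (cd_comp p g x A B). Qed.

Section Mellin.
Variable Gam : C -> C.
Hypothesis HGam : is_gamma Gam.

Definition MT_sum (N : nat) (a b c : C) : C := sum_n (fun m => sum_n (MT_term a b c m) N) N.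

(** For a finite double sum the exchange with the integral is linearity; each pair contributes
    Gamma(c) (m + n)^-c. *)
Lemma mellin_sumprod N a b c : (0 < Re c)%R -> Clim (int_0oo (mell c (sumprod N a b))) (Gam c * MT_sum N a b c).
Proof.
intros Hc.
set (co := fun m n => Rcpow (INR (S m)) (- a) * Rcpow (INR (S n)) (- b)).
set (g := fun m n => gint (INR (S m + S n)) c).
assert (E : forall t, mell c (sumprod N a b) t = sum_n (fun m => sum_n (fun n => co m n * g m n t) N) N).
{ intros t. unfold mell, sumprod, pl_sum. rewrite sum_n_prod, <- sum_n_C_mult. apply sum_n_ext. intros m.
  ceq. rewrite <- sum_n_C_mult. apply sum_n_ext. intros n. unfold pl_term, co, g, gint. ceq.
  rewrite plus_INR. replace (exp (- (t * (INR (S m) + INR (S n)))))%R with (exp (- (INR (S m) * t)) * exp (- (INR (S n) * t)))%R.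
  2: { rewrite <- exp_plus. f_equal. ring. }
  rewrite RtoC_mult. ring. }
apply (Clim_ext (fun j => sum_n (fun m => sum_n (fun n => co m n * int_0oo (g m n) j) N) N)).
- intros j. symmetry. apply CInt_unique.
  apply (is_RInt_ext (V := C_R_NormedModule) (fun t => sum_n (fun m => sum_n (fun n => co m n * g m n t) N) N)).
  { intros t _. symmetry. apply E. }
  apply (is_CInt_sum_n (fun m t => sum_n (fun n => co m n * g m n t) N)). intros m.
  apply (is_CInt_sum_n (fun n t => co m n * g m n t)). intros n. apply is_CInt_mult, CInt_correct, ex_CInt_pos.
  + apply node_bounds.
  + generalize (INR_S_pos j). lra.
  + intros t Ht. now apply ccont_gint.
- replace (Gam c * MT_sum N a b c) with (sum_n (fun m => sum_n (fun n => co m n * (Gam c * Rcpow (INR (S m + S n)) (- c))) N) N).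
  + apply (Clim_sum_n (fun j m => sum_n (fun n => co m n * int_0oo (g m n) j) N)). intros m.
    apply (Clim_sum_n (fun j n => co m n * int_0oo (g m n) j)). intros n.
    apply Clim_scal, impr_int_0oo. apply Gam_scaled; [exact HGam|exact Hc|]. apply lt_0_INR. lia.
  + unfold MT_sum. rewrite <- sum_n_C_mult. apply sum_n_ext. intros m. ceq. rewrite <- sum_n_C_mult. apply sum_n_ext. intros n.
    unfold MT_term, co. ceq. ring.
Qed.

Definition mellin (a b c : C) : C := I01 (mell c (polyprod a b)) + I1oo (mell c (polyprod a b)).

Section Large_c.
Variables (a b c : C) (k : nat).
Hypothesis Ha : (2 - Re a <= INR k)%R.
Hypothesis Hb : (2 - Re b <= INR k)%R.
Hypothesis Hc : (INR (2 * k) <= Re c - 1)%R.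

(** The tail bound of the polylogarithms, of order 1 / (N+1) uniformly up to the integrable weight,
    replaces a dominated convergence theorem. *)
Lemma mellin_sum_diff : exists M, forall N, (Cmod (Gam c * MT_sum N a b c - mellin a b c) <= M * / INR (S N))%R.
Proof.
destruct (nat_above (Re c - 1 - INR (2 * k))) as [n Hn].
assert (Hc0 : (0 < Re c)%R) by (generalize (pos_INR (2 * k)); lra).
exists (3 * mellin_const k n)%R. intros N.
assert (HI : Clim (int_0oo (mell c (polyprod a b))) (mellin a b c)).
{ apply (int_0oo_lim _ (mellin_const k n)).
  - apply pcont_mell, pcont_polyprod.
  - intros t Ht. rewrite Cmod_mell. eapply Rle_trans; [|apply (mellin_small k n (Re c) t Hc Ht)].
    apply Rmult_le_compat_l; [left; apply exp_pos|]. apply polyprod_bound; [exact Ha|exact Hb|lra].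
  - intros t Ht. rewrite Cmod_mell. eapply Rle_trans; [|apply (mellin_decay k n (Re c) t Hn Ht)].
    apply Rmult_le_compat_l; [left; apply exp_pos|]. apply polyprod_bound; [exact Ha|exact Hb|lra]. }
apply (Clim_le_const (fun j => int_0oo (mell c (sumprod N a b)) j - int_0oo (mell c (polyprod a b)) j) _ _ 0).
{ apply Clim_minus; [now apply mellin_sumprod|exact HI]. }
intros j _.
assert (IN : (0 < / INR (S N))%R) by apply Rinv_0_lt_compat, INR_S_pos.
replace (int_0oo (mell c (sumprod N a b)) j - int_0oo (mell c (polyprod a b)) j) with
  (int_0oo (fun t => mell c (sumprod N a b) t - mell c (polyprod a b) t) j).
2: { apply CInt_minus; apply ex_CInt_pos; try apply node_bounds; try (generalize (INR_S_pos j); lra);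
     apply pcont_mell; [apply pcont_sumprod|apply pcont_polyprod]. }
replace (3 * mellin_const k n * / INR (S N))%R with (3 * (mellin_const k n * / INR (S N)))%R by ring.
assert (B : forall t, (0 < t)%R -> (Cmod (mell c (sumprod N a b) t - mell c (polyprod a b) t) <=
   exp ((Re c - 1) * ln t) * (4 * (pl_const k t * pl_const k t)) * / INR (S N))%R).
{ intros t Ht. replace (mell c (sumprod N a b) t - mell c (polyprod a b) t) with (mell c (fun t => sumprod N a b t - polyprod a b t) t) by (unfold mell; ring).
  rewrite Cmod_mell, Rmult_assoc. apply Rmult_le_compat_l; [left; apply exp_pos|].
  rewrite Rmult_comm. apply sumprod_diff; assumption. }
apply int_0oo_bound.
- intros t Ht. apply (ccont_minus (mell c (sumprod N a b)) (mell c (polyprod a b))); apply pcont_mell; try exact Ht; [apply pcont_sumprod|apply pcont_polyprod].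
- intros t Ht. eapply Rle_trans; [apply B; lra|]. apply Rmult_le_compat_r; [lra|]. now apply mellin_small.
- intros t Ht. eapply Rle_trans; [apply B; lra|].
  replace (mellin_const k n * / INR (S N) * / t ^ 2)%R with (mellin_const k n * / t ^ 2 * / INR (S N))%R by ring.
  apply Rmult_le_compat_r; [lra|]. now apply mellin_decay.
Qed.

Hypothesis HG : Gam c <> 0.

Lemma MT_sum_lim : Clim (fun N => MT_sum N a b c) (mellin a b c / Gam c).
Proof.
destruct mellin_sum_diff as [M HM].
apply (Clim_ext (fun N => / Gam c * (Gam c * MT_sum N a b c))); [intros N; field; exact HG|].
replace (mellin a b c / Gam c) with (/ Gam c * mellin a b c) by (unfold Cdiv; ring). apply Clim_scal.
intros eps. destruct (inv_INR_small M eps) as [N HN]. exists N. intros n Hn.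
eapply Rle_lt_trans; [apply HM|now apply HN].
Qed.

Lemma MT_double_series : is_double_series (MT_term a b c) (mellin a b c / Gam c).
Proof.
split.
- exists 4%R. intros N. now apply (MT_abs_bound a b c k).
- intros P HP. apply locally_Cmod in HP. destruct HP as [d Hd]. destruct (MT_sum_lim d) as [N HN].
  exists N. intros n Hn. apply Hd, HN, Hn.
Qed.

Lemma MT_sum_bound N : (Cmod (MT_sum N a b c) <= 4)%R.
Proof.
eapply Rle_trans; [|apply (MT_abs_bound a b c k Ha Hb Hc N)].
unfold MT_sum. eapply Rle_trans; [exact (norm_sum_n_m (V := C_NormedModule) (fun m => sum_n (MT_term a b c m) N) 0 N)|].
apply sum_n_m_le. intros m. exact (norm_sum_n_m (V := C_NormedModule) (MT_term a b c m) 0 N).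
Qed.

End Large_c.

End Mellin.

(** * Integrals of powers over (0, 1) and cleared denominators *)

Lemma csum_ext u v K : (forall k, (k < K)%nat -> u k = v k) -> csum u K = csum v K.
Proof. induction K as [|K IH]; intros H; simpl; [reflexivity|]. rewrite IH by (intros; apply H; lia). now rewrite H by lia. Qed.

Lemma csum_scal c u K : csum (fun k => c * u k) K = c * csum u K.
Proof. induction K as [|K IH]; simpl; [ring|]. rewrite IH. ring. Qed.

Definition lim01 (f : R -> C) (l : C) : Prop := pcont f /\ Clim (int_01 f) l.

Lemma ex_int_01 f n : pcont f -> ex_CInt f (node n) 1.
Proof. intros H. apply ex_CInt_pos; [apply node_bounds|lra|exact H]. Qed.

Lemma lim01_ext f g l : (forall t, (0 < t)%R -> f t = g t) -> lim01 f l -> lim01 g l.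
Proof.
intros E [A B]. split.
- intros t Ht. apply (continuous_ext_loc (T := R_UniformSpace) (U := C_UniformSpace) g f t); [|now apply A].
  exists (mkposreal t Ht). intros y Hy. apply E. unfold ball in Hy; simpl in Hy.
  unfold AbsRing_ball, abs, minus, plus, opp in Hy; simpl in Hy. apply Rabs_def2 in Hy. lra.
- apply (Clim_ext (int_01 f)); [|exact B]. intros n. apply CInt_ext. intros t Ht. apply E.
  destruct (node_bounds n). rewrite Rmin_left in Ht by lra. lra.
Qed.

Lemma lim01_plus f g l m : lim01 f l -> lim01 g m -> lim01 (fun t => f t + g t) (l + m).
Proof.
intros [A B] [A' B']. split; [intros t Ht; now apply ccont_plus; [apply A|apply A']|].
apply (Clim_ext (fun n => int_01 f n + int_01 g n)); [|now apply Clim_plus].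
intros n. symmetry. apply CInt_plus; now apply ex_int_01.
Qed.

Lemma lim01_scal k f l : lim01 f l -> lim01 (fun t => k * f t) (k * l).
Proof.
intros [A B]. split; [intros t Ht; now apply ccont_scal, A|].
apply (Clim_ext (fun n => k * int_01 f n)); [|now apply Clim_scal].
intros n. symmetry. apply CInt_mult. now apply ex_int_01.
Qed.

Lemma lim01_0 : lim01 (fun _ => 0) 0.
Proof.
split; [intros t _; apply continuous_const|].
apply (Clim_ext (fun _ => 0)); [|apply Clim_const]. intros n. unfold int_01. rewrite CInt_const. ring.
Qed.

Lemma lim01_csum (f : nat -> R -> C) (l : nat -> C) K : (forall k, (k < K)%nat -> lim01 (f k) (l k)) ->
  lim01 (fun t => csum (fun k => f k t) K) (csum l K).
Proof.
induction K as [|K IH]; intros H; [exact lim01_0|]. simpl.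
apply (lim01_plus (fun t => csum (fun k => f k t) K) (f K)); [apply IH; intros; apply H; lia|apply H; lia].
Qed.

Lemma lim01_pow s : (1 <= Re s)%R -> lim01 (fun t => Rcpow t (s - 1)) (/ s).
Proof.
intros Hs. split; [intros t Ht; now apply ccont_Rcpow|].
assert (s0 : s <> 0) by (intros E; rewrite E in Hs; simpl in Hs; lra).
apply (Clim_ext (fun n => / s - / s * Rcpow (node n) s)).
- intros n. destruct (node_bounds n) as [B1 B2].
  assert (K : is_CInt (fun t => Rcpow t (s - 1)) (node n) 1 (/ s * Rcpow 1 s - / s * Rcpow (node n) s)).
  { apply (CInt_FTC (fun t => / s * Rcpow t s) (fun t => Rcpow t (s - 1))).
    - intros t Ht. rewrite Rmin_left in Ht by lra.
      replace (Rcpow t (s - 1)) with (/ s * (s * Rcpow t (s - 1))) by (field; exact s0).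
      apply rder_scal, rder_Rcpow. lra.
    - intros t Ht. rewrite Rmin_left in Ht by lra. apply ccont_Rcpow. lra. }
  unfold int_01. rewrite (CInt_unique _ _ _ _ K), Rcpow_base_1. ring.
- replace (/ s) with (/ s - / s * 0) at 1 by ring.
  apply Clim_minus; [apply Clim_const|apply Clim_scal].
  apply (Clim_0_le _ node); [|apply node_small]. intros n. destruct (node_bounds n) as [B1 B2].
  rewrite Cmod_Rcpow. rewrite <- (exp_ln (node n)) at 2 by exact B1. apply exp_mono.
  assert (L : (ln (node n) <= 0)%R) by (rewrite <- ln_1; apply ln_le; lra). nra.
Qed.

(** The Pochhammer product with its factor c + i left out: the numerator of 1 / (c + i) over the
    common denominator (c)_n. *)
Fixpoint poch_omit (n i : nat) (c : C) : C :=
  match n with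
  | O => 1
  | S m => poch_omit m i c * (if Nat.eqb m i then 1 else c + RtoC (INR m))
  end.

Lemma poch_omit_ge n i c : (n <= i)%nat -> poch_omit n i c = pochhammer c n.
Proof.
induction n as [|n IH]; intros H; [reflexivity|]. simpl. rewrite IH by lia.
destruct (Nat.eqb_spec n i); [lia|reflexivity].
Qed.

Lemma poch_omit_eq n i c : (i < n)%nat -> (c + RtoC (INR i)) * poch_omit n i c = pochhammer c n.
Proof.
induction n as [|n IH]; intros H; [lia|]. simpl. destruct (Nat.eqb_spec n i) as [E|E].
- subst. rewrite poch_omit_ge by lia. ring.
- rewrite <- IH by lia. ring.
Qed.

Inductive idx : Type := AC (l : nat) | BC (l : nat) | ABC.

Definition form (i : idx) (x : V3) : C :=
  match i with
  | AC l => pa x + pc x - 1 + RtoC (INR l)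
  | BC l => pb x + pc x - 1 + RtoC (INR l)
  | ABC => pa x + pb x + pc x - 2
  end.

Fixpoint idxs (K : nat) : list idx :=
  match K with O => ABC :: nil | S k => AC k :: BC k :: idxs k end.

Fixpoint lprod (l : list idx) (x : V3) : C :=
  match l with nil => 1 | i :: l' => form i x * lprod l' x end.

Section Cleared.
Variables (zeta Gam : C -> C).
Hypothesis Hzeta : is_riemann_zeta zeta.
Hypothesis HGam : is_gamma Gam.
Notation tz := (zeta_coef zeta).
Notation Rpl := (taylor_rem zeta Gam).

(** The coefficient of t^(form i x - 1) in t^(c-1) times the product of the two expansions. Its
    integral over (0, 1) gives the fraction with denominator [form i], so this is the residue before
    division by Gamma(c). *)
Definition residue_coef (i : idx) (x : V3) : C :=
  match i with
  | AC l => Gam (1 - pa x) * tz (pb x) l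
  | BC l => Gam (1 - pb x) * tz (pa x) l
  | ABC => Gam (1 - pa x) * Gam (1 - pb x)
  end.

(* [lnum l / lprod l] is the sum of the [residue_coef i / form i] *)
Fixpoint lnum (l : list idx) (x : V3) : C :=
  match l with nil => 0 | i :: l' => residue_coef i x * lprod l' x + form i x * lnum l' x end.

Fixpoint lsum (l : list idx) (x : V3) : C :=
  match l with nil => 0 | i :: l' => residue_coef i x / form i x + lsum l' x end.

Fixpoint lpow (l : list idx) (x : V3) (t : R) : C :=
  match l with nil => 0 | i :: l' => residue_coef i x * Rcpow t (form i x - 1) + lpow l' x t end.

Lemma lnum_lsum l x : (forall i, In i l -> form i x <> 0) -> lnum l x = lprod l x * lsum l x.
Proof.
induction l as [|i l IH]; intros H; simpl; [ring|]. rewrite IH by (intros j Hj; apply H; now right).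
field. apply H. now left.
Qed.

Lemma lim01_lpow l x : (forall i, In i l -> (1 <= Re (form i x))%R) -> lim01 (lpow l x) (lsum l x).
Proof.
induction l as [|i l IH]; intros H; [exact lim01_0|]. simpl.
apply (lim01_plus (fun t => residue_coef i x * Rcpow t (form i x - 1)) (lpow l x)).
- apply (lim01_scal (residue_coef i x) (fun t => Rcpow t (form i x - 1)) (/ form i x)), lim01_pow, H. now left.
- apply IH. intros j Hj. apply H. now right.
Qed.

Lemma lpow_idxs K x t : (0 < t)%R ->
  let u := Rcpow t (pa x - 1) in let v := Rcpow t (pb x - 1) in let w := Rcpow t (pc x - 1) in
  lpow (idxs K) x t = Gam (1 - pa x) * Gam (1 - pb x) * (u * v * w)
    + Gam (1 - pa x) * (u * w) * csum (fun k => tz (pb x) k * RtoC (t ^ k)) K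
    + Gam (1 - pb x) * (v * w) * csum (fun k => tz (pa x) k * RtoC (t ^ k)) K.
Proof.
intros Ht u v w. induction K as [|K IH].
- simpl. replace (pa x + pb x + pc x - 2 - 1) with ((pa x - 1) + (pb x - 1) + (pc x - 1)) by ring.
  rewrite !Rcpow_plus. fold u v w. ring.
- simpl lpow. rewrite IH. simpl csum.
  replace (pa x + pc x - 1 + RtoC (INR K) - 1) with ((pa x - 1) + (pc x - 1) + RtoC (INR K)) by ring.
  replace (pb x + pc x - 1 + RtoC (INR K) - 1) with ((pb x - 1) + (pc x - 1) + RtoC (INR K)) by ring.
  rewrite !Rcpow_plus, !Rcpow_INR by exact Ht. fold u v w. ring.
Qed.

Definition lead (K : nat) (a : C) (t : R) : C := Gam (1 - a) * Rcpow t (a - 1) + csum (fun k => tz a k * RtoC (t ^ k)) K.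

Lemma lead_eq K a t : lead K a t = polylog a t - Rpl K a t.
Proof. unfold lead, taylor_rem, sub_polylog. ring. Qed.

(** The contribution of Taylor term times Taylor term, whose only denominators are c + j + k. *)
Definition const_sum (K : nat) (x : V3) : C :=
  csum (fun j => csum (fun k => tz (pa x) j * tz (pb x) k * / (pc x + RtoC (INR (j + k)))) K) K.

Lemma lim01_lead K x : (forall i, In i (idxs K) -> (1 <= Re (form i x))%R) -> (1 <= Re (pc x))%R ->
  lim01 (mell (pc x) (fun t => lead K (pa x) t * lead K (pb x) t)) (lsum (idxs K) x + const_sum K x).
Proof.
intros H Hc.
apply (lim01_ext (fun t => lpow (idxs K) x t + csum (fun j => csum (fun k => tz (pa x) j * tz (pb x) k * Rcpow t (pc x + RtoC (INR (j + k)) - 1)) K) K)).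
- intros t Ht. rewrite lpow_idxs by exact Ht. unfold mell, lead.
  set (sa := csum (fun k => tz (pa x) k * RtoC (t ^ k)) K). set (sb := csum (fun k => tz (pb x) k * RtoC (t ^ k)) K).
  assert (E : csum (fun j => csum (fun k => tz (pa x) j * tz (pb x) k * Rcpow t (pc x + RtoC (INR (j + k)) - 1)) K) K
     = Rcpow t (pc x - 1) * sb * sa).
  { unfold sa. rewrite <- csum_scal. apply csum_ext. intros j _.
    transitivity (Rcpow t (pc x - 1) * (tz (pa x) j * RtoC (t ^ j)) * sb); [|ring].
    unfold sb. rewrite <- csum_scal. apply csum_ext. intros k _.
    replace (pc x + RtoC (INR (j + k)) - 1) with ((pc x - 1) + RtoC (INR (j + k))) by ring.
    rewrite Rcpow_plus, Rcpow_INR, pow_add, RtoC_mult by exact Ht. ring. }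
  rewrite E. ring.
- apply lim01_plus; [now apply lim01_lpow|].
  apply (lim01_csum (fun j t => csum (fun k => tz (pa x) j * tz (pb x) k * Rcpow t (pc x + RtoC (INR (j + k)) - 1)) K)). intros j _.
  apply (lim01_csum (fun k t => tz (pa x) j * tz (pb x) k * Rcpow t (pc x + RtoC (INR (j + k)) - 1))). intros k _.
  apply (lim01_scal (tz (pa x) j * tz (pb x) k) (fun t => Rcpow t (pc x + RtoC (INR (j + k)) - 1))), lim01_pow.
  replace (Re (pc x + RtoC (INR (j + k)))) with (Re (pc x) + INR (j + k))%R by reflexivity. generalize (pos_INR (j + k)). lra.
Qed.

(** The product of the polylogarithms minus the product of their truncated expansions, written out
    with truncation = polylogarithm - remainder. *)
Definition quad_rem (K : nat) (a b : C) (t : R) : C :=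
  Rpl K a t * polylog b t + polylog a t * Rpl K b t - Rpl K a t * Rpl K b t.

Lemma pcont_taylor_rem K a : ~ isZ a -> pcont (Rpl K a).
Proof.
intros Ha t Ht. unfold taylor_rem.
apply (ccont_minus (sub_polylog Gam a) (fun t => csum (fun k => tz a k * RtoC (t ^ k)) K)).
- eapply rder_ccont. now apply rder_sub_polylog.
- induction K as [|K IH]; [apply continuous_const|]. simpl csum.
  apply (ccont_plus (fun t => csum (fun k => tz a k * RtoC (t ^ k)) K) (fun t => tz a K * RtoC (t ^ K))); [exact IH|].
  apply (ccont_scal (tz a K) (fun t => RtoC (t ^ K))), ccont_RtoC. apply (ex_derive_continuous (fun t => t ^ K)%R). auto_derive. auto.
Qed.

Lemma pcont_quad_rem K a b : ~ isZ a -> ~ isZ b -> pcont (quad_rem K a b).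
Proof.
intros Ha Hb t Ht. unfold quad_rem.
assert (A := pcont_taylor_rem K a Ha t Ht). assert (B := pcont_taylor_rem K b Hb t Ht).
assert (A1 := ccont_polylog a t Ht). assert (B1 := ccont_polylog b t Ht).
apply (ccont_minus (fun t => Rpl K a t * polylog b t + polylog a t * Rpl K b t) (fun t => Rpl K a t * Rpl K b t)).
- apply (ccont_plus (fun t => Rpl K a t * polylog b t) (fun t => polylog a t * Rpl K b t)).
  + now apply (ccont_mult (Rpl K a) (polylog b)).
  + now apply (ccont_mult (polylog a) (Rpl K b)).
- now apply (ccont_mult (Rpl K a) (Rpl K b)).
Qed.

(** A remainder is O(t^K) while a polylogarithm may grow like t^-k; the product is O(t^(K-k)). *)
Lemma quad_rem_bound K k a b M N t : (2 - Re a <= INR k)%R -> (2 - Re b <= INR k)%R -> (k <= K)%nat -> (0 < t <= 1)%R ->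
  (0 <= M)%R -> (0 <= N)%R ->
  (Cmod (Rpl K a t) <= M * t ^ K)%R -> (Cmod (Rpl K b t) <= N * t ^ K)%R ->
  (Cmod (quad_rem K a b t) <= (2 * (INR (fact k) * 2 ^ k) * (M + N) + M * N) * t ^ (K - k))%R.
Proof.
intros Ha Hb HK Ht M0 N0 HM HN. unfold quad_rem. set (D := (INR (fact k) * 2 ^ k)%R).
assert (D0 : (0 < D)%R) by (apply Rmult_lt_0_compat; [apply INR_fact_lt_0|apply pow_lt; lra]).
assert (P : (2 * pl_const k t <= 2 * D * (/ t) ^ k)%R).
{ unfold pl_const. fold D. rewrite <- (Rmult_1_r (2 * D * (/ t) ^ k)).
  replace (2 * (D * (/ t) ^ k * exp (- (t / 2))))%R with (2 * D * (/ t) ^ k * exp (- (t / 2)))%R by ring.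
  apply Rmult_le_compat_l.
  - apply Rmult_le_pos; [lra|]. apply pow_le. left. apply Rinv_0_lt_compat. lra.
  - apply Rle_trans with (exp 0); [apply exp_mono; lra|right; apply exp_0]. }
assert (A := polylog_bound a t k Ha (proj1 Ht)). assert (B := polylog_bound b t k Hb (proj1 Ht)).
assert (E : (t ^ K * (/ t) ^ k = t ^ (K - k))%R).
{ replace K with ((K - k) + k)%nat at 1 by lia. rewrite pow_add, Rmult_assoc, <- Rpow_mult_distr, Rinv_r, pow1 by lra. ring. }
assert (tK : (0 <= t ^ K)%R) by (apply pow_le; lra). assert (tK1 : (t ^ K <= 1)%R) by (rewrite <- (pow1 K); apply pow_incr; lra).
assert (tk : (t ^ K <= t ^ (K - k))%R).
{ replace K with ((K - k) + k)%nat at 1 by lia. rewrite pow_add. rewrite <- (Rmult_1_r (t ^ (K - k))) at 2.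
  apply Rmult_le_compat_l; [apply pow_le; lra|]. rewrite <- (pow1 k). apply pow_incr. lra. }
replace (Rpl K a t * polylog b t + polylog a t * Rpl K b t - Rpl K a t * Rpl K b t) with
  (Rpl K a t * polylog b t + (polylog a t * Rpl K b t + - (Rpl K a t * Rpl K b t))) by ring.
eapply Rle_trans; [apply Cmod_triangle|]. eapply Rle_trans; [apply Rplus_le_compat_l, Cmod_triangle|].
rewrite Cmod_opp, !Cmod_mult.
apply Rle_trans with (M * t ^ K * (2 * D * (/ t) ^ k) + (2 * D * (/ t) ^ k * (N * t ^ K) + M * t ^ K * (N * 1)))%R.
- apply Rplus_le_compat; [|apply Rplus_le_compat].
  + apply Rmult_le_compat; try apply Cmod_ge_0; [exact HM|lra].
  + apply Rmult_le_compat; try apply Cmod_ge_0; [lra|exact HN].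
  + apply Rmult_le_compat; try apply Cmod_ge_0; [exact HM|]. eapply Rle_trans; [exact HN|]. apply Rmult_le_compat_l; lra.
- replace (M * t ^ K * (2 * D * (/ t) ^ k) + (2 * D * (/ t) ^ k * (N * t ^ K) + M * t ^ K * (N * 1)))%R
    with (2 * D * (M + N) * (t ^ K * (/ t) ^ k) + M * N * t ^ K)%R by ring.
  rewrite E. assert (0 <= M * N)%R by now apply Rmult_le_pos. nra.
Qed.

Definition mellin_rem (K : nat) (x : V3) : C :=
  I01 (mell (pc x) (quad_rem K (pa x) (pb x))) + I1oo (mell (pc x) (polyprod (pa x) (pb x))).

Definition const_num (K : nat) (x : V3) : C :=
  csum (fun j => csum (fun k => tz (pa x) j * tz (pb x) k * poch_omit (2 * K) (j + k) (pc x)) K) K.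

(* For [c] large this is [lprod (idxs K)] times the continuation of the double series: the fractions
   [1 / (c + i)] are cleared by the Pochhammer factor of
   [Gam (c + 2 K) = pochhammer c (2 K) * Gam c]. *)
Definition cleared (K : nat) (x : V3) : C :=
  (pochhammer (pc x) (2 * K) * (lnum (idxs K) x + lprod (idxs K) x * mellin_rem K x)
   + lprod (idxs K) x * const_num K x) / Gam (pc x + RtoC (INR (2 * K))).

Lemma const_num_sum K x : (1 <= Re (pc x))%R -> const_num K x = pochhammer (pc x) (2 * K) * const_sum K x.
Proof.
intros Hc. unfold const_num, const_sum. rewrite <- csum_scal. apply csum_ext. intros j Hj.
rewrite <- csum_scal. apply csum_ext. intros k Hk. rewrite <- (poch_omit_eq (2 * K) (j + k)) by lia.
field. intros E. assert (Q : Re (pc x + RtoC (INR (j + k))) = 0%R) by (rewrite E; reflexivity).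
change (Re (pc x) + INR (j + k) = 0)%R in Q. generalize (pos_INR (j + k)). lra.
Qed.

End Cleared.

Lemma locally_Re_gt (z : C) r : (r < Re z)%R -> locally z (fun w : C => (r < Re w)%R).
Proof.
intros H. apply locally_Cmod. assert (P : (0 < Re z - r)%R) by lra. exists (mkposreal _ P). simpl. intros w Hw.
assert (Q := Re_lower z w _ Hw). lra.
Qed.

Lemma locally_Re_lt (z : C) r : (Re z < r)%R -> locally z (fun w : C => (Re w < r)%R).
Proof.
intros H. apply locally_Cmod. assert (P : (0 < r - Re z)%R) by lra. exists (mkposreal _ P). simpl. intros w Hw.
assert (Q := Re_le_Cmod (w - z)). replace (Re (w - z)) with (Re w - Re z)%R in Q by reflexivity. lra.
Qed.

Lemma locally_Im_abs (z : C) r : (Rabs (Im z) < r)%R -> locally z (fun w : C => (Rabs (Im w) < r)%R).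
Proof.
intros H. apply locally_Cmod. assert (P : (0 < r - Rabs (Im z))%R) by lra. exists (mkposreal _ P). simpl. intros w Hw.
assert (Q := im_le_Cmod (w - z)). replace (Im (w - z)) with (Im w - Im z)%R in Q by reflexivity.
assert (T := Rabs_triang_inv (Im w) (Im z)). lra.
Qed.

Lemma locally_cd {V : NormedModule C_AbsRing} (p : V -> C) x (P : C -> Prop) : cd p x -> locally (p x) P -> locally x (fun y => P (p y)).
Proof. intros H HP. exact (cd_continuous p x H P HP). Qed.

(* With [K = order k], the remainder integral converges on [dom k] and [Gam (c + 2 K)] has no zero
   there; [large k] lies in the region of absolute convergence. *)
Definition dom (k : nat) (x : V3) : Prop :=
  (2 - INR k < Re (pa x))%R /\ (2 - INR k < Re (pb x))%R /\ (1 - INR k < Re (pc x))%R /\ (Rabs (Im (pc x)) < INR k)%R.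

Definition order (k : nat) : nat := (k * k + 2 * k)%nat.

(** The part 2 k + 1 of the threshold makes series and Mellin integral converge, given Re a, Re b >
    2 - k; the part k^2 dominates (Im c)^2, so that Gamma(c) <> 0. *)
Definition large (k : nat) (x : V3) : Prop := dom k x /\ (INR (2 * k) + 1 + INR k * INR k < Re (pc x))%R.

Definition nonres (x : V3) : Prop := ~ isZ (pa x) /\ ~ isZ (pb x).

Lemma dom_locally k x : dom k x -> locally x (dom k).
Proof.
intros (A & B & D & E). unfold dom.
apply filter_and; [apply (locally_cd pa x (fun w => (2 - INR k < Re w)%R)); [apply pa_cd|now apply locally_Re_gt]|].
apply filter_and; [apply (locally_cd pb x (fun w => (2 - INR k < Re w)%R)); [apply pb_cd|now apply locally_Re_gt]|].
apply filter_and; [apply (locally_cd pc x (fun w => (1 - INR k < Re w)%R)); [apply pc_cd|now apply locally_Re_gt]|].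
apply (locally_cd pc x (fun w => (Rabs (Im w) < INR k)%R)); [apply pc_cd|now apply locally_Im_abs].
Qed.

Lemma large_locally k x : large k x -> locally x (large k).
Proof.
intros (A & B). apply filter_and; [now apply dom_locally|].
apply (locally_cd pc x (fun w => (INR (2 * k) + 1 + INR k * INR k < Re w)%R)); [apply pc_cd|now apply locally_Re_gt].
Qed.

Lemma nonres_locally x : nonres x -> locally x nonres.
Proof.
intros [A B]. apply filter_and.
- apply (locally_cd pa x (fun w => ~ isZ w)); [apply pa_cd|now apply not_isZ_locally].
- apply (locally_cd pb x (fun w => ~ isZ w)); [apply pb_cd|now apply not_isZ_locally].
Qed.

Lemma sq_lt_of_abs (y r : R) : (Rabs y < r)%R -> (y * y < r * r)%R.
Proof. intros H. apply Rabs_def2 in H. nra. Qed.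

Lemma form_cd i x : cd (form i) x.
Proof.
assert (A : forall (p q : V3 -> C) (u v : C), cd p x -> cd q x -> cd (fun y => p y + q y - u + v) x).
{ intros p q u v P Q. apply (cd_plus (fun y => p y + q y - u) (fun _ => v)); [|apply cd_const].
  apply (cd_minus (fun y => p y + q y) (fun _ => u)); [|apply cd_const]. now apply cd_plus. }
destruct i as [l|l|].
- refine (cd_ext _ _ _ _ (A pa pc 1 (RtoC (INR l)) (pa_cd x) (pc_cd x))). intros y. reflexivity.
- refine (cd_ext _ _ _ _ (A pb pc 1 (RtoC (INR l)) (pb_cd x) (pc_cd x))). intros y. reflexivity.
- refine (cd_ext _ _ _ _ (A _ pc 2 0 (A pa pb 0 0 (pa_cd x) (pb_cd x)) (pc_cd x))). intros y. unfold form. ring.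
Qed.

Lemma lprod_cd l x : cd (lprod l) x.
Proof.
induction l as [|i l IH]; [exact (cd_const (RtoC 1) x)|]. simpl. apply (cd_mult (form i) (lprod l)); [apply form_cd|exact IH].
Qed.

Lemma csum_cd {V : NormedModule C_AbsRing} (f : nat -> V -> C) K x : (forall k, (k < K)%nat -> cd (f k) x) -> cd (fun y => csum (fun k => f k y) K) x.
Proof.
induction K as [|K IH]; intros H; [exact (cd_const (RtoC 0) x)|]. simpl.
apply (cd_plus (fun y => csum (fun k => f k y) K) (f K)); [apply IH; intros; apply H; lia|apply H; lia].
Qed.

Lemma pochhammer_cd {V : NormedModule C_AbsRing} (p : V -> C) n x : cd p x -> cd (fun y => pochhammer (p y) n) x.
Proof.
intros H. induction n as [|n IH]; [exact (cd_const (RtoC 1) x)|]. simpl.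
apply (cd_mult (fun y => pochhammer (p y) n) (fun y => p y + RtoC (INR n))); [exact IH|].
apply cd_plus; [exact H|apply cd_const].
Qed.

Lemma poch_omit_cd {V : NormedModule C_AbsRing} (p : V -> C) n i x : cd p x -> cd (fun y => poch_omit n i (p y)) x.
Proof.
intros H. induction n as [|n IH]; [exact (cd_const (RtoC 1) x)|]. simpl.
apply (cd_mult (fun y => poch_omit n i (p y)) (fun y => if Nat.eqb n i then 1 else p y + RtoC (INR n))); [exact IH|].
destruct (Nat.eqb n i); [apply cd_const|]. apply cd_plus; [exact H|apply cd_const].
Qed.

Lemma cd_one_minus {V : NormedModule C_AbsRing} (p : V -> C) x : cd p x -> cd (fun y => 1 - p y) x.
Proof. intros H. apply cd_minus; [apply cd_const|exact H]. Qed.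

Section Cleared_holomorphy.
Variables (zeta Gam : C -> C).
Hypothesis Hzeta : is_riemann_zeta zeta.
Hypothesis HGam : is_gamma Gam.
Notation tz := (zeta_coef zeta).
Notation Rpl := (taylor_rem zeta Gam).
Notation F0 := (cleared zeta Gam).
Notation res := (residue_coef zeta Gam).

Lemma zeta_coef_cd_comp k (p : V3 -> C) x : cd p x -> ~ isZ (p x) -> cd (fun y => tz (p y) k) x.
Proof. intros A B. apply (cd_comp_scalar (fun a => tz a k) p); [exact A|]. now apply zeta_coef_cd. Qed.

Lemma Gam_one_minus_cd (p : V3 -> C) x : cd p x -> ~ isZ (p x) -> cd (fun y => Gam (1 - p y)) x.
Proof.
intros A B. apply (cd_comp_scalar Gam (fun y => 1 - p y)); [now apply cd_one_minus|].
apply (Gam_cd_Z Gam HGam). intros Q. now apply B, isZ_one_minus.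
Qed.

Lemma res_cd i x : nonres x -> cd (res i) x.
Proof.
intros [A B]. destruct i as [l|l|]; simpl.
- apply (cd_mult (fun x => Gam (1 - pa x)) (fun x => tz (pb x) l)); [now apply Gam_one_minus_cd; [apply pa_cd|]|now apply zeta_coef_cd_comp; [apply pb_cd|]].
- apply (cd_mult (fun x => Gam (1 - pb x)) (fun x => tz (pa x) l)); [now apply Gam_one_minus_cd; [apply pb_cd|]|now apply zeta_coef_cd_comp; [apply pa_cd|]].
- apply (cd_mult (fun x => Gam (1 - pa x)) (fun x => Gam (1 - pb x))); [now apply Gam_one_minus_cd; [apply pa_cd|]|now apply Gam_one_minus_cd; [apply pb_cd|]].
Qed.

Lemma lnum_cd l x : nonres x -> cd (lnum zeta Gam l) x.
Proof.
intros H. induction l as [|i l IH]; [exact (cd_const (RtoC 0) x)|]. simpl.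
apply (cd_plus (fun x => res i x * lprod l x) (fun x => form i x * lnum zeta Gam l x)).
- apply (cd_mult (res i) (lprod l)); [now apply res_cd|apply lprod_cd].
- apply (cd_mult (form i) (lnum zeta Gam l)); [apply form_cd|exact IH].
Qed.

Lemma const_num_cd K x : nonres x -> cd (const_num zeta K) x.
Proof.
intros [A B]. unfold const_num.
apply (csum_cd (fun j x => csum (fun k => tz (pa x) j * tz (pb x) k * poch_omit (2 * K) (j + k) (pc x)) K)). intros j _.
apply (csum_cd (fun k x => tz (pa x) j * tz (pb x) k * poch_omit (2 * K) (j + k) (pc x))). intros k _.
apply (cd_mult (fun x => tz (pa x) j * tz (pb x) k) (fun x => poch_omit (2 * K) (j + k) (pc x))); [|apply poch_omit_cd, pc_cd].
apply (cd_mult (fun x => tz (pa x) j) (fun x => tz (pb x) k)); [now apply zeta_coef_cd_comp; [apply pa_cd|]|now apply zeta_coef_cd_comp; [apply pb_cd|]].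
Qed.

Lemma quad_rem_cd K t x : (0 < t)%R -> nonres x -> cd (fun y => mell (pc y) (quad_rem zeta Gam K (pa y) (pb y)) t) x.
Proof.
intros Ht [A B]. unfold mell.
assert (PA : cd (fun y => polylog (pa y) t) x) by (apply (cd_comp_scalar (fun a => polylog a t) pa); [apply pa_cd|now apply polylog_cd]).
assert (PB : cd (fun y => polylog (pb y) t) x) by (apply (cd_comp_scalar (fun a => polylog a t) pb); [apply pb_cd|now apply polylog_cd]).
assert (RA : cd (fun y => Rpl K (pa y) t) x) by (apply (cd_comp_scalar (fun a => Rpl K a t) pa); [apply pa_cd|now apply taylor_rem_cd]).
assert (RB : cd (fun y => Rpl K (pb y) t) x) by (apply (cd_comp_scalar (fun a => Rpl K a t) pb); [apply pb_cd|now apply taylor_rem_cd]).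
apply (cd_mult (fun y => Rcpow t (pc y - 1)) (fun y => quad_rem zeta Gam K (pa y) (pb y) t)).
- apply (cd_Rcpow _ (fun y => pc y - 1)). apply cd_minus; [apply pc_cd|apply cd_const].
- unfold quad_rem. apply (cd_minus (fun y => Rpl K (pa y) t * polylog (pb y) t + polylog (pa y) t * Rpl K (pb y) t) (fun y => Rpl K (pa y) t * Rpl K (pb y) t)).
  + apply (cd_plus (fun y => Rpl K (pa y) t * polylog (pb y) t) (fun y => polylog (pa y) t * Rpl K (pb y) t)).
    * now apply (cd_mult (fun y => Rpl K (pa y) t) (fun y => polylog (pb y) t)).
    * now apply (cd_mult (fun y => polylog (pa y) t) (fun y => Rpl K (pb y) t)).
  + now apply (cd_mult (fun y => Rpl K (pa y) t) (fun y => Rpl K (pb y) t)).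
Qed.

Lemma polyprod_cd t x : (0 < t)%R -> cd (fun y : V3 => mell (pc y) (polyprod (pa y) (pb y)) t) x.
Proof.
intros Ht. unfold mell.
assert (PA : cd (fun y => polylog (pa y) t) x) by (apply (cd_comp_scalar (fun a => polylog a t) pa); [apply pa_cd|now apply polylog_cd]).
assert (PB : cd (fun y => polylog (pb y) t) x) by (apply (cd_comp_scalar (fun a => polylog a t) pb); [apply pb_cd|now apply polylog_cd]).
apply (cd_mult (fun y => Rcpow t (pc y - 1)) (fun y => polyprod (pa y) (pb y) t)).
- apply (cd_Rcpow _ (fun y => pc y - 1)). apply cd_minus; [apply pc_cd|apply cd_const].
- now apply (cd_mult (fun y => polylog (pa y) t) (fun y => polylog (pb y) t)).
Qed.

Lemma mellin_rem_bound_01 k x M N : dom k x -> (0 <= M)%R -> (0 <= N)%R ->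
  (forall t, (0 < t <= 1)%R -> (Cmod (Rpl (order k) (pa x) t) <= M * t ^ order k)%R) ->
  (forall t, (0 < t <= 1)%R -> (Cmod (Rpl (order k) (pb x) t) <= N * t ^ order k)%R) ->
  forall t, (0 < t <= 1)%R -> (Cmod (mell (pc x) (quad_rem zeta Gam (order k) (pa x) (pb x)) t)
    <= 2 * (INR (fact k) * 2 ^ k) * (M + N) + M * N)%R.
Proof.
intros (A & B & D & _) HM HN H1 H2 t Ht. rewrite Cmod_mell.
assert (Q := quad_rem_bound zeta Gam (order k) k (pa x) (pb x) M N t ltac:(lra) ltac:(lra) ltac:(unfold order; lia) Ht HM HN (H1 t Ht) (H2 t Ht)).
set (E := (2 * (INR (fact k) * 2 ^ k) * (M + N) + M * N)%R) in *.
assert (E0 : (0 <= E)%R).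
{ unfold E. apply Rplus_le_le_0_compat; [|now apply Rmult_le_pos]. apply Rmult_le_pos; [|lra].
  apply Rmult_le_pos; [lra|]. apply Rmult_le_pos; [apply pos_INR|apply pow_le; lra]. }
apply Rle_trans with (exp ((Re (pc x) - 1) * ln t) * (E * t ^ (order k - k)))%R; [apply Rmult_le_compat_l; [left; apply exp_pos|exact Q]|].
rewrite <- Rpower_pow by lra. unfold Rpower.
replace (exp ((Re (pc x) - 1) * ln t) * (E * exp (INR (order k - k) * ln t)))%R with
  (E * exp ((Re (pc x) - 1 + INR (order k - k)) * ln t))%R by (rewrite Rmult_plus_distr_r, exp_plus; ring).
rewrite <- (Rmult_1_r E) at 2. apply Rmult_le_compat_l; [exact E0|].
apply Rle_trans with (exp 0); [apply exp_mono|right; apply exp_0].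
assert (L : (ln t <= 0)%R) by (rewrite <- ln_1; apply ln_le; lra).
(* On [dom k] the exponent Re c - 1 exceeds - k, so a remainder of order t^k already makes the
   integrand bounded near 0. *)
assert (O : (INR k <= INR (order k - k))%R) by (apply le_INR; unfold order; nia). nra.
Qed.

Lemma mellin_rem_cd k x : dom k x -> nonres x -> cd (mellin_rem zeta Gam (order k)) x.
Proof.
intros Hd Hn. destruct (Hn) as [Ha Hb].
destruct (taylor_rem_bound zeta Gam Hzeta HGam (order k) _ Ha) as (M & M0 & HM).
destruct (taylor_rem_bound zeta Gam Hzeta HGam (order k) _ Hb) as (N & N0 & HN).
destruct (nat_above (Re (pc x) + 1)) as [n Hn'].
assert (L := filter_and _ _ (dom_locally k x Hd) (filter_and _ _ (nonres_locally x Hn)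
  (filter_and _ _ (locally_cd pa x _ (pa_cd x) HM) (filter_and _ _ (locally_cd pb x _ (pb_cd x) HN)
    (locally_cd pc x _ (pc_cd x) (locally_Re_lt (pc x) (Re (pc x) + 1) ltac:(lra))))))).
destruct (proj1 (locally_norm_ball _ _) L) as [d Hd']. clear L.
unfold mellin_rem. apply (cd_plus (fun y => I01 (mell (pc y) (quad_rem zeta Gam (order k) (pa y) (pb y)))) (fun y => I1oo (mell (pc y) (polyprod (pa y) (pb y))))).
- apply (I01_cd (fun t y => mell (pc y) (quad_rem zeta Gam (order k) (pa y) (pb y)) t) x d
    (2 * (INR (fact k) * 2 ^ k) * (M + N) + M * N) (cond_pos d)).
  + intros t y Ht Hy. apply quad_rem_cd; [exact Ht|]. now apply (Hd' y).
  + intros y Hy. apply pcont_mell. destruct (Hd' y Hy) as (_ & [Y1 Y2] & _). now apply pcont_quad_rem.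
  + intros t y Ht Hy. destruct (Hd' y Hy) as (Y1 & _ & Y2 & Y3 & _). now apply mellin_rem_bound_01.
- apply (I1oo_cd (fun t y => mell (pc y) (polyprod (pa y) (pb y)) t) x d (mellin_const k n) (cond_pos d)).
  + intros t y Ht Hy. now apply polyprod_cd.
  + intros y Hy. apply pcont_mell, pcont_polyprod.
  + intros t y Ht Hy. destruct (Hd' y Hy) as ((Y1 & Y2 & _) & _ & _ & _ & Y3).
    rewrite Cmod_mell. eapply Rle_trans; [|apply (mellin_decay k n (Re (pc y)) t); [generalize (pos_INR (2 * k)); lra|exact Ht]].
    apply Rmult_le_compat_l; [left; apply exp_pos|]. apply polyprod_bound; lra.
Qed.

(** Here 2 K = 2 k^2 + 4 k, so Re (c + 2 K) > 1 - k + 2 k^2 + 4 k, while (Im c)^2 < k^2. *)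
Lemma order_Gam k x : dom k x -> (1 + Im (pc x + RtoC (INR (2 * order k))) * Im (pc x + RtoC (INR (2 * order k))) / 2 < Re (pc x + RtoC (INR (2 * order k))))%R.
Proof.
intros (_ & _ & D & E).
change (Im (pc x + RtoC (INR (2 * order k)))) with (Im (pc x) + 0)%R. rewrite Rplus_0_r.
change (Re (pc x + RtoC (INR (2 * order k)))) with (Re (pc x) + INR (2 * order k))%R.
assert (Q := sq_lt_of_abs _ _ E). unfold order. rewrite mult_INR, plus_INR, !mult_INR. simpl (INR 2).
assert (P := Rabs_pos (Im (pc x))). nra.
Qed.

Lemma cleared_cd k x : dom k x -> nonres x -> cd (F0 (order k)) x.
Proof.
intros Hd Hn. unfold cleared.
assert (G := order_Gam k x Hd).
apply (cd_div (fun x => pochhammer (pc x) (2 * order k) * (lnum zeta Gam (idxs (order k)) x + lprod (idxs (order k)) x * mellin_rem zeta Gam (order k) x)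
   + lprod (idxs (order k)) x * const_num zeta (order k) x) (fun x => Gam (pc x + RtoC (INR (2 * order k))))).
- apply (cd_plus (fun x => pochhammer (pc x) (2 * order k) * (lnum zeta Gam (idxs (order k)) x + lprod (idxs (order k)) x * mellin_rem zeta Gam (order k) x))
    (fun x => lprod (idxs (order k)) x * const_num zeta (order k) x)).
  + apply (cd_mult (fun x => pochhammer (pc x) (2 * order k)) (fun x => lnum zeta Gam (idxs (order k)) x + lprod (idxs (order k)) x * mellin_rem zeta Gam (order k) x)).
    * apply pochhammer_cd, pc_cd.
    * apply (cd_plus (lnum zeta Gam (idxs (order k))) (fun x => lprod (idxs (order k)) x * mellin_rem zeta Gam (order k) x)); [now apply lnum_cd|].
      apply (cd_mult (lprod (idxs (order k))) (mellin_rem zeta Gam (order k))); [apply lprod_cd|now apply mellin_rem_cd].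
  + apply (cd_mult (lprod (idxs (order k))) (const_num zeta (order k))); [apply lprod_cd|now apply const_num_cd].
- apply (cd_comp_scalar Gam (fun y => pc y + RtoC (INR (2 * order k)))); [apply cd_plus; [apply pc_cd|apply cd_const]|].
  apply (Gam_cd_pos Gam HGam). assert (Q := Rle_0_sqr (Im (pc x + RtoC (INR (2 * order k))))). unfold Rsqr in Q. lra.
- now apply (Gam_neq_0_large Gam HGam).
Qed.

Lemma form_large k i x : large k x -> (1 <= Re (form i x))%R.
Proof.
intros [(A & B & _) D]. rewrite mult_INR in D. simpl (INR 2) in D. assert (P := Rle_0_sqr (INR k)). unfold Rsqr in P.
assert (K := pos_INR k).
destruct i as [l|l|]; simpl form.
- change (1 <= Re (pa x) + Re (pc x) + - 1 + INR l)%R. generalize (pos_INR l). lra.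
- change (1 <= Re (pb x) + Re (pc x) + - 1 + INR l)%R. generalize (pos_INR l). lra.
- change (1 <= Re (pa x) + Re (pb x) + Re (pc x) + - 2)%R. lra.
Qed.

Lemma large_Gam k x : large k x -> Gam (pc x) <> 0.
Proof.
intros [(_ & _ & _ & E) D]. apply (Gam_neq_0_large Gam HGam).
assert (Q := sq_lt_of_abs _ _ E). generalize (pos_INR (2 * k)). nra.
Qed.

Lemma Re_neq_0 (z : C) : (1 <= Re z)%R -> z <> 0.
Proof. intros H E. rewrite E in H. simpl in H. lra. Qed.

(** In this region every form and c have real part at least 1, so the truncated product can be
    integrated over (0, 1) term by term; the fractions obtained are then multiplied out by [lprod]
    and the Pochhammer factor, and Gamma(c + 2 K) = (c)_(2K) Gamma(c) cancels the latter. *)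
Theorem cleared_large k x : large k x -> nonres x ->
  F0 (order k) x = lprod (idxs (order k)) x * (mellin (pa x) (pb x) (pc x) / Gam (pc x)).
Proof.
intros Hl Hn. assert (Hl0 := Hl). destruct Hl0 as [Hd Hc]. destruct (Hn) as [Ha Hb].
set (K := order k).
assert (c1 : (1 <= Re (pc x))%R) by (generalize (pos_INR (2 * k)); nra).
assert (fl : forall i, In i (idxs K) -> (1 <= Re (form i x))%R) by (intros i _; now apply (form_large k)).
destruct (taylor_rem_bound zeta Gam Hzeta HGam K _ Ha) as (M & M0 & HM). apply locally_singleton in HM.
destruct (taylor_rem_bound zeta Gam Hzeta HGam K _ Hb) as (N & N0 & HN). apply locally_singleton in HN.
destruct (Hd) as (d1 & d2 & _).
assert (E : I01 (mell (pc x) (polyprod (pa x) (pb x))) =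
  lsum zeta Gam (idxs K) x + const_sum zeta K x + I01 (mell (pc x) (quad_rem zeta Gam K (pa x) (pb x)))).
{ apply (Clim_unique (int_01 (mell (pc x) (polyprod (pa x) (pb x))))).
  - apply (int_01_lim _ (mellin_const k 0)); [apply pcont_mell, pcont_polyprod|].
    intros t Ht. rewrite Cmod_mell. eapply Rle_trans; [|apply (mellin_small k 0 (Re (pc x)) t); [generalize (pos_INR k); nra|exact Ht]].
    apply Rmult_le_compat_l; [left; apply exp_pos|]. apply polyprod_bound; lra.
  - apply (lim01_ext (fun t => mell (pc x) (fun t => lead zeta Gam K (pa x) t * lead zeta Gam K (pb x) t) t + mell (pc x) (quad_rem zeta Gam K (pa x) (pb x)) t)).
    + intros t _. unfold mell, polyprod, quad_rem. rewrite !lead_eq. ring.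
    + apply lim01_plus; [now apply lim01_lead|]. split; [now apply pcont_mell, pcont_quad_rem|].
      apply (int_01_lim _ (2 * (INR (fact k) * 2 ^ k) * (M + N) + M * N)); [now apply pcont_mell, pcont_quad_rem|].
      now apply mellin_rem_bound_01. }
unfold mellin. rewrite E. unfold cleared. fold K.
rewrite const_num_sum by exact c1.
rewrite lnum_lsum by (intros i Hi; now apply Re_neq_0, fl).
rewrite (Gam_pochhammer_pos Gam HGam) by lra.
assert (G1 := large_Gam k x Hl).
assert (G2 : pochhammer (pc x) (2 * K) <> 0).
{ intros Z. apply (Gam_neq_0_large Gam HGam _ (order_Gam k x Hd)). fold K.
  rewrite (Gam_pochhammer_pos Gam HGam) by lra. rewrite Z. ring. }
unfold mellin_rem. field. split; assumption.
Qed.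

End Cleared_holomorphy.

(** * Geometry of the space of triples *)

Lemma pa_plus (x y : V3) : pa (plus x y) = pa x + pa y. Proof. reflexivity. Qed.
Lemma pb_plus (x y : V3) : pb (plus x y) = pb x + pb y. Proof. reflexivity. Qed.
Lemma pc_plus (x y : V3) : pc (plus x y) = pc x + pc y. Proof. reflexivity. Qed.
Lemma pa_scal (z : C) (x : V3) : pa (scal z x) = z * pa x. Proof. reflexivity. Qed.
Lemma pb_scal (z : C) (x : V3) : pb (scal z x) = z * pb x. Proof. reflexivity. Qed.
Lemma pc_scal (z : C) (x : V3) : pc (scal z x) = z * pc x. Proof. reflexivity. Qed.
Lemma pa_minus (x y : V3) : pa (minus x y) = pa x - pa y. Proof. reflexivity. Qed.
Lemma pb_minus (x y : V3) : pb (minus x y) = pb x - pb y. Proof. reflexivity. Qed.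
Lemma pc_minus (x y : V3) : pc (minus x y) = pc x - pc y. Proof. reflexivity. Qed.

(** Balls of C in its uniform structure are squares, not discs. *)
Definition square (e : R) (z w : C) : Prop := (Rabs (Re w - Re z) < e /\ Rabs (Im w - Im z) < e)%R.

Lemma ball_V3 (p : V3) (e : R) (x : V3) :
  ball p e x <-> square e (pa p) (pa x) /\ square e (pb p) (pb x) /\ square e (pc p) (pc x).
Proof.
destruct p as [[[p1 p2] [p3 p4]] [p5 p6]], x as [[[x1 x2] [x3 x4]] [x5 x6]].
split.
- intros [[[A B] [D E]] [F G]]. now split; [split|split; split].
- intros [[A B] [[D E] [F G]]]. now split; [split; split|split].
Qed.

Lemma Re_minus_abs (v w : C) : (Rabs (Re v - Re w) <= Cmod (v - w))%R.
Proof.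
assert (J1 := Re_le_Cmod (v - w)). assert (J2 := Re_le_Cmod (- (v - w))). rewrite Cmod_opp in J2.
change (Re (v - w)) with (Re v - Re w)%R in J1. change (Re (- (v - w))) with (- (Re v - Re w))%R in J2.
apply Rabs_le. lra.
Qed.

Lemma square_step (e : R) (z w v : C) (d : R) : square e z w -> (Cmod (v - w) < d)%R ->
  (d <= e - Rabs (Re w - Re z))%R -> (d <= e - Rabs (Im w - Im z))%R -> square e z v.
Proof.
intros [A B] Hv Q1 Q2. assert (I := im_le_Cmod (v - w)). assert (J := Re_minus_abs v w).
change (Im (v - w)) with (Im v - Im w)%R in I.
split.
- replace (Re v - Re z)%R with ((Re v - Re w) + (Re w - Re z))%R by ring.
  eapply Rle_lt_trans; [apply Rabs_triang|]. lra.
- replace (Im v - Im z)%R with ((Im v - Im w) + (Im w - Im z))%R by ring.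
  eapply Rle_lt_trans; [apply Rabs_triang|]. lra.
Qed.

Lemma locally_square (e : R) (z w : C) : square e z w -> locally w (square e z).
Proof.
intros [A B]. apply locally_Cmod.
assert (P : (0 < Rmin (e - Rabs (Re w - Re z)) (e - Rabs (Im w - Im z)))%R) by (apply Rmin_case; lra).
exists (mkposreal _ P). simpl. intros v Hv.
assert (Q1 := Rmin_l (e - Rabs (Re w - Re z)) (e - Rabs (Im w - Im z))).
assert (Q2 := Rmin_r (e - Rabs (Re w - Re z)) (e - Rabs (Im w - Im z))).
apply (square_step e z w v _ (conj A B) Hv); [exact Q1|exact Q2].
Qed.

Lemma ball_open_V3 (p : V3) (eps : posreal) : open (ball p eps).
Proof.
intros x Hx. apply ball_V3 in Hx. destruct Hx as (A & B & D).
generalize (filter_and _ _ (locally_cd pa x _ (pa_cd x) (locally_square _ _ _ A))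
  (filter_and _ _ (locally_cd pb x _ (pb_cd x) (locally_square _ _ _ B)) (locally_cd pc x _ (pc_cd x) (locally_square _ _ _ D)))).
apply filter_imp. intros y Hy. now apply ball_V3.
Qed.

Lemma square_convex e z u v s : (0 <= s <= 1)%R -> square e z u -> square e z v -> square e z (u + RtoC s * (v - u)).
Proof.
intros Hs [A B] [D E].
assert (K : forall p q r, (Rabs (q - p) < e -> Rabs (r - p) < e -> Rabs (q + s * (r - q) - p) < e)%R).
{ intros p q r H1 H2.
  replace (q + s * (r - q) - p)%R with ((1 - s) * (q - p) + s * (r - p))%R by ring.
  eapply Rle_lt_trans; [apply Rabs_triang|]. rewrite !Rabs_mult, (Rabs_pos_eq s), (Rabs_pos_eq (1 - s)) by lra.
  assert (M1 := Rmax_l (Rabs (q - p)) (Rabs (r - p))). assert (M2 := Rmax_r (Rabs (q - p)) (Rabs (r - p))).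
  assert (M3 : (Rmax (Rabs (q - p)) (Rabs (r - p)) < e)%R) by now apply Rmax_case.
  apply Rle_lt_trans with (2 := M3). nra. }
split.
- replace (Re (u + RtoC s * (v - u))) with (Re u + s * (Re v - Re u))%R by (unfold Re; simpl; ring). now apply K.
- replace (Im (u + RtoC s * (v - u))) with (Im u + s * (Im v - Im u))%R by (unfold Im; simpl; ring). now apply K.
Qed.

Lemma ball_convex_V3 (p : V3) (eps : posreal) : convex (ball p eps).
Proof.
intros x y s Hs Hx Hy. apply ball_V3 in Hx. apply ball_V3 in Hy. apply ball_V3.
rewrite pa_plus, pb_plus, pc_plus, pa_scal, pb_scal, pc_scal, pa_minus, pb_minus, pc_minus.
destruct Hx as (A & B & D), Hy as (A' & B' & D').
split; [now apply square_convex|]. split; now apply square_convex.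
Qed.

Definition vec (a b c : C) : V3 := ((a, b), c).

Lemma vec_ext (x y : V3) : pa x = pa y -> pb x = pb y -> pc x = pc y -> x = y.
Proof. destruct x as [[a b] c], y as [[a' b'] c']. unfold pa, pb, pc; simpl. now intros -> -> ->. Qed.

Lemma move_a x z : pa (plus x (scal z (vec 1 0 0))) = pa x + z.
Proof. rewrite pa_plus, pa_scal. unfold vec, pa at 2; simpl. ring. Qed.
Lemma move_a_b x z : pb (plus x (scal z (vec 1 0 0))) = pb x.
Proof. rewrite pb_plus, pb_scal. unfold vec, pb at 2; simpl. ring. Qed.
Lemma move_a_c x z : pc (plus x (scal z (vec 1 0 0))) = pc x.
Proof. rewrite pc_plus, pc_scal. unfold vec, pc at 2; simpl. ring. Qed.
Lemma move_b x z : pb (plus x (scal z (vec 0 1 0))) = pb x + z.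
Proof. rewrite pb_plus, pb_scal. unfold vec, pb at 2; simpl. ring. Qed.
Lemma move_b_a x z : pa (plus x (scal z (vec 0 1 0))) = pa x.
Proof. rewrite pa_plus, pa_scal. unfold vec, pa at 2; simpl. ring. Qed.
Lemma move_b_c x z : pc (plus x (scal z (vec 0 1 0))) = pc x.
Proof. rewrite pc_plus, pc_scal. unfold vec, pc at 2; simpl. ring. Qed.
Lemma move_c x z w : pc (plus x (scal z (vec 0 0 w))) = pc x + z * w.
Proof. rewrite pc_plus, pc_scal. unfold vec, pc at 2; simpl. ring. Qed.
Lemma move_c_a x z w : pa (plus x (scal z (vec 0 0 w))) = pa x.
Proof. rewrite pa_plus, pa_scal. unfold vec, pa at 2; simpl. ring. Qed.
Lemma move_c_b x z w : pb (plus x (scal z (vec 0 0 w))) = pb x.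
Proof. rewrite pb_plus, pb_scal. unfold vec, pb at 2; simpl. ring. Qed.

Lemma Cmean_ext f g r : (forall t, f (circ r t) = g (circ r t)) -> Cmean f r = Cmean g r.
Proof. intros H. unfold Cmean. f_equal. apply CInt_ext. intros t _. apply H. Qed.

Lemma Z_dist (m k : Z) : m <> k -> (1 <= Cmod (RtoC (IZR m) - RtoC (IZR k)))%R.
Proof.
intros H. rewrite <- RtoC_minus, <- minus_IZR, Cmod_R, <- abs_IZR. apply (IZR_le 1). lia.
Qed.

(** One radius must work for a whole disc of centres. About an integer, radius 1/2 with centres
    moved by less than 1/4 stays away from all integers; otherwise a third of the smaller of 1 and a
    lower bound for the distance to the integers serves for both. *)
Lemma avoid_circle (a0 : C) : exists r d : R, (0 < r < 1)%R /\ (0 < d < 1)%R /\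
  forall a t, (Cmod (a - a0) < d)%R -> ~ isZ (a + circ r t).
Proof.
destruct (classic (isZ a0)) as [[k Hk]|Ha].
- exists (/ 2)%R, (/ 4)%R. split; [lra|]. split; [lra|]. intros a t Hd [m Hm].
  assert (C1 := Cmod_circ (/ 2) t ltac:(lra)).
  assert (E : a - a0 + circ (/ 2) t = RtoC (IZR m) - RtoC (IZR k)) by (rewrite <- Hm, <- Hk; ring).
  destruct (Z.eq_dec m k) as [->|N].
  + assert (T := Cmod_triangle (a - a0) (- (a - a0 + circ (/ 2) t))).
    rewrite Cmod_opp, E in T. replace (a - a0 + - (RtoC (IZR k) - RtoC (IZR k))) with (- circ (/ 2) t - - (a - a0 + circ (/ 2) t) - (RtoC (IZR k) - RtoC (IZR k))) in T by ring.
    rewrite E in T. replace (RtoC (IZR k) - RtoC (IZR k)) with (RtoC 0) in T by ring.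
    replace (- circ (/ 2) t - - 0 - 0) with (- circ (/ 2) t) in T by ring. rewrite Cmod_opp, C1, Cmod_0 in T. lra.
  + assert (Q := Z_dist m k N). rewrite <- E in Q. assert (T := Cmod_triangle (a - a0) (circ (/ 2) t)). lra.
- destruct (not_isZ_dist a0 Ha) as [d Hd]. assert (P := cond_pos d).
  set (e := Rmin d 1). assert (e0 : (0 < e)%R) by (unfold e; apply Rmin_case; lra).
  assert (e1 := Rmin_l d 1). assert (e2 := Rmin_r d 1). fold e in e1, e2.
  exists (e / 3)%R, (e / 3)%R. split; [lra|]. split; [lra|]. intros a t Ht [m Hm].
  assert (Q := Hd m). rewrite <- Hm in Q. rewrite <- Cmod_opp in Q.
  replace (- (a0 - (a + circ (e / 3) t))) with ((a - a0) + circ (e / 3) t) in Q by ring.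
  assert (T := Cmod_triangle (a - a0) (circ (e / 3) t)). rewrite (Cmod_circ (e / 3) t) in T by lra. lra.
Qed.

(** * Comparison with the given continuation *)

Section Continuation.
Variables (T : V3 -> C) (zeta Gam : C -> C).
Hypothesis HT : is_MT_continuation T.
Hypothesis Hzeta : is_riemann_zeta zeta.
Hypothesis HGam : is_gamma Gam.
Notation F0 := (cleared zeta Gam).

Lemma large_ineq k x : large k x -> (2 - Re (pa x) <= INR k)%R /\ (2 - Re (pb x) <= INR k)%R /\ (INR (2 * k) <= Re (pc x) - 1)%R.
Proof. intros [(A & B & _) D]. assert (0 <= INR k * INR k)%R by (apply Rmult_le_pos; apply pos_INR). lra. Qed.

Lemma T_large k x : large k x -> T x = mellin (pa x) (pb x) (pc x) / Gam (pc x).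
Proof.
intros H. destruct (large_ineq k x H) as (A & B & D).
destruct x as [[a b] c]. apply (proj2 HT). apply (MT_double_series Gam HGam a b c k A B D).
apply (large_Gam Gam HGam k _ H).
Qed.

Lemma MT_sum_cd N x : cd (fun y : V3 => MT_sum N (pa y) (pb y) (pc y)) x.
Proof.
apply (cd_sum_n (fun m y => sum_n (MT_term (pa y) (pb y) (pc y) m) N)). intros m _.
apply (cd_sum_n (fun n y => MT_term (pa y) (pb y) (pc y) m n)). intros n _. unfold MT_term.
apply (cd_mult (fun y => Rcpow (INR (S m)) (- pa y) * Rcpow (INR (S n)) (- pb y)) (fun y => Rcpow (INR (S m + S n)) (- pc y))).
- apply (cd_mult (fun y => Rcpow (INR (S m)) (- pa y)) (fun y => Rcpow (INR (S n)) (- pb y))).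
  + apply (cd_Rcpow _ (fun y => - pa y)), cd_opp, pa_cd.
  + apply (cd_Rcpow _ (fun y => - pb y)), cd_opp, pb_cd.
- apply (cd_Rcpow _ (fun y => - pc y)), cd_opp, pc_cd.
Qed.

(** In the region of absolute convergence the values of [T] are prescribed at every point, not only
    off a thin set, and they are limits of uniformly bounded entire partial sums. *)
Lemma T_large_cd k x : large k x -> cd T x.
Proof.
intros H. destruct (proj1 (locally_norm_ball _ _) (large_locally k x H)) as [d Hd].
apply (cd_bounded_limit (fun N (y : V3) => MT_sum N (pa y) (pb y) (pc y)) T x d 4 (cond_pos d)).
- intros N y _. apply MT_sum_cd.
- intros N y Hy. destruct (large_ineq k y (Hd y Hy)) as (A & B & D). now apply (MT_sum_bound _ _ _ k).
- intros y Hy. rewrite (T_large k y (Hd y Hy)). destruct (large_ineq k y (Hd y Hy)) as (A & B & D).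
  apply (MT_sum_lim Gam HGam _ _ _ k A B D). apply (large_Gam Gam HGam k). now apply Hd.
Qed.

Definition cleared_T (k : nat) (x : V3) : C := lprod (idxs (order k)) x * T x.

Lemma cleared_T_cd k x : large k x -> cd (cleared_T k) x.
Proof. intros H. apply (cd_mult (lprod (idxs (order k))) T); [apply lprod_cd|now apply (T_large_cd k)]. Qed.

Lemma cleared_eq_T k x : large k x -> nonres x -> F0 (order k) x = cleared_T k x.
Proof. intros H N. unfold cleared_T. rewrite (T_large k x H). now apply cleared_large. Qed.

(* Averaging over circles in [a] and [b] that avoid the integers removes the apparent
   singularities of [cleared] at integral [a], [b]. *)
Section Average.
Variables (a0 b0 : C) (ra da rb db : R) (k : nat).
Hypothesis Hra : (0 < ra < 1)%R.
Hypothesis Hda : (0 < da < 1)%R.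
Hypothesis Hrb : (0 < rb < 1)%R.
Hypothesis Hdb : (0 < db < 1)%R.
Hypothesis Aa : forall a t, (Cmod (a - a0) < da)%R -> ~ isZ (a + circ ra t).
Hypothesis Ab : forall b t, (Cmod (b - b0) < db)%R -> ~ isZ (b + circ rb t).
(** The margin 2 leaves room for moving the centre by less than 1 and then going once around a
    circle of radius less than 1. *)
Hypothesis Ka : (2 - INR k < Re a0 - 2)%R.
Hypothesis Kb : (2 - INR k < Re b0 - 2)%R.

Definition mean_a (y : V3) : C := Cmean (fun z => F0 (order k) (plus y (scal z (vec 1 0 0)))) ra.
Definition mean_ab (y : V3) : C := Cmean (fun z => mean_a (plus y (scal z (vec 0 1 0)))) rb.

Definition cdom (x : V3) : Prop := (1 - INR k < Re (pc x))%R /\ (Rabs (Im (pc x)) < INR k)%R.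
Definition box1 (x : V3) : Prop := (Cmod (pa x - a0) < da)%R /\ ~ isZ (pb x) /\ (2 - INR k < Re (pb x))%R /\ cdom x.
Definition box2 (x : V3) : Prop := (Cmod (pa x - a0) < da)%R /\ (Cmod (pb x - b0) < db)%R /\ cdom x.
Definition big (x : V3) : Prop := (INR (2 * k) + 1 + INR k * INR k < Re (pc x))%R.

Lemma near_disc (w z w0 : C) d r : (Cmod (w - w0) < d)%R -> (d < 1)%R -> (Cmod z < r)%R -> (r <= 1)%R -> (2 - INR k < Re w0 - 2)%R -> (2 - INR k < Re (w + z))%R.
Proof.
intros A B D E F. assert (P := Re_lower w0 (w + z) 2).
assert (Q := Cmod_triangle (w - w0) z). replace (w - w0 + z) with (w + z - w0) in Q by ring. lra.
Qed.

Lemma circ_lt r t : (0 < r < 1)%R -> (Cmod (circ r t) < 1)%R.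
Proof. intros H. rewrite Cmod_circ; lra. Qed.

Lemma dom_move_a x z : box1 x -> (Cmod z < 1)%R -> dom k (plus x (scal z (vec 1 0 0))).
Proof.
intros (A & B & D & E & F) Hz. unfold dom. rewrite move_a, move_a_b, move_a_c. repeat split; try assumption.
apply (near_disc (pa x) z a0 da 1); (assumption || lra).
Qed.

Lemma box1_move_b x t : box2 x -> box1 (plus x (scal (circ rb t) (vec 0 1 0))).
Proof.
intros (A & B & D). unfold box1, cdom. rewrite move_b_a, move_b, move_b_c. repeat split; try (apply A || apply D).
- now apply Ab.
- apply (near_disc (pb x) (circ rb t) b0 db 1); try assumption; try lra. now apply circ_lt.
Qed.

Lemma mean_a_hol x : box1 x -> hol mean_a x.
Proof.
intros H. apply (circle_mean_hol (F0 (order k)) x (vec 1 0 0) ra); [lra|]. intros t.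
assert (D := dom_move_a x (circ ra t) H (circ_lt ra t Hra)).
assert (N : nonres (plus x (scal (circ ra t) (vec 1 0 0)))).
{ split; [rewrite move_a; now apply Aa, H|rewrite move_a_b; apply H]. }
unfold hol. generalize (filter_and _ _ (dom_locally k _ D) (nonres_locally _ N)).
apply filter_imp. intros y [Y1 Y2]. now apply cleared_cd.
Qed.

Lemma mean_ab_hol x : box2 x -> hol mean_ab x.
Proof. intros H. apply (circle_mean_hol mean_a x (vec 0 1 0) rb); [lra|]. intros t. now apply mean_a_hol, box1_move_b. Qed.

Lemma line_cd (f : V3 -> C) (x v : V3) (z : C) : cd f (plus x (scal z v)) -> cd (fun z : C => f (plus x (scal z v))) z.
Proof. intros H. exact (cd_line f x v z H). Qed.

(** On the circle [cleared] equals the function [cleared_T], which for large Re c is holomorphic on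
    the whole disc, integral a included; so the mean is its value at the centre. *)
Lemma mean_a_big x : box1 x -> big x -> mean_a x = cleared_T k x.
Proof.
intros H B. unfold mean_a.
rewrite (Cmean_ext _ (fun z => cleared_T k (plus x (scal z (vec 1 0 0))))).
- rewrite (mean_value _ 1 ra).
  + f_equal. apply vec_ext; [rewrite move_a|rewrite move_a_b|rewrite move_a_c]; ring.
  + exact Hra.
  + intros z Hz. apply line_cd, cleared_T_cd. split; [now apply dom_move_a|]. rewrite move_a_c. exact B.
- intros t. apply cleared_eq_T.
  + split; [apply dom_move_a; [exact H|now apply circ_lt]|]. rewrite move_a_c. exact B.
  + split; [rewrite move_a; now apply Aa, H|rewrite move_a_b; apply H].
Qed.

Lemma mean_ab_big x : box2 x -> big x -> mean_ab x = cleared_T k x.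
Proof.
intros H B. unfold mean_ab.
rewrite (Cmean_ext _ (fun z => cleared_T k (plus x (scal z (vec 0 1 0))))).
- rewrite (mean_value _ 1 rb).
  + f_equal. apply vec_ext; [rewrite move_b_a|rewrite move_b|rewrite move_b_c]; ring.
  + exact Hrb.
  + intros z Hz. apply line_cd, cleared_T_cd. destruct H as (H1 & H2 & H3). split; [|rewrite move_b_c; exact B].
    unfold dom. rewrite move_b_a, move_b, move_b_c. repeat split; try apply H3.
    * replace (pa x) with (pa x + 0) by ring. apply (near_disc (pa x) 0 a0 da 1); try assumption; try lra. rewrite Cmod_0. lra.
    * apply (near_disc (pb x) z b0 db 1); (assumption || lra).
- intros t. apply mean_a_big; [now apply box1_move_b|]. unfold big. rewrite move_b_c. exact B.
Qed.

Lemma box2_dom x : box2 x -> dom k x.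
Proof.
intros (H1 & H2 & H3). unfold dom. repeat split; try apply H3.
- replace (pa x) with (pa x + 0) by ring. apply (near_disc (pa x) 0 a0 da 1); try assumption; try lra. rewrite Cmod_0. lra.
- replace (pb x) with (pb x + 0) by ring. apply (near_disc (pb x) 0 b0 db 1); try assumption; try lra. rewrite Cmod_0. lra.
Qed.

Lemma locally_disc (z w : C) d : (Cmod (z - w) < d)%R -> locally z (fun y : C => (Cmod (y - w) < d)%R).
Proof.
intros H. apply locally_Cmod. assert (P : (0 < d - Cmod (z - w))%R) by lra. exists (mkposreal _ P). simpl. intros y Hy.
replace (y - w) with ((y - z) + (z - w)) by ring. eapply Rle_lt_trans; [apply Cmod_triangle|]. lra.
Qed.

Lemma box2_locally x : box2 x -> locally x box2.
Proof.
intros H. generalize (dom_locally k x (box2_dom x H)). destruct H as (H1 & H2 & _). intros L.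
generalize (filter_and _ _ (locally_cd pa x _ (pa_cd x) (locally_disc _ _ _ H1)) (filter_and _ _ (locally_cd pb x _ (pb_cd x) (locally_disc _ _ _ H2)) L)).
apply filter_imp. intros y (Y1 & Y2 & _ & _ & Y3). split; [exact Y1|]. split; [exact Y2|exact Y3].
Qed.

Lemma big_locally x : box2 x -> big x -> locally x (fun y => box2 y /\ big y /\ large k y).
Proof.
intros H B. apply filter_and; [now apply box2_locally|].
assert (L : large k x) by (split; [now apply box2_dom|exact B]).
generalize (large_locally k x L). apply filter_imp. intros y Y. split; [apply Y|exact Y].
Qed.

Definition shift_c (w : R) (x : V3) : V3 := plus x (vec 0 0 (RtoC w)).

Lemma box2_shift x w s : box2 x -> (0 <= w)%R -> (0 <= s <= 1)%R ->
  box2 (plus (shift_c w x) (scal (RtoC s) (vec 0 0 (RtoC (- w))))).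
Proof.
intros (H1 & H2 & H3 & H4) Hw Hs. unfold box2, cdom. rewrite move_c_a, move_c_b, move_c. unfold shift_c.
rewrite pa_plus, pb_plus, pc_plus.
change (pa (vec 0 0 (RtoC w))) with (RtoC 0). change (pb (vec 0 0 (RtoC w))) with (RtoC 0). change (pc (vec 0 0 (RtoC w))) with (RtoC w).
rewrite !Cplus_0_r, <- RtoC_mult, <- Cplus_assoc, <- RtoC_plus.
change (Re (pc x + RtoC (w + s * - w))) with (Re (pc x) + (w + s * - w))%R.
change (Im (pc x + RtoC (w + s * - w))) with (Im (pc x) + 0)%R. rewrite Rplus_0_r.
repeat split; try assumption. nra.
Qed.

Lemma shift_back x w : plus (shift_c w x) (vec 0 0 (RtoC (- w))) = x.
Proof.
unfold shift_c. apply vec_ext; rewrite !pa_plus || rewrite !pb_plus || rewrite !pc_plus; unfold pa, pb, pc, vec; simpl; try ring.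
rewrite RtoC_opp. ring.
Qed.

(** From Re c > 1 - k, the lower bound in [cdom], this shift passes the threshold of [big]. *)
Definition up (x : V3) : V3 := shift_c (INR (2 * k) + 1 + INR k * INR k + INR k) x.

Lemma up_pos : (0 <= INR (2 * k) + 1 + INR k * INR k + INR k)%R.
Proof. assert (P := pos_INR k). assert (Q := pos_INR (2 * k)). nra. Qed.

Lemma up_box2 x : box2 x -> box2 (up x).
Proof.
intros H. assert (Q := box2_shift x _ 0 H up_pos ltac:(lra)).
replace (up x) with (plus (shift_c (INR (2 * k) + 1 + INR k * INR k + INR k) x) (scal (RtoC 0) (vec 0 0 (RtoC (- (INR (2 * k) + 1 + INR k * INR k + INR k)))))); [exact Q|].
unfold up. apply vec_ext; [apply move_c_a|apply move_c_b|rewrite move_c; ring].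
Qed.

Lemma up_big x : box2 x -> big (up x).
Proof.
intros (_ & _ & H & _). unfold big, up, shift_c. rewrite pc_plus.
change (pc (vec 0 0 (RtoC (INR (2 * k) + 1 + INR k * INR k + INR k)))) with (RtoC (INR (2 * k) + 1 + INR k * INR k + INR k)).
change (INR (2 * k) + 1 + INR k * INR k < Re (pc x) + (INR (2 * k) + 1 + INR k * INR k + INR k))%R. lra.
Qed.

(** The identity holds near the raised point and is carried down a segment on which only c moves;
    there the average stays holomorphic because its circles in a and b avoid the integers
    throughout. *)
Lemma mean_ab_agree x : box2 x -> agree T (lprod (idxs (order k))) mean_ab x.
Proof.
intros H. rewrite <- (shift_back x (INR (2 * k) + 1 + INR k * INR k + INR k)).
apply (agree_segment ball_open_V3 ball_convex_V3).
- apply (proj1 HT).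
- intros s Hs. split; [|apply hol_all; intros y; apply lprod_cd].
  apply mean_ab_hol. apply box2_shift; [exact H|exact up_pos|exact Hs].
- apply agree_here. generalize (big_locally _ (up_box2 x H) (up_big x H)). apply filter_imp.
  intros y (Y1 & Y2 & _). rewrite mean_ab_big by assumption. apply Cmult_comm.
Qed.

(** The same segment keeps a and b fixed, hence nonintegral, so [cleared] is holomorphic along it
    and agrees with the average at its upper end. *)
Lemma mean_ab_cleared x : box2 x -> nonres x -> mean_ab x = F0 (order k) x.
Proof.
intros H N. cut (mean_ab x - F0 (order k) x = 0).
{ intros E. replace (mean_ab x) with (mean_ab x - F0 (order k) x + F0 (order k) x) by ring. rewrite E. ring. }
rewrite <- (shift_back x (INR (2 * k) + 1 + INR k * INR k + INR k)).
assert (Nup : forall w s, nonres (plus (shift_c w x) (scal (RtoC s) (vec 0 0 (RtoC (- w)))))).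
{ intros w s. split; [rewrite move_c_a|rewrite move_c_b]; unfold shift_c.
  - rewrite pa_plus. change (pa (vec 0 0 (RtoC w))) with (RtoC 0). rewrite Cplus_0_r. apply N.
  - rewrite pb_plus. change (pb (vec 0 0 (RtoC w))) with (RtoC 0). rewrite Cplus_0_r. apply N. }
apply (identity_segment (fun y => mean_ab y - F0 (order k) y)).
- intros s Hs. assert (B := box2_shift x _ s H up_pos Hs). apply hol_minus; [now apply mean_ab_hol|].
  unfold hol. generalize (filter_and _ _ (box2_locally _ B) (nonres_locally _ (Nup _ s))).
  apply filter_imp. intros y [Y1 Y2]. apply cleared_cd; try assumption. now apply box2_dom.
- assert (N0 : nonres (up x)).
  { unfold up, shift_c. split.
    - rewrite pa_plus. match goal with |- ~ isZ (_ + ?u) => change u with (RtoC 0) end. rewrite Cplus_0_r. apply N.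
    - rewrite pb_plus. match goal with |- ~ isZ (_ + ?u) => change u with (RtoC 0) end. rewrite Cplus_0_r. apply N. }
  generalize (filter_and _ _ (big_locally _ (up_box2 x H) (up_big x H)) (nonres_locally _ N0)). apply filter_imp.
  intros y ((Y1 & Y2 & Y3) & Y4). rewrite mean_ab_big, cleared_eq_T by assumption. ring.
Qed.

End Average.

(** [N] lets the caller force a given hyperplane to occur among the factors of [lprod]. The single k
    exceeds all coordinates of p with enough slack for [Ka], [Kb] and [cdom]. *)
Theorem local_model (p : V3) (N : nat) : exists (k : nat) (Fh : V3 -> C), (N <= order k)%nat /\
  locally p (fun x => dom k x /\ hol Fh x /\ agree T (lprod (idxs (order k))) Fh x /\
    (nonres x -> Fh x = F0 (order k) x)).
Proof.
destruct (avoid_circle (pa p)) as (ra & da & Hra & Hda & Aa).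
destruct (avoid_circle (pb p)) as (rb & db & Hrb & Hdb & Ab).
destruct (nat_above (5 + Rabs (Re (pa p)) + Rabs (Re (pb p)) + Rabs (Re (pc p)) + Rabs (Im (pc p)) + INR N)) as [k Hk].
assert (A1 := Rle_abs (- Re (pa p))). assert (A2 := Rle_abs (- Re (pb p))). assert (A3 := Rle_abs (- Re (pc p))).
rewrite Rabs_Ropp in A1, A2, A3.
assert (P1 := Rabs_pos (Re (pa p))). assert (P2 := Rabs_pos (Re (pb p))). assert (P3 := Rabs_pos (Re (pc p))).
assert (P4 := Rabs_pos (Im (pc p))). assert (P5 := pos_INR N).
exists k, (mean_ab ra rb k). split.
- assert (Q : (INR N <= INR k)%R) by lra. apply INR_le in Q. unfold order. nia.
- assert (B : box2 (pa p) (pb p) da db k p).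
  { unfold box2, cdom. replace (pa p - pa p) with (RtoC 0) by ring. replace (pb p - pb p) with (RtoC 0) by ring.
    rewrite Cmod_0. repeat split; lra. }
  assert (Ka : (2 - INR k < Re (pa p) - 2)%R) by lra. assert (Kb : (2 - INR k < Re (pb p) - 2)%R) by lra.
  generalize (box2_locally (pa p) (pb p) da db k Hda Hdb Ka Kb p B). apply filter_imp. intros x Hx.
  split; [now apply (box2_dom (pa p) (pb p) da db k)|]. split; [now apply (mean_ab_hol (pa p) (pb p) ra da rb db k)|].
  split; [now apply (mean_ab_agree (pa p) (pb p) ra da rb db k)|now apply (mean_ab_cleared (pa p) (pb p) ra da rb db k)].
Qed.

End Continuation.

(** * Exceptional sets and residues *)

(** exp(2 pi i s) - 1, an entire function that vanishes at the integers and at no nonreal point; it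
    turns the exclusion of integers into the exclusion of an analytic set. *)
Definition ez (s : C) : C := Cexp (2 * PI * Ci * s) - 1.

Lemma ez_cd s : cd ez s.
Proof.
apply (cd_minus (V := C_NormedModule) (fun s => Cexp (2 * PI * Ci * s)) (fun _ => 1)); [|apply (cd_const (V := C_NormedModule))].
apply (cd_comp (V := C_NormedModule) (fun s => 2 * PI * Ci * s) Cexp).
- apply (cd_mult (V := C_NormedModule) (fun _ => 2 * PI * Ci) (fun s => s)); [apply (cd_const (V := C_NormedModule))|apply cd_idC].
- apply (cder_cd _ _ _ (cder_Cexp _)).
Qed.

Lemma Cexp_period n : Cexp (2 * PI * Ci * RtoC (INR n)) = 1.
Proof.
unfold Cexp. replace (Re (2 * PI * Ci * RtoC (INR n))) with 0%R by (simpl; ring).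
replace (Im (2 * PI * Ci * RtoC (INR n))) with (0 + 2 * INR n * PI)%R by (simpl; ring).
rewrite cos_period, sin_period, exp_0, cos_0, sin_0, Rmult_1_r, Rmult_0_r. reflexivity.
Qed.

Lemma ez_Z s : isZ s -> ez s = 0.
Proof.
intros [k ->]. unfold ez. destruct (Z.le_gt_cases 0 k) as [H|H].
- replace (IZR k) with (INR (Z.to_nat k)) by (rewrite INR_IZR_INZ, Z2Nat.id by exact H; reflexivity).
  rewrite Cexp_period. ring.
- replace (2 * PI * Ci * RtoC (IZR k)) with (- (2 * PI * Ci * RtoC (INR (Z.to_nat (- k))))).
  + rewrite Cexp_opp, Cexp_period. field.
  + rewrite INR_IZR_INZ, Z2Nat.id by lia. rewrite opp_IZR, RtoC_opp. ring.
Qed.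

Lemma ez_neq_0 s : Im s <> 0%R -> ez s <> 0.
Proof.
intros H E. assert (K : Cmod (Cexp (2 * PI * Ci * s)) = 1%R).
{ replace (Cexp (2 * PI * Ci * s)) with (ez s + 1) by (unfold ez; ring). rewrite E, Cplus_0_l. apply Cmod_1. }
rewrite Cmod_Cexp in K. replace (Re (2 * PI * Ci * s)) with (- (2 * PI * Im s))%R in K by (destruct s; simpl; ring).
rewrite <- exp_0 in K. apply exp_inv in K. apply H.
assert (P := PI_RGT_0). nra.
Qed.

(** A hyperplane of the other edge family would force this sum to be an integer. For [ABC]
    integrality of a or b already detects the intersections, and c merely fills the slot. *)
Definition third (i : idx) (x : V3) : C :=
  match i with AC _ => pb x + pc x | BC _ => pa x + pc x | ABC => pc x end.

(* Off the zeros of [gen i], the hyperplane [form i = 0] meets no other polar hyperplane and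
   [a], [b], [c] are not resonant. *)
Definition gen (i : idx) (x : V3) : C := ez (pa x) * ez (pb x) * (ez (pc x) * ez (third i x)).

Lemma gen_cd i x : cd (gen i) x.
Proof.
assert (E : forall p : V3 -> C, cd p x -> cd (fun y => ez (p y)) x) by (intros p H; apply (cd_comp_scalar ez p); [exact H|apply ez_cd]).
apply (cd_mult (fun x => ez (pa x) * ez (pb x)) (fun x => ez (pc x) * ez (third i x))).
- apply (cd_mult (fun x => ez (pa x)) (fun x => ez (pb x))); apply E; [apply pa_cd|apply pb_cd].
- apply (cd_mult (fun x => ez (pc x)) (fun x => ez (third i x))); apply E; [apply pc_cd|].
  destruct i as [l|l|]; [apply (cd_plus pb pc); [apply pb_cd|apply pc_cd]|apply (cd_plus pa pc); [apply pa_cd|apply pc_cd]|apply pc_cd].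
Qed.

Lemma gen_neq_0 i x : gen i x <> 0 -> ~ isZ (pa x) /\ ~ isZ (pb x) /\ ~ isZ (pc x) /\ ~ isZ (third i x).
Proof.
intros H. repeat split; intros Z; apply H; unfold gen; rewrite (ez_Z _ Z); ring.
Qed.

Lemma gen_intro i x : Im (pa x) <> 0%R -> Im (pb x) <> 0%R -> Im (pc x) <> 0%R -> Im (third i x) <> 0%R -> gen i x <> 0.
Proof. intros A B D E. unfold gen. repeat apply Cmult_neq_0; now apply ez_neq_0. Qed.

Lemma isZ_int_minus_nat (k : Z) n : isZ (RtoC (IZR k) - RtoC (INR n)).
Proof. exists (k - Z.of_nat n)%Z. now rewrite minus_IZR, RtoC_minus, <- INR_IZR_INZ. Qed.

Lemma isZ_int_plus_nat (k : Z) n : isZ (RtoC (IZR k) + RtoC (INR n)).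
Proof. exists (k + Z.of_nat n)%Z. now rewrite plus_IZR, RtoC_plus, <- INR_IZR_INZ. Qed.

Lemma Csolve (u v w : C) : u = 0 -> w = v + u -> w = v.
Proof. intros -> ->. ring. Qed.

Lemma RtoC_INR_inj m n : RtoC (INR m) = RtoC (INR n) -> m = n.
Proof. intros H. apply RtoC_inj in H. now apply INR_eq. Qed.

Lemma forms_distinct i j x : form i x = 0 -> gen i x <> 0 -> form j x = 0 -> j = i.
Proof.
intros Hi Hg Hj. destruct (gen_neq_0 i x Hg) as (A & B & D & E).
assert (H : form j x - form i x = 0) by (rewrite Hi, Hj; ring).
destruct i as [l|l|], j as [m|m|]; simpl in *; try reflexivity.
- f_equal. apply RtoC_INR_inj. apply (Csolve _ _ _ H). ring.
- exfalso. apply E. replace (pb x + pc x) with (RtoC (IZR 1) - RtoC (INR m)); [apply isZ_int_minus_nat|].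
  symmetry. apply (Csolve _ _ _ Hj). ring.
- exfalso. apply B. replace (pb x) with (RtoC (IZR 1) + RtoC (INR l)); [apply isZ_int_plus_nat|].
  symmetry. apply (Csolve _ _ _ H). ring.
- exfalso. apply E. replace (pa x + pc x) with (RtoC (IZR 1) - RtoC (INR m)); [apply isZ_int_minus_nat|].
  symmetry. apply (Csolve _ _ _ Hj). ring.
- f_equal. apply RtoC_INR_inj. apply (Csolve _ _ _ H). ring.
- exfalso. apply A. replace (pa x) with (RtoC (IZR 1) + RtoC (INR l)); [apply isZ_int_plus_nat|].
  symmetry. apply (Csolve _ _ _ H). ring.
- exfalso. apply B. replace (pb x) with (RtoC (IZR 1) + RtoC (INR m)); [apply isZ_int_plus_nat|].
  symmetry. apply (Csolve (- (form (AC m) x - form ABC x))); simpl; [rewrite Hi, Hj; ring|ring].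
- exfalso. apply A. replace (pa x) with (RtoC (IZR 1) + RtoC (INR m)); [apply isZ_int_plus_nat|].
  symmetry. apply (Csolve (- (form (BC m) x - form ABC x))); simpl; [rewrite Hi, Hj; ring|ring].
Qed.

Definition rank (i : idx) : nat := match i with AC l => S l | BC l => S l | ABC => O end.

Lemma in_idxs K i : In i (idxs K) <-> (rank i <= K)%nat.
Proof.
induction K as [|K IH]; simpl.
- split; [intros [<-|[]]; simpl; lia|]. destruct i; simpl; intros H; try lia. now left.
- rewrite IH. split.
  + intros [<-|[<-|H]]; simpl; lia.
  + intros H. destruct (Nat.eq_dec (rank i) (S K)) as [E|N]; [|right; right; lia].
    destruct i as [l|l|]; simpl in E; [left|right; left|discriminate]; f_equal; lia.
Qed.

Lemma idxs_NoDup K : NoDup (idxs K).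
Proof.
induction K as [|K IH]; simpl; [repeat constructor; intros []|].
constructor; [intros [H|H]; [discriminate|apply in_idxs in H; simpl in H; lia]|].
constructor; [intros H; apply in_idxs in H; simpl in H; lia|exact IH].
Qed.

Lemma lprod_app l1 l2 x : lprod (l1 ++ l2) x = lprod l1 x * lprod l2 x.
Proof. induction l1 as [|i l1 IH]; simpl; [ring|]. rewrite IH. ring. Qed.

Lemma lprod_neq_0 l x : (forall i, In i l -> form i x <> 0) -> lprod l x <> 0.
Proof.
induction l as [|i l IH]; intros H; simpl; [apply C1_nz|].
apply Cmult_neq_0; [apply H; now left|apply IH; intros j Hj; apply H; now right].
Qed.

Lemma lnum_split (zeta Gam : C -> C) l1 i l2 x : form i x = 0 -> lnum zeta Gam (l1 ++ i :: l2) x = residue_coef zeta Gam i x * lprod (l1 ++ l2) x.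
Proof.
intros H. induction l1 as [|j l1 IH]; simpl; [rewrite H; ring|].
rewrite IH, lprod_app. simpl. rewrite H. ring.
Qed.

Lemma form_line i x y t : form i (plus x (scal t (minus y x))) = form i x + t * (form i y - form i x).
Proof.
destruct i; unfold form; rewrite ?pa_plus, ?pb_plus, ?pc_plus, ?pa_scal, ?pb_scal, ?pc_scal, ?pa_minus, ?pb_minus, ?pc_minus; ring.
Qed.

Lemma form_flat i : flat (fun x => form i x = 0).
Proof. intros x y t Hx Hy. rewrite form_line, Hx, Hy. ring. Qed.

Lemma form_finite (p : V3) : exists (eps : posreal) (l : list idx), forall x i, ball p eps x -> form i x = 0 -> In i l.
Proof.
destruct (nat_above (3 + Rabs (Re (pa p)) + Rabs (Re (pb p)) + Rabs (Re (pc p)))) as [K HK].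
exists (mkposreal 1 Rlt_0_1), (idxs (S K)). intros x i Hx Hi. apply in_idxs. apply ball_V3 in Hx.
destruct Hx as ([A _] & [B _] & [D _]). cbn [pos] in A, B, D.
apply Rabs_def2 in A. apply Rabs_def2 in B. apply Rabs_def2 in D.
assert (A1 := Rle_abs (- Re (pa p))). assert (A2 := Rle_abs (- Re (pb p))). assert (A3 := Rle_abs (- Re (pc p))).
rewrite Rabs_Ropp in A1, A2, A3.
assert (B1 := Rabs_pos (Re (pa p))). assert (B2 := Rabs_pos (Re (pb p))).
apply (f_equal Re) in Hi.
destruct i as [l|l|]; simpl rank; [| |lia]; apply le_n_S, INR_le.
- change (Re (pa x) + Re (pc x) + - 1 + INR l = 0)%R in Hi. lra.
- change (Re (pb x) + Re (pc x) + - 1 + INR l = 0)%R in Hi. lra.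
Qed.

Definition dir (i : idx) : V3 := match i with BC _ => vec 0 1 0 | _ => vec 1 0 0 end.

Lemma form_dir i x z : form i (plus x (scal z (dir i))) = form i x + z.
Proof.
destruct i; unfold form, dir; rewrite ?move_a, ?move_a_b, ?move_a_c, ?move_b, ?move_b_a, ?move_b_c; ring.
Qed.

Lemma form_not_zero i (p : V3) : form i p = 0 -> ~ locally p (fun x => form i x = 0).
Proof.
intros H0 H.
assert (E0 : plus p (scal (RtoC 0) (dir i)) = p).
{ transitivity (plus p zero); [f_equal; exact (scal_zero_l (dir i))|exact (plus_zero_r p)]. }
assert (L := line_continuous p (dir i) (RtoC 0)).
assert (K : locally (RtoC 0) (fun t : C => form i (plus p (scal t (dir i))) = 0)).
{ refine (L (fun x => form i x = 0) _). rewrite E0. exact H. }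
apply locally_Cmod in K. destruct K as [d Hd]. assert (P := cond_pos d).
specialize (Hd (RtoC (d / 2))). rewrite form_dir, H0, Cplus_0_l in Hd.
assert (Q : RtoC (d / 2) = 0).
{ apply Hd. replace (RtoC (d / 2) - 0) with (RtoC (d / 2)) by ring. rewrite Cmod_R, Rabs_pos_eq; lra. }
apply RtoC_inj in Q. lra.
Qed.

Section Final.
Variables (T : V3 -> C) (zeta Gam : C -> C).
Hypothesis HT : is_MT_continuation T.
Hypothesis Hzeta : is_riemann_zeta zeta.
Hypothesis HGam : is_gamma Gam.
Notation F0 := (cleared zeta Gam).
Notation res := (residue_coef zeta Gam).

Lemma sum_n_first (u : nat -> C) N : sum_n u (S N) = u O + sum_n (fun n => u (S n)) N.
Proof.
induction N as [|N IH]; [now rewrite sum_n_S, !sum_O|]. rewrite sum_n_S, IH, (sum_n_S (fun n => u (S n))). ceq. ring.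
Qed.

(** With x = n - 1 each term n >= 2 is at most 1 / (x+1)^4 <= 1 / (4 x^2), so the terms after the
    leading 1 sum to at most 1/2 in modulus. *)
Lemma zeta_neq_0 s : (4 <= Re s)%R -> zeta s <> 0.
Proof.
intros Hs E. assert (L := Clim_of_is_series _ _ (proj2 Hzeta s ltac:(lra))). rewrite E in L.
destruct (L (mkposreal (/ 2) ltac:(lra))) as [N HN]. specialize (HN (S N) (Nat.le_succ_diag_r N)). cbn [pos] in HN.
rewrite sum_n_first in HN. simpl (INR 1) in HN. rewrite Rcpow_base_1 in HN.
set (S0 := sum_n (fun n => Rcpow (INR (S (S n))) (- s)) N) in HN.
assert (B : (Cmod S0 <= 2 * / 4)%R).
{ apply mtest_partial. intros n. rewrite Cmod_Rcpow. change (Re (- s)) with (- Re s)%R.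
  assert (P := INR_S_pos n). rewrite (S_INR (S n)). set (x := INR (S n)) in *.
  assert (x1 : (1 <= x)%R) by (unfold x; rewrite S_INR; generalize (pos_INR n); lra).
  apply Rle_trans with ((/ (x + 1)) ^ 4)%R.
  - rewrite <- exp_ln_inv_pow by lra. apply exp_mono.
    assert (0 <= ln (x + 1))%R by (rewrite <- ln_1; apply ln_le; lra). simpl (INR 4). nra.
  - rewrite pow_inv, <- Rinv_mult. apply Rinv_le_contravar.
    + apply Rmult_lt_0_compat; [lra|apply pow_lt; lra].
    + replace ((x + 1) ^ 4)%R with ((x + 1) ^ 2 * (x + 1) ^ 2)%R by ring. apply Rmult_le_compat; nra. }
assert (Q := Cmod_triangle (1 + S0 - 0) (- S0)). replace (1 + S0 - 0 + - S0) with (RtoC 1) in Q by ring.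
rewrite Cmod_1, Cmod_opp in Q. lra.
Qed.

(** With first coordinate -2 + i the argument 1 - a = 3 - i lies where Gamma is known not to vanish;
    the coordinate l + 4 + 3 i puts the zeta argument at 4 + 3 i. The roles are exchanged for [BC],
    and c is then determined by the hyperplane. All imaginary parts tested by [gen] are nonzero. *)
Definition point (i : idx) : V3 :=
  match i with
  | AC l => vec (-2, 1)%R (INR l + 4, 3)%R (3 - INR l, -1)%R
  | BC l => vec (INR l + 4, 3)%R (-2, 1)%R (3 - INR l, -1)%R
  | ABC => vec (-2, 1)%R (-2, 1)%R (6, -2)%R
  end.

Lemma point_form i : form i (point i) = 0.
Proof. destruct i as [l|l|]; apply injective_projections; simpl; ring. Qed.

Lemma point_gen i : gen i (point i) <> 0.
Proof. apply gen_intro; destruct i as [l|l|]; simpl; lra. Qed.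

Lemma point_Gam : Gam (1 - ((-2, 1)%R : C)) <> 0.
Proof. apply (Gam_neq_0_large Gam HGam). simpl. lra. Qed.

Lemma zeta_coef_neq_0 l (s : C) : (4 <= Re (s - RtoC (INR l)))%R -> zeta_coef zeta s l <> 0.
Proof.
intros H. apply Cmult_neq_0; [now apply zeta_neq_0|]. apply RtoC_neq_0. apply Rmult_integral_contrapositive_currified.
- apply pow_nonzero. lra.
- apply Rinv_neq_0_compat, INR_fact_neq_0.
Qed.

Lemma point_res i : res i (point i) <> 0.
Proof.
destruct i as [l|l|]; apply Cmult_neq_0; try exact point_Gam; apply zeta_coef_neq_0; simpl; lra.
Qed.

(** On the hyperplane every summand that still contains the factor [form i] vanishes, so only the
    i-th numerator survives, times the product Q of the other forms. Gamma(c + 2 K) = (c)_(2K)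
    Gamma(c) with nonzero left side also gives Gamma(c) <> 0. *)
Lemma generic_value i x k (Fh : V3 -> C) : form i x = 0 -> gen i x <> 0 -> dom k x -> (rank i <= order k)%nat ->
  (nonres x -> Fh x = F0 (order k) x) ->
  exists Q : V3 -> C, (forall y, cd Q y) /\ (forall y, lprod (idxs (order k)) y = form i y * Q y) /\ Q x <> 0 /\
    Gam (pc x) <> 0 /\ Fh x = res i x / Gam (pc x) * Q x.
Proof.
intros Hi Hg Hd Hk HF. destruct (gen_neq_0 i x Hg) as (A & B & D & E).
apply in_idxs in Hk. destruct (in_split i _ Hk) as (l1 & l2 & El).
assert (ND := idxs_NoDup (order k)). rewrite El in ND. apply NoDup_remove_2 in ND.
exists (lprod (l1 ++ l2)). split; [intros y; apply lprod_cd|].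
split; [intros y; rewrite El, !lprod_app; simpl; ring|].
split.
{ apply lprod_neq_0. intros j Hj Z. apply ND. rewrite <- (forms_distinct i j x Hi Hg Z). exact Hj. }
assert (G := Gam_neq_0_large Gam HGam _ (order_Gam k x Hd)).
rewrite (Gam_pochhammer Gam HGam) in G by exact D.
assert (G1 : Gam (pc x) <> 0) by (intros Z; apply G; rewrite Z; ring).
assert (G2 : pochhammer (pc x) (2 * order k) <> 0) by (intros Z; apply G; rewrite Z; ring).
split; [exact G1|].
rewrite HF by (split; assumption). unfold cleared. rewrite (Gam_pochhammer Gam HGam) by exact D.
rewrite El at 1. rewrite lnum_split by exact Hi.
replace (lprod (idxs (order k)) x) with (RtoC 0) by (rewrite El, lprod_app; simpl; rewrite Hi; ring).
field. split; assumption.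
Qed.

Lemma agree_ext P P' F q : (forall x, P x = P' x) -> agree T P F q -> agree T P' F q.
Proof.
intros E (e & h & Hh & K). exists e, h. split; [exact Hh|]. intros x Hx Nx. rewrite <- E. now apply K.
Qed.

Lemma residue_generic i x : form i x = 0 -> gen i x <> 0 -> residue_at T (form i) x (res i x / Gam (pc x)).
Proof.
intros Hi Hg. destruct (local_model T zeta Gam HT Hzeta HGam x (rank i)) as (k & Fh & Hk & L).
apply locally_singleton in L. destruct L as (Hd & HF & HA & HE).
destruct (generic_value i x k Fh Hi Hg Hd Hk HE) as (Q & Q1 & Q2 & Q3 & G & Q4).
replace (res i x / Gam (pc x)) with (Fh x / Q x) by (rewrite Q4; field; split; assumption).
apply (agree_residue ball_open_V3 ball_convex_V3); try assumption.
- apply (agree_ext _ _ _ _ Q2 HA).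
- intros y. apply form_cd.
- now apply hol_all.
Qed.

Lemma generic_Gam i x : form i x = 0 -> gen i x <> 0 -> Gam (pc x) <> 0.
Proof.
intros Hi Hg. destruct (local_model T zeta Gam HT Hzeta HGam x (rank i)) as (k & Fh & Hk & L).
apply locally_singleton in L. destruct L as (Hd & _ & _ & HE).
now destruct (generic_value i x k Fh Hi Hg Hd Hk HE) as (Q & _ & _ & _ & G & _).
Qed.

Definition special (i : idx) (x : V3) : Prop := form i x = 0 /\ (gen i x = 0 \/ res i x = 0).

(** The numerator itself is not holomorphic at integral a or b, so it cannot serve as an equation
    there. The local model [Fh] can: at generic points of the hyperplane it is a nonzero multiple of
    the numerator, and the factor [gen i] accounts for all other points. *)
Lemma special_analytic i : analytic_set (special i).
Proof.
intros p. destruct (local_model T zeta Gam HT Hzeta HGam p (rank i)) as (k & Fh & Hk & L).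
destruct L as [e He].
exists e, 2%nat, (fun n => match n with O => form i | _ => fun x => gen i x * Fh x end). split.
- intros n _ x Hx. destruct n as [|n]; [apply form_cd|].
  apply (cd_mult (gen i) Fh); [apply gen_cd|]. apply hol_cd. now apply (He x).
- intros x Hx. destruct (He x Hx) as (Hd & HF & HA & HE).
  assert (K : form i x = 0 -> gen i x <> 0 -> (Fh x = 0 <-> res i x = 0)).
  { intros Hi Hg. destruct (generic_value i x k Fh Hi Hg Hd Hk HE) as (Q & _ & _ & Q3 & G & Q4). split.
    - intros Z. rewrite Z in Q4. replace (res i x) with (res i x / Gam (pc x) * Q x * (Gam (pc x) / Q x)) by (field; split; assumption).
      rewrite <- Q4. ring.
    - intros Z. rewrite Q4, Z. unfold Cdiv. ring. }
  split.
  + intros [Hi Hs] n Hn. destruct n as [|n]; [exact Hi|]. destruct (classic (gen i x = 0)) as [Z|Z]; [rewrite Z; ring|].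
    destruct Hs as [Hs|Hs]; [contradiction|]. apply K in Hs; try assumption. rewrite Hs. ring.
  + intros H. assert (Hi := H O Nat.lt_0_2). assert (H1 := H 1%nat Nat.lt_1_2). split; [exact Hi|].
    destruct (classic (gen i x = 0)) as [Z|Z]; [now left|right]. apply K; [exact Hi|exact Z|].
    apply NNPP. intros N. now apply (Cmult_neq_0 _ _ Z N).
Qed.

Lemma point_not_special i : ~ special i (point i).
Proof. intros [_ [H|H]]; [now apply (point_gen i)|now apply (point_res i)]. Qed.

Lemma not_special_pole i x : form i x = 0 -> ~ special i x -> pole_order_at T (form i) x 1 /\ polar_set T x.
Proof.
intros Hi Hs.
assert (Hg : gen i x <> 0) by (intros Z; apply Hs; split; [exact Hi|now left]).
assert (Hr : res i x <> 0) by (intros Z; apply Hs; split; [exact Hi|now right]).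
destruct (local_model T zeta Gam HT Hzeta HGam x (rank i)) as (k & Fh & Hk & L).
apply locally_singleton in L. destruct L as (Hd & HF & HA & HE).
destruct (generic_value i x k Fh Hi Hg Hd Hk HE) as (Q & Q1 & Q2 & Q3 & G & Q4).
assert (F1 : Fh x <> 0).
{ rewrite Q4. apply Cmult_neq_0; [|exact Q3]. apply Cmult_neq_0; [exact Hr|].
  intros Z. apply C1_nz. rewrite <- (Cinv_r _ G), Z. ring. }
assert (HA' := agree_ext _ _ _ _ Q2 HA).
assert (Hf : hol (form i) x) by (apply hol_all; intros y; apply form_cd).
assert (HQ : hol Q x) by now apply hol_all.
split.
- apply (agree_pole ball_open_V3 ball_convex_V3 T (form i) Q Fh x); try assumption. now apply form_not_zero.
- apply (agree_polar ball_open_V3 ball_convex_V3 T (form i) Q Fh x); assumption.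
Qed.

Lemma regular_locally (p : V3) : regular_at T p -> locally p (regular_at T).
Proof.
intros (e & f & Hf & h & Hh & E). exists e. intros q Hq.
destruct (ball_in_ball ball_open_V3 p e q Hq) as [d Hd].
exists d, f. split; [intros y Hy; now apply Hf, Hd|]. exists h. split.
- now apply (nonzero_sub ball_open_V3 ball_convex_V3 p e h q d Hd).
- intros y Hy. now apply E, Hd.
Qed.

Lemma polar_iff x : polar_set T x <-> exists i, form i x = 0.
Proof.
split.
- intros H. apply NNPP. intros N. apply H.
  destruct (local_model T zeta Gam HT Hzeta HGam x 0) as (k & Fh & _ & L).
  apply locally_singleton in L. destruct L as (Hd & HF & HA & _).
  apply (agree_regular ball_open_V3 ball_convex_V3 T _ Fh x HA HF).
  + apply hol_all. intros y. apply lprod_cd.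
  + apply lprod_neq_0. intros i _ Z. apply N. now exists i.
(* If a point of the hyperplane were regular, so would be a neighbourhood; but points outside
   [special i] are dense on the hyperplane and polar. *)
- intros [i Hi] H.
  destruct (flat_dense (fun x => form i x = 0) (special i) x (point i) (regular_at T)) as (y & Y1 & Y2 & Y3).
  + apply form_flat.
  + apply special_analytic.
  + exact Hi.
  + apply point_form.
  + apply point_not_special.
  + now apply regular_locally.
  + now apply (proj2 (not_special_pole i y Y1 Y2)).
Qed.

Lemma polar_divisor_iff D : polar_divisor T D <-> exists i, forall x, D x <-> form i x = 0.
Proof.
apply (polar_divisors_family idx form).
- apply form_cd.
- apply form_flat.
- apply form_finite.
- intros i. exists (point i). split; [apply point_form|]. intros j Hj. apply (forms_distinct i j (point i)); [apply point_form|apply point_gen|exact Hj].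
- apply polar_iff.
Qed.

Lemma form_generic i (Q : V3 -> Prop) : (forall x, form i x = 0 -> gen i x <> 0 -> Q x) -> generically (zero_set (form i)) Q.
Proof.
intros H. exists (fun x => form i x = 0 /\ gen i x = 0). split; [|split; [|split]].
- apply analytic_inter; apply analytic_zero_set; [apply form_cd|apply gen_cd].
- now intros x [A _].
- exists (point i). split; [apply point_form|]. intros [_ Z]. now apply (point_gen i).
- intros x A B. apply H; [exact A|]. intros Z. apply B. now split.
Qed.

Lemma form_simple_pole i : generically_simple_pole T (form i).
Proof.
exists (special i). split; [apply special_analytic|]. split; [now intros x [A _]|]. split.
- exists (point i). split; [apply point_form|apply point_not_special].
- intros x A B. now apply not_special_pole.
Qed.

End Final.

Lemma lam_ac_form l : lam_ac l = form (AC l).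
Proof. apply functional_extensionality. intros [[a b] c]. reflexivity. Qed.

Lemma lam_bc_form l : lam_bc l = form (BC l).
Proof. apply functional_extensionality. intros [[a b] c]. reflexivity. Qed.

Lemma lam_abc_form : lam_abc = form ABC.
Proof. apply functional_extensionality. intros [[a b] c]. reflexivity. Qed.

(** On the hyperplane 1 - u = c + l, so Gamma(1 - u) / Gamma(c) = (c)_l; the sign and the factorial
    come from the Taylor coefficient. *)
Lemma residue_value_edge (zeta Gam : C -> C) (HGam : is_gamma Gam) (u v c : C) l : ~ isZ c -> Gam c <> 0 -> u + c - 1 + RtoC (INR l) = 0 ->
  Gam (1 - u) * zeta_coef zeta v l / Gam c = (-1) ^ l * (pochhammer c l / INR (fact l)) * zeta (v - INR l).
Proof.
intros Hc HG E. replace (1 - u) with (c + RtoC (INR l)).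
2: { replace (c + RtoC (INR l)) with (1 - u + (u + c - 1 + RtoC (INR l))) by ring. rewrite E. ring. }
rewrite (Gam_pochhammer Gam HGam c l Hc). unfold zeta_coef.
assert (F : RtoC (INR (fact l)) <> 0) by apply RtoC_neq_0, INR_fact_neq_0.
rewrite RtoC_div by apply INR_fact_neq_0. rewrite RtoC_pow. field. split; assumption.
Qed.

Lemma beta_argument (a b c : C) : a + b + c - 2 = 0 -> 1 - a + (1 - b) = c.
Proof. intros E. replace (1 - a + (1 - b)) with (c - (a + b + c - 2)) by ring. rewrite E. ring. Qed.

Theorem proposition6p1
  (T : C * C * C -> C) (zeta Gam : C -> C)
  (HT : is_MT_continuation T)
  (Hzeta : is_riemann_zeta zeta) (HGam : is_gamma Gam) :
  (forall l : nat,
     residue_along T (lam_ac l)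
       (fun '(a, b, c) =>
          (-1) ^ l * (pochhammer c l / INR (fact l)) * zeta (b - INR l)) /\
     residue_along T (lam_bc l)
       (fun '(a, b, c) =>
          (-1) ^ l * (pochhammer c l / INR (fact l)) * zeta (a - INR l))) /\
  residue_along T lam_abc (fun '(a, b, c) => Beta Gam (1 - a) (1 - b)) /\
  (forall D : C * C * C -> Prop,
     polar_divisor T D <->
     ((exists l : nat, forall x, D x <-> zero_set (lam_ac l) x) \/
      (exists l : nat, forall x, D x <-> zero_set (lam_bc l) x) \/
      (forall x, D x <-> zero_set lam_abc x))) /\
  (forall l : nat,
     generically_simple_pole T (lam_ac l) /\
     generically_simple_pole T (lam_bc l)) /\
  generically_simple_pole T lam_abc.
Proof.
assert (RG := residue_generic T zeta Gam HT Hzeta HGam).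
assert (GG : forall i x, form i x = 0 -> gen i x <> 0 -> ~ isZ (pc x) /\ Gam (pc x) <> 0).
{ intros i x Hi Hg. split; [now apply (gen_neq_0 i x)|].
  now apply (generic_Gam T zeta Gam HT Hzeta HGam i). }
split; [intros l; rewrite lam_ac_form, lam_bc_form; split|split; [rewrite lam_abc_form|split; [|split]]].
- apply form_generic. intros x Hi Hg. destruct (GG _ _ Hi Hg) as [G1 G2]. specialize (RG _ _ Hi Hg).
  destruct x as [[a b] c]. simpl in RG.
  rewrite (residue_value_edge zeta Gam HGam) in RG; [exact RG|exact G1|exact G2|exact Hi].
- apply form_generic. intros x Hi Hg. destruct (GG _ _ Hi Hg) as [G1 G2]. specialize (RG _ _ Hi Hg).
  destruct x as [[a b] c]. simpl in RG.
  rewrite (residue_value_edge zeta Gam HGam) in RG; [exact RG|exact G1|exact G2|exact Hi].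
(* On a + b + c = 2 the sum (1 - a) + (1 - b) is c, so the division by Gamma(c) is the denominator
   of the beta function. *)
- apply form_generic. intros x Hi Hg. specialize (RG _ _ Hi Hg).
  destruct x as [[a b] c]. unfold Beta.
  now rewrite (beta_argument a b c Hi).
- intros D. etransitivity; [apply (polar_divisor_iff T zeta Gam HT Hzeta HGam)|]. unfold zero_set. split.
  + intros [[l|l|] H]; [left; exists l|right; left; exists l|right; right].
    * now rewrite lam_ac_form.
    * now rewrite lam_bc_form.
    * now rewrite lam_abc_form.
  + intros [[l H]|[[l H]|H]].
    * exists (AC l). now rewrite <- lam_ac_form.
    * exists (BC l). now rewrite <- lam_bc_form.
    * exists ABC. now rewrite <- lam_abc_form.
- intros l. rewrite lam_ac_form, lam_bc_form. split; now apply (form_simple_pole T zeta Gam).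
- rewrite lam_abc_form. now apply (form_simple_pole T zeta Gam).
Qed.
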